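(* For $t\ge0$, $r\in\mathbb R$ let \[ y_n(t,r)=n^{-1/4}\Bigl\{E^\omega\bigl(X^{\lfloor ntb\rfloor+\lfloor r\sqrt n\rfloor,\,\lfloor nt\rfloor}_{\lfloor nt\rfloor}\bigr)-\lfloor r\sqrt n\rfloor\Bigr\}, \] regarded as a random variable of $\omega$ under $\mathbb P$. Under (A1) and (A2), for any finite set of points $(t_j,r_j)\in\mathbb R_+\times\mathbb R$, $1\le j\le k$, the vector $(y_n(t_j,r_j))_{1\le j\le k}$ converges weakly in $\mathbb R^k$ to $(y(t_j,r_j))_{1\le j\le k}$, where $y$ is the mean-zero Gaussian process with covariance $Ey(s,q)y(t,r)=\Gamma_q((s,q),(t,r))$.
   Context: Environment setup: Fix an integer $M\ge1$. $\mathcal P$ = probability vectors $u=(u(y):-M\le y\le M)$, with $u(y)=0$ for $|y|>M$. An environment is $\omega=(\omega_{x,\tau}:(x,\tau)\in\mathbb Z^2)\in\Omega=\mathcal P^{\mathbb Z^2}$, $u^\omega_\tau(x,y)=\omega_{x,\tau}(y)$; under $\mathbb P$ (expectation $\mathbb E$) the vectors $\omega_{x,\tau}$ are i.i.d. $p(0,j)=\mathbb Eu_0(0,j)$. Standing assumptions: (A1) there is no integer $h>1$ and $x\in\mathbb Z$ with $\sum_kp(0,x+kh)=1$; (A2) $\mathbb P\{\max_ju_0(0,j)<1\}>0$. Backward walk: given $\omega$ and $(i,\tau)\in\mathbb Z^2$, $(X^{i,\tau}_s)_{s\ge0}$ is the Markov chain on $\mathbb Z$ under the quenched law $P^\omega$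 (expectation $E^\omega$) with $X^{i,\tau}_0=i$ and $P^\omega(X^{i,\tau}_{s+1}=y\mid X^{i,\tau}_s=x)=u^\omega_{\tau-s}(x,y-x)$. Constants: $V=\sum_jjp(0,j)$, $b=-V$; $D(\omega)=\sum_xxu^\omega_0(0,x)$, $\sigma_D^2=\mathbb E[(D-V)^2]$; $\sigma_a^2=\sum_x(x-V)^2p(0,x)$; $\phi^\omega(t)=\sum_xu^\omega_0(0,x)e^{itx}$, $\lambda(t)=\mathbb E|\phi^\omega(t)|^2$, $\bar\lambda(t)=|\sum_xp(0,x)e^{itx}|^2$; $\beta=\frac1{2\pi}\int_{-\pi}^\pi\frac{1-\lambda(t)}{1-\bar\lambda(t)}dt$; $\kappa=\sigma_D^2/(\beta\sigma_a^2)$. $\Gamma_q((s,q),(t,r))=\frac\kappa2\int_{\sigma_a^2|t-s|}^{\sigma_a^2(t+s)}\frac1{\sqrt{2\pi v}}\exp\{-\frac{(q-r)^2}{2v}\}dv$. *)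

(* Defs.v *)
From HB Require Import structures.
From mathcomp Require Import all_boot all_order all_algebra.
From mathcomp Require Import all_classical all_reals all_analysis.
Set Implicit Arguments. Unset Strict Implicit. Unset Printing Implicit Defensive.
Import Order.TTheory GRing.Theory Num.Theory.
Import numFieldNormedType.Exports.
Local Open Scope classical_set_scope.
Local Open Scope ring_scope.

Section Defs.
Context {R : realType}.

Definition sumM (M : nat) (F : int -> R) : R :=
  \sum_(k < (2 * M).+1) F (k%:Z - M%:Z).

(* An environment: e x tau j = omega_{x,tau}(j) = u_tau(x, j). *)
Definition env := int -> int -> int -> R.

(* Quenched mean E^omega (X^{i,tau}_s) of the backward walk, computed by
   first-step decomposition: X_1 = i + j with probability u_tau(i,j), after
   which the walk is the backward walk started at (i+j, tau-1). *)
Fixpoint qE (M : nat) (e : env) (s : nat) (i tau : int) : R :=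
  match s with
  | 0 => i%:~R
  | s'.+1 => sumM M (fun j => e i tau j * qE M e s' (i + j) (tau - 1))
  end.

Context {d : measure_display} {Omega : measurableType d}.
Variables (P : probability Omega R) (om : Omega -> env) (M : nat).

Definition site_event (x tau : int) (A : int -> set R) : set Omega :=
  [set w | forall j : int, (- M%:Z <= j <= M%:Z) -> A j (om w x tau j)].

Definition sites_independent : Prop :=
  forall (n : nat) (sx st : 'I_n -> int),
    (forall l l', sx l = sx l' -> st l = st l' -> l = l') ->
    forall A : 'I_n -> int -> set R, (forall l j, measurable (A l j)) ->
    fine (P [set w | forall l, site_event (sx l) (st l) (A l) w])
      = \prod_(l < n) fine (P (site_event (sx l) (st l) (A l))).

Definition sites_identically_distributed : Prop :=
  forall (x tau x' tau' : int) (A : int -> set R), (forall j, measurable (A j)) ->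
    P (site_event x tau A) = P (site_event x' tau' A).

Definition pbar (j : int) : R := fine ('E_P[fun w => om w 0%R 0%R j])%E.
Definition Vdrift : R := sumM M (fun j => j%:~R * pbar j).
Definition bdrift : R := - Vdrift.
Definition Dmean (w : Omega) : R := sumM M (fun j => j%:~R * om w 0 0 j).
Definition sigmaD2 : R := fine ('E_P[fun w => ((Dmean w - Vdrift) ^+ 2)%R])%E.
Definition sigmaa2 : R := sumM M (fun j => (j%:~R - Vdrift) ^+ 2 * pbar j).
(* |phi^omega(t)|^2 written with real and imaginary parts *)
Definition absphi2 (w : Omega) (t : R) : R :=
  (sumM M (fun j => om w 0 0 j * cos (t * j%:~R))) ^+ 2
  + (sumM M (fun j => om w 0 0 j * sin (t * j%:~R))) ^+ 2.
Definition lambda (t : R) : R := fine ('E_P[fun w => absphi2 w t])%E.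
Definition lambdabar (t : R) : R :=
  (sumM M (fun j => pbar j * cos (t * j%:~R))) ^+ 2
  + (sumM M (fun j => pbar j * sin (t * j%:~R))) ^+ 2.
Definition beta : R :=
  (pi *+ 2)^-1 * Rintegral (@lebesgue_measure R) `[- pi, pi]
                   (fun t => (1 - lambda t) / (1 - lambdabar t)).
Definition kappa : R := sigmaD2 / (beta * sigmaa2).
Definition Gamma_q (sq tr : R * R) : R :=
  let: (s, q) := sq in let: (t, r) := tr in
  kappa / 2 * Rintegral (@lebesgue_measure R)
     `[sigmaa2 * `|t - s|, sigmaa2 * (t + s)]
     (fun v => (Num.sqrt (pi *+ 2 * v))^-1 * expR (- (q - r) ^+ 2 / (v *+ 2))).

Definition y_n (n : nat) (t r : R) (w : Omega) : R :=
  (Num.sqrt (Num.sqrt n%:R))^-1 *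
  (qE M (om w) (Num.truncn (n%:R * t))
       (Num.floor (n%:R * t * bdrift) + Num.floor (r * Num.sqrt n%:R))
       (Num.floor (n%:R * t))
   - (Num.floor (r * Num.sqrt n%:R))%:~R).

End Defs.

Definition centered_normal_law {R : realType} {d} {T : measurableType d}
  (P : probability T R) (Z : T -> R) (v : R) : Prop :=
  forall A : set R, measurable A ->
    P (Z @^-1` A) = if v == 0 then ((\1_A 0 : R)%:E)%E
                    else normal_prob 0 (Num.sqrt v) A.

Definition centered_gaussian_vec {R : realType} {d} {T : measurableType d}
  (P : probability T R) (k : nat) (Y : T -> 'rV[R]_k) (C : 'M[R]_k) : Prop :=
  (forall i, measurable_fun setT (fun w => Y w 0 i)) /\
  forall a : 'rV[R]_k,
    centered_normal_law P (fun w => \sum_(i < k) a 0 i * Y w 0 i)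
      (\sum_(i < k) \sum_(j < k) a 0 i * a 0 j * C i j).

Definition conv_in_law {R : realType} {d} {T : measurableType d}
  {d'} {T' : measurableType d'} (P : probability T R) (P' : probability T' R)
  (k : nat) (Yn : nat -> T -> 'rV[R]_k) (Y : T' -> 'rV[R]_k) : Prop :=
  forall f : 'rV[R]_k -> R, continuous f -> (exists B : R, forall x, `|f x| <= B) ->
    ('E_P[f \o Yn n] @[n --> \oo] --> 'E_P'[f \o Y])%E.

(* Main.v *)
Require Import Defs.
From HB Require Import structures.
From mathcomp Require Import all_boot all_order all_algebra.
From mathcomp Require Import all_classical all_reals all_analysis.
From mathcomp Require Import measurable_realfun zify ring lra.
Import Order.TTheory GRing.Theory Num.Theory.
Import numFieldNormedType.Exports.
Local Open Scope classical_set_scope.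
Local Open Scope ring_scope.
Set Implicit Arguments. Unset Strict Implicit. Unset Printing Implicit Defensive.

(** Follow all the walks downwards in time from one common level. Up to O(n^(-1/4)), a linear
    combination of the y_n(t_j, r_j) is a sum of martingale differences, one for each time level:
    the quenched mean of the drift fluctuations D - V at the current positions. Independence of
    the levels makes the conditional variances equal to sigma_D^2 n^(-1/2) times the quenched
    collision probabilities of pairs of walks. The potential kernel of the difference walk of two
    independent walks, corrected by beta at the origin, turns the accumulated collisions into an
    increment of the mean distance |y - x| / (2 sigma_a^2); a smoothed distance, solution of the
    heat equation, identifies the limit of this mean distance, and the integral defining Gamma_q
    is exactly its increment. The martingale central limit theorem then gives convergence of all
    E cos(a . y_n + theta). Bernstein polynomials in sines of the coordinates and a second moment
    bound upgrade this to weak convergence. The same approximation shows that trigonometric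
    means determine laws, which is used to recognise the limit, built by Cholesky elimination. *)

(** * Expectations of bounded variables *)

(** No conditional expectation and no path space is built. Conditioning on all levels but one is
    replaced by resampling: under [P \x P], gluing the kept sites of one copy to the remaining sites
    of the other reproduces the law of the environment, so a relation that holds after averaging
    over the resampled sites integrates to the whole. The walks enter only through the functional
    [law], a finite convex combination of point evaluations. The natural scale is s = n^(1/4): s^4
    steps, distances of order s^2, collisions of order s^2. Two walks fail to be independent only
    when they meet, so the errors made at meetings are paid by the O(s^2) bound on collisions, which
    has to come first, from the potential kernel alone. The distance |y - x| has a kink where a
    Taylor expansion breaks down; the heat flow run for an extra time [eps] smooths it. The errors
    then have the form C sqrt(eps) + C'/s with C chosen before [eps]: s tends to infinity first,
    [eps] to 0 afterwards. (A1) makes the denominator of the potential kernel positive, (A2) makes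
    [beta] positive. *)

Section BoundedExpectation.
Context {R : realType} {d : measure_display} {T : measurableType d}.
Variable P : probability T R.

Definition bounded_rv (X : T -> R) : Prop :=
  measurable_fun setT X /\ exists B : R, forall w, `|X w| <= B.

Definition Ex (X : T -> R) : R := \int[P]_w X w.

Lemma bounded_rv_integrable X : bounded_rv X -> P.-integrable setT (EFin \o X).
Proof.
move=> [mX [B hB]]; apply: measurable_bounded_integrable => //.
  exact: fin_num_fun_lty (fin_num_measure P).
exists B; split; first exact: num_real.
by move=> x Bx w _ /=; apply: le_trans (hB w) (ltW Bx).
Qed.

Lemma expectation_Ex X : bounded_rv X -> ('E_P[X])%E = (Ex X)%:E.
Proof.
move=> bX; rewrite unlock /Ex /Rintegral fineK//.
exact: integrable_fin_num (bounded_rv_integrable bX).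
Qed.

Lemma fine_expectation X : fine ('E_P[X])%E = Ex X.
Proof. by rewrite unlock. Qed.

Lemma bounded_rv_cst c : bounded_rv (fun=> c).
Proof. by split => //; exists `|c|. Qed.

Lemma bounded_rvD X Y : bounded_rv X -> bounded_rv Y ->
  bounded_rv (fun w => X w + Y w).
Proof.
move=> [mX [A hA]] [mY [B hB]]; split; first exact: measurable_funD.
by exists (A + B) => w; apply: le_trans (ler_normD _ _) (lerD (hA w) (hB w)).
Qed.

Lemma bounded_rvM X Y : bounded_rv X -> bounded_rv Y ->
  bounded_rv (fun w => X w * Y w).
Proof.
move=> [mX [A hA]] [mY [B hB]]; split; first exact: measurable_funM.
by exists (A * B) => w; rewrite normrM; apply: ler_pM.
Qed.

Lemma bounded_rvZ c X : bounded_rv X -> bounded_rv (fun w => c * X w).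
Proof. by move=> bX; apply: bounded_rvM => //; exact: bounded_rv_cst. Qed.

Lemma bounded_rvN X : bounded_rv X -> bounded_rv (fun w => - X w).
Proof.
move=> [mX [B hB]]; split; first exact: measurableT_comp.
by exists B => w; rewrite normrN.
Qed.

Lemma bounded_rvB X Y : bounded_rv X -> bounded_rv Y ->
  bounded_rv (fun w => X w - Y w).
Proof. by move=> bX bY; apply: bounded_rvD => //; exact: bounded_rvN. Qed.

Lemma bounded_rv_sum (I : Type) (s : seq I) (p : pred I) (X : I -> T -> R) :
  (forall i, p i -> bounded_rv (X i)) ->
  bounded_rv (fun w => \sum_(i <- s | p i) X i w).
Proof.
move=> bX; elim: s => [|i s IHs].
  rewrite (_ : (fun w => _) = fun=> 0); last by apply: funext => w; rewrite big_nil.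
  exact: bounded_rv_cst.
rewrite (_ : (fun w => _) = fun w => if p i
    then X i w + \sum_(j <- s | p j) X j w else \sum_(j <- s | p j) X j w); last first.
  by apply: funext => w; rewrite big_cons.
by case pi: (p i); [exact: bounded_rvD (bX i pi) IHs|].
Qed.

Lemma bounded_rv_norm X : bounded_rv X -> bounded_rv (fun w => `|X w|).
Proof.
move=> [mX [B hB]]; split; first exact: measurableT_comp.
by exists B => w; rewrite normr_id.
Qed.

Lemma Ex_cst c : Ex (fun=> c) = c.
Proof.
rewrite /Ex Rintegral_cst//; apply: etrans (mulr1 c); congr (_ * _).
by apply: (congr1 fine (y := 1%E)); exact: probability_setT.
Qed.

Lemma ExD X Y : bounded_rv X -> bounded_rv Y ->
  Ex (fun w => X w + Y w) = Ex X + Ex Y.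
Proof. by move=> bX bY; rewrite /Ex RintegralD//; exact: bounded_rv_integrable. Qed.

Lemma ExZ c X : bounded_rv X -> Ex (fun w => c * X w) = c * Ex X.
Proof. by move=> bX; rewrite /Ex RintegralZl//; exact: bounded_rv_integrable. Qed.

Lemma ExN X : bounded_rv X -> Ex (fun w => - X w) = - Ex X.
Proof.
move=> bX; rewrite -mulN1r -ExZ//; congr (Rintegral _ _).
by apply: funext => w; rewrite mulN1r.
Qed.

Lemma ExB X Y : bounded_rv X -> bounded_rv Y ->
  Ex (fun w => X w - Y w) = Ex X - Ex Y.
Proof. by move=> bX bY; rewrite ExD ?ExN//; exact: bounded_rvN. Qed.

Lemma Ex_sum (I : Type) (s : seq I) (p : pred I) (X : I -> T -> R) :
  (forall i, p i -> bounded_rv (X i)) ->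
  Ex (fun w => \sum_(i <- s | p i) X i w) = \sum_(i <- s | p i) Ex (X i).
Proof.
move=> bX; elim: s => [|i s IHs].
  rewrite big_nil (_ : (fun w => _) = fun=> 0) ?Ex_cst//.
  by apply: funext => w; rewrite big_nil.
rewrite big_cons (_ : (fun w => _) = fun w => if p i
    then X i w + \sum_(j <- s | p j) X j w else \sum_(j <- s | p j) X j w); last first.
  by apply: funext => w; rewrite big_cons.
by case pi: (p i) => //; rewrite ExD ?IHs//; [exact: bX|exact: bounded_rv_sum].
Qed.

Lemma le_Ex X Y : bounded_rv X -> bounded_rv Y -> (forall w, X w <= Y w) ->
  Ex X <= Ex Y.
Proof.
by move=> bX bY XY; apply: le_Rintegral => //; exact: bounded_rv_integrable.
Qed.

Lemma Ex_ge0 X : (forall w, 0 <= X w) -> 0 <= Ex X.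
Proof. by move=> X0; apply: Rintegral_ge0. Qed.

Lemma normr_Ex X : bounded_rv X -> `|Ex X| <= Ex (fun w => `|X w|).
Proof.
by move=> bX; apply: le_normr_Rintegral => //; exact: bounded_rv_integrable.
Qed.

End BoundedExpectation.

Lemma measurable_forall (d : measure_display) (T : measurableType d)
    (I : countType) (F : I -> set T) :
  (forall i, measurable (F i)) -> measurable [set w | forall i, F i w].
Proof.
move=> mF; rewrite (_ : [set w | _] = ~` (\bigcup_i ~` F i)).
  by apply: measurableC; apply: countable_bigcupT_measurable => // i; exact: measurableC.
apply/seteqP; split=> w /=; first by move=> Fw [i _]; apply; exact: Fw.
by move=> nF i; apply: contrapT => nFi; apply: nF; exists i.
Qed.

(** * Resampling the environment *)

Section EnvironmentMeasure.
Context {R : realType} (M : nat).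

Definition in_range (j : int) : bool := - M%:Z <= j <= M%:Z.

Definition cylset (A : int -> int -> int -> set R) : set (@env R) :=
  [set e | forall x tau j, in_range j -> A x tau j (e x tau j)].

Definition trivial_off (s : seq (int * int)) (A : int -> int -> int -> set R) :=
  forall x tau j, (x, tau) \notin s -> A x tau j = setT.

(** Only jumps within [-M, M] are constrained, as in [site_event]: the independence hypothesis
    speaks of no other coordinate, so the sigma-algebra of [envT] must not see them. *)
Definition cylinders : set (set (@env R)) :=
  [set C | exists s A, [/\ forall x tau j, measurable (A x tau j),
                          trivial_off s A & C = cylset A]].

Definition envT : Type := g_sigma_algebraType cylinders.
HB.instance Definition _ := Measurable.on envT.

Lemma cylinders_setI : setI_closed cylinders.
Proof.
move=> _ _ [s [A [mA tA ->]]] [s' [A' [mA' tA' ->]]].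
exists (s ++ s'), (fun x tau j => A x tau j `&` A' x tau j); split.
- by move=> x tau j; exact: measurableI.
- move=> x tau j; rewrite mem_cat negb_or => /andP[/tA -> /tA' ->].
  by rewrite setIT.
- apply/seteqP; split=> e /=.
    by move=> [h h'] x tau j jM; split; [exact: h|exact: h'].
  by move=> h; split=> x tau j /(h x tau) [].
Qed.

Lemma measurable_env (d : measure_display) (T : measurableType d)
    (f : T -> @env R) :
  (forall x tau j, in_range j -> measurable_fun setT (fun w => f w x tau j)) ->
  measurable_fun setT (f : T -> envT).
Proof.
move=> mf; apply: (@measurability _ _ _ envT _ _ cylinders) => //.
move=> _ [_ [s [A [mA tA ->]]] <-]; rewrite setTI /cylset.
apply: (@measurable_forall _ _ _ (fun x => [set w | forall tau j, in_range j ->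
  A x tau j (f w x tau j)])) => x.
apply: (@measurable_forall _ _ _ (fun tau => [set w | forall j, in_range j ->
  A x tau j (f w x tau j)])) => tau.
apply: (@measurable_forall _ _ _ (fun j => [set w | in_range j ->
  A x tau j (f w x tau j)])) => j.
have [jM|/negP jM] := boolP (in_range j).
  rewrite (_ : [set w | _] = (fun w => f w x tau j) @^-1` A x tau j).
    by rewrite -[X in measurable X]setTI; exact: mf.
  by apply/seteqP; split=> w /= h //; exact: h.
by rewrite (_ : [set w | _] = setT)//; apply/seteqP; split=> w //= _ /jM.
Qed.

Lemma measurable_coord x tau j : in_range j ->
  measurable_fun setT (fun e : envT => e x tau j).
Proof.
move=> jM _ B mB; rewrite setTI; apply: sub_sigma_algebra.
exists [:: (x, tau)], (fun x' tau' j' => if (x' == x) && (tau' == tau) && (j' == j)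
  then B else setT); split.
- by move=> x' tau' j'; case: ifP.
- move=> x' tau' j'; rewrite inE xpair_eqE => /negbTE -> //.
- apply/seteqP; split=> e /=.
    by move=> Be x' tau' j' _; case: ifP => // /andP[/andP[/eqP -> /eqP ->] /eqP ->].
  by move=> /(_ x tau j jM); rewrite !eqxx.
Qed.

Section Law.
Context {d : measure_display} {Omega : measurableType d}.
Variables (P : probability Omega R) (om : Omega -> @env R).
Hypothesis measurable_om : forall x tau j, measurable_fun setT (fun w => om w x tau j).
Hypothesis independent_om : sites_independent P om M.

Lemma prob_cylset s A : uniq s -> (forall x tau j, measurable (A x tau j)) ->
  trivial_off s A ->
  P (om @^-1` cylset A) =
    (\prod_(p <- s) fine (P (site_event om M p.1 p.2 (A p.1 p.2))))%:E.
Proof.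
move=> us mA tA.
have mcyl : measurable (om @^-1` cylset A).
  have mom : measurable_fun setT (om : Omega -> envT).
    by apply: measurable_env => x tau j _; exact: measurable_om.
  rewrite -[X in measurable X]setTI; apply: mom => //.
  by apply: sub_sigma_algebra; exists s, A.
rewrite -[LHS]fineK ?fin_num_measure//; congr EFin.
have := @independent_om (size s) (fun l => (tnth (in_tuple s) l).1)
  (fun l => (tnth (in_tuple s) l).2) _
  (fun l => A (tnth (in_tuple s) l).1 (tnth (in_tuple s) l).2) _.
rewrite (big_tnth _ _ s) => <-; last 2 first.
- move=> l l' e1 e2; apply/val_inj/eqP.
  rewrite -(nth_uniq (0, 0) (ltn_ord l) (ltn_ord l') us); apply/eqP.
  move: e1 e2; rewrite !(tnth_nth (0, 0)) /=.
  by case: (nth _ _ l) (nth _ _ l') => [a b] [a' b'] /= -> ->.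
- by move=> l j; exact: mA.
congr (fine (P _)); apply/seteqP; split=> w /=.
  by move=> h l j jM; exact: h.
move=> h x tau j jM; have [xs|xs] := boolP ((x, tau) \in s); last by rewrite tA.
have /tnthP[l e] : (x, tau) \in in_tuple s by [].
by have := h l j jM; rewrite -e.
Qed.

(** Cylinders form a pi-system containing the whole space, so two push-forward measures on [envT]
    that agree on them coincide. The second measure is left general because it is applied to
    [P \x P]. *)
Lemma law_unique (d2 : measure_display) (T2 : measurableType d2)
    (P2 : {measure set T2 -> \bar R}) (f : T2 -> @env R) :
  (forall x tau j, in_range j -> measurable_fun setT (fun w => f w x tau j)) ->
  (forall s A, uniq s -> (forall x tau j, measurable (A x tau j)) ->
    trivial_off s A -> P2 (f @^-1` cylset A) = P (om @^-1` cylset A)) ->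
  forall F : envT -> R, measurable_fun setT F ->
  P2.-integrable setT (EFin \o (F \o f)) ->
  P.-integrable setT (EFin \o (F \o om)) ->
  \int[P2]_w F (f w) = \int[P]_w F (om w).
Proof.
move=> mf ef F mF iF2 iF.
have mf' : measurable_fun setT (f : T2 -> envT) by exact: measurable_env.
have mom : measurable_fun setT (om : Omega -> envT).
  by apply: measurable_env => x tau j _; exact: measurable_om.
have mEF : measurable_fun setT (EFin \o F) by exact/measurable_EFinP.
rewrite /Rintegral; congr fine.
have -> : (\int[P2]_w (F (f w))%:E)%E = (\int[pushforward P2 (f : T2 -> envT)]_e (F e)%:E)%E.
  by rewrite (integral_pushforward mf').
have -> : (\int[P]_w (F (om w))%:E)%E = (\int[pushforward P (om : Omega -> envT)]_e (F e)%:E)%E.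
  by rewrite (integral_pushforward mom).
apply: eq_measure_integral => A mA _.
pose g := fun n : nat => [set: envT].
apply: (@measure_unique _ _ envT cylinders g) => //.
- exact: cylinders_setI.
- move=> n; exists [::], (fun _ _ _ => setT); split=> //.
  by apply/seteqP; split.
- by rewrite bigcup_const//; exists 0%N.
- move=> _ [s [B [mB tB ->]]]; rewrite /pushforward.
  apply: (ef (undup s)) => //; first exact: undup_uniq.
  by move=> x tau j; rewrite mem_undup; exact: tB.
- move=> k; change (P2 setT < +oo)%E; have e : cylset (fun _ _ _ => setT) = [set: @env R].
    by apply/seteqP; split.
  have := ef [::] (fun _ _ _ => setT) isT (fun _ _ _ => measurableT)
    (fun _ _ _ _ => erefl).
  rewrite e !preimage_setT => ->.
  by apply: le_lt_trans (ltry 1%R); exact: probability_le1.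
Qed.

Definition mix (S : int -> int -> bool) (e e' : @env R) : @env R :=
  fun x tau j => if S x tau then e x tau j else e' x tau j.

(** A cylinder splits into its constraints on the sites in [S] and those outside. The two halves
    concern different copies, so their probabilities multiply; by independence of the sites the
    result is the same product over sites as for a single copy. *)
Lemma law_mix S (F : envT -> R) : measurable_fun setT F ->
  (P \x P)%E.-integrable setT (fun w => (F (mix S (om w.1) (om w.2)))%:E) ->
  P.-integrable setT (EFin \o (F \o om)) ->
  \int[(P \x P)%E]_w F (mix S (om w.1) (om w.2)) = \int[P]_w F (om w).
Proof.
move=> mF iF2 iF.
apply: (law_unique (f := fun w => mix S (om w.1) (om w.2))) => //.
  move=> x tau j _; rewrite /mix; case: (S x tau).
    exact: measurableT_comp (measurable_om x tau j) (@measurable_fst _ _ _ _).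
  exact: measurableT_comp (measurable_om x tau j) (@measurable_snd _ _ _ _).
move=> s A us mA tA.
pose A1 x tau j := if S x tau then A x tau j else setT.
pose A2 x tau j := if S x tau then setT else A x tau j.
have mA1 x tau j : measurable (A1 x tau j) by rewrite /A1; case: ifP.
have mA2 x tau j : measurable (A2 x tau j) by rewrite /A2; case: ifP.
have tA1 : trivial_off s A1 by move=> x tau j /tA e; rewrite /A1 e if_same.
have tA2 : trivial_off s A2 by move=> x tau j /tA e; rewrite /A2 e if_same.
have mcyl B : trivial_off s B -> (forall x tau j, measurable (B x tau j)) ->
    measurable (om @^-1` cylset B).
  move=> tB mB; have mom : measurable_fun setT (om : Omega -> envT).
    by apply: measurable_env => x tau j _; exact: measurable_om.
  rewrite -[X in measurable X]setTI; apply: mom => //.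
  by apply: sub_sigma_algebra; exists s, B.
rewrite (_ : _ @^-1` _ = (om @^-1` cylset A1) `*` (om @^-1` cylset A2)); last first.
  rewrite /A1 /A2 /mix /cylset; apply/seteqP; split=> -[w w'] /=.
    by move=> h; split=> x tau j jM; have := h x tau j jM; case: ifP.
  by move=> [h1 h2] x tau j jM; move: (h1 x tau j jM) (h2 x tau j jM); case: ifP.
transitivity (P (om @^-1` cylset A1) * P (om @^-1` cylset A2))%E.
  exact: product_measure1E (mcyl _ tA1 mA1) (mcyl _ tA2 mA2).
rewrite !(prob_cylset us)// -EFinM -big_split /=; congr EFin.
(* At each site one of the two half-cylinders is unconstrained and contributes a factor 1. *)
apply: eq_bigr => -[x tau] _ /=; rewrite /A1 /A2; case: (S x tau).
  rewrite (_ : site_event om M x tau (fun=> setT) = setT) ?probability_setT ?mulr1//.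
  by apply/seteqP; split.
rewrite (_ : site_event om M x tau (fun=> setT) = setT) ?probability_setT ?mul1r//.
by apply/seteqP; split.
Qed.

Lemma law_shift (x0 tau0 : int) (F : envT -> R) :
  sites_identically_distributed P om M -> measurable_fun setT F ->
  P.-integrable setT (fun w => (F (fun x tau => om w (x0 + x) (tau0 + tau)))%:E) ->
  P.-integrable setT (EFin \o (F \o om)) ->
  \int[P]_w F (fun x tau => om w (x0 + x) (tau0 + tau)) = \int[P]_w F (om w).
Proof.
move=> hid mF iF2 iF.
apply: (law_unique (f := fun w x tau => om w (x0 + x) (tau0 + tau))) => //.
move=> s A us mA tA; rewrite (prob_cylset us)//.
pose B x tau := A (x - x0) (tau - tau0).
rewrite (_ : _ @^-1` _ = om @^-1` cylset B); last first.
  rewrite /B /cylset; apply/seteqP; split=> w /= h x tau j jM.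
    by have := h (x - x0) (tau - tau0) j jM; rewrite !(addrC x0) !(addrC tau0) !subrK.
  by have := h (x0 + x) (tau0 + tau) j jM; rewrite !(addrAC _ _ (- _)) !subrr !add0r.
pose sh (p : int * int) := (x0 + p.1, tau0 + p.2).
have sh_inj : injective sh.
  by move=> [a b] [a' b'] [/addrI -> /addrI ->].
have tB : trivial_off (map sh s) B.
  move=> x tau j; rewrite /B => xs; apply: tA; apply: contra xs => xs.
  by apply/mapP; exists (x - x0, tau - tau0) => //; rewrite /sh /= !(addrC x0) !(addrC tau0) !subrK.
have ush : uniq (map sh s) by rewrite map_inj_uniq.
apply: etrans (prob_cylset ush (fun x tau j => mA (x - x0) (tau - tau0) j) tB) _.
congr EFin; rewrite big_map; apply: eq_bigr => -[x tau] _ /=; congr fine.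
rewrite /B !(addrAC _ _ (- _)) !subrr !add0r.
exact: hid.
Qed.
End Law.
End EnvironmentMeasure.

Section SumM.
Context {R : realType} (M : nat).
Implicit Types f g : int -> R.

Lemma eq_sumM f g : (forall j, in_range M j -> f j = g j) -> sumM M f = sumM M g.
Proof.
move=> fg; apply: eq_bigr => k _; apply: fg; rewrite /in_range.
have := ltn_ord k; rewrite ltnS => hk; apply/andP; split; first by rewrite lerBrDr addNr.
by rewrite lerBlDr -PoszD lez_nat addnn -mul2n.
Qed.

Lemma sumMD f g : sumM M (fun j => f j + g j) = sumM M f + sumM M g.
Proof. exact: big_split. Qed.

Lemma sumMB f g : sumM M (fun j => f j - g j) = sumM M f - sumM M g.
Proof. exact: sumrB. Qed.

Lemma sumMZ c f : sumM M (fun j => c * f j) = c * sumM M f.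
Proof. by rewrite /sumM mulr_sumr. Qed.

Lemma sumMZr c f : sumM M (fun j => f j * c) = sumM M f * c.
Proof. by rewrite /sumM mulr_suml. Qed.

Lemma ler_sumM f g : (forall j, in_range M j -> f j <= g j) -> sumM M f <= sumM M g.
Proof.
move=> fg; apply: ler_sum => k _; apply: fg; rewrite /in_range.
have := ltn_ord k; rewrite ltnS => hk; apply/andP; split; first by rewrite lerBrDr addNr.
by rewrite lerBlDr -PoszD lez_nat addnn -mul2n.
Qed.

Lemma sumM_ge0 f : (forall j, in_range M j -> 0 <= f j) -> 0 <= sumM M f.
Proof.
move=> f0; apply: le_trans (ler_sumM f0); rewrite /sumM big1//.
Qed.

Lemma ler_norm_sumM f : `|sumM M f| <= sumM M (fun j => `|f j|).
Proof. exact: ler_norm_sum. Qed.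

Lemma sumM_exchange (F : int -> int -> R) :
  sumM M (fun i => sumM M (F i)) = sumM M (fun j => sumM M (F^~ j)).
Proof. exact: exchange_big. Qed.

Lemma ler_sumM1 f j : in_range M j -> (forall i, in_range M i -> 0 <= f i) ->
  f j <= sumM M f.
Proof.
rewrite /in_range => jM f0; have hj : (`|(j + M%:Z)%R|%N < (2 * M).+1)%N.
  by rewrite ltnS -lez_nat gez0_abs; lia.
rewrite /sumM (bigD1 (Ordinal hj)) //= gez0_abs; last by lia.
rewrite addrK lerDl; apply: sumr_ge0 => k _; apply: f0; rewrite /in_range.
by have := ltn_ord k; lia.
Qed.
End SumM.

Section Environments.
Context {R : realType} (M : nat).

Definition valid_env (e : @env R) : Prop :=
  (forall x tau j, 0 <= e x tau j) /\ (forall x tau, sumM M (e x tau) = 1).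

Lemma valid_mix S e e' : valid_env e -> valid_env e' -> valid_env (mix S e e').
Proof.
by move=> [e0 e1] [e'0 e'1]; split=> x tau; rewrite /mix; case: (S x tau).
Qed.

Lemma valid_env_le1 e x tau j : valid_env e -> in_range M j -> e x tau j <= 1.
Proof. by move=> [e0 e1] jM; rewrite -(e1 x tau); apply: ler_sumM1. Qed.

(** Boundedness is asked on valid environments only: on all functions even a single coordinate is
    unbounded. The class is closed under the operations used later, so that every expectation taken
    is that of a bounded variable. *)
Definition nice (F : @env R -> R) : Prop :=
  measurable_fun setT (F : envT M -> R) /\
  exists B : R, forall e, valid_env e -> `|F e| <= B.

Lemma nice_cst c : nice (fun=> c).
Proof. by split => //; exists `|c|. Qed.

Lemma niceD F G : nice F -> nice G -> nice (fun e => F e + G e).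
Proof.
move=> [mF [A hA]] [mG [B hB]]; split; first exact: measurable_funD.
exists (A + B) => e ve; apply: le_trans (ler_normD _ _) (lerD _ _).
  exact: hA. exact: hB.
Qed.

Lemma niceM F G : nice F -> nice G -> nice (fun e => F e * G e).
Proof.
move=> [mF [A hA]] [mG [B hB]]; split; first exact: measurable_funM.
by exists (A * B) => e ve; rewrite normrM; apply: ler_pM; rewrite ?hA ?hB.
Qed.

Lemma niceZ c F : nice F -> nice (fun e => c * F e).
Proof. by move=> nF; apply: niceM => //; exact: nice_cst. Qed.

Lemma niceN F : nice F -> nice (fun e => - F e).
Proof.
move=> [mF [B hB]]; split; first exact: measurableT_comp.
by exists B => e ve; rewrite normrN hB.
Qed.

Lemma niceB F G : nice F -> nice G -> nice (fun e => F e - G e).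
Proof. by move=> nF nG; apply: niceD => //; exact: niceN. Qed.

Lemma niceX F n : nice F -> nice (fun e => F e ^+ n).
Proof.
move=> nF; elim: n => [|n IHn]; first exact: nice_cst.
rewrite (_ : (fun e => _) = fun e => F e * F e ^+ n); first exact: niceM.
by apply: funext => e; rewrite exprS.
Qed.

Lemma nice_norm F : nice F -> nice (fun e => `|F e|).
Proof.
move=> [mF [B hB]]; split; first exact: measurableT_comp.
by exists B => e ve; rewrite normr_id hB.
Qed.

Lemma nice_sum (I : Type) (s : seq I) (F : I -> @env R -> R) :
  (forall i, nice (F i)) -> nice (fun e => \sum_(i <- s) F i e).
Proof.
move=> nF; elim: s => [|i s IHs].
  rewrite (_ : (fun e => _) = fun=> 0); first exact: nice_cst.
  by apply: funext => e; rewrite big_nil.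
rewrite (_ : (fun e => _) = fun e => F i e + \sum_(j <- s) F j e); first exact: niceD.
by apply: funext => e; rewrite big_cons.
Qed.

Lemma nice_sumM (F : int -> @env R -> R) :
  (forall j, in_range M j -> nice (F j)) -> nice (fun e => sumM M (F^~ e)).
Proof.
(* [nice_sum] asks for niceness at every index, which is known only within the range; putting zero
   outside leaves the sum unchanged. *)
move=> nF; pose F' j := if in_range M j then F j else fun=> 0.
rewrite (_ : (fun e => _) = fun e => sumM M (F'^~ e)); last first.
  by apply: funext => e; apply: eq_sumM => j jM; rewrite /F' jM.
apply: nice_sum => k; rewrite /F'; case: ifP => [/nF//|_]; exact: nice_cst.
Qed.

Lemma nice_coord x tau j : in_range M j -> nice (fun e => e x tau j).
Proof.
move=> jM; split; first exact: measurable_coord.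
exists 1 => e ve; rewrite ger0_norm; last by case: ve.
exact: valid_env_le1.
Qed.

Lemma nice_comp (h : R -> R) F : continuous h -> (exists C, forall x, `|h x| <= C) ->
  nice F -> nice (fun e => h (F e)).
Proof.
move=> ch [C hC] [mF _]; split; last by exists C.
by apply: measurableT_comp mF; exact: continuous_measurable_fun.
Qed.

Lemma nice_expR F : nice F -> nice (fun e => expR (F e)).
Proof.
move=> [mF [B hB]]; split; first exact: measurableT_comp.
exists (expR B) => e /hB FB; rewrite ger0_norm ?expR_ge0// ler_expR.
exact: le_trans (ler_norm _) FB.
Qed.

Lemma nice_if_le F c G : nice F -> nice G ->
  nice (fun e => if F e <= c then G e else 0).
Proof.
move=> [mF _] [mG [B hB]]; split.
  by apply: measurable_fun_ifT => //; exact: measurable_fun_ler.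
exists B => e ve; case: ifP => _; first exact: hB.
by rewrite normr0; apply: le_trans (hB e ve).
Qed.

Lemma nice_mixr S F e : nice F -> valid_env e -> nice (fun e' => F (mix S e e')).
Proof.
move=> [mF [B hB]] ve; split; last by exists B => e' ve'; apply/hB/valid_mix.
apply: (measurableT_comp mF); apply: measurable_env => x tau j jM.
by rewrite /mix; case: (S x tau); [exact: measurable_cst|exact: measurable_coord].
Qed.

Lemma nice_shift x0 tau0 F : nice F ->
  nice (fun e => F (fun x tau => e (x0 + x) (tau0 + tau))).
Proof.
move=> [mF [B hB]]; split; last first.
  by exists B => e [e0 e1]; apply: hB; split=> *; [exact: e0|exact: e1].
apply: (measurableT_comp mF); apply: measurable_env => x tau j jM.
exact: measurable_coord.
Qed.

Section Expectation.
Context {d : measure_display} {Omega : measurableType d}.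
Variables (P : probability Omega R) (om : Omega -> @env R).
Hypothesis measurable_om : forall x tau j, measurable_fun setT (fun w => om w x tau j).
Hypothesis valid_om : forall w, valid_env (om w).

Definition Ev (F : @env R -> R) : R := Ex P (fun w => F (om w)).

Lemma nice_bounded_rv F : nice F -> bounded_rv (fun w => F (om w)).
Proof.
move=> [mF [B hB]]; split; last by exists B => w; exact: hB.
by apply: (measurableT_comp mF); apply: measurable_env => x tau j _.
Qed.

Lemma EvD F G : nice F -> nice G -> Ev (fun e => F e + G e) = Ev F + Ev G.
Proof. by move=> /nice_bounded_rv nF /nice_bounded_rv nG; rewrite /Ev -ExD. Qed.

Lemma EvB F G : nice F -> nice G -> Ev (fun e => F e - G e) = Ev F - Ev G.
Proof. by move=> /nice_bounded_rv nF /nice_bounded_rv nG; rewrite /Ev -ExB. Qed.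

Lemma EvZ c F : nice F -> Ev (fun e => c * F e) = c * Ev F.
Proof. by move=> /nice_bounded_rv nF; rewrite /Ev -ExZ. Qed.

Lemma Ev_cst c : Ev (fun=> c) = c.
Proof. exact: Ex_cst. Qed.

Lemma Ev_sum (I : Type) (s : seq I) (F : I -> @env R -> R) :
  (forall i, nice (F i)) ->
  Ev (fun e => \sum_(i <- s) F i e) = \sum_(i <- s) Ev (F i).
Proof. by move=> nF; rewrite /Ev -Ex_sum// => i _; exact: nice_bounded_rv. Qed.

Lemma eq_Ev F G : (forall e, valid_env e -> F e = G e) -> Ev F = Ev G.
Proof. by move=> FG; congr Ex; apply: funext => w; exact: FG. Qed.

Lemma Ev_sumM (F : int -> @env R -> R) : (forall j, in_range M j -> nice (F j)) ->
  Ev (fun e => sumM M (F^~ e)) = sumM M (fun j => Ev (F j)).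
Proof.
move=> nF; pose F' j := if in_range M j then F j else fun=> 0.
rewrite (@eq_Ev _ (fun e => sumM M (F'^~ e))); last first.
  by move=> e _; apply: eq_sumM => j jM; rewrite /F' jM.
rewrite Ev_sum.
  rewrite -[LHS]/(sumM M (fun j => Ev (F' j))).
  by apply: eq_sumM => j jM; rewrite /F' jM.
by move=> k; rewrite /F'; case: ifP => [/nF//|_]; exact: nice_cst.
Qed.

Lemma le_Ev F G : nice F -> nice G -> (forall e, valid_env e -> F e <= G e) ->
  Ev F <= Ev G.
Proof.
move=> /nice_bounded_rv nF /nice_bounded_rv nG FG; apply: le_Ex => // w.
exact: FG.
Qed.

Lemma Ev_ge0 F : (forall e, valid_env e -> 0 <= F e) -> 0 <= Ev F.
Proof. by move=> F0; apply: Ex_ge0 => w; exact: F0. Qed.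

Lemma normr_Ev F : nice F -> `|Ev F| <= Ev (fun e => `|F e|).
Proof. by move=> /nice_bounded_rv nF; exact: normr_Ex. Qed.

(** Cauchy-Schwarz, read off from the nonnegative mean of the square of |F| - m, where m is the mean
    of |F|. *)
Lemma sqr_Ev_norm_le F : nice F -> (Ev (fun e => `|F e|)) ^+ 2 <= Ev (fun e => F e ^+ 2).
Proof.
move=> nF; set m := Ev _; have nF2 : nice (fun e => F e ^+ 2) by exact: niceX.
have nn := nice_norm nF.
have : 0 <= Ev (fun e => (`|F e| - m) ^+ 2) by apply: Ev_ge0 => e _; exact: sqr_ge0.
rewrite (@eq_Ev _ (fun e => (F e ^+ 2 - (m *+ 2) * `|F e|) + m ^+ 2)); last first.
  by move=> e _; rewrite sqrrB -[F e ^+ 2]real_normK ?num_real//; ring.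
rewrite EvD; [|by apply: niceB => //; exact: niceZ|exact: nice_cst].
rewrite (EvB nF2 (niceZ _ nn)) EvZ// Ev_cst -/m; lra.
Qed.

Hypothesis independent_om : sites_independent P om M.

(* Resampling the sites outside [S] does not change the law of the environment. *)
Lemma le_Ev_resample S F G : nice F -> nice G ->
  (forall e, valid_env e -> Ev (fun e' => F (mix S e e')) <= G e) -> Ev F <= Ev G.
Proof.
move=> nF nG FG; have [mF [B hB]] := nF.
have iF := bounded_rv_integrable P (nice_bounded_rv nF).
have iF2 : (P \x P)%E.-integrable setT
    (fun w => (F (mix S (om w.1) (om w.2)))%:E).
  apply: (@measurable_bounded_integrable _ _ _ (P \x P)%E
    (fun w => F (mix S (om w.1) (om w.2)))) => //.
  - have := product_measure1E P P (@measurableT _ Omega) (@measurableT _ Omega).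
    rewrite setXTT => PPT; apply: (@le_lt_trans _ _ (P setT * P setT)%E).
      by rewrite le_eqVlt; apply/orP; left; apply/eqP; exact: PPT.
    by rewrite -ge0_fin_numE ?mule_ge0// fin_numM// fin_num_measure.
  - apply: (measurableT_comp mF); apply: measurable_env => x tau j _.
    rewrite /mix; case: (S x tau).
      exact: measurableT_comp (measurable_om x tau j) (@measurable_fst _ _ _ _).
    exact: measurableT_comp (measurable_om x tau j) (@measurable_snd _ _ _ _).
  - exists B; split; first exact: num_real.
    move=> x Bx w _ /=; apply: le_trans (ltW Bx); apply: hB.
    exact: valid_mix.
have e1 : ((Ev F)%:E = \int[P]_w \int[P]_w' (F (mix S (om w) (om w')))%:E)%E.
  rewrite /Ev /Ex -(law_mix measurable_om independent_om mF iF2 iF) /Rintegral fineK.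
    by rewrite -(integral12_prod_meas1 iF2).
  exact: integrable_fin_num iF2.
have iG := bounded_rv_integrable P (nice_bounded_rv nG).
rewrite -lee_fin e1 -(expectation_Ex P (nice_bounded_rv nG)) unlock.
apply: le_integral => //; first exact: integrable_fubini_F iF2.
move=> w _ /=.
have nFw := nice_mixr S nF (valid_om w).
have := expectation_Ex P (nice_bounded_rv nFw); rewrite unlock => ->.
by rewrite lee_fin; exact: FG.
Qed.

Lemma Ev_resample S F G : nice F -> nice G ->
  (forall e, valid_env e -> Ev (fun e' => F (mix S e e')) = G e) -> Ev F = Ev G.
Proof.
move=> nF nG FG; apply/eqP; rewrite eq_le; apply/andP; split.
  by apply: (@le_Ev_resample S) => // e ve; rewrite FG.
(* The reverse inequality is the same lemma applied to -F and -G. *)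
rewrite -(ler_nM2l (ltrN10 R)) -(EvZ (-1) nF) -(EvZ (-1) nG).
apply: (@le_Ev_resample S); [exact: niceZ|exact: niceZ|move=> e ve].
by rewrite (EvZ (-1) (nice_mixr S nF ve)) FG.
Qed.

Hypothesis identical_om : sites_identically_distributed P om M.

Lemma Ev_shift x0 tau0 F : nice F ->
  Ev (fun e => F (fun x tau => e (x0 + x) (tau0 + tau))) = Ev F.
Proof.
move=> nF; apply: (law_shift measurable_om independent_om) => //.
- by case: nF.
- exact (bounded_rv_integrable P (nice_bounded_rv (nice_shift x0 tau0 nF))).
- exact (bounded_rv_integrable P (nice_bounded_rv nF)).
Qed.

End Expectation.
End Environments.

(** * Quenched laws of the walks *)

Section QuenchedLaw.
Context {R : realType} (M T : nat).
Implicit Types (e : @env R) (f g : int -> R) (w v : nat * int).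

Definition level (k : nat) : int := T%:Z - k%:Z.

Definition transition e (tau : int) f (x : int) : R :=
  sumM M (fun j => e x tau j * f (x + j)).

(* A walk [w = (k0, x0)] stays at [x0] until stage [k0], i.e. it starts from the
   site [(x0, T - k0)]; between the stages [k] and [k + 1] it crosses the level [T - k]. *)
Definition stage_step e w k f : int -> R :=
  if (w.1 <= k)%N then transition e (level k) f else f.

(** The last step acts on [f] first: a composition of transition operators evaluated at the start.
    Peeling off the last step, where [qE] peels off the first, makes the state at stage [k] depend
    only on the levels already crossed. *)
Fixpoint law e w k f : R :=
  if k is k'.+1 then law e w k' (stage_step e w k' f) else f w.2.

(** Given the environment two walks are independent, hence an iterated functional; after averaging
    over the environment the joint law is no longer a product once the walks can meet. *)
Definition law2 e w v k (F : int -> int -> R) : R :=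
  law e w k (fun x => law e v k (F x)).

Definition stage_step2 e w v k (F : int -> int -> R) (x y : int) : R :=
  stage_step e w k (fun x' => stage_step e v k (F x') y) x.

(** Each step multiplies the number of atoms by 2M + 1. Linearity, monotonicity and exchange of two
    laws all follow from this representation. *)
Lemma law_repr e w k : valid_env M e ->
  exists (I : finType) (c : I -> R) (z : I -> int),
    [/\ forall i, 0 <= c i, \sum_i c i = 1 &
        forall f, law e w k f = \sum_i c i * f (z i)].
Proof.
move=> [e0 e1]; elim: k => [|k [I [c [z [c0 c1 cf]]]]].
  exists unit, (fun=> 1), (fun=> w.2); split => //=.
    by rewrite (bigD1 tt)//= big1 ?addr0// => -[].
  by move=> f; rewrite (bigD1 tt)//= big1 ?addr0 ?mul1r// => -[].
rewrite /= /stage_step; case: (w.1 <= k)%N; last by exists I, c, z.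
exists (I * 'I_(2 * M).+1)%type,
  (fun p : I * 'I_(2 * M).+1 => c p.1 * e (z p.1) (level k) (p.2%:Z - M%:Z)),
  (fun p : I * 'I_(2 * M).+1 => z p.1 + (p.2%:Z - M%:Z)); split => /=.
- by move=> p; apply: mulr_ge0.
- rewrite -(pair_bigA _ (fun i (j : 'I_(2 * M).+1) => c i * e (z i) (level k) (j%:Z - M%:Z))) /=.
  rewrite -[RHS]c1; apply: eq_bigr => i _.
  by rewrite -mulr_sumr -[X in _ * X]/(sumM M (e (z i) (level k))) e1 mulr1.
- move=> f; rewrite cf.
  rewrite -(pair_bigA _ (fun i (j : 'I_(2 * M).+1) => c i * e (z i) (level k) (j%:Z - M%:Z) *
     f (z i + (j%:Z - M%:Z)))) /=.
  apply: eq_bigr => i _; rewrite mulr_sumr; apply: eq_bigr => j _.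
  by rewrite mulrA.
Qed.

Section Linear.
Variables (e : @env R) (w : nat * int) (k : nat).
Hypothesis ve : valid_env M e.

Lemma law_cst c : law e w k (fun=> c) = c.
Proof.
have [I [a [z [_ a1 ->]]]] := law_repr w k ve.
by rewrite -mulr_suml a1 mul1r.
Qed.

Lemma lawZ c f : law e w k (fun x => c * f x) = c * law e w k f.
Proof.
have [I [a [z [_ _ af]]]] := law_repr w k ve; rewrite !af mulr_sumr.
by apply: eq_bigr => i _; rewrite mulrCA.
Qed.

Lemma lawD f g : law e w k (fun x => f x + g x) = law e w k f + law e w k g.
Proof.
have [I [a [z [_ _ af]]]] := law_repr w k ve; rewrite !af -big_split.
by apply: eq_bigr => i _; rewrite mulrDr.
Qed.

Lemma lawB f g : law e w k (fun x => f x - g x) = law e w k f - law e w k g.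
Proof.
have [I [a [z [_ _ af]]]] := law_repr w k ve; rewrite !af -sumrB.
by apply: eq_bigr => i _; rewrite mulrBr.
Qed.

Lemma law_sum (I : Type) (s : seq I) (F : I -> int -> R) :
  law e w k (fun x => \sum_(i <- s) F i x) = \sum_(i <- s) law e w k (F i).
Proof.
have [J [a [z [_ _ af]]]] := law_repr w k ve; rewrite af.
under [RHS]eq_bigr do rewrite af.
by rewrite exchange_big; apply: eq_bigr => j _; rewrite mulr_sumr.
Qed.

Lemma le_law f g : (forall x, f x <= g x) -> law e w k f <= law e w k g.
Proof.
have [I [a [z [a0 _ af]]]] := law_repr w k ve; rewrite !af => fg.
by apply: ler_sum => i _; apply: ler_wpM2l.
Qed.

Lemma normr_law f : `|law e w k f| <= law e w k (fun x => `|f x|).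
Proof.
have [I [a [z [a0 _ af]]]] := law_repr w k ve; rewrite !af.
apply: le_trans (ler_norm_sum _ _ _) _; apply: ler_sum => i _.
by rewrite normrM (ger0_norm (a0 i)).
Qed.

Lemma normr_law_le f C : (forall x, `|f x| <= C) -> `|law e w k f| <= C.
Proof.
by move=> fC; apply: le_trans (normr_law f) _; rewrite -[leRHS]law_cst; exact: le_law.
Qed.

Lemma law_exchange v l (F : int -> int -> R) :
  law e w k (fun x => law e v l (F x)) = law e v l (fun y => law e w k (F^~ y)).
Proof.
have [J [b [y [_ _ bf]]]] := law_repr v l ve; rewrite bf.
transitivity (law e w k (fun x => \sum_j b j * F x (y j))).
  by congr (law e w k _); apply: funext => x; rewrite bf.
by rewrite law_sum; apply: eq_bigr => j _; rewrite lawZ.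
Qed.

End Linear.

Lemma law2D e w v k F G : valid_env M e ->
  law2 e w v k (fun x y => F x y + G x y) = law2 e w v k F + law2 e w v k G.
Proof.
move=> ve; rewrite /law2 -lawD//; congr (law e w k _); apply: funext => x.
exact: lawD.
Qed.

Lemma law2B e w v k F G : valid_env M e ->
  law2 e w v k (fun x y => F x y - G x y) = law2 e w v k F - law2 e w v k G.
Proof.
move=> ve; rewrite /law2 -lawB//; congr (law e w k _); apply: funext => x.
exact: lawB.
Qed.

Lemma law2Z e w v k c F : valid_env M e ->
  law2 e w v k (fun x y => c * F x y) = c * law2 e w v k F.
Proof.
move=> ve; rewrite /law2 -lawZ//; congr (law e w k _); apply: funext => x.
exact: lawZ.
Qed.

Lemma law2_cst e w v k c : valid_env M e -> law2 e w v k (fun _ _ => c) = c.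
Proof.
move=> ve; rewrite /law2 -[RHS](law_cst w k ve c); congr (law e w k _).
by apply: funext => x; exact: law_cst.
Qed.

Lemma le_law2 e w v k F G : valid_env M e -> (forall x y, F x y <= G x y) ->
  law2 e w v k F <= law2 e w v k G.
Proof. by move=> ve FG; apply: le_law => // x; apply: le_law. Qed.

Lemma normr_law2 e w v k F : valid_env M e ->
  `|law2 e w v k F| <= law2 e w v k (fun x y => `|F x y|).
Proof.
move=> ve; apply: le_trans (normr_law _ _ ve _) _.
by apply: le_law => // x; exact: normr_law.
Qed.

Lemma normr_law2_le e w v k F C : valid_env M e -> (forall x y, `|F x y| <= C) ->
  `|law2 e w v k F| <= C.
Proof.
by move=> ve FC; apply: normr_law_le => // x; exact: normr_law_le.
Qed.

Lemma law2_fst e w v k f : valid_env M e -> law2 e w v k (fun x _ => f x) = law e w k f.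
Proof.
by move=> ve; congr (law e w k _); apply: funext => x; exact: law_cst.
Qed.

Lemma law2_snd e w v k f : valid_env M e -> law2 e w v k (fun _ y => f y) = law e v k f.
Proof. by move=> ve; exact: law_cst. Qed.

(** The step of [w] is a finite sum whose coefficients do not involve the position of [v], so it
    passes inside the law of [v] by linearity. *)
Lemma law2S e w v k F : valid_env M e ->
  law2 e w v k.+1 F = law2 e w v k (stage_step2 e w v k F).
Proof.
move=> ve; rewrite /law2 /=; congr (law e w k _); apply: funext => x.
rewrite /stage_step2 {1 3}/stage_step; case: ifP => // _; rewrite /transition /sumM.
rewrite law_sum//; apply: eq_bigr => j _; exact/esym/lawZ.
Qed.

(** [f] may depend on the stage: the potential kernel uses a constant family, the smoothed distance
    one that nearly solves a backward heat equation. *)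
Lemma law2_telescope e w v (f : nat -> int -> int -> R) l K : valid_env M e -> (l <= K)%N ->
  law2 e w v K (f K) - law2 e w v l (f l) =
  \sum_(l <= k < K) law2 e w v k (fun x y => stage_step2 e w v k (f k.+1) x y - f k x y).
Proof.
move=> ve; elim: K => [|K IHK].
  by rewrite leqn0 => /eqP ->; rewrite big_geq// subrr.
rewrite leq_eqVlt => /predU1P[->|lK]; first by rewrite big_geq// subrr.
rewrite big_nat_recr//= -IHK// law2S// law2B//; ring.
Qed.

Definition same_below k e e' : Prop :=
  forall x l j, (l < k)%N -> e x (level l) j = e' x (level l) j.

Lemma law_same_below e e' w k : same_below k e e' -> law e w k = law e' w k.
Proof.
move=> ee; apply: funext => f; elim: k f ee => [//|k IHk] f ee /=.
rewrite IHk; last by move=> x l j lk; apply: ee; exact: ltnW.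
congr (law e' w k _); rewrite /stage_step; case: ifP => // _.
by apply: funext => x; apply: eq_bigr => j _; rewrite ee.
Qed.

Lemma law2_same_below e e' w v k : same_below k e e' -> law2 e w v k = law2 e' w v k.
Proof.
by move=> ee; apply: funext => F; rewrite /law2 !(law_same_below _ ee).
Qed.

Lemma nice_transition tau (F : @env R -> int -> R) x : (forall x, nice M (F^~ x)) ->
  nice M (fun e => transition e tau (F e) x).
Proof.
move=> nF; apply: (@nice_sumM _ _ (fun j e => e x tau j * F e (x + j))) => j jM.
by apply: niceM; [exact: nice_coord|exact: nF].
Qed.

Lemma nice_stage_step w k (F : @env R -> int -> R) x : (forall x, nice M (F^~ x)) ->
  nice M (fun e => stage_step e w k (F e) x).
Proof.
by rewrite /stage_step => nF; case: (w.1 <= k)%N; [exact: nice_transition|exact: nF].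
Qed.

Lemma nice_law w k (F : @env R -> int -> R) : (forall x, nice M (F^~ x)) ->
  nice M (fun e => law e w k (F e)).
Proof.
elim: k F => [|k IHk] F nF /=; first exact: nF.
by apply: (IHk (fun e => stage_step e w k (F e))) => x; exact: nice_stage_step.
Qed.

Lemma nice_law2 w v k (F : @env R -> int -> int -> R) :
  (forall x y, nice M (fun e => F e x y)) -> nice M (fun e => law2 e w v k (F e)).
Proof.
by move=> nF; apply: (@nice_law w k (fun e x => law e v k (F e x))) => x; apply: nice_law.
Qed.

Lemma nice_stage_step2 w v k (F : int -> int -> R) x y :
  nice M (fun e => stage_step2 e w v k F x y).
Proof.
apply: (@nice_stage_step w k (fun e x' => stage_step e v k (F x') y)) => x'.
by apply: (@nice_stage_step v k (fun _ => F x')) => y'; exact: nice_cst.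
Qed.

(** The sites kept when the level crossed between the stages [k] and [k + 1] is resampled. What is
    known at stage [k] uses earlier levels only and is unchanged, so averaging over the resampled
    copy plays the part of a conditional expectation given the past. *)
Definition other_levels (k : nat) : int -> int -> bool := fun _ tau => tau != level k.

Lemma level_inj : injective level.
Proof. by move=> k l; rewrite /level => h; lia. Qed.

Lemma same_below_mix k e e' : same_below k (mix (other_levels k) e e') e.
Proof.
move=> x l j lk; rewrite /mix /other_levels ifT//; apply/eqP => /level_inj kl.
by rewrite kl ltnn in lk.
Qed.

Lemma mix_level k e e' x : mix (other_levels k) e e' x (level k) = e' x (level k).
Proof. by rewrite /mix /other_levels eqxx. Qed.

End QuenchedLaw.

Section QuenchedMean.
Context {R : realType} (M : nat).

Fixpoint first_step (e : @env R) (s : nat) (f : int -> R) (i tau : int) : R :=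
  if s is s'.+1 then sumM M (fun j => e i tau j * first_step e s' f (i + j) (tau - 1))
  else f i.

(** The Markov property in the form that trades a first step for a last one; it reconciles the
    recursion of [qE] with that of [law]. *)
Lemma first_stepS e s f i tau :
  first_step e s.+1 f i tau = first_step e s (transition M e (tau - s%:Z) f) i tau.
Proof.
elim: s i tau => [|s IHs] i tau; first by rewrite /= subr0.
rewrite [LHS]/= [RHS]/=; apply: eq_bigr => j _; congr (_ * _).
rewrite -[LHS]/(first_step e s.+1 f _ _) IHs; congr (first_step e s _ _ _).
by congr transition; lia.
Qed.

Lemma law_qE (T : nat) (e : @env R) k0 x0 s :
  law M T e (k0, x0) (k0 + s) (fun x => x%:~R) = qE M e s x0 (level T k0).
Proof.
have step f : law M T e (k0, x0) (k0 + s) f = first_step e s f x0 (level T k0).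
  elim: s f => [|s IHs] f.
    rewrite addn0 /=; suff frozen k g : (k <= k0)%N -> law M T e (k0, x0) k g = g x0.
      by rewrite frozen.
    elim: k g => [//|k IHk] g kk /=.
    by rewrite /stage_step /= leqNgt kk IHk// ltnW.
  rewrite addnS first_stepS [LHS]/= IHs /stage_step leq_addr.
  by congr (first_step e s (transition M e _ f) _ _); rewrite /level; lia.
rewrite step; elim: s x0 (level T k0) {step} => [//|s IHs] x0 tau /=.
by apply: eq_bigr => j _; rewrite IHs.
Qed.
End QuenchedMean.

(** * Annealed means and collisions *)

Section Annealed.
Context {R : realType} (M T : nat).
Context {d : measure_display} {Omega : measurableType d}.
Variables (P : probability Omega R) (om : Omega -> @env R).
Hypothesis measurable_om : forall x tau j, measurable_fun setT (fun w => om w x tau j).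
Hypothesis valid_om : forall w, valid_env M (om w).
Hypothesis independent_om : sites_independent P om M.
Hypothesis identical_om : sites_identically_distributed P om M.
Implicit Types (e : @env R) (f : int -> R) (F : int -> int -> R) (w v : nat * int).

Local Notation Ev := (Ev P om).
Local Notation p := (pbar P om).
Local Notation nice := (@nice R M).
Local Notation valid_env := (@valid_env R M).

(** Averaged joint law of the steps of two walks on the same site: they use the same random vector,
    so it differs from a product of two copies of [pbar]. *)
Definition pair_mean (z1 z2 : int) : R := Ev (fun e => e 0 0 z1 * e 0 0 z2).

Lemma pbar_Ev j : p j = Ev (fun e => e 0 0 j).
Proof. exact: fine_expectation. Qed.

Lemma Ev_coord x tau j : in_range M j -> Ev (fun e => e x tau j) = p j.
Proof.
move=> jM; rewrite pbar_Ev.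
rewrite -(Ev_shift measurable_om valid_om independent_om identical_om x tau
  (nice_coord 0 0 jM)).
by congr Ex; apply: funext => o; rewrite !addr0.
Qed.

Lemma Ev_coord_same x tau z1 z2 : in_range M z1 -> in_range M z2 ->
  Ev (fun e => e x tau z1 * e x tau z2) = pair_mean z1 z2.
Proof.
move=> z1M z2M; rewrite /pair_mean.
rewrite -(Ev_shift measurable_om valid_om independent_om identical_om x tau
  (niceM (nice_coord 0 0 z1M) (nice_coord 0 0 z2M))).
by congr Ex; apply: funext => o; rewrite !addr0.
Qed.

Lemma Ev_coord_neq x y tau z1 z2 : x != y -> in_range M z1 -> in_range M z2 ->
  Ev (fun e => e x tau z1 * e y tau z2) = p z1 * p z2.
Proof.
move=> xy z1M z2M; rewrite -(Ev_coord x tau z1M) -(Ev_coord y tau z2M) mulrC.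
have n1 : nice (fun e => e x tau z1) by exact: nice_coord.
have n2 : nice (fun e => e y tau z2) by exact: nice_coord.
rewrite -(EvZ P measurable_om valid_om _ n1).
apply: (Ev_resample measurable_om valid_om independent_om (S := fun u _ => u == x)).
- exact: niceM.
- exact: niceZ.
move=> e ve.
rewrite (@eq_Ev _ M _ _ _ _ valid_om _ (fun e' => e x tau z1 * e' y tau z2)); last first.
  by move=> e' _; rewrite /mix eqxx eq_sym (negbTE xy).
by rewrite (EvZ P measurable_om valid_om _ n2) mulrC.
Qed.

Lemma pbar_ge0 j : 0 <= p j.
Proof. by rewrite pbar_Ev; apply: (Ev_ge0 P valid_om) => e []. Qed.

Lemma sum_pbar : sumM M p = 1.
Proof.
rewrite -(Ev_cst P om 1) (@eq_Ev _ M _ _ _ _ valid_om _ (fun e => sumM M (e 0 0))).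
  rewrite (Ev_sumM P measurable_om valid_om (F := fun j e => e 0 0 j)); last first.
    by move=> j jM; exact: nice_coord.
  by apply: eq_sumM => j jM; exact: pbar_Ev.
by move=> e [].
Qed.

(** A deterministic environment with the averaged jump law at every site. It is valid, so all lemmas
    about [law] apply to the averaged walk as well. *)
Definition mean_env : @env R := fun _ _ j => p j.

Lemma valid_mean_env : valid_env mean_env.
Proof. by split=> x tau; [exact: pbar_ge0|exact: sum_pbar]. Qed.

Definition mean_step2 w v k F x y : R :=
  Ev (fun e => stage_step2 M T e w v k F x y).

Lemma Ev_transition tau f x :
  Ev (fun e => transition M e tau f x) = transition M mean_env tau f x.
Proof.
rewrite (Ev_sumM P measurable_om valid_om (F := fun j e => e x tau j * f (x + j))); last first.
  by move=> j jM; apply: niceM; [exact: nice_coord|exact: nice_cst].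
apply: eq_sumM => j jM; rewrite /mean_env -(Ev_coord x tau jM) [RHS]mulrC.
rewrite -(EvZ P measurable_om valid_om _ (nice_coord x tau jM)).
by congr Ex; apply: funext => o; rewrite mulrC.
Qed.

Lemma Ev_transition2 tau F x y :
  Ev (fun e => transition M e tau (fun x' => transition M e tau (F x') y) x) =
  sumM M (fun z1 => sumM M (fun z2 =>
    Ev (fun e => e x tau z1 * e y tau z2) * F (x + z1) (y + z2))).
Proof.
rewrite (Ev_sumM P measurable_om valid_om
  (F := fun j e => e x tau j * transition M e tau (F (x + j)) y)); last first.
  move=> j jM; apply: niceM; first exact: nice_coord.
  by apply: (@nice_transition _ _ _ (fun _ => F (x + j))) => z; exact: nice_cst.
apply: eq_sumM => z1 z1M.
rewrite (@eq_Ev _ M _ _ _ _ valid_om _ (fun e => sumM M (fun z2 =>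
   F (x + z1) (y + z2) * (e x tau z1 * e y tau z2)))); last first.
  move=> e _; rewrite -sumMZ; apply: eq_sumM => z2 _; ring.
rewrite (Ev_sumM P measurable_om valid_om
  (F := fun z2 e => F (x + z1) (y + z2) * (e x tau z1 * e y tau z2))); last first.
  by move=> j jM; apply: niceZ; apply: niceM; exact: nice_coord.
apply: eq_sumM => z2 z2M; rewrite mulrC.
by rewrite (EvZ P measurable_om valid_om)//; apply: niceM; exact: nice_coord.
Qed.

(** The two steps read different sites, or at most one walk moves, so the expectation factors into
    averaged steps. *)
Lemma mean_step2_free w v k F x y : ~~ [&& (w.1 <= k)%N, (v.1 <= k)%N & x == y] ->
  mean_step2 w v k F x y = stage_step2 M T mean_env w v k F x y.
Proof.
rewrite /mean_step2 /stage_step2 /stage_step.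
case: (w.1 <= k)%N; case: (v.1 <= k)%N => //= xy; last 3 first.
- exact: (Ev_transition _ (fun x' => F x' y)).
- exact: Ev_transition.
- exact: Ev_cst.
rewrite Ev_transition2; apply: eq_sumM => z1 z1M; rewrite -sumMZ.
by apply: eq_sumM => z2 z2M; rewrite Ev_coord_neq// mulrA.
Qed.

Lemma mean_step2_collide w v k F x : (w.1 <= k)%N -> (v.1 <= k)%N ->
  mean_step2 w v k F x x =
  sumM M (fun z1 => sumM M (fun z2 => pair_mean z1 z2 * F (x + z1) (x + z2))).
Proof.
move=> wk vk; rewrite /mean_step2 /stage_step2 /stage_step wk vk Ev_transition2.
apply: eq_sumM => z1 z1M; apply: eq_sumM => z2 z2M.
by rewrite Ev_coord_same.
Qed.

Lemma Ev_law e w k (G : @env R -> int -> R) : valid_env e -> (forall x, nice (G^~ x)) ->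
  Ev (fun e' => law M T e w k (G e')) = law M T e w k (fun x => Ev (G^~ x)).
Proof.
move=> ve nG; have [I [c [z [_ _ cf]]]] := law_repr T w k ve; rewrite cf.
rewrite (@eq_Ev _ M _ _ _ _ valid_om _ (fun e' => \sum_i c i * G e' (z i))); last first.
  by move=> e' _; rewrite cf.
rewrite (Ev_sum P measurable_om valid_om); last by move=> i; exact: niceZ.
by apply: eq_bigr => i _; rewrite (EvZ P measurable_om valid_om).
Qed.

Lemma Ev_law2 e w v k (G : @env R -> int -> int -> R) : valid_env e ->
  (forall x y, nice (fun e' => G e' x y)) ->
  Ev (fun e' => law2 M T e w v k (G e')) =
  law2 M T e w v k (fun x y => Ev (fun e' => G e' x y)).
Proof.
move=> ve nG; rewrite /law2 (@Ev_law e w k (fun e' x => law M T e v k (G e' x)))//.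
  by congr (law M T e w k _); apply: funext => x; apply: (@Ev_law _ _ _ (fun e' => G e' x)).
move=> x; have [I [c [z [_ _ cf]]]] := law_repr T v k ve.
rewrite (_ : (fun e' => _) = fun e' => \sum_i c i * G e' x (z i)); last first.
  by apply: funext => e'; rewrite cf.
by apply: nice_sum => i; exact: niceZ.
Qed.

(* Probability, given the environment, that both walks are active and together. *)
Definition collision w v k e : R :=
  if (w.1 <= k)%N && (v.1 <= k)%N then law2 M T e w v k (fun x y => (x == y)%:R) else 0.

Lemma nice_collision w v k : nice (collision w v k).
Proof.
rewrite /collision; case: andP => _; last exact: nice_cst.
by apply: (@nice_law2 _ _ _ _ _ _ (fun _ x y => (x == y)%:R)) => x y; exact: nice_cst.
Qed.

Lemma collision_ge0 w v k e : valid_env e -> 0 <= collision w v k e.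
Proof.
move=> ve; rewrite /collision; case: andP => // _.
rewrite -(law2_cst T w v k 0 ve); apply: le_law2 => // x y; exact: ler0n.
Qed.

(** * Second moments of the noise carried by a pair of walks *)

Section Noise.
Variables (w v : nat * int) (N : nat -> @env R -> int -> int -> R) (C : R).
Hypothesis nice_N : forall k x y, nice (fun e => N k e x y).
Hypothesis local_N : forall k e e' x y,
  ((w.1 <= k)%N -> e x (level T k) = e' x (level T k)) ->
  ((v.1 <= k)%N -> e y (level T k) = e' y (level T k)) -> N k e x y = N k e' x y.
Hypothesis centered_N : forall k x y, Ev (fun e => N k e x y) = 0.
Hypothesis bounded_N : forall k e x y, valid_env e -> `|N k e x y| <= C.

Local Notation noise k := (fun e => law2 M T e w v k (N k e)).

Lemma nice_noise k : nice (noise k).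
Proof. by apply: nice_law2. Qed.

Lemma noise_mix k e e' : noise k (mix (other_levels T k) e e') = law2 M T e w v k (N k e').
Proof.
cbv beta; rewrite (law2_same_below M w v (@same_below_mix _ T k e e')).
congr (law2 M T e w v k _); apply: funext => x; apply: funext => y.
by apply: local_N => _; exact: mix_level.
Qed.

Lemma Ev_noise k : Ev (noise k) = 0.
Proof.
rewrite -(Ev_cst P om 0).
apply: (Ev_resample measurable_om valid_om independent_om (S := other_levels T k)).
- exact: nice_noise.
- exact: nice_cst.
move=> e ve.
rewrite (@eq_Ev _ M _ _ _ _ valid_om _ (fun e' => law2 M T e w v k (N k e'))); last first.
  by move=> e' _; exact: noise_mix.
rewrite Ev_law2// -(law2_cst T w v k 0 ve); congr (law2 M T e w v k _).
by apply: funext => x; apply: funext => y.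
Qed.

(** Martingale difference property: [A] is fixed by the other levels, and given these the noise has
    mean zero. *)
Lemma Ev_past_noise k A : nice A ->
  (forall e e', A (mix (other_levels T k) e e') = A e) -> Ev (fun e => A e * noise k e) = 0.
Proof.
move=> nA Ae; rewrite -(Ev_cst P om 0).
apply: (Ev_resample measurable_om valid_om independent_om (S := other_levels T k)).
- by apply: niceM => //; exact: nice_noise.
- exact: nice_cst.
move=> e ve.
rewrite (@eq_Ev _ M _ _ _ _ valid_om _ (fun e' => A e * law2 M T e w v k (N k e'))); last first.
  by move=> e' _; rewrite noise_mix Ae.
have nl : nice (fun e' => law2 M T e w v k (N k e')).
  have := nice_mixr (other_levels T k) (nice_noise k) ve.
  by congr nice; apply: funext => e'; rewrite noise_mix.
rewrite (EvZ P measurable_om valid_om _ nl) Ev_law2//.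
rewrite (_ : (fun x y => _) = fun _ _ => 0) ?law2_cst ?mulr0//.
by apply: funext => x; apply: funext => y.
Qed.

(** Counts the coincidences of an active site of the first pair with an active site of the second.
    When it vanishes, the two noises read disjoint sites. *)
Let overlap k (x y x' y' : int) : R :=
  (if (w.1 <= k)%N then (x == x')%:R else 0)
  + (if (w.1 <= k)%N && (v.1 <= k)%N then (x == y')%:R + (y == x')%:R else 0)
  + (if (v.1 <= k)%N then (y == y')%:R else 0).

Lemma Ev_noise_pair k x y x' y' :
  Ev (fun e => N k e x y * N k e x' y') <= C ^+ 2 * overlap k x y x' y'.
Proof.
have NN : Ev (fun e => N k e x y * N k e x' y') <= C ^+ 2.
  rewrite -(Ev_cst P om (C ^+ 2)); apply: (le_Ev P measurable_om valid_om).
  - exact: niceM.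
  - exact: nice_cst.
  move=> e ve; apply: le_trans (ler_norm _) _; rewrite normrM expr2.
  by apply: ler_pM => //; exact: bounded_N.
(* [S] collects the sites that the first noise may read; the second noise is resampled independently
   outside it. *)
pose S u (tau : int) := ((w.1 <= k)%N && (u == x)) || ((v.1 <= k)%N && (u == y)).
have o0 : 0 <= overlap k x y x' y'.
  by rewrite /overlap; do !apply: addr_ge0; case: ifP => // _; rewrite ?addr_ge0 ?ler0n.
have [disj|] := boolP (((w.1 <= k)%N ==> ~~ S x' 0) && ((v.1 <= k)%N ==> ~~ S y' 0)).
  rewrite [X in X <= _](_ : _ = 0).
    by rewrite mulr_ge0// sqr_ge0.
  rewrite -(Ev_cst P om 0).
  apply: (Ev_resample measurable_om valid_om independent_om (S := S)).
  - exact: niceM.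
  - exact: nice_cst.
  move=> e ve.
  rewrite (@eq_Ev _ M _ _ _ _ valid_om _ (fun e' => N k e x y * N k e' x' y')).
    by rewrite (EvZ P measurable_om valid_om)// centered_N mulr0.
  move=> e' _; congr (_ * _); apply: local_N => hk; rewrite /mix.
  - by rewrite /S hk eqxx.
  - by rewrite /S hk eqxx orbT.
  - by move: disj; rewrite hk => /andP[/negbTE Sx' _]; rewrite -[S x' _]/(S x' 0) Sx'.
  - by move: disj; rewrite hk => /andP[_ /negbTE Sy']; rewrite -[S y' _]/(S y' 0) Sy'.
move=> ov; apply: le_trans NN _; rewrite ler_peMr ?sqr_ge0//.
move: ov o0; rewrite /overlap /S (eq_sym x' x) (eq_sym y' x) (eq_sym x' y) (eq_sym y' y).
case: (w.1 <= k)%N; case: (v.1 <= k)%N => //=;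
  case: (x == x'); case: (x == y'); case: (y == x'); case: (y == y') => //= _ _; lra.
Qed.

(** The square of a quenched mean is a quenched mean over two independent replicas of the pair. Only
    replicas with a common site contribute, and the four possible coincidences give the collisions
    of [w] with a replica of [w], twice of [w] with [v], and of [v] with a replica of [v]. *)
Lemma Ev_noise_sqr k : Ev (fun e => noise k e ^+ 2) <=
  C ^+ 2 * Ev (fun e => collision w w k e + 2 * collision w v k e + collision v v k e).
Proof.
have nc : nice (fun e => collision w w k e + 2 * collision w v k e + collision v v k e).
  apply: niceD; last exact: nice_collision.
  by apply: niceD; [exact: nice_collision|apply: niceZ; exact: nice_collision].
rewrite -(EvZ P measurable_om valid_om _ nc).
apply: (le_Ev_resample measurable_om valid_om independent_om (S := other_levels T k)).
- by apply: niceX; exact: nice_noise.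
- exact: niceZ.
move=> e ve.
rewrite (@eq_Ev _ M _ _ _ _ valid_om _ (fun e' => law2 M T e w v k (fun x y =>
   law2 M T e w v k (fun x' y' => N k e' x y * N k e' x' y')))); last first.
  move=> e' _; rewrite noise_mix expr2 -law2Z//; congr (law2 M T e w v k _).
  apply: funext => x; apply: funext => y; rewrite law2Z// mulrC//.
have nNN x y x' y' : nice (fun e' => N k e' x y * N k e' x' y') by exact: niceM.
rewrite Ev_law2//; last first.
  move=> x y; have [I [c [z [_ _ cf]]]] := law_repr T w k ve.
  have [J [b [u [_ _ bf]]]] := law_repr T v k ve.
  rewrite (_ : (fun e' => _) = fun e' => \sum_i c i * \sum_j b j * (N k e' x y * N k e' (z i) (u j))).
    by apply: nice_sum => i; apply: niceZ; apply: nice_sum => j; apply: niceZ.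
  by apply: funext => e'; rewrite /law2 cf; apply: eq_bigr => i _; rewrite bf.
apply: (@le_trans _ _ (law2 M T e w v k (fun x y => law2 M T e w v k (fun x' y' =>
    C ^+ 2 * overlap k x y x' y')))).
  apply: le_law2 => // x y; rewrite Ev_law2//.
  by apply: le_law2 => // x' y'; exact: Ev_noise_pair.
rewrite (_ : (fun x y => _) = fun x y => C ^+ 2 * law2 M T e w v k (overlap k x y)); last first.
  by apply: funext => x; apply: funext => y; rewrite law2Z.
rewrite law2Z// ler_wpM2l ?sqr_ge0//.
have Q w1 w2 : (if (w1.1 <= k)%N && (w2.1 <= k)%N then
   law M T e w1 k (fun x => law M T e w2 k (fun y => (x == y)%:R)) else 0) = collision w1 w2 k e by [].
rewrite /overlap.
rewrite (_ : (fun x y => _) = fun x y => law2 M T e w v k (fun x' y' =>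
    if (w.1 <= k)%N then (x == x')%:R else 0) + law2 M T e w v k (fun x' y' =>
    if (w.1 <= k)%N && (v.1 <= k)%N then (x == y')%:R + (y == x')%:R else 0)
    + law2 M T e w v k (fun x' y' => if (v.1 <= k)%N then (y == y')%:R else 0)); last first.
  by apply: funext => x; apply: funext => y; rewrite !law2D.
rewrite !law2D//.
have e1 : law2 M T e w v k (fun x y => law2 M T e w v k (fun x' y' =>
    if (w.1 <= k)%N then (x == x')%:R else 0)) = collision w w k e.
  rewrite /collision andbb; case: ifP => _; last by rewrite !law2_cst.
  rewrite (law2_fst T w v k (fun x => law2 M T e w v k (fun x' _ => (x == x')%:R)))//.
  by congr (law M T e w k _); apply: funext => x; rewrite law2_fst.
have e3 : law2 M T e w v k (fun x y => law2 M T e w v k (fun x' y' =>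
    if (v.1 <= k)%N then (y == y')%:R else 0)) = collision v v k e.
  rewrite /collision andbb; case: ifP => _; last by rewrite !law2_cst.
  rewrite (law2_snd T w v k (fun y => law2 M T e w v k (fun _ y' => (y == y')%:R)))//.
  by congr (law M T e v k _); apply: funext => y; rewrite law2_snd.
rewrite e1 e3 lerD2r lerD2l /collision; case: andP => _; last first.
  by rewrite !law2_cst// mulr0.
rewrite (_ : (fun x y => _) = fun x y => law2 M T e w v k (fun _ y' => (x == y')%:R)
    + law2 M T e w v k (fun x' _ => (y == x')%:R)); last first.
  by apply: funext => x; apply: funext => y; rewrite law2D.
rewrite law2D// mulr_natl mulr2n lerD//.
  rewrite (law2_fst T w v k (fun x => law2 M T e w v k (fun _ y' => (x == y')%:R)))//.
  rewrite le_eqVlt; apply/orP; left; apply/eqP.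
  by congr (law M T e w k _); apply: funext => x; rewrite law2_snd.
rewrite (law2_snd T w v k (fun y => law2 M T e w v k (fun x' _ => (y == x')%:R)))//.
rewrite le_eqVlt; apply/orP; left; apply/eqP; rewrite [RHS]law_exchange//.
congr (law M T e v k _); apply: funext => y; rewrite law2_fst//.
by congr (law M T e w k _); apply: funext => x; rewrite eq_sym.
Qed.

(** Noises of different levels are orthogonal, so their second moments add. *)
Lemma Ev_noise_sum_sqr l K : Ev (fun e => (\sum_(l <= k < K) noise k e) ^+ 2) <=
  C ^+ 2 * \sum_(l <= k < K)
    Ev (fun e => collision w w k e + 2 * collision w v k e + collision v v k e).
Proof.
elim: K => [|K IHK].
  rewrite big_geq// mulr0 -[leRHS](Ev_cst P om 0) le_eqVlt; apply/orP; left; apply/eqP.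
  by congr Ex; apply: funext => o; rewrite big_geq// expr0n.
have [lK|Kl] := leqP l K; last first.
  rewrite big_geq// mulr0 -[leRHS](Ev_cst P om 0) le_eqVlt; apply/orP; left; apply/eqP.
  by congr Ex; apply: funext => o; rewrite big_geq// expr0n.
pose A e := \sum_(l <= k < K) noise k e.
have nA : nice A by apply: nice_sum => k; exact: nice_noise.
have nN := nice_noise K.
rewrite big_nat_recr//= mulrDr.
rewrite (@eq_Ev _ M _ _ _ _ valid_om _ (fun e => (A e ^+ 2 + 2 * (A e * noise K e)) + noise K e ^+ 2)); last first.
  by move=> e _; rewrite big_nat_recr//= -/(A e); ring.
have nA2 := niceX 2 nA; have nAN := niceM nA nN; have n2AN := niceZ 2 nAN.
rewrite (EvD P measurable_om valid_om (niceD nA2 n2AN) (niceX 2 nN)).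
rewrite (EvD P measurable_om valid_om nA2 n2AN) (EvZ P measurable_om valid_om _ nAN).
rewrite Ev_past_noise//; last first.
  move=> e e'; apply: eq_big_nat => k /andP[_ kK].
  have sb : same_below T k (mix (other_levels T K) e e') e.
    by move=> x i j ik; apply: same_below_mix; exact: ltn_trans ik kK.
  rewrite (law2_same_below M w v sb); congr (law2 M T e w v k _).
  apply: funext => x; apply: funext => y.
  by apply: local_N => _; apply: funext => j; exact: (@same_below_mix _ T K e e').
rewrite mulr0 addr0 lerD//; exact: Ev_noise_sqr.
Qed.
End Noise.
End Annealed.

(** * Dirichlet and Fejer kernels *)

Section Fejer.
Context {R : realType}.
Implicit Types (t : R) (m n : nat).

Definition dirichlet m t : R := 1 + \sum_(l < m) 2 * cos (l.+1%:R * t).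

(** The unnormalised Fejer kernel: (1 - cos(n t)) / (1 - cos t) written as a trigonometric
    polynomial, which removes the singularity at t = 0. *)
Definition fejer n t : R := \sum_(m < n) dirichlet m t.

Lemma dirichletE m t :
  (1 - cos t) * dirichlet m t = cos (m%:R * t) - cos (m.+1%:R * t).
Proof.
elim: m => [|m IHm]; first by rewrite /dirichlet big_ord0 addr0 mulr1 mul0r cos0 mul1r.
rewrite /dirichlet big_ord_recr /= addrA mulrDr IHm.
have -> : m%:R * t = m.+1%:R * t - t by rewrite -(natr1 m) mulrDl mul1r addrK.
have -> : m.+2%:R * t = m.+1%:R * t + t by rewrite -(natr1 m.+1) mulrDl mul1r.
rewrite cosB cosD; ring.
Qed.

Lemma fejerE n t : (1 - cos t) * fejer n t = 1 - cos (n%:R * t).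
Proof.
elim: n => [|n IHn]; first by rewrite /fejer big_ord0 mulr0 mul0r cos0 subrr.
rewrite /fejer big_ord_recr /= mulrDr IHn dirichletE; ring.
Qed.

Lemma continuous_cosM (c : R) : continuous (fun t => cos (c * t)).
Proof.
move=> t; apply: (@continuous_comp _ _ _ (fun t => c * t) cos).
  exact: mulrl_continuous.
exact: continuous_cos.
Qed.

Lemma continuous_sum (I : Type) (s : seq I) (f : I -> R -> R) :
  (forall i, continuous (f i)) -> continuous (fun t => \sum_(i <- s) f i t).
Proof.
move=> cf; elim: s => [|i s IHs] t.
  rewrite (_ : (fun _ => _) = fun=> 0); first exact: cvg_cst.
  by apply: funext => u; rewrite big_nil.
rewrite (_ : (fun _ => _) = fun u => f i u + \sum_(j <- s) f j u).
  by apply: cvgD; [exact: cf|exact: IHs].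
by apply: funext => u; rewrite big_cons.
Qed.

Lemma continuous_scale (c : R) (f : R -> R) : continuous f -> continuous (fun t => c * f t).
Proof. by move=> cf t; apply: cvgM; [exact: cvg_cst|exact: cf]. Qed.

Lemma continuous_dirichlet m : continuous (dirichlet m).
Proof.
move=> t; apply: cvgD; first exact: cvg_cst.
apply: (@continuous_sum _ (index_enum 'I_m) (fun (l : 'I_m) t => 2 * cos (l.+1%:R * t))) => l.
by apply: continuous_scale; exact: continuous_cosM.
Qed.

Lemma continuous_fejer n : continuous (fejer n).
Proof.
by move=> t; apply: (@continuous_sum _ (index_enum 'I_n) (fun (m : 'I_n) t => dirichlet m t)) => m; exact: continuous_dirichlet.
Qed.

Lemma fejer0 n : fejer n 0 = n%:R ^+ 2.
Proof.
have d0 m : dirichlet m 0 = 1 + 2 * m%:R.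
  rewrite /dirichlet (eq_bigr (fun=> 2)).
    by rewrite sumr_const card_ord mulr_natr.
  by move=> l _; rewrite mulr0 cos0 mulr1.
elim: n => [|n IHn]; first by rewrite /fejer big_ord0 expr0n.
rewrite /fejer big_ord_recr /= -/(fejer n 0) IHn d0 -natr1; ring.
Qed.

Lemma fejer_ge0 n t : 0 <= fejer n t.
Proof.
(* Where cos t = 1 the quotient formula is void, and positivity comes from every cosine of the sum
   being 1. *)
have [/eqP c1|c1] := boolP (cos t == 1).
  have s0 : sin t = 0 by apply: cos1sin0; rewrite c1 normr1.
  have ck k : cos (k%:R * t) = 1 /\ sin (k%:R * t) = 0.
    elim: k => [|k [IHc IHs]]; first by rewrite mul0r cos0 sin0.
    by rewrite -natr1 mulrDl mul1r cosD sinD IHc IHs c1 s0 !mulr0 !mul0r mulr1 subr0 addr0.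
  apply: sumr_ge0 => m _; rewrite addr_ge0//; apply: sumr_ge0 => l _.
  by rewrite (ck l.+1).1 mulr1.
have c0 : 0 < 1 - cos t by rewrite subr_gt0 lt_neqAle c1 cos_le1.
by rewrite -(pmulr_rge0 _ c0) fejerE subr_ge0 cos_le1.
Qed.

(** The quotient of n^2 - fejer n t by 1 - cos t, again as a trigonometric polynomial, hence bounded
    near t = 0. *)
Definition fejer_gap n t : R := \sum_(m < n) \sum_(l < m) 2 * fejer l.+1 t.

Lemma fejer_gapE n t : fejer n 0 - fejer n t = (1 - cos t) * fejer_gap n t.
Proof.
rewrite /fejer /fejer_gap -sumrB mulr_sumr; apply: eq_bigr => m _.
rewrite /dirichlet opprD addrACA subrr add0r -sumrB mulr_sumr.
by apply: eq_bigr => l _; rewrite mulr0 cos0 mulrCA fejerE; ring.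
Qed.

Lemma continuous_fejer_gap n : continuous (fejer_gap n).
Proof.
move=> t; apply: (@continuous_sum _ (index_enum 'I_n) (fun (m : 'I_n) t => \sum_(l < m) 2 * fejer l.+1 t)) => m.
move=> {}t; apply: (@continuous_sum _ (index_enum 'I_m) (fun (l : 'I_m) t => 2 * fejer l.+1 t)) => l.
by apply: continuous_scale; exact: continuous_fejer.
Qed.
End Fejer.

(** * Means over the circle *)

Section Circle.
Context {R : realType}.
Local Notation mu := (@lebesgue_measure R).
Implicit Types (f g : R -> R) (c t : R).

Definition mean_circle (f : R -> R) : R :=
  (pi *+ 2)^-1 * Rintegral mu `[- pi, pi] f.

Let pi2_gt0 : 0 < pi *+ 2 :> R.
Proof. by rewrite pmulrn_lgt0// pi_gt0. Qed.

Lemma continuous_integrable_circle (f : R -> R) : continuous f ->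
  mu.-integrable `[- pi, pi] (EFin \o f).
Proof.
move=> cf; apply: continuous_compact_integrable; first exact: segment_compact.
exact: continuous_subspaceT.
Qed.

Lemma mean_circleD f g : continuous f -> continuous g ->
  mean_circle (fun t => f t + g t) = mean_circle f + mean_circle g.
Proof.
by move=> cf cg; rewrite /mean_circle RintegralD ?mulrDr//; exact: continuous_integrable_circle.
Qed.

Lemma mean_circleB f g : continuous f -> continuous g ->
  mean_circle (fun t => f t - g t) = mean_circle f - mean_circle g.
Proof.
by move=> cf cg; rewrite /mean_circle RintegralB ?mulrBr//; exact: continuous_integrable_circle.
Qed.

Lemma mean_circleZ c f : continuous f ->
  mean_circle (fun t => c * f t) = c * mean_circle f.
Proof.
move=> cf; rewrite /mean_circle RintegralZl; [exact: mulrCA|by []|].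
exact: continuous_integrable_circle.
Qed.

Lemma mean_circle_cst c : mean_circle (fun=> c) = c.
Proof.
rewrite /mean_circle Rintegral_cst//= lebesgue_measure_itv /= lte_fin.
have pipi : - pi < pi :> R by apply: lt_trans (pi_gt0 R); rewrite oppr_lt0 pi_gt0.
by rewrite pipi /= opprK -mulr2n mulrCA mulVf ?mulr1// gt_eqF.
Qed.

Lemma mean_circle_sum (I : Type) (s : seq I) (f : I -> R -> R) :
  (forall i, continuous (f i)) ->
  mean_circle (fun t => \sum_(i <- s) f i t) = \sum_(i <- s) mean_circle (f i).
Proof.
move=> cf; elim: s => [|i s IHs].
  rewrite big_nil (_ : (fun _ => _) = fun=> 0) ?mean_circle_cst//.
  by apply: funext => u; rewrite big_nil.
rewrite big_cons (_ : (fun _ => _) = fun u => f i u + \sum_(j <- s) f j u).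
  by rewrite mean_circleD ?IHs//; exact: continuous_sum.
by apply: funext => u; rewrite big_cons.
Qed.

Lemma le_mean_circle f g : continuous f -> continuous g ->
  (forall t, t \in `[- pi, pi] -> f t <= g t) -> mean_circle f <= mean_circle g.
Proof.
move=> cf cg fg; apply: ler_wpM2l; first by rewrite invr_ge0 ltW.
apply: le_Rintegral => //.
- exact: continuous_integrable_circle.
- exact: continuous_integrable_circle.
Qed.

(** The point 0 is exempt because quotients such as the integrand of [beta] take a conventional
    value there; it is a null set. *)
Lemma eq_mean_circle f g : continuous f -> measurable_fun `[- pi, pi] g ->
  (forall t, t \in `[- pi, pi] -> t != 0 -> f t = g t) -> mean_circle f = mean_circle g.
Proof.
move=> cf mg fg; congr (_ * fine _).
apply: ae_eq_integral => //.
- by apply/measurable_EFinP; apply: measurable_funTS; exact: continuous_measurable_fun.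
- exact/measurable_EFinP.
exists [set 0]; split=> //; first exact: lebesgue_measure_set1.
move=> t /= /not_implyP[tpi ft]; apply: contrapT => /eqP t0; apply: ft.
by rewrite fg// inE.
Qed.

Lemma mean_circle_cos n : mean_circle (fun t => cos (n%:R * t)) = (n == 0%N)%:R.
Proof.
case: n => [|n] /=.
  rewrite (_ : (fun t => _) = fun=> 1) ?mean_circle_cst//.
  by apply: funext => t; rewrite mul0r cos0.
have n0 : n.+1%:R != 0 :> R by rewrite pnatr_eq0.
have pipi : - pi < pi :> R by apply: lt_trans (pi_gt0 R); rewrite oppr_lt0 pi_gt0.
pose F t : R := n.+1%:R^-1 * sin (n.+1%:R * t).
have dF t : is_derive t 1 F (cos (n.+1%:R * t)).
  apply: is_derive_eq; rewrite /GRing.scale /=.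
  by rewrite mulr1 mulrCA mulVf// mulr1.
have cF : continuous F.
  move=> t; apply: differentiable_continuous; apply/derivable1_diffP.
  by have [] := dF t.
rewrite /mean_circle /Rintegral (continuous_FTC2 (F := F) pipi).
- have s0 : sin (n.+1%:R * pi) = 0 :> R.
    elim: n {n0 F dF cF} => [|n IHn]; first by rewrite mul1r sinpi.
    by rewrite -natr1 mulrDl mul1r sinD IHn sinpi mul0r mulr0 addr0.
  by rewrite /= /F mulrN sinN s0 oppr0 mulr0 subr0 mulr0.
- by apply: continuous_subspaceT; exact: continuous_cosM.
- split.
  + by move=> t _; have [] := dF t.
  + by apply: cvg_at_right_filter; exact: cF.
  + by apply: cvg_at_left_filter; exact: cF.
- by move=> t _; rewrite derive1E; have [_] := dF t.
Qed.

Lemma mean_circle_fejer n : mean_circle (fejer n) = n%:R.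
Proof.
rewrite (@mean_circle_sum _ (index_enum 'I_n) (fun (m : 'I_n) t => dirichlet m t)); last first.
  by move=> m; exact: continuous_dirichlet.
rewrite (eq_bigr (fun=> 1)) ?sumr_const ?card_ord// => m _.
have cc (l : 'I_m) : continuous (fun t => 2 * cos (l.+1%:R * t) : R).
  by apply: continuous_scale; exact: continuous_cosM.
rewrite (@mean_circleD (fun=> 1)); last 2 first.
- exact: cst_continuous.
- by apply: (@continuous_sum _ _ (index_enum 'I_m) (fun (l : 'I_m) t => 2 * cos (l.+1%:R * t))).
rewrite mean_circle_cst (@mean_circle_sum _ _ (fun (l : 'I_m) t => 2 * cos (l.+1%:R * t)))//.
rewrite big1 ?addr0// => l _.
by rewrite mean_circleZ ?mean_circle_cos ?mulr0//; exact: continuous_cosM.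
Qed.
End Circle.

(** * Potential kernel of the difference of two independent walks *)

Section PotentialKernel.
Context {R : realType} (M : nat).
Implicit Types (c q : int -> int -> R) (F : int -> R) (t : R) (z j x : int).

Definition diff_avg c F : R := sumM M (fun j => sumM M (fun j' => c j j' * F (j' - j))).

Lemma eq_diff_avg c F G : F =1 G -> diff_avg c F = diff_avg c G.
Proof. by move=> FG; apply: eq_sumM => j _; apply: eq_sumM => j' _; rewrite FG. Qed.

Lemma diff_avgB c F G : diff_avg c (fun z => F z - G z) = diff_avg c F - diff_avg c G.
Proof.
rewrite /diff_avg -sumMB; apply: eq_sumM => j _.
by rewrite -sumMB; apply: eq_sumM => j' _; rewrite mulrBr.
Qed.

Lemma diff_avgZ c a F : diff_avg c (fun z => a * F z) = a * diff_avg c F.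
Proof.
rewrite /diff_avg -sumMZ; apply: eq_sumM => j _.
by rewrite -sumMZ; apply: eq_sumM => j' _; rewrite mulrCA.
Qed.

Definition pair_law c : Prop :=
  (forall j j', 0 <= c j j') /\ sumM M (fun j => sumM M (c j)) = 1.

Lemma diff_avg_cst c a : pair_law c -> diff_avg c (fun=> a) = a.
Proof.
move=> [_ c1]; rewrite /diff_avg -[RHS]mul1r -c1 -sumMZr.
by apply: eq_sumM => j _; rewrite sumMZr.
Qed.

Lemma le_diff_avg c F G : pair_law c -> (forall z, F z <= G z) ->
  diff_avg c F <= diff_avg c G.
Proof.
move=> [c0 _] FG; apply: ler_sumM => j _; apply: ler_sumM => j' _.
exact: ler_wpM2l.
Qed.

Lemma le_term_diff_avg c F j j' : pair_law c -> (forall z, 0 <= F z) ->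
  in_range M j -> in_range M j' -> c j j' * F (j' - j) <= diff_avg c F.
Proof.
move=> [c0 _] F0 jM j'M.
apply: le_trans (@ler_sumM1 _ M (fun j => sumM M (fun j' => c j j' * F (j' - j))) j jM _).
  by apply: (@ler_sumM1 _ M (fun j' => c j j' * F (j' - j))) => // i _; exact: mulr_ge0.
by move=> i _; apply: sumM_ge0 => k _; exact: mulr_ge0.
Qed.

(** For a law [c] of pairs (j, j') this is 1 minus the mean of cos(t (j' - j)), divided by 1 - cos t
    and extended continuously. For [indep_pair] it is the denominator [Q] of the potential kernel,
    and [Q 0] is the second moment of j' - j. *)
Definition fejer_avg c t : R := diff_avg c (fun z => fejer `|z|%N t).

Lemma cos_absz z t : cos (`|z|%N%:R * t) = cos (t * z%:~R).
Proof.
case: z => n; first by rewrite absz_nat mulrC.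
by rewrite NegzE abszN absz_nat mulrNz mulrN cosN mulrC.
Qed.

Lemma fejer_avgE c t : pair_law c ->
  (1 - cos t) * fejer_avg c t = 1 - diff_avg c (fun z => cos (t * z%:~R)).
Proof.
move=> kc; rewrite /fejer_avg -diff_avgZ -{2}(diff_avg_cst 1 kc) -diff_avgB.
by apply: eq_diff_avg => z; rewrite fejerE cos_absz.
Qed.

Lemma continuous_diff_avg c (F : int -> R -> R) : (forall z, continuous (F z)) ->
  continuous (fun t => diff_avg c (F^~ t)).
Proof.
move=> cF; apply: continuous_sum => j; apply: continuous_sum => j'.
exact: continuous_scale.
Qed.

Lemma mean_circle_diff_avg c (F : int -> R -> R) : (forall z, continuous (F z)) ->
  mean_circle (fun t => diff_avg c (F^~ t)) = diff_avg c (fun z => mean_circle (F z)).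
Proof.
move=> cF; rewrite /diff_avg /sumM mean_circle_sum; last first.
  by move=> j; apply: continuous_sum => j'; exact: continuous_scale.
apply: eq_bigr => j _; rewrite mean_circle_sum; last by move=> j'; exact: continuous_scale.
by apply: eq_bigr => j' _; rewrite mean_circleZ.
Qed.

Lemma continuous_fejer_avg c : continuous (fejer_avg c).
Proof. by apply: continuous_diff_avg => z; exact: continuous_fejer. Qed.

Lemma fejer_avg_ge0 c t : pair_law c -> 0 <= fejer_avg c t.
Proof.
move=> kc; rewrite -(diff_avg_cst 0 kc); apply: le_diff_avg => // z.
exact: fejer_ge0.
Qed.

Lemma cos_circle_neq1 t : t \in `[- pi, pi] -> t != 0 -> cos t != 1.
Proof.
move=> tpi t0; apply/eqP => c1; move/eqP: t0; apply; apply/normr0_eq0.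
apply: cos_inj; rewrite ?cos_norm ?c1 ?cos0//.
  by move: tpi; rewrite !in_itv /= normr_ge0 ler_norml.
by rewrite in_itv /= lexx pi_ge0.
Qed.

Variable p : int -> R.
Hypothesis p_ge0 : forall j, 0 <= p j.
Hypothesis p_sum : sumM M p = 1.
Hypothesis aperiodic : ~ (exists h x : int, 1 < h /\
  sumM M (fun j => if (h %| (j - x))%Z then p j else 0) = 1).

Definition indep_pair j j' : R := p j * p j'.

Lemma indep_pair_law : pair_law indep_pair.
Proof.
split=> [j j'|]; first exact: mulr_ge0.
transitivity (sumM M (fun j => p j * 1)).
  by apply: eq_sumM => j _; rewrite -p_sum -sumMZ.
by rewrite sumMZr p_sum mul1r.
Qed.

Local Notation Q := (fejer_avg indep_pair).

Let exists_atom : exists2 y, in_range M y & 0 < p y.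
Proof.
apply: contrapT => h; have : sumM M p <= sumM M (fun=> 0).
  apply: ler_sumM => j jM; rewrite leNgt; apply/negP => pj; apply: h; by exists j.
by rewrite p_sum /sumM big1// ler10.
Qed.

Let concentrated_contra (h : nat) y : (1 < h)%N ->
  (forall j, in_range M j -> 0 < p j -> (h%:Z %| j - y)%Z) -> False.
Proof.
move=> h1 hj; apply: aperiodic; exists h%:Z, y; split; first by rewrite ltz_nat.
rewrite -[RHS]p_sum; apply: eq_sumM => j jM; case: ifPn => // ndiv.
apply/eqP; rewrite eq_le p_ge0 /= leNgt; apply/negP => pj.
by move/negP: ndiv; apply; exact: hj.
Qed.

Lemma cos_multiple (k : nat) t : cos t = 1 -> cos (k%:R * t) = 1 /\ sin (k%:R * t) = 0.
Proof.
move=> c1; have s0 : sin t = 0 by apply: cos1sin0; rewrite c1 normr1.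
elim: k => [|k [IHc IHs]]; first by rewrite mul0r cos0 sin0.
by rewrite -natr1 mulrDl mul1r cosD sinD IHc IHs c1 s0 !mulr0 !mul0r mulr1 subr0 addr0.
Qed.

(** If Q(t) = 0, every pair of atoms contributes zero. At cos t = 1 this means that all atoms equal
    [y]. Otherwise cos((j - y) t) = 1 for every atom j: either all differences vanish, or the least
    positive period h exceeds 1 and divides all of them. Each case contradicts (A1). *)
Lemma fejer_avg_gt0 t : 0 < Q t.
Proof.
rewrite lt_neqAle fejer_avg_ge0 ?andbT; last exact: indep_pair_law.
apply/eqP => Q0; have [y yM py] := exists_atom.
pose d z := 1 - cos (t * z%:~R).
have [c1|c1] := eqVneq (cos t) 1.
  (* All atoms will turn out to be [y], so any modulus above 1 serves. *)
  apply: (@concentrated_contra 2 y) => // j jM pj.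
  have : p y * p j * fejer `|(j - y)%R|%N t <= Q t.
    apply: (@le_term_diff_avg indep_pair (fun z => fejer `|z|%N t)) => //.
      exact: indep_pair_law.
    by move=> z; exact: fejer_ge0.
  rewrite -Q0 pmulr_rle0 ?mulr_gt0//.
  have -> : fejer `|(j - y)%R|%N t = fejer `|(j - y)%R|%N 0.
    by apply/eqP; rewrite eq_sym -subr_eq0 fejer_gapE c1 subrr mul0r.
  rewrite fejer0 -natrX lern0 expn_eq0 absz_eq0 subr_eq0 => /andP[/eqP -> _].
  by rewrite subrr dvdz0.
have dz j : in_range M j -> 0 < p j -> cos (`|(j - y)%R|%N%:R * t) = 1.
  move=> jM pj; have : p y * p j * d (j - y) <= diff_avg indep_pair d.
    apply: (@le_term_diff_avg indep_pair d) => //; first exact: indep_pair_law.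
    by move=> z; rewrite subr_ge0 cos_le1.
  rewrite /d diff_avgB (diff_avg_cst _ indep_pair_law) -fejer_avgE; last exact: indep_pair_law.
  rewrite -Q0 mulr0 pmulr_rle0 ?mulr_gt0// subr_le0 -cos_absz => c.
  by apply/eqP; rewrite eq_le cos_le1 c.
have [[k k0]|nk] := pselect (exists2 k, (0 < k)%N & cos (k%:R * t) = 1); last first.
  apply: (@concentrated_contra 2 y) => // j jM pj.
  have [/eqP|j0] := posnP `|(j - y)%R|%N.
    by rewrite absz_eq0 => /eqP ->; rewrite dvdz0.
  by case: nk; exists `|(j - y)%R|%N => //; exact: dz.
move=> ck; pose G k := (0 < k)%N && (cos (k%:R * t) == 1).
have exG : exists k, G k by exists k; rewrite /G k0 ck /=.
(* The least period divides every other: a nonzero remainder would be a smaller one. *)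
have [h /andP[h0 /eqP ch] hmin] := ex_minnP exG.
apply: (@concentrated_contra h y).
  rewrite ltn_neqAle h0 andbT; apply/eqP => h1; move: ch; rewrite -h1 mul1r => /eqP.
  by rewrite (negbTE c1).
move=> j jM pj; have cn := dz j jM pj.
rewrite dvdzE absz_nat; have [//|r0] := posnP (`|(j - y)%R| %% h)%N.
  by move/eqP.
have : G (`|(j - y)%R| %% h)%N.
  rewrite /G r0 /=; have [cq sq] := cos_multiple (`|(j - y)%R| %/ h)%N ch.
  move: cn; rewrite {1}(divn_eq `|(j - y)%R|%N h) natrD mulrDl natrM -mulrA.
  by rewrite cosD cq sq mul1r mul0r subr0 => ->.
by move/hmin; rewrite leqNgt ltn_mod h0.
Qed.

(** After cancelling the common factor 1 - cos t, this is the mean of (1 - cos(t z)) / (1 -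
    lambdabar t), the classical potential kernel. The cancellation leaves a continuous integrand. *)
Definition potential z : R := mean_circle (fun t => fejer `|z|%N t / Q t).

Lemma continuous_div_Q (f : R -> R) : continuous f -> continuous (fun t => f t / Q t).
Proof.
move=> cf t; apply: cvgM; first exact: cf.
apply: cvgV; first by rewrite gt_eqF// fejer_avg_gt0.
exact: continuous_fejer_avg.
Qed.

Let cpot z : continuous (fun t => fejer `|z|%N t / Q t).
Proof. by apply: continuous_div_Q; exact: continuous_fejer. Qed.

Lemma diff_avg_potential c : diff_avg c potential = mean_circle (fun t => fejer_avg c t / Q t).
Proof.
rewrite /potential -mean_circle_diff_avg//; congr mean_circle; apply: funext => t.
by rewrite /fejer_avg mulrC -diff_avgZ; apply: eq_diff_avg => z; rewrite mulrC.
Qed.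

(** After multiplication by (1 - cos t) Q(t) this is an identity of cosines under the integral: the
    addition formula, and the fact that (1 - cos t) Q(t) is 1 minus the mean of cos(t z). The sine
    part vanishes because the law of the difference is symmetric. *)
Lemma potential_harmonic x :
  diff_avg indep_pair (fun z => potential (x + z)) = potential x + (x == 0)%:R.
Proof.
have ck := indep_pair_law.
have -> : (x == 0)%:R = mean_circle (fun t => cos (`|x|%N%:R * t)) :> R.
  by rewrite mean_circle_cos absz_eq0.
have cF z : continuous (fun t => fejer `|(x + z)%R|%N t / Q t) by exact: cpot.
rewrite -(mean_circle_diff_avg _ cF) /potential -mean_circleD//; last exact: continuous_cosM.
apply: eq_mean_circle; first exact: continuous_diff_avg.
  apply: measurable_funTS; apply: continuous_measurable_fun => t; apply: cvgD.
    exact: cpot.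
  exact: continuous_cosM.
move=> t tpi t0; have c1 := cos_circle_neq1 tpi t0.
have c0 : 1 - cos t != 0 by rewrite subr_eq0 eq_sym.
have Qn : Q t != 0 by rewrite gt_eqF// fejer_avg_gt0.
apply: (mulfI c0); apply: (mulIf Qn).
have -> : (1 - cos t) * diff_avg indep_pair (fun z => fejer `|(x + z)%R|%N t / Q t) * Q t =
          diff_avg indep_pair (fun z => 1 - cos (t * (x + z)%:~R)).
  rewrite -mulrA -(mulrC (Q t)) -(diff_avgZ _ (Q t)) -(diff_avgZ _ (1 - cos t)).
  by apply: eq_diff_avg => z; rewrite (mulrC (Q t)) divfK// fejerE cos_absz.
rewrite (diff_avgB _ (fun=> 1)) (diff_avg_cst 1 ck).
rewrite mulrDr mulrDl -mulrA divfK// fejerE.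
rewrite mulrAC fejer_avgE// !cos_absz.
have -> : diff_avg indep_pair (fun z => cos (t * (x + z)%:~R)) =
    cos (t * x%:~R) * diff_avg indep_pair (fun z => cos (t * z%:~R)) -
    sin (t * x%:~R) * diff_avg indep_pair (fun z => sin (t * z%:~R)).
  rewrite -!diff_avgZ -diff_avgB; apply: eq_diff_avg => z.
  by rewrite intrD mulrDr cosD.
have -> : diff_avg indep_pair (fun z => sin (t * z%:~R)) = 0.
  set S := diff_avg _ _; suff : S = - S by lra.
  rewrite /S -[RHS]mulN1r -diff_avgZ /diff_avg [RHS]sumM_exchange.
  apply: eq_sumM => j _; apply: eq_sumM => j' _.
  by rewrite /indep_pair (mulrC (p j)) mulN1r -sinN -mulrN -intrN opprB.
ring.
Qed.

(** 1/Q(t) - 1/Q(0) is divisible by 1 - cos t, and this factor cancels the denominator of the Fejer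
    kernel. What remains is 1 - cos(z t) times a function that does not depend on z. *)
Lemma potential_asymptotic :
  exists C : R, forall z, `|potential z - `|z|%N%:R / Q 0| <= C.
Proof.
pose H t := diff_avg indep_pair (fun z => fejer_gap `|z|%N t).
have Q0 : Q 0 != 0 by rewrite gt_eqF// fejer_avg_gt0.
have cH : continuous (fun t => `|H t / Q t|).
  move=> t; apply: (@continuous_comp _ _ _ (fun t => H t / Q t) Num.norm); last exact: norm_continuous.
  by apply: continuous_div_Q; apply: continuous_diff_avg => z; exact: continuous_fejer_gap.
have pipi : - pi <= pi :> R by apply: le_trans (pi_ge0 R); rewrite oppr_le0 pi_ge0.
have [t1 _ Hmax] := EVT_max pipi (continuous_subspaceT cH).
set B := `|H t1 / Q t1| in Hmax.
(* 2 bounds 1 - cos, and [B] is the maximum of |H/Q| over the circle. *)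
exists (2 * B / Q 0) => z.
have -> : `|z|%N%:R / Q 0 = mean_circle (fun t => (Q 0)^-1 * fejer `|z|%N t).
  rewrite mean_circleZ; last exact: continuous_fejer.
  by rewrite mean_circle_fejer mulrC.
rewrite /potential -mean_circleB//; last by apply: continuous_scale; exact: continuous_fejer.
pose D t := fejer `|z|%N t / Q t - (Q 0)^-1 * fejer `|z|%N t.
have cD : continuous D.
  move=> t; apply: cvgB; first exact: cpot.
  by apply: continuous_scale; exact: continuous_fejer.
have DE t : t \in `[- pi, pi] -> `|D t| <= 2 * B / Q 0.
  move=> tpi; have Qt : Q t != 0 by rewrite gt_eqF// fejer_avg_gt0.
  have -> : D t = (1 - cos (`|z|%N%:R * t)) * (H t / Q t) / Q 0.
    have QH : Q 0 - Q t = (1 - cos t) * H t.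
      rewrite /H -diff_avgZ -diff_avgB; apply: eq_diff_avg => y; exact: fejer_gapE.
    rewrite -fejerE /D; move: QH => /(congr1 (fun y => y * fejer `|z|%N t / (Q t * Q 0))).
    rewrite (_ : (Q 0 - Q t) * _ / _ = fejer `|z|%N t / Q t - (Q 0)^-1 * fejer `|z|%N t); last by field; rewrite Q0 Qt.
    move=> ->; field; by rewrite Q0 Qt.
  have Qi : 0 <= (Q 0)^-1 by rewrite invr_ge0 ltW// fejer_avg_gt0.
  rewrite (normrM _ (Q 0)^-1) (ger0_norm Qi) ler_wpM2r// normrM.
  apply: ler_pM => //; last exact: Hmax.
  rewrite ger0_norm ?subr_ge0 ?cos_le1//; have := cos_geN1 (`|z|%N%:R * t); lra.
rewrite ler_norml; apply/andP; split.
  rewrite -[leLHS]mean_circle_cst; apply: le_mean_circle => //.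
    exact: cst_continuous.
  by move=> t /DE; rewrite ler_norml => /andP[].
rewrite -[leRHS]mean_circle_cst; apply: le_mean_circle => //; first exact: cst_continuous.
by move=> t /DE; rewrite ler_norml => /andP[].
Qed.

(** As Q is at most its maximum over the circle, the potential at z is at least |z| divided by that
    maximum, hence positive away from 0. *)
Lemma diff_avg_potential_gt0 c : pair_law c ->
  (exists j j', [/\ in_range M j, in_range M j', j != j' & 0 < c j j']) ->
  0 < diff_avg c potential.
Proof.
move=> kc [j [j' [jM j'M jj' cj]]].
have pipi : - pi <= pi :> R by apply: le_trans (pi_ge0 R); rewrite oppr_le0 pi_ge0.
have [t1 _ Qmax] := EVT_max pipi (continuous_subspaceT (continuous_fejer_avg (c := indep_pair))).
have lb z : `|z|%N%:R / Q t1 <= potential z.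
  rewrite mulrC -(mean_circle_fejer `|z|%N) -mean_circleZ; last exact: continuous_fejer.
  apply: le_mean_circle => //; first by apply: continuous_scale; exact: continuous_fejer.
  move=> t /Qmax Qt; rewrite mulrC ler_wpM2l ?fejer_ge0// lef_pV2 ?posrE ?fejer_avg_gt0//.
have p0 z : 0 <= potential z.
  by apply: le_trans (lb z); rewrite mulr_ge0// invr_ge0 ltW// fejer_avg_gt0.
apply: lt_le_trans (le_term_diff_avg kc p0 jM j'M).
rewrite mulr_gt0//; apply: lt_le_trans (lb _).
rewrite mulr_gt0 ?invr_gt0 ?fejer_avg_gt0// ltr0n absz_gt0 subr_eq0 eq_sym//.
Qed.

End PotentialKernel.

(** * Mean value and Taylor bounds *)

Section Calculus.
Context {R : realType}.
Implicit Types (f g : R -> R) (x h s v : R).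

Lemma is_derive_continuous f (df : R -> R) : (forall x, is_derive x 1 f (df x)) -> continuous f.
Proof.
move=> fdf x; apply: differentiable_continuous; apply/derivable1_diffP.
by have [] := fdf x.
Qed.

Lemma increment_bound g (dg : R -> R) h B :
  (forall s, is_derive s 1 g (dg s)) ->
  (forall s, `|s| <= `|h| -> `|dg s| <= B) -> `|g h - g 0| <= B * `|h|.
Proof.
move=> gdg dgB; have cg := is_derive_continuous gdg.
have [h0|h0] := leP 0 h.
  have [c] := MVT_segment h0 (fun x _ => gdg x) (continuous_subspaceT cg).
  rewrite in_itv /= => /andP[c0 ch] ->; rewrite subr0 normrM ler_wpM2r//.
  by apply: dgB; rewrite !ger0_norm.
have [c] := MVT_segment (ltW h0) (fun x _ => gdg x) (continuous_subspaceT cg).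
rewrite in_itv /= => /andP[hc c0]; rewrite distrC => ->; rewrite sub0r normrM normrN.
rewrite ler_wpM2r//; apply: dgB.
by rewrite (ltr0_norm h0) (ler0_norm c0) lerN2.
Qed.

Lemma is_derive_translate f (df : R -> R) x s : (forall x, is_derive x 1 f (df x)) ->
  is_derive s 1 (fun s => f (x + s)) (df (x + s)).
Proof.
move=> fdf; rewrite -[df (x + s)]mulr1.
have ds : is_derive s 1 (fun s => x + s) 1.
  by apply: is_derive_eq; rewrite add0r mulr1.
exact: (@is_derive1_comp _ f (fun s => x + s) s _ _ (fdf (x + s)) ds).
Qed.

Lemma lipschitz_derive f (df : R -> R) L : (forall x, is_derive x 1 f (df x)) ->
  (forall x, `|df x| <= L) -> forall x h, `|f (x + h) - f x| <= L * `|h|.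
Proof.
move=> fdf dfL x h.
have gdg s := is_derive_translate x s fdf.
by have := increment_bound gdg (fun s _ => dfL (x + s)) (h := h); rewrite addr0.
Qed.

(** Two mean value bounds, for the remainder of [df] and then for that of [f]; the constant L
    instead of L/6 suffices. *)
Lemma taylor2 f (df ddf : R -> R) L : 0 <= L ->
  (forall x, is_derive x 1 f (df x)) -> (forall x, is_derive x 1 df (ddf x)) ->
  (forall x h, `|ddf (x + h) - ddf x| <= L * `|h|) ->
  forall x h, `|f (x + h) - f x - h * df x - h ^+ 2 / 2 * ddf x| <= L * `|h| ^+ 3.
Proof.
move=> L0 fdf dfddf ddfL x h.
pose g1 s := df (x + s) - df x - s * ddf x.
have g1d s : is_derive s 1 g1 (ddf (x + s) - ddf x).
  rewrite /g1; have hs := is_derive_translate x s dfddf.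
  by apply: is_derive_eq; rewrite /GRing.scale /=; ring.
pose g s := f (x + s) - f x - s * df x - s ^+ 2 / 2 * ddf x.
have gd s : is_derive s 1 g (g1 s).
  rewrite /g; have hs := is_derive_translate x s fdf.
  apply: is_derive_eq; rewrite /g1 /GRing.scale /=; by field.
have g1B s : `|s| <= `|h| -> `|g1 s| <= L * `|h| ^+ 2.
  move=> sh; have := @increment_bound g1 _ s (L * `|h|) g1d _.
  rewrite {2}/g1 addr0 subrr mul0r !subr0 => H.
  apply: le_trans (H _) _.
    move=> u us; apply: le_trans (ddfL _ _) _; rewrite ler_wpM2l//.
    exact: le_trans us sh.
  by rewrite -mulrA ler_wpM2l// expr2 ler_wpM2l.
have := increment_bound gd g1B.
rewrite {2}/g addr0 subrr mul0r expr0n /= mul0r mul0r !subr0 => H.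
by apply: le_trans H _; rewrite -mulrA -exprSr.
Qed.

Lemma is_derive_within (f : R -> R) (df : R -> R) a b :
  (forall x, a <= x <= b -> is_derive x 1 f (df x)) -> {within `[a, b], continuous f}.
Proof.
move=> fdf; apply: derivable_within_continuous => x; rewrite in_itv /= => xab.
by have [] := fdf x xab.
Qed.

End Calculus.

(** * The standard normal density and the mean of |z + N| *)

Section Gauss.
Context {R : realType}.
Local Notation mu := (@lebesgue_measure R).
Implicit Types (x z v : R).

Definition gauss z : R := (Num.sqrt (pi *+ 2))^-1 * expR (- (z ^+ 2 / 2)).

Lemma gauss_normal_pdf : gauss = normal_pdf 0 1.
Proof.
apply: funext => z; rewrite /normal_pdf (negbTE (oner_neq0 _)) /normal_peak /normal_fun.
by rewrite /gauss subr0 expr1n mul1r mulNr.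
Qed.

Lemma gauss_ge0 z : 0 <= gauss z.
Proof. by rewrite gauss_normal_pdf normal_pdf_ge0. Qed.

Lemma sqrt2pi_ge1 : 1 <= Num.sqrt (pi *+ 2) :> R.
Proof.
rewrite -[leLHS]sqrtr1 ler_wsqrtr// mulr2n; have := pi_ge2 R; lra.
Qed.

Lemma expRN_bound (y : R) : 0 <= y -> (1 + y) * expR (- y) <= 1.
Proof.
move=> y0; rewrite expRN ler_pdivrMr ?expR_gt0// mul1r; exact: expR_ge1Dx.
Qed.

(** Comes from 1 + y <= exp y. This polynomial decay is enough for the limit at infinity and for the
    Lipschitz constants of the heat kernel. *)
Lemma gauss_bound z : (1 + z ^+ 2 / 2) * gauss z <= 1.
Proof.
rewrite /gauss mulrCA -[leRHS]mul1r; apply: ler_pM.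
- by rewrite invr_ge0.
- by rewrite mulr_ge0 ?expR_ge0// addr_ge0// divr_ge0// sqr_ge0.
- by rewrite invf_le1 ?sqrt2pi_ge1// (lt_le_trans _ sqrt2pi_ge1).
- by apply: expRN_bound; rewrite divr_ge0// sqr_ge0.
Qed.

Lemma gauss_le1 z : gauss z <= 1.
Proof.
apply: le_trans (gauss_bound z); rewrite ler_peMl ?gauss_ge0//.
by rewrite lerDl divr_ge0// sqr_ge0.
Qed.

Lemma is_derive_gauss z : is_derive z 1 gauss (- z * gauss z).
Proof.
rewrite /gauss; apply: is_derive_eq; rewrite /GRing.scale /=; field.
by rewrite gt_eqF// (lt_le_trans _ sqrt2pi_ge1).
Qed.

Lemma continuous_gauss : continuous gauss.
Proof. exact: is_derive_continuous is_derive_gauss. Qed.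

Lemma gaussN z : gauss (- z) = gauss z.
Proof. by rewrite /gauss sqrrN. Qed.

Definition gauss_cdf z : R := Rintegral mu `]-oo, z] gauss.

Lemma integrable_gauss (A : set R) : measurable A -> mu.-integrable A (EFin \o gauss).
Proof.
move=> mA; apply: (integrableS measurableT) => //.
by rewrite gauss_normal_pdf; exact: integrable_normal_pdf.
Qed.

Lemma is_derive_gauss_cdf z : is_derive z 1 gauss_cdf (gauss z).
Proof.
have zu : z < z + 1 by rewrite ltrDl.
have [|dF F'] := continuous_FTC1 zu (integrable_gauss (measurable_itv (Interval -oo%O (BRight (z + 1))))) _
  (@continuous_gauss z); first by rewrite ltNyr.
by split => //; rewrite -derive1E F'.
Qed.

Lemma gauss_cdf_ge0 z : 0 <= gauss_cdf z.
Proof. by apply: Rintegral_ge0 => x _; exact: gauss_ge0. Qed.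

Lemma gauss_cdf_compl z : 1 - gauss_cdf z = Rintegral mu `[z, +oo[ gauss.
Proof.
have iT := integrable_gauss measurableT.
have i1 : Rintegral mu setT gauss = 1.
  by rewrite /Rintegral gauss_normal_pdf integral_normal_pdf.
have := @Rintegral_itvB R gauss -oo%O +oo%O z.
rewrite set_itvNyy i1 => -> //.
by rewrite Rintegral_itv_obnd_cbnd//; apply: integrable_gauss; exact: measurable_itv.
Qed.

Lemma gauss_cdf_le1 z : gauss_cdf z <= 1.
Proof.
rewrite -subr_ge0 gauss_cdf_compl; apply: Rintegral_ge0 => x _; exact: gauss_ge0.
Qed.

Lemma cvg_gauss_y : - gauss x @[x --> +oo] --> (0 : R).
Proof.
rewrite -[X in _ --> X]oppr0; apply: cvgN.
apply/cvgrPdist_le => e e0; near=> x; rewrite sub0r normrN ger0_norm ?gauss_ge0//.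
have x0 : 0 < x by [].
have x2 : 0 < 1 + x ^+ 2 / 2 by rewrite ltr_pwDl// divr_ge0// sqr_ge0.
rewrite -(ler_pM2l x2); apply: le_trans (gauss_bound x) _.
have ex : 1 <= e * x by rewrite mulrC -ler_pdivrMr//.
have xx : x <= 1 + x ^+ 2 / 2 by have := sqr_ge0 (x - 1); rewrite sqrrB1; lra.
by apply: le_trans ex _; rewrite mulrC ler_wpM2r// ltW.
Unshelve. all: by end_near. Qed.

(** Mills' bound: on [z, oo[ the factor z is at most x, and x gauss(x) is the derivative of -
    gauss. *)
Lemma gauss_tail z : 0 <= z -> z * (1 - gauss_cdf z) <= gauss z.
Proof.
move=> z0; rewrite gauss_cdf_compl.
have tail : (\int[mu]_(x in `[z, +oo[) (x * gauss x)%:E = (gauss z)%:E)%E.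
  have dN x : is_derive x 1 (fun u => - gauss u) (x * gauss x).
    by have dg := is_derive_gauss x; apply: is_derive_eq; rewrite mulNr opprK.
  rewrite (@ge0_continuous_FTC2y _ _ (fun u => - gauss u) z 0).
  - by rewrite -EFinD opprK add0r.
  - by move=> x zx; rewrite mulr_ge0 ?gauss_ge0// (le_trans z0).
  - apply: continuous_subspaceT => x; apply: cvgM; [exact: cvg_id|exact: continuous_gauss].
  - exact: cvg_gauss_y.
  - by move=> x _; have [] := dN x.
  - by apply: cvg_at_right_filter; apply: cvgN; exact: continuous_gauss.
  - by move=> x _; rewrite derive1E; have [_] := dN x.
rewrite -RintegralZl//; last by apply: integrable_gauss; exact: measurable_itv.
rewrite -[leRHS]/(fine (gauss z)%:E) -tail; apply: le_Rintegral => //.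
- have := integrable_gauss (measurable_itv `[z, +oo[) => ig.
  by apply: integrableZl ig.
- apply/integrableP; split.
    apply/measurable_EFinP; apply: measurable_funTS; apply: continuous_measurable_fun => x.
    by apply: cvgM; [exact: cvg_id|exact: continuous_gauss].
  apply: le_lt_trans (ltry (gauss z)); rewrite -tail.
  rewrite le_eqVlt; apply/orP; left; apply/eqP; apply: eq_integral => x.
  rewrite inE /= in_itv /= andbT => zx.
  by rewrite ger0_norm// mulr_ge0 ?gauss_ge0// (le_trans z0).
- move=> x; rewrite /= in_itv /= andbT => zx.
  by rewrite ler_wpM2r// gauss_ge0.
Qed.

Lemma gauss_cdfN z : gauss_cdf (- z) = 1 - gauss_cdf z.
Proof.
rewrite gauss_cdf_compl /gauss_cdf /Rintegral; congr fine.
rewrite ge0_integration_by_substitutionNy.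
- by apply: eq_integral => x _ /=; rewrite gaussN.
- exact: continuous_subspaceT continuous_gauss.
- by move=> x _; exact: gauss_ge0.
Qed.

(** The mean of sign(z + N) for a standard normal N, which is the derivative of [mean_abs]. *)
Definition sign_mean z : R := 2 * gauss_cdf z - 1.

(* [mean_abs z] is the mean of [|z + N|] for a standard normal [N]. *)
Definition mean_abs z : R := z * sign_mean z + 2 * gauss z.

Lemma is_derive_sign_mean z : is_derive z 1 sign_mean (2 * gauss z).
Proof.
have dF := is_derive_gauss_cdf z; rewrite /sign_mean.
by apply: is_derive_eq; rewrite /GRing.scale /= subr0.
Qed.

Lemma is_derive_mean_abs z : is_derive z 1 mean_abs (sign_mean z).
Proof.
have dF := is_derive_sign_mean z; have dg := is_derive_gauss z; rewrite /mean_abs.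
apply: is_derive_eq; rewrite /GRing.scale /=; ring.
Qed.

Lemma sign_mean_bound z : `|sign_mean z| <= 1.
Proof.
rewrite ler_norml /sign_mean; have := gauss_cdf_ge0 z; have := gauss_cdf_le1 z; lra.
Qed.

(** For z >= 0 the difference is 2 gauss(z) - 2 z (1 - gauss_cdf z), and the tail bound places it
    between 0 and 2; negative z follow by symmetry. *)
Lemma mean_abs_dist z : `|mean_abs z - `|z| | <= 2.
Proof.
have g1 := gauss_le1 z; have g0 := gauss_ge0 z; rewrite /mean_abs /sign_mean.
have [z0|z0] := leP 0 z.
  have t := gauss_tail z0; have c1 := gauss_cdf_le1 z.
  have t0 : 0 <= z * (1 - gauss_cdf z) by rewrite mulr_ge0 ?subr_ge0.
  rewrite (ger0_norm z0) ler_norml; lra.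
have nz0 : 0 <= - z by rewrite oppr_ge0 ltW.
have := gauss_tail nz0; rewrite gauss_cdfN gaussN opprB addrC subrK => t.
have t0 : 0 <= - z * gauss_cdf z by rewrite mulr_ge0 ?gauss_cdf_ge0.
rewrite (ltr0_norm z0) ler_norml; lra.
Qed.
End Gauss.

(** * Heat kernel and smoothed distance *)

Section Heat.
Context {R : realType}.
Local Notation mu := (@lebesgue_measure R).
Implicit Types (x z v h eps delta : R).

(** The integrand of [Gamma_q]. It is the time derivative of [heat_abs], and half of its second
    space derivative. *)
Definition heat v x : R :=
  (Num.sqrt (pi *+ 2 * v))^-1 * expR (- x ^+ 2 / (v *+ 2)).

Lemma heat_ge0 v x : 0 <= heat v x.
Proof. by rewrite mulr_ge0 ?invr_ge0 ?sqrtr_ge0 ?expR_ge0. Qed.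

Lemma heatE v x : 0 < v -> heat v x = gauss (x / Num.sqrt v) / Num.sqrt v.
Proof.
move=> v0; have sv : Num.sqrt v != 0 by rewrite gt_eqF// sqrtr_gt0.
have e : Num.sqrt (pi *+ 2 * v) = Num.sqrt (pi *+ 2) * Num.sqrt v.
  by rewrite sqrtrM// mulrn_wge0// pi_ge0.
rewrite /heat /gauss e invfM mulrAC; congr (_ * expR _ * _).
by rewrite expr_div_n sqr_sqrtr ?ltW//; field; rewrite gt_eqF.
Qed.

(* The mean of [|x + sqrt v N|], a solution of the heat equation. *)
Definition heat_abs v x : R := Num.sqrt v * mean_abs (x / Num.sqrt v).

Lemma heat_abs_dist v x : 0 < v -> `|heat_abs v x - `|x| | <= 2 * Num.sqrt v.
Proof.
move=> v0; have sv : 0 < Num.sqrt v by rewrite sqrtr_gt0.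
have -> : heat_abs v x - `|x| = Num.sqrt v * (mean_abs (x / Num.sqrt v) - `|x / Num.sqrt v|).
  by rewrite /heat_abs mulrBr normrM normfV (gtr0_norm sv); field; rewrite gt_eqF.
by rewrite normrM (gtr0_norm sv) mulrC ler_wpM2r ?mean_abs_dist// ltW.
Qed.

Lemma is_derive_dilate (f df : R -> R) a x : (forall x, is_derive x 1 f (df x)) ->
  is_derive x 1 (fun x => f (x / a)) (df (x / a) / a).
Proof.
move=> fdf; have da : is_derive x 1 (fun x => x / a) a^-1.
  by apply: is_derive_eq; rewrite /GRing.scale /= mulr1 mulr0 add0r.
exact: (@is_derive1_comp _ f (fun x => x / a) x _ _ (fdf (x / a)) da).
Qed.

Lemma is_derive_heat_abs v x : 0 < v ->
  is_derive x 1 (heat_abs v) (sign_mean (x / Num.sqrt v)).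
Proof.
move=> v0; have sv : Num.sqrt v != 0 by rewrite gt_eqF// sqrtr_gt0.
have dm := is_derive_dilate (Num.sqrt v) x is_derive_mean_abs; rewrite /heat_abs.
by apply: is_derive_eq; rewrite /GRing.scale /= mulrC divfK.
Qed.

Lemma is_derive_sign_mean_dilate v x : 0 < v ->
  is_derive x 1 (fun x => sign_mean (x / Num.sqrt v)) (2 * heat v x).
Proof.
move=> v0; rewrite heatE// mulrA.
exact: (is_derive_dilate (Num.sqrt v) x is_derive_sign_mean).
Qed.

Lemma heat_abs_lipschitz v x h : 0 < v -> `|heat_abs v (x + h) - heat_abs v x| <= `|h|.
Proof.
move=> v0; rewrite -[leRHS]mul1r.
apply: (lipschitz_derive (fun x => is_derive_heat_abs x v0)) => y; exact: sign_mean_bound.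
Qed.

Lemma heat_lipschitz eps v x h : 0 < eps -> eps <= v ->
  `|heat v (x + h) - heat v x| <= eps^-1 * `|h|.
Proof.
move=> e0 ev; have v0 := lt_le_trans e0 ev.
have sv : 0 < Num.sqrt v by rewrite sqrtr_gt0.
have dh (y : R) : is_derive y 1 (heat v) (- (y / Num.sqrt v) * gauss (y / Num.sqrt v) / v).
  have -> : heat v = fun x => gauss (x / Num.sqrt v) / Num.sqrt v.
    by apply: funext => u; exact: heatE.
  have dg := is_derive_dilate (Num.sqrt v) y is_derive_gauss.
  apply: is_derive_eq; rewrite /GRing.scale /= mulr0 add0r.
  have e := esym (sqr_sqrtr (ltW v0)); set s := Num.sqrt v in sv e *; rewrite [in RHS]e.
  by field; rewrite gt_eqF.
apply: (lipschitz_derive dh) => y; set z := y / _.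
rewrite normrM normfV (gtr0_norm v0) normrM normrN (ger0_norm (gauss_ge0 _)).
have b : `|z| * gauss z <= 1.
  apply: le_trans (gauss_bound z); rewrite ler_wpM2r ?gauss_ge0//.
  have := sqr_ge0 (`|z| - 1); rewrite sqrrB1 real_normK ?num_real//; lra.
rewrite -[leRHS]mul1r; apply: ler_pM => //.
- by rewrite mulr_ge0 ?gauss_ge0.
- by rewrite invr_ge0 ltW.
- by rewrite lef_pV2.
Qed.

Lemma heat_abs_taylor eps v x h : 0 < eps -> eps <= v ->
  `|heat_abs v (x + h) - heat_abs v x - h * sign_mean (x / Num.sqrt v) - h ^+ 2 * heat v x|
     <= 2 / eps * `|h| ^+ 3.
Proof.
move=> e0 ev; have v0 := lt_le_trans e0 ev.
have L0 : 0 <= 2 / eps by rewrite divr_ge0 ?ltW.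
have := @taylor2 R (heat_abs v) (fun x => sign_mean (x / Num.sqrt v))
  (fun x => 2 * heat v x) (2 / eps) L0 (fun x => is_derive_heat_abs x v0)
  (fun x => is_derive_sign_mean_dilate x v0) _ x h.
rewrite [h ^+ 2 / 2 * _]mulrA divfK; last by rewrite pnatr_eq0.
apply => y k; rewrite -mulrBr normrM ger0_norm// -mulrA ler_wpM2l//.
exact: heat_lipschitz.
Qed.

Lemma is_derive_over_sqrt (f df : R -> R) x v : 0 < v -> (forall x, is_derive x 1 f (df x)) ->
  is_derive v 1 (fun v => f (x / Num.sqrt v))
    (df (x / Num.sqrt v) * (- (x / Num.sqrt v) / (v *+ 2))).
Proof.
move=> v0 fdf; have sv : Num.sqrt v != 0 by rewrite gt_eqF// sqrtr_gt0.
have ds := is_derive1_sqrt v0.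
have da : is_derive v 1 (fun v => x / Num.sqrt v) (- (x / Num.sqrt v) / (v *+ 2)).
  apply: is_derive_eq; rewrite /GRing.scale /=.
  by have e := esym (sqr_sqrtr (ltW v0)); set s := Num.sqrt v in sv e *; rewrite [in RHS]e; field.
exact: (@is_derive1_comp _ f (fun v => x / Num.sqrt v) v _ _ (fdf (x / Num.sqrt v)) da).
Qed.

Lemma is_derive_heat_abs_time v x : 0 < v ->
  is_derive v 1 (fun v => heat_abs v x) (heat v x).
Proof.
move=> v0; have sv : Num.sqrt v != 0 by rewrite gt_eqF// sqrtr_gt0.
have ds := is_derive1_sqrt v0; have dm := is_derive_over_sqrt x v0 is_derive_mean_abs.
rewrite /heat_abs; apply: is_derive_eq; rewrite /GRing.scale /= heatE// /mean_abs.
have e := esym (sqr_sqrtr (ltW v0)); set s := Num.sqrt v in sv e *; rewrite ?[X in _ / (X *+ 2)]e.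
by field.
Qed.

Lemma is_derive_heat_time v x : 0 < v ->
  is_derive v 1 (fun v => heat v x)
    (((x / Num.sqrt v) ^+ 2 - 1) * gauss (x / Num.sqrt v) / (v * Num.sqrt v *+ 2)).
Proof.
move=> v0; have sv : Num.sqrt v != 0 by rewrite gt_eqF// sqrtr_gt0.
have ds := is_derive1_sqrt v0; have dg := is_derive_over_sqrt x v0 is_derive_gauss.
have d : is_derive v 1 (fun v => gauss (x / Num.sqrt v) / Num.sqrt v)
    (((x / Num.sqrt v) ^+ 2 - 1) * gauss (x / Num.sqrt v) / (v * Num.sqrt v *+ 2)).
  apply: is_derive_eq; rewrite /GRing.scale /=.
  have e := esym (sqr_sqrtr (ltW v0)); set s := Num.sqrt v in sv e *.
  by rewrite e; field.
apply: near_eq_is_derive d.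
near=> u; apply/esym/heatE; near: u; exact: lt_nbhsr.
Unshelve. all: by end_near. Qed.

Lemma time_increment_bound (g dg : R -> R) v delta B : 0 <= delta ->
  (forall s, v <= s <= v + delta -> is_derive s 1 g (dg s)) ->
  (forall s, v <= s <= v + delta -> `|dg s| <= B) ->
  `|g (v + delta) - g v| <= B * delta.
Proof.
move=> d0 gdg dgB; have vd : v <= v + delta by rewrite lerDl.
have gin s : s \in `]v, (v + delta)[ -> is_derive s 1 g (dg s).
  by rewrite in_itv /= => /andP[/ltW vs /ltW sd]; apply: gdg; rewrite vs.
have [c] := MVT_segment vd gin (is_derive_within gdg).
rewrite in_itv /= => cI ->; rewrite addrAC subrr add0r normrM (ger0_norm d0).
by rewrite ler_wpM2r// dgB.
Qed.

Lemma heat_time_lipschitz eps v x delta : 0 < eps -> eps <= v -> 0 <= delta ->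
  `|heat (v + delta) x - heat v x| <= (eps * Num.sqrt eps)^-1 * delta.
Proof.
move=> e0 ev d0; apply: (time_increment_bound d0 (g := fun v => heat v x)) => s /andP[vs _].
  by apply: is_derive_heat_time; exact: lt_le_trans (lt_le_trans e0 ev) vs.
have es := le_trans ev vs; have s0 := lt_le_trans e0 es; set z := x / _.
have ss0 : 0 < Num.sqrt s by rewrite sqrtr_gt0.
have se0 : 0 < Num.sqrt eps by rewrite sqrtr_gt0.
have p0 : 0 < s * Num.sqrt s by rewrite mulr_gt0.
have g0 := gauss_ge0 z.
rewrite normrM normrM normfV (ger0_norm g0) (gtr0_norm (_ : 0 < _ *+ 2)); last by rewrite pmulrn_lgt0.
have b : `|z ^+ 2 - 1| * gauss z <= 2.
  apply: (@le_trans _ _ (2 * ((1 + z ^+ 2 / 2) * gauss z))); last first.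
    by rewrite -[leRHS]mulr1 ler_wpM2l// gauss_bound.
  rewrite mulrA ler_wpM2r// ler_norml; have := sqr_ge0 z; lra.
apply: (@le_trans _ _ (2 / (s * Num.sqrt s *+ 2))).
  by rewrite ler_wpM2r// invr_ge0 mulrn_wge0// ltW.
have -> : 2 / (s * Num.sqrt s *+ 2) = (s * Num.sqrt s)^-1.
  by field; rewrite !gt_eqF.
rewrite lef_pV2 ?posrE ?mulr_gt0//; apply: ler_pM => //; [exact: ltW|exact: ler_wsqrtr].
Qed.

Lemma heat_abs_time_step eps v x delta : 0 < eps -> eps <= v -> 0 <= delta ->
  `|heat_abs (v + delta) x - heat_abs v x - delta * heat v x|
     <= (eps * Num.sqrt eps)^-1 * delta ^+ 2.
Proof.
move=> e0 ev d0; have v0 := lt_le_trans e0 ev.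
pose g s := heat_abs s x - s * heat v x.
have -> : heat_abs (v + delta) x - heat_abs v x - delta * heat v x = g (v + delta) - g v.
  rewrite /g; ring.
rewrite expr2 mulrA; apply: (@time_increment_bound g (fun s => heat s x - heat v x)) => //.
  move=> s /andP[vs _]; have ds := is_derive_heat_abs_time x (lt_le_trans v0 vs).
  by rewrite /g; apply: is_derive_eq; rewrite /GRing.scale /=; ring.
move=> s /andP[vs sd]; have -> : s = v + (s - v) by rewrite addrC subrK.
apply: le_trans (heat_time_lipschitz _ e0 ev _) _; first by rewrite subr_ge0.
apply: ler_wpM2l; last by rewrite lerBlDl.
by rewrite invr_ge0 mulr_ge0 ?sqrtr_ge0// ltW.
Qed.

Lemma heat_le eps v x : 0 < eps -> eps <= v -> heat v x <= (Num.sqrt eps)^-1.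
Proof.
move=> e0 ev; have v0 := lt_le_trans e0 ev; rewrite heatE// -[leRHS]mul1r.
apply: ler_pM; rewrite ?gauss_ge0 ?invr_ge0 ?sqrtr_ge0 ?gauss_le1//.
by rewrite lef_pV2 ?posrE ?sqrtr_gt0// ler_wsqrtr.
Qed.

Lemma heat_abs_time_lipschitz eps v x delta : 0 < eps -> eps <= v -> 0 <= delta ->
  `|heat_abs (v + delta) x - heat_abs v x| <= (Num.sqrt eps)^-1 * delta.
Proof.
move=> e0 ev d0; apply: (time_increment_bound d0 (g := fun v => heat_abs v x)) => s /andP[vs _].
  by apply: is_derive_heat_abs_time; exact: lt_le_trans (lt_le_trans e0 ev) vs.
by rewrite ger0_norm ?heat_ge0// heat_le// (le_trans ev).
Qed.

(** [heat_abs 0 x] evaluates to 0 because sqrt 0 = 0, and not to the limit |x|; hence the case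
    distinction. *)
Definition heat_abs0 v x : R := if v == 0 then `|x| else heat_abs v x.

(** For v = 0 or v >= eps the distance to |x| or the time derivative gives at most 2 sqrt(eps).
    Otherwise both values are compared with |x|: sqrt(eps + v) <= 3/2 sqrt(eps) and sqrt v <=
    sqrt(eps) contribute 3 + 2 = 5. *)
Lemma heat_abs0_shift eps v x : 0 < eps -> 0 <= v ->
  `|heat_abs (eps + v) x - heat_abs0 v x| <= 5 * Num.sqrt eps.
Proof.
move=> e0 v0; rewrite /heat_abs0; have se0 : 0 < Num.sqrt eps by rewrite sqrtr_gt0.
have [->|vn0] := eqVneq v 0.
  rewrite addr0; apply: le_trans (heat_abs_dist x e0) _.
  by apply: ler_wpM2r; [exact: ltW|lra].
have vp : 0 < v by rewrite lt_neqAle eq_sym vn0.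
have [ev|ve] := leP eps v.
  rewrite (addrC eps); apply: le_trans (heat_abs_time_lipschitz x e0 ev (ltW e0)) _.
  rewrite -[X in _ * X](sqr_sqrtr (ltW e0)) expr2 mulKf ?gt_eqF//; lra.
have d1 := heat_abs_dist x (addr_gt0 e0 vp).
have d2 := heat_abs_dist x vp; rewrite distrC in d2.
have s1 : Num.sqrt (eps + v) <= 3 / 2 * Num.sqrt eps.
  rewrite -(ler_pXn2r (n := 2))// ?nnegrE ?mulr_ge0 ?sqrtr_ge0//.
  rewrite exprMn !sqr_sqrtr ?ltW ?addr_gt0//; lra.
have s2 : Num.sqrt v <= Num.sqrt eps by rewrite ler_wsqrtr// ltW.
have := ler_distD `|x| (heat_abs (eps + v) x) (heat_abs v x); lra.
Qed.

Lemma continuous_heat_time x a b : 0 < a -> {within `[a, b], continuous (heat^~ x)}.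
Proof.
move=> a0; apply: is_derive_within => s /andP[a_s _].
by apply: is_derive_heat_time; exact: lt_le_trans a0 a_s.
Qed.

Lemma integral_heat_pos x a b : 0 < a -> a <= b ->
  (\int[mu]_(v in `[a, b]) (heat v x)%:E = (heat_abs b x - heat_abs a x)%:E)%E.
Proof.
move=> a0; rewrite le_eqVlt => /predU1P[->|ab].
  by rewrite subrr set_itv1 integral_set1.
have cG (c : R) : 0 < c -> continuous_at c (heat_abs^~ x).
  move=> c0; apply: differentiable_continuous; apply/derivable1_diffP.
  by have [] := is_derive_heat_abs_time x c0.
rewrite (continuous_FTC2 (F := heat_abs^~ x) ab).
- by rewrite EFinB.
- exact: continuous_heat_time.
- split.
  + move=> v; rewrite in_itv /= => /andP[av _].
    by have [] := is_derive_heat_abs_time x (lt_trans a0 av).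
  + by apply: cvg_at_right_filter; exact: cG.
  + by apply: cvg_at_left_filter; apply: cG; exact: lt_trans ab.
- move=> v; rewrite in_itv /= => /andP[av _].
  by rewrite derive1E; have [_] := is_derive_heat_abs_time x (lt_trans a0 av).
Qed.

Lemma Rintegral_heat x a b : 0 <= a -> a <= b ->
  Rintegral mu `[a, b] (heat^~ x) = heat_abs0 b x - heat_abs0 a x.
Proof.
rewrite le_eqVlt => /predU1P[<-{a}|a0] ab; last first.
  rewrite /heat_abs0 !gt_eqF//; last exact: lt_le_trans ab.
  by rewrite /Rintegral integral_heat_pos.
move: ab; rewrite le_eqVlt => /predU1P[<-|b0].
  by rewrite subrr set_itv1 Rintegral_set1.
rewrite /heat_abs0 eqxx gt_eqF// /Rintegral.
pose F (n : nat) := [set` `[b / n.+1%:R, b]].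
have mF n : measurable (F n) by exact: measurable_itv.
have ndF : nondecreasing_seq F.
  move=> m n mn; apply/subsetPset => v; rewrite /F /= !in_itv /= => /andP[mv ->].
  rewrite andbT; apply: le_trans mv; apply: ler_wpM2l; first exact: ltW.
  by rewrite lef_pV2 ?posrE ?ltr0n// ler_nat ltnS.
have UF : \bigcup_n F n = [set` `]0, b]].
  apply/seteqP; split=> v /=.
    move=> [n _]; rewrite /F /= !in_itv /= => /andP[nv ->]; rewrite andbT.
    by apply: lt_le_trans nv; rewrite divr_gt0.
  rewrite in_itv /= => /andP[v0 vb]; exists (Num.truncn (b / v)) => //.
  rewrite /F /= in_itv /= vb andbT ler_pdivrMr ?ltr0n// mulrC -ler_pdivrMr//.
  exact/ltW/truncnS_gt.
have f0 n v : F n v -> (0 <= (heat v x)%:E)%E by move=> _; rewrite lee_fin heat_ge0.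
have mf n : measurable_fun (F n) (fun v => (heat v x)%:E).
  apply/measurable_EFinP; apply: subspace_continuous_measurable_fun => //.
  by apply: continuous_heat_time; rewrite divr_gt0.
have mb : measurable_fun `]0, b] (fun v => (heat v x)%:E).
  by rewrite -UF; apply/measurable_fun_bigcup.
have := ge0_nondecreasing_set_cvg_integral (mu := mu) ndF mF mf f0.
rewrite UF integral_itv_obnd_cbnd// => cv.
have lim : (\int[mu]_(v in F n) (heat v x)%:E @[n --> \oo] --> (heat_abs b x - `|x|)%:E)%E.
  rewrite (_ : (fun n => _) = EFin \o (fun n : nat => heat_abs b x - heat_abs (b / n.+1%:R) x)).
    apply/fine_cvgP; split; first by near=> n.
    apply: cvgB; first exact: cvg_cst.
    apply/cvgrPdist_le => e e0; near=> n.
    have bn0 : 0 < b / n.+1%:R by rewrite divr_gt0.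
    rewrite distrC; apply: le_trans (heat_abs_dist x bn0) _.
    rewrite -ler_pdivlMl// -(ler_pXn2r (n := 2))// ?nnegrE ?sqrtr_ge0//; last first.
      by rewrite mulr_ge0// ltW.
    rewrite (sqr_sqrtr (ltW bn0)) ler_pdivrMr ?ltr0n// mulrC -ler_pdivrMr; last by rewrite exprn_gt0// mulr_gt0.
    apply: (@le_trans _ _ n%:R); last by rewrite ler_nat.
    by near: n; exact: nbhs_infty_ger.
  apply: funext => n; rewrite /= integral_heat_pos ?divr_gt0//.
  rewrite ler_pdivrMr ?ltr0n//; apply: ler_peMr; [exact: ltW|by rewrite ler1n].
by rewrite (cvg_unique _ cv lim).
Unshelve. all: by end_near. Qed.

End Heat.

(** * Drift and noise of functions of two walks *)

Section Decomposition.
Context {R : realType} (M : nat).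
Context {d : measure_display} {Omega : measurableType d}.
Variables (P : probability Omega R) (om : Omega -> @env R).
Hypothesis measurable_om : forall x tau j, measurable_fun setT (fun w => om w x tau j).
Hypothesis valid_om : forall w, valid_env M (om w).
Hypothesis independent_om : sites_independent P om M.
Hypothesis identical_om : sites_identically_distributed P om M.
Implicit Types (e : @env R) (f : int -> R) (F : int -> int -> R) (w v : nat * int).

Local Notation Ev := (Ev P om).
Local Notation p := (pbar P om).
Local Notation nice := (@nice R M).
Local Notation valid_env := (@valid_env R M).
Local Notation mean_env := (mean_env P om).
Local Notation V := (Vdrift P om M).

Lemma transition_dist e tau f x a c : valid_env e ->
  (forall z, in_range M z -> `|f (x + z) - a| <= c) -> `|transition M e tau f x - a| <= c.
Proof.
move=> [e0 e1] fc.
have -> : transition M e tau f x - a = sumM M (fun z => e x tau z * (f (x + z) - a)).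
  rewrite -{1}[a]mul1r -(e1 x tau) -sumMZr -sumMB.
  by apply: eq_sumM => z _; rewrite mulrBr.
apply: le_trans (ler_norm_sumM _ _) _; rewrite -[leRHS]mul1r -(e1 x tau) -sumMZr.
by apply: ler_sumM => z zM; rewrite normrM (ger0_norm (e0 _ _ _)) ler_wpM2l// fc.
Qed.

Lemma stage_step2_dist T e w v k F x y a c : valid_env e ->
  (forall z1 z2, in_range M z1 -> in_range M z2 -> `|F (x + z1) (y + z2) - a| <= c) ->
  `|stage_step2 M T e w v k F x y - a| <= c.
Proof.
move=> ve Fc; have r0 : in_range M 0 by rewrite /in_range; lia.
have step1 z1 : in_range M z1 -> `|stage_step M T e v k (F (x + z1)) y - a| <= c.
  move=> z1M; rewrite /stage_step; case: ifP => _.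
    by apply: transition_dist => // z2 z2M; exact: Fc.
  by have := Fc z1 0 z1M r0; rewrite addr0.
rewrite /stage_step2 {1}/stage_step; case: ifP => _.
  by apply: transition_dist => // z1 z1M; exact: step1.
by have := step1 0 r0; rewrite addr0.
Qed.

Lemma mean_step2_dist T w v k F x y a c :
  (forall z1 z2, in_range M z1 -> in_range M z2 -> `|F (x + z1) (y + z2) - a| <= c) ->
  `|mean_step2 M T P om w v k F x y - a| <= c.
Proof.
move=> Fc; have nF : nice (fun e => stage_step2 M T e w v k F x y) by exact: nice_stage_step2.
rewrite /mean_step2 -{1}(Ev_cst P om a).
rewrite -(EvB P measurable_om valid_om nF (nice_cst M a)).
apply: le_trans (normr_Ev P measurable_om valid_om (niceB nF (nice_cst M a))) _.
rewrite -[leRHS](Ev_cst P om); apply: (le_Ev P measurable_om valid_om).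
- by apply: nice_norm; apply: niceB => //; exact: nice_cst.
- exact: nice_cst.
- by move=> e ve; exact: stage_step2_dist.
Qed.

Section NoiseDecomposition.
Variables (T : nat) (w v : nat * int) (f : nat -> int -> int -> R) (c : R).
Hypothesis oscillation : forall k x y z1 z2, in_range M z1 -> in_range M z2 ->
  `|f k (x + z1) (y + z2) - f k x y| <= c.

Definition step_noise k e x y : R :=
  stage_step2 M T e w v k (f k.+1) x y - mean_step2 M T P om w v k (f k.+1) x y.

Lemma nice_step_noise k x y : nice (fun e => step_noise k e x y).
Proof. by apply: niceB; [exact: nice_stage_step2|exact: nice_cst]. Qed.

Lemma local_step_noise k e e' x y :
  ((w.1 <= k)%N -> e x (level T k) = e' x (level T k)) ->
  ((v.1 <= k)%N -> e y (level T k) = e' y (level T k)) ->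
  step_noise k e x y = step_noise k e' x y.
Proof.
move=> ex ey; congr (_ - _).
have step1 g : stage_step M T e v k g y = stage_step M T e' v k g y.
  rewrite /stage_step; case: ifP => // /ey eey.
  by apply: eq_sumM => z _; rewrite eey.
rewrite /stage_step2 {1 3}/stage_step; case: ifP => [/ex eex|_]; last exact: step1.
by apply: eq_sumM => z _; rewrite eex step1.
Qed.

Lemma centered_step_noise k x y : Ev (fun e => step_noise k e x y) = 0.
Proof.
rewrite (EvB P measurable_om valid_om); [|exact: nice_stage_step2|exact: nice_cst].
by rewrite Ev_cst subrr.
Qed.

Lemma bounded_step_noise k e x y : valid_env e -> `|step_noise k e x y| <= 2 * c.
Proof.
move=> ve; have o z1 z2 := @oscillation k.+1 x y z1 z2.
have h1 := stage_step2_dist T w v k ve o; have h2 := mean_step2_dist T w v k o.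
rewrite distrC in h2; rewrite mulrDl !mul1r.
apply: le_trans (lerD h1 h2); exact: ler_distD.
Qed.

(** Doob's decomposition: the first sum is the drift given the past, the second has centred,
    mutually orthogonal terms. *)
Lemma law2_decomposition l K e : valid_env e -> (l <= K)%N ->
  law2 M T e w v K (f K) - law2 M T e w v l (f l) =
  \sum_(l <= k < K) law2 M T e w v k (fun x y =>
      mean_step2 M T P om w v k (f k.+1) x y - f k x y)
  + \sum_(l <= k < K) law2 M T e w v k (step_noise k e).
Proof.
move=> ve lK; rewrite law2_telescope// -big_split /=; apply: eq_bigr => k _.
rewrite -law2D//; congr (law2 M T e w v k _); apply: funext => x; apply: funext => y.
by rewrite /step_noise; ring.
Qed.

Lemma Ev_step_noise_sum_sqr l K :
  Ev (fun e => (\sum_(l <= k < K) law2 M T e w v k (step_noise k e)) ^+ 2) <=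
  (2 * c) ^+ 2 * \sum_(l <= k < K) Ev (fun e =>
    collision M T w w k e + 2 * collision M T w v k e + collision M T v v k e).
Proof.
apply: (Ev_noise_sum_sqr measurable_om valid_om independent_om).
- exact: nice_step_noise.
- exact: local_step_noise.
- exact: centered_step_noise.
- exact: bounded_step_noise.
Qed.

Lemma Ev_step_noise k : Ev (fun e => law2 M T e w v k (step_noise k e)) = 0.
Proof.
apply: (Ev_noise measurable_om valid_om independent_om).
- exact: nice_step_noise.
- exact: local_step_noise.
- exact: centered_step_noise.
Qed.

Lemma nice_step_noise_sum l K :
  nice (fun e => \sum_(l <= k < K) law2 M T e w v k (step_noise k e)).
Proof.
by apply: nice_sum => k; apply: nice_law2 => x y; exact: nice_step_noise.
Qed.
End NoiseDecomposition.

Lemma valid_mean : valid_env mean_env.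
Proof. exact: valid_mean_env. Qed.

(** A single walk crosses each level once, so it always reads a fresh vector and its averaged law is
    that of a random walk with steps [pbar]. Two walks break this when they meet. *)
Lemma Ev_law_mean T w k f : Ev (fun e => law M T e w k f) = law M T mean_env w k f.
Proof.
elim: k f => [|k IHk] f; first exact: Ev_cst.
rewrite /= -IHk.
apply: (Ev_resample measurable_om valid_om independent_om (S := other_levels T k)).
- apply: (@nice_law R M T w k (fun e => stage_step M T e w k f)) => x.
  by apply: (@nice_stage_step _ _ _ w k (fun _ => f)) => z; exact: nice_cst.
- by apply: (@nice_law R M T w k (fun _ => stage_step M T mean_env w k f)) => x; exact: nice_cst.
move=> e ve.
rewrite (@eq_Ev _ M _ _ _ _ valid_om _ (fun e' => law M T e w k (stage_step M T e' w k f))); last first.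
  move=> e' _; rewrite (law_same_below M w (@same_below_mix _ T k e e')).
  congr (law M T e w k _); rewrite /stage_step; case: ifP => // _.
  apply: funext => x; apply: eq_sumM => z _.
  by rewrite mix_level.
have nst x : nice (fun e' => stage_step M T e' w k f x).
  by apply: (@nice_stage_step _ _ _ w k (fun _ => f)) => z; exact: nice_cst.
rewrite (Ev_law T P measurable_om valid_om w k ve nst); congr (law M T e w k _).
apply: funext => x; rewrite /stage_step; case: ifP => _; last exact: Ev_cst.
exact: Ev_transition.
Qed.

(* Truncated subtraction: a walk that has not started yet has made no step. *)
Definition steps w k : nat := (k - w.1)%N.

Definition centre w k : R := w.2%:~R + V * (steps w k)%:R.

Lemma sum_pbar_centered : sumM M (fun z => p z * (z%:~R - V)) = 0.
Proof.
under eq_sumM => z _ do rewrite mulrBr.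
rewrite sumMB sumMZr (sum_pbar P measurable_om valid_om) mul1r /Vdrift.
by apply/eqP; rewrite subr_eq0; apply/eqP; apply: eq_sumM => z _; rewrite mulrC.
Qed.

Lemma sum_pbar_sqr : sumM M (fun z => p z * (z%:~R - V) ^+ 2) = sigmaa2 P om M.
Proof. by apply: eq_sumM => z _; rewrite mulrC. Qed.

Lemma Ev_law_sqr T w k :
  Ev (fun e => law M T e w k (fun x => (x%:~R - centre w k) ^+ 2)) =
  sigmaa2 P om M * (steps w k)%:R.
Proof.
rewrite Ev_law_mean; elim: k => [|k IHk].
  by rewrite /= /centre /steps sub0n mulr0 addr0 subrr expr0n mulr0.
rewrite /= /stage_step; case: ifP => wk; last first.
  have -> : steps w k.+1 = steps w k by rewrite /steps; lia.
  by rewrite -IHk; congr (law M T _ w k _); apply: funext => x; rewrite /centre /steps; congr ((_ - (_ + _ * _%:R)) ^+ 2); lia.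
have sS : steps w k.+1 = (steps w k).+1 by rewrite /steps subSn.
rewrite (_ : transition _ _ _ _ = fun x => (x%:~R - centre w k) ^+ 2 + sigmaa2 P om M).
  rewrite (lawD T w k valid_mean) IHk (law_cst T w k valid_mean) sS -natr1; ring.
apply: funext => x; rewrite -sum_pbar_sqr /transition /mean_env.
have -> : (x%:~R - centre w k) ^+ 2 = sumM M (fun z => p z * (x%:~R - centre w k) ^+ 2
     + 2 * (x%:~R - centre w k) * (p z * (z%:~R - V))).
  rewrite sumMD sumMZ sum_pbar_centered mulr0 addr0 sumMZr.
  by rewrite (sum_pbar P measurable_om valid_om) mul1r.
rewrite -sumMD; apply: eq_sumM => z _; rewrite /centre sS -natr1 intrD; ring.
Qed.

Lemma sigmaa2_ge0 : 0 <= sigmaa2 P om M.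
Proof.
rewrite -sum_pbar_sqr; apply: sumM_ge0 => z _.
by rewrite mulr_ge0 ?sqr_ge0// (pbar_ge0 P valid_om).
Qed.

Lemma nice_law2_cst T w v k F : nice (fun e => law2 M T e w v k F).
Proof. by apply: (@nice_law2 _ _ _ _ _ _ (fun _ => F)) => x y; exact: nice_cst. Qed.

(** Uses |u| <= u^2 / (2 r) + r / 2 for both centred positions. [r] stays free and is later set to
    s^2, the order of the standard deviation after s^4 steps. *)
Lemma Ev_law2_dist T w v k (r : R) : 0 < r ->
  Ev (fun e => law2 M T e w v k (fun x y => `|(y - x)%:~R|)) <=
  r + sigmaa2 P om M * ((steps w k)%:R + (steps v k)%:R) / (2 * r)
    + `|centre v k - centre w k|.
Proof.
move=> r0.
pose s w x : R := (x%:~R - centre w k) ^+ 2.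
have ns u : nice (fun e => law M T e u k (s u)).
  by apply: (@nice_law _ _ _ _ _ (fun _ => s u)) => x; exact: nice_cst.
pose B e := (2 * r)^-1 * (law M T e w k (s w) + law M T e v k (s v))
   + (r + `|centre v k - centre w k|).
have nB : nice B.
  apply: niceD; last exact: nice_cst.
  by apply: niceZ; apply: niceD; exact: ns.
apply: (@le_trans _ _ (Ev B)); last first.
  rewrite (EvD P measurable_om valid_om _ (nice_cst M _)); last first.
    by apply: niceZ; apply: niceD; exact: ns.
  rewrite (EvZ P measurable_om valid_om _ (niceD (ns w) (ns v))).
  rewrite (EvD P measurable_om valid_om (ns w) (ns v)) !Ev_law_sqr Ev_cst.
  rewrite le_eqVlt; apply/orP; left; apply/eqP; ring.
apply: (le_Ev P measurable_om valid_om) => //; first exact: nice_law2_cst.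
move=> e ve; have -> : B e = law2 M T e w v k (fun x y =>
    (2 * r)^-1 * (s w x + s v y) + (r + `|centre v k - centre w k|)).
  rewrite law2D// law2Z// law2D// law2_cst// law2_fst// law2_snd//.
apply: le_law2 => // x y; rewrite /s intrB.
set a := x%:~R - centre w k; set b := y%:~R - centre v k.
have -> : y%:~R - x%:~R = b - a + (centre v k - centre w k) by rewrite /a /b; ring.
apply: le_trans (ler_normD _ _) _; rewrite addrA lerD2r.
apply: le_trans (ler_normB _ _) _.
have h (u : R) : `|u| <= u ^+ 2 / (2 * r) + r / 2.
  have := sqr_ge0 (`|u| - r); rewrite sqrrB real_normK ?num_real// => hh.
  have -> : u ^+ 2 / (2 * r) + r / 2 = (u ^+ 2 + r ^+ 2) / (2 * r).
    by field; rewrite gt_eqF.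
  rewrite ler_pdivlMr ?mulr_gt0//; lra.
have := h a; have := h b; rewrite mulrDr ![(2 * r)^-1 * _]mulrC; lra.
Qed.

End Decomposition.

(** * Collision counts through the potential kernel *)

Section Occupation.
Context {R : realType} (M : nat).
Context {d : measure_display} {Omega : measurableType d}.
Variables (P : probability Omega R) (om : Omega -> @env R).
Hypothesis measurable_om : forall x tau j, measurable_fun setT (fun w => om w x tau j).
Hypothesis valid_om : forall w, valid_env M (om w).
Hypothesis independent_om : sites_independent P om M.
Hypothesis identical_om : sites_identically_distributed P om M.
Hypothesis aperiodic_om : ~ (exists h x : int, 1 < h /\
  sumM M (fun j => if (h %| (j - x))%Z then pbar P om j else 0) = 1).
Hypothesis random_om : (0 < P [set w | forall j : int, (om w 0 0 j < 1)%R])%E.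
Implicit Types (e : @env R) (f : int -> R) (F : int -> int -> R) (w v : nat * int).

Local Notation Ev := (Ev P om).
Local Notation p := (pbar P om).
Local Notation q := (pair_mean P om).
Local Notation nice := (@nice R M).
Local Notation valid_env := (@valid_env R M).
Local Notation mean_env := (mean_env P om).
Local Notation Q := (fejer_avg M (indep_pair p)).
Local Notation pot := (potential M p).
Local Notation sigma2 := (sigmaa2 P om M).

Let p_ge0 j : 0 <= p j. Proof. exact: pbar_ge0 valid_om j. Qed.
Let p_sum : sumM M p = 1. Proof. exact: sum_pbar. Qed.
Let kp : pair_law M (indep_pair p). Proof. exact: indep_pair_law. Qed.
Let Q_gt0 t : 0 < Q t. Proof. exact: fejer_avg_gt0. Qed.

Lemma pair_mean_law : pair_law M q.
Proof.
split=> [j j'|]; first by apply: (Ev_ge0 P valid_om) => e [e0 _]; exact: mulr_ge0.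
rewrite -(Ev_cst P om 1) (@eq_Ev _ M _ _ _ _ valid_om _
  (fun e => sumM M (fun j => sumM M (fun j' => e 0 0 j * e 0 0 j')))); last first.
  move=> e [_ e1]; rewrite -[LHS](e1 0 0); apply: eq_sumM => j _.
  by rewrite sumMZ e1 mulr1.
have nn j j' : in_range M j -> in_range M j' -> nice (fun e => e 0 0 j * e 0 0 j').
  by move=> jM j'M; apply: niceM; exact: nice_coord.
rewrite (Ev_sumM P measurable_om valid_om (F := fun j e => sumM M (fun j' => e 0 0 j * e 0 0 j'))).
  apply: eq_sumM => j jM.
  by rewrite (Ev_sumM P measurable_om valid_om (F := fun j' e => e 0 0 j * e 0 0 j')) // => j'; exact: nn.
by move=> j jM; apply: (@nice_sumM _ _ (fun j' e => e 0 0 j * e 0 0 j')) => j'; exact: nn.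
Qed.

Lemma pair_meanC j j' : q j j' = q j' j.
Proof. by congr Ex; apply: funext => o; rewrite mulrC. Qed.

Lemma cos_sin_sqr (g : int -> R) t :
  (sumM M (fun j => g j * cos (t * j%:~R))) ^+ 2 + (sumM M (fun j => g j * sin (t * j%:~R))) ^+ 2
  = sumM M (fun j => sumM M (fun j' => g j * g j' * cos (t * (j' - j)%:~R))).
Proof.
rewrite !expr2 -!sumMZr -sumMD; apply: eq_sumM => j _.
rewrite -!sumMZ -sumMD; apply: eq_sumM => j' _.
by rewrite intrB mulrBr cosB; ring.
Qed.

Lemma lambdabarE t : lambdabar P om M t = diff_avg M (indep_pair p) (fun z => cos (t * z%:~R)).
Proof. exact: cos_sin_sqr. Qed.

Lemma lambdaE t : lambda P om M t = diff_avg M q (fun z => cos (t * z%:~R)).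
Proof.
rewrite /lambda fine_expectation.
transitivity (Ev (fun e => sumM M (fun j => sumM M (fun j' =>
    cos (t * (j' - j)%:~R) * (e 0 0 j * e 0 0 j'))))).
  congr Ex; apply: funext => o; rewrite /absphi2 cos_sin_sqr.
  by apply: eq_sumM => j _; apply: eq_sumM => j' _; rewrite mulrC.
have nn j j' : in_range M j -> in_range M j' ->
    nice (fun e => cos (t * (j' - j)%:~R) * (e 0 0 j * e 0 0 j')).
  by move=> jM j'M; apply: niceZ; apply: niceM; exact: nice_coord.
rewrite (Ev_sumM P measurable_om valid_om (F := fun j e => sumM M (fun j' =>
   cos (t * (j' - j)%:~R) * (e 0 0 j * e 0 0 j')))).
  apply: eq_sumM => j jM.
  rewrite (Ev_sumM P measurable_om valid_om (F := fun j' e =>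
    cos (t * (j' - j)%:~R) * (e 0 0 j * e 0 0 j'))); last by move=> j'; exact: nn.
  apply: eq_sumM => j' j'M; rewrite (EvZ P measurable_om valid_om) 1?mulrC//.
  by apply: niceM; exact: nice_coord.
by move=> j jM; apply: (@nice_sumM _ _ (fun j' e => cos (t * (j' - j)%:~R) * (e 0 0 j * e 0 0 j'))) => j'; exact: nn.
Qed.

(** Identifies the analytic constant with the mean potential one step after a collision, which is
    how [beta] enters the limit. *)
Lemma betaE : beta P om M = diff_avg M q pot.
Proof.
rewrite diff_avg_potential//.
pose f t := fejer_avg M q t / Q t.
have cf : continuous f by apply: continuous_div_Q => //; exact: continuous_fejer_avg.
(* Where cos t = 1 the defining quotient is 0/0, which evaluates to 0; on the circle this happens
   only at t = 0. *)
have gE : (fun t => (1 - lambda P om M t) / (1 - lambdabar P om M t)) =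
    (fun t => if cos t == 1 then 0 else f t).
  apply: funext => t; rewrite lambdaE lambdabarE.
  rewrite -(fejer_avgE t pair_mean_law) -(fejer_avgE t kp).
  case: eqP => [->|/eqP c1]; first by rewrite subrr !mul0r.
  rewrite /f; field; rewrite gt_eqF// subr_eq0 eq_sym//.
rewrite -[LHS]/(mean_circle _) gE; apply/esym; apply: eq_mean_circle => //.
  apply: measurable_funTS; apply: measurable_fun_ifT => //.
    apply: measurable_fun_eqr => //; apply: continuous_measurable_fun; exact: continuous_cos.
  exact: continuous_measurable_fun.
by move=> t tpi t0; rewrite (negbTE (cos_circle_neq1 tpi t0)).
Qed.

(** The second moment of the difference of two independent steps is twice the variance of one
    step. *)
Lemma Q0E : Q 0 = 2 * sigma2.
Proof.
rewrite /fejer_avg; under eq_diff_avg => z do rewrite fejer0.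
have e (z : int) : `|z|%N%:R ^+ 2 = z%:~R ^+ 2 :> R.
  by rewrite -[z%:~R ^+ 2]real_normK ?num_real// -intr_norm -abszE.
under eq_diff_avg => z do rewrite e.
have s1 := sum_pbar_sqr M P om; have s0 := sum_pbar_centered P measurable_om valid_om.
transitivity (sumM M (fun j => p j * sigma2 + p j * (j%:~R - Vdrift P om M) ^+ 2)); last first.
  by rewrite sumMD sumMZr p_sum s1 mul1r mulrDl mul1r.
apply: eq_sumM => j _; rewrite -s1.
transitivity (sumM M (fun j' => p j * (p j' * (j'%:~R - Vdrift P om M) ^+ 2)
   + (p j * (j%:~R - Vdrift P om M) ^+ 2) * p j'
   - (2 * p j * (j%:~R - Vdrift P om M)) * (p j' * (j'%:~R - Vdrift P om M)))).
  by apply: eq_sumM => j' _; rewrite /indep_pair intrB; ring.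
by rewrite sumMB sumMD !sumMZ s0 p_sum mulr0 subr0 mulr1.
Qed.

Lemma sigma2_gt0 : 0 < sigma2.
Proof. by have := Q_gt0 0; rewrite Q0E pmulr_rgt0. Qed.

(** Otherwise the sum of the squared weights at a site has mean 1. It never exceeds 1, with equality
    only for a point mass, so the vector would almost surely be a point mass, against (A2). *)
Lemma pair_mean_off_diagonal :
  exists j j', [/\ in_range M j, in_range M j', j != j' & 0 < q j j'].
Proof.
apply: contrapT => h.
have q0 j j' : in_range M j -> in_range M j' -> j != j' -> q j j' = 0.
  move=> jM j'M jj'; apply/eqP; rewrite eq_le pair_mean_law.1 andbT leNgt; apply/negP => q0.
  by apply: h; exists j, j'.
have diag : sumM M (fun j => q j j) = 1.
  rewrite -pair_mean_law.2; apply: eq_sumM => j jM.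
  apply/eqP; rewrite eq_le; apply/andP; split.
    by apply: (@ler_sumM1 _ M (q j)) => // j' _; exact: pair_mean_law.1.
  have -> : sumM M (q j) = sumM M (fun j' => if j' == j then q j j else 0).
    by apply: eq_sumM => j' j'M; have [->//|jj'] := eqVneq; rewrite q0// eq_sym.
  have jM' := jM; rewrite /in_range in jM'.
  have hj : (`|(j + M%:Z)%R|%N < (2 * M).+1)%N by lia.
  rewrite /sumM (bigD1 (Ordinal hj)) //= gez0_abs; last by lia.
  rewrite addrK eqxx big1 ?addr0// => i /negP ij; case: eqP => // e; case: ij.
  by apply/eqP/val_inj; rewrite /= -e; lia.
pose g e : R := 1 - sumM M (fun j => e 0 0 j * e 0 0 j).
have nsq : nice (fun e => sumM M (fun j => e 0 0 j * e 0 0 j)).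
  by apply: (@nice_sumM _ _ (fun j e => e 0 0 j * e 0 0 j)) => j jM; apply: niceM; exact: nice_coord.
have ng : nice g by apply: niceB => //; exact: nice_cst.
have Eg : Ev g = 0.
  rewrite (EvB P measurable_om valid_om (nice_cst M 1) nsq) Ev_cst.
  rewrite (Ev_sumM P measurable_om valid_om (F := fun j e => e 0 0 j * e 0 0 j)).
    by rewrite -[sumM M _]/(sumM M (fun j => q j j)) diag subrr.
  by move=> j jM; apply: niceM; exact: nice_coord.
have g0 e : valid_env e -> 0 <= g e.
  move=> ve; have [e0 e1] := ve; rewrite subr_ge0 -(e1 0 0); apply: ler_sumM => j jM.
  by rewrite ler_piMr// (valid_env_le1 _ _ ve).
have bg := nice_bounded_rv measurable_om valid_om ng.
have gm : measurable_fun setT (fun o => (g (om o))%:E).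
  by apply/measurable_EFinP; case: bg.
have int0 : (\int[P]_o `|(g (om o))%:E| = 0)%E.
  rewrite (eq_integral (fun o => (g (om o))%:E)); last first.
    by move=> o _; rewrite gee0_abs// lee_fin g0.
  have := expectation_Ex P bg; rewrite unlock => ->.
  by rewrite -[Ex P _]/(Ev g) Eg.
have [N [mN N0 subN]] := (ae_eq_integral_abs P measurableT gm).1 int0.
suff : (P [set o | forall j : int, (om o 0 0 j < 1)%R] <= 0)%E.
  by rewrite leNgt random_om.
rewrite -N0; apply: le_measure; rewrite ?inE//.
  apply: (@measurable_forall _ _ int (fun j => [set o | om o 0 0 j < 1])) => j.
  rewrite -[X in measurable X]setTI.
  exact: (measurable_fun_ltr (measurable_om 0 0 j) (measurable_cst (1 : R))).
(* If all weights are below 1, a positive one strictly exceeds its square and [g] is positive: the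
   event of (A2) lies in a null set. *)
move=> o /= o1; apply: subN => /= gz.
have gz0 : g (om o) = 0 by apply: EFin_inj; exact: (gz I).
move: gz0; have [e0 e1] := valid_om o; apply/eqP; rewrite gt_eqF// subr_gt0 -(e1 0 0).
have [y yM ey] : exists2 y, in_range M y & 0 < om o 0 0 y.
  apply: contrapT => h'; have : sumM M (om o 0 0) <= sumM M (fun=> 0).
    apply: ler_sumM => j jM; rewrite leNgt; apply/negP => pj; apply: h'; by exists j.
  by rewrite e1 /sumM big1// ler10.
rewrite -subr_gt0 -sumMB.
apply: (@lt_le_trans _ _ (om o 0 0 y - om o 0 0 y * om o 0 0 y)).
  by rewrite subr_gt0 gtr_pMr.
apply: (@ler_sumM1 _ M (fun j => om o 0 0 j - om o 0 0 j * om o 0 0 j)) => // j jM.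
by rewrite subr_ge0 ler_piMr// (valid_env_le1 _ _ (valid_om o)).
Qed.

Lemma beta_gt0 : 0 < beta P om M.
Proof.
rewrite betaE; apply: diff_avg_potential_gt0 => //; first exact: pair_mean_law.
exact: pair_mean_off_diagonal.
Qed.

Definition pair_potential (x y : int) : R := pot (y - x).
Local Notation pot2 := pair_potential.

Lemma pot_ge0 z : 0 <= pot z.
Proof.
apply: mulr_ge0; first by rewrite invr_ge0 mulrn_wge0// pi_ge0.
by apply: Rintegral_ge0 => t _; rewrite divr_ge0 ?fejer_ge0// ltW.
Qed.

Lemma pot0 : pot 0 = 0.
Proof.
rewrite /potential (_ : (fun t => _) = fun=> 0) ?mean_circle_cst//.
by apply: funext => t; rewrite /fejer big_ord0 mul0r.
Qed.

(** Off the diagonal the two steps are independent and the kernel is harmonic. On it the pair leaves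
    potential 0 with law [pair_mean], whose mean potential is [beta]. *)
Lemma mean_step2_pot T w v k x y : (w.1 <= k)%N -> (v.1 <= k)%N ->
  mean_step2 M T P om w v k pot2 x y = pot2 x y + beta P om M * (x == y)%:R.
Proof.
move=> wk vk; have [<-|xy] := eqVneq x y.
  rewrite (mean_step2_collide T measurable_om valid_om independent_om identical_om)//.
  rewrite /pot2 subrr pot0 add0r mulr1 betaE; apply: eq_sumM => z1 _; apply: eq_sumM => z2 _.
  by congr (_ * potential _ _ _); ring.
rewrite (mean_step2_free T measurable_om valid_om independent_om identical_om); last first.
  by rewrite (negbTE xy) !andbF.
have := potential_harmonic p_ge0 p_sum aperiodic_om (y - x).
rewrite subr_eq0 eq_sym (negbTE xy) addr0 mulr0 addr0 /pot2 => <-.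
rewrite /stage_step2 /stage_step wk vk /diff_avg; apply: eq_sumM => z1 _.
rewrite -sumMZ; apply: eq_sumM => z2 _; rewrite /indep_pair mulrA.
by congr (_ * potential _ _ _); ring.
Qed.

Lemma collision_frozen T w v k e : (k < maxn w.1 v.1)%N -> collision M T w v k e = 0.
Proof. by rewrite /collision leq_max => /orP[]; rewrite ltnNge => /negbTE ->; rewrite ?andbF. Qed.

(** A collision raises the mean potential by exactly [beta], so up to noise the potential counts
    collisions. Counting starts when the later walk starts; before that [collision] is 0 by
    definition. *)
Lemma occupation_identity T w v K e : valid_env e -> (maxn w.1 v.1 <= K)%N ->
  beta P om M * \sum_(0 <= k < K) collision M T w v k e =
  law2 M T e w v K pot2 - law2 M T e w v (maxn w.1 v.1) pot2
  - \sum_(maxn w.1 v.1 <= k < K) law2 M T e w v k (step_noise M P om T w v (fun=> pot2) k e).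
Proof.
move=> ve lK; rewrite (law2_decomposition P om T w v (fun=> pot2) ve lK) addrK.
rewrite (@big_cat_nat _ _ _ (maxn w.1 v.1))//= [X in X + _]big_nat_cond big1 ?add0r; last first.
  by move=> k /andP[/andP[_ kl] _]; exact: collision_frozen.
rewrite mulr_sumr; apply: eq_big_nat => k /andP[]; rewrite geq_max => /andP[wk vk] _.
rewrite /collision wk vk -law2Z//; congr (law2 M T e w v k _).
by apply: funext => x; apply: funext => y; rewrite mean_step2_pot// addrAC subrr add0r.
Qed.

(** Linear growth with a bounded error makes one-step oscillations bounded, which is what the noise
    bounds require. *)
Lemma pot_bounds : exists C : R, [/\ 0 <= C,
  forall z, `|pot z - `|z%:~R| / Q 0| <= C &
  forall x y z1 z2, in_range M z1 -> in_range M z2 ->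
    `|pot2 (x + z1) (y + z2) - pot2 x y| <= C].
Proof.
have [C hC] := potential_asymptotic p_ge0 p_sum aperiodic_om.
have C0 : 0 <= C by apply: le_trans (hC 0).
have hC' z : `|pot z - `|z%:~R| / Q 0| <= C.
  by have := hC z; rewrite (_ : `|z|%N%:R = `|z%:~R : R|) // -intr_norm -abszE.
have Qi : 0 <= (Q 0)^-1 by rewrite invr_ge0 ltW.
exists (2 * C + (2 * M%:R) / Q 0); split.
- by rewrite addr_ge0 ?mulr_ge0// mulr_ge0.
- by move=> z; apply: le_trans (hC' z) _; rewrite mulrDl mul1r -addrA lerDl addr_ge0// mulr_ge0// mulr_ge0.
move=> x y z1 z2 z1M z2M; rewrite /pot2.
set a := y + z2 - (x + z1); set b := y - x.
have ab : `|(`|a%:~R| - `|b%:~R|) / Q 0| <= (2 * M%:R) / Q 0 :> R.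
  rewrite normrM (ger0_norm Qi) ler_wpM2r//; apply: le_trans (ler_dist_dist _ _) _.
  rewrite -intrB -intr_norm -natrM pmulrn ler_int.
  by move: z1M z2M; rewrite /in_range /a /b; lia.
have := hC' a; have := hC' b; move: ab; rewrite mulrBl !ler_norml.
move=> /andP[h1 h2] /andP[h3 h4] /andP[h5 h6]; apply/andP; split; lra.
Qed.

(** The mean potential at stage [K] is at most a constant plus the mean distance over Q(0), and that
    distance is O(s^2) after O(s^4) steps. The noise is centred and drops out. *)
Lemma occupation_bound (A : R) : 0 <= A -> exists2 C : R, 0 <= C &
  forall (s : R) T K w v, 1 <= s -> K%:R <= A * s ^+ 4 ->
    `|centre M P om v K - centre M P om w K| <= A * s ^+ 2 ->
    \sum_(0 <= k < K) Ev (collision M T w v k) <= C * s ^+ 2.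
Proof.
move=> A0; have [C [C0 Casym Cosc]] := pot_bounds; have b0 := beta_gt0.
have Qi : 0 <= (Q 0)^-1 by rewrite invr_ge0 ltW.
have s20 := ltW sigma2_gt0.
have bi : 0 <= (beta P om M)^-1 by rewrite invr_ge0 ltW.
have sA : 0 <= sigma2 * A by exact: mulr_ge0.
have cQ : 0 <= C + (1 + sigma2 * A + A) / Q 0.
  by rewrite addr_ge0// mulr_ge0// !addr_ge0.
(* [C] bounds the error of |z|/Q(0); the three summands over Q(0) are those of [Ev_law2_dist] at r =
   s^2: r itself, the variances, the distance of the centres. *)
exists ((beta P om M)^-1 * (C + (1 + sigma2 * A + A) / Q 0)); first exact: mulr_ge0.
move=> s T K w v s1 KA cA.
have s0 : 0 < s by exact: lt_le_trans s1.
have ss : 1 <= s ^+ 2 by rewrite exprn_ege1.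
have [Kl|lK] := ltnP K (maxn w.1 v.1).
  rewrite big_nat_cond big1.
    by rewrite mulr_ge0 ?sqr_ge0// mulr_ge0.
  move=> k /andP[/andP[_ kK] _]; rewrite -[RHS](Ev_cst P om 0); congr Ex; apply: funext => o.
  by rewrite collision_frozen// (ltn_trans kK).
have nc k : nice (collision M T w v k) by exact: nice_collision.
rewrite -(Ev_sum P measurable_om valid_om)//.
rewrite -[leRHS]mulrA -(ler_pM2l b0) mulVKf ?gt_eqF//.
rewrite -(EvZ P measurable_om valid_om); last exact: nice_sum.
rewrite (@eq_Ev _ M _ _ _ _ valid_om _ (fun e =>
  law2 M T e w v K pot2 - law2 M T e w v (maxn w.1 v.1) pot2
  - \sum_(maxn w.1 v.1 <= k < K) law2 M T e w v k (step_noise M P om T w v (fun=> pot2) k e))); last first.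
  by move=> e ve; exact: occupation_identity.
have nL k : nice (fun e => law2 M T e w v k pot2) by exact: nice_law2_cst.
have nN k : nice (fun e => law2 M T e w v k (step_noise M P om T w v (fun=> pot2) k e)).
  by apply: nice_law2 => x y; exact: nice_step_noise.
rewrite (EvB P measurable_om valid_om); [|by apply: niceB|exact: nice_sum].
rewrite (Ev_sum P measurable_om valid_om)// big1_seq ?subr0; last first.
  move=> k _.
  exact: (Ev_step_noise measurable_om valid_om independent_om T w v (fun=> pot2)).
rewrite (EvB P measurable_om valid_om)//.
apply: (@le_trans _ _ (Ev (fun e => law2 M T e w v K pot2))).
  rewrite gerBl; apply: (Ev_ge0 P valid_om) => e ve.
  by rewrite -(law2_cst T w v (maxn w.1 v.1) 0 ve); apply: le_law2 => // x y; exact: pot_ge0.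
pose D x y : R := `|(y - x)%:~R|.
have nD : nice (fun e => law2 M T e w v K D) by exact: nice_law2_cst.
apply: (@le_trans _ _ (Ev (fun e => C + (Q 0)^-1 * law2 M T e w v K D))).
  apply: (le_Ev P measurable_om valid_om) => //.
    by apply: niceD; [exact: nice_cst|exact: niceZ].
  move=> e ve; rewrite -(law2_cst T w v K C ve) -law2Z// -law2D//.
  apply: le_law2 => // x y; rewrite -lerBlDr mulrC.
  exact: le_trans (ler_norm _) (Casym _).
rewrite (EvD P measurable_om valid_om (nice_cst M C) (niceZ _ nD)) Ev_cst.
rewrite (EvZ P measurable_om valid_om _ nD) mulrDl; apply: lerD; first by rewrite ler_peMr.
rewrite [leLHS]mulrC [leRHS]mulrAC; apply: ler_wpM2r => //.
have s20' : 0 < s ^+ 2 by rewrite exprn_gt0.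
apply: le_trans (Ev_law2_dist measurable_om valid_om independent_om identical_om T w v K s20') _.
rewrite (mulrDl (1 + sigma2 * A) A) (mulrDl 1 (sigma2 * A)) mul1r.
apply: lerD => //; apply: lerD => //.
rewrite ler_pdivrMr ?mulr_gt0// -mulrA -mulrA ler_wpM2l//.
have stepsK u : (steps u K)%:R <= A * s ^+ 4.
  by apply: le_trans KA; rewrite ler_nat leq_subr.
have := stepsK w; have := stepsK v => h1 h2.
apply: (@le_trans _ _ (A * s ^+ 4 + A * s ^+ 4)); first exact: lerD.
by rewrite le_eqVlt; apply/orP; left; apply/eqP; ring.
Qed.

(** The second moment is at most (2 c)^2 times a number of collisions of replicas, which is O(s^2);
    hence O(c s) in L^2 and so in L^1. *)
Lemma noise_bound (A : R) : 0 <= A -> exists2 C : R, 0 <= C &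
  forall (s c : R) T l K w v (f : nat -> int -> int -> R), 1 <= s -> K%:R <= A * s ^+ 4 ->
    `|centre M P om v K - centre M P om w K| <= A * s ^+ 2 -> 0 <= c ->
    (forall k x y z1 z2, in_range M z1 -> in_range M z2 ->
      `|f k (x + z1) (y + z2) - f k x y| <= c) ->
    Ev (fun e => `|\sum_(l <= k < K) law2 M T e w v k (step_noise M P om T w v f k e)|)
      <= c * (C * s).
Proof.
move=> A0; have [C C0 hC] := occupation_bound A0.
(* (2 c)^2 times 4 C s^2 is 16 c^2 C s^2, and C <= (C + 1)^2. *)
exists (4 * (C + 1)); first by rewrite mulr_ge0// addr_ge0.
move=> s c T l K w v f s1 KA cA c0 fc.
have s0 : 0 <= s by exact: le_trans s1.
have nS : nice (fun e => \sum_(l <= k < K) law2 M T e w v k (step_noise M P om T w v f k e)).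
  exact: nice_step_noise_sum.
rewrite -(ler_pXn2r (n := 2)) ?nnegrE//; last 2 first.
- by apply: (Ev_ge0 P valid_om) => e _.
- by rewrite mulr_ge0// mulr_ge0// mulr_ge0// addr_ge0.
apply: le_trans (sqr_Ev_norm_le P measurable_om valid_om nS) _.
apply: le_trans (Ev_step_noise_sum_sqr measurable_om valid_om independent_om T w v fc l K) _.
have nc w' v' k : nice (collision M T w' v' k) by exact: nice_collision.
have E k : Ev (fun e => collision M T w w k e + 2 * collision M T w v k e + collision M T v v k e)
   = Ev (collision M T w w k) + 2 * Ev (collision M T w v k) + Ev (collision M T v v k).
  rewrite (EvD P measurable_om valid_om (niceD (nc _ _ _) (niceZ _ (nc _ _ _))) (nc _ _ _)).
  rewrite (EvD P measurable_om valid_om (nc _ _ _) (niceZ _ (nc _ _ _))).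
  by rewrite (EvZ P measurable_om valid_om _ (nc _ _ _)).
have Ec0 w' v' k : 0 <= Ev (collision M T w' v' k).
  by apply: (Ev_ge0 P valid_om) => e ve; exact: collision_ge0.
have B w' v' : `|centre M P om v' K - centre M P om w' K| <= A * s ^+ 2 ->
    \sum_(l <= k < K) Ev (collision M T w' v' k) <= C * s ^+ 2.
  move=> h; apply: le_trans (hC s T K w' v' s1 KA h).
  have [lK|Kl] := leqP l K; last by rewrite [leLHS]big_geq ?(ltnW Kl)// sumr_ge0.
  by rewrite [leRHS](@big_cat_nat _ _ _ l)//= lerDr sumr_ge0.
have Aw u : `|centre M P om u K - centre M P om u K| <= A * s ^+ 2.
  by rewrite subrr normr0 mulr_ge0 ?sqr_ge0.
rewrite (eq_bigr _ (fun k _ => E k)) !big_split /= -mulr_sumr.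
have h1 := B w w (Aw w); have h2 := B w v cA; have h3 := B v v (Aw v).
apply: (@le_trans _ _ ((2 * c) ^+ 2 * (4 * (C * s ^+ 2)))).
  rewrite ler_wpM2l ?sqr_ge0//; lra.
rewrite !exprMn.
have -> : 2 ^+ 2 * c ^+ 2 * (4 * (C * s ^+ 2)) = c ^+ 2 * (4 ^+ 2 * C * s ^+ 2) by ring.
rewrite ler_wpM2l ?sqr_ge0// -[leRHS]mulrA -[leLHS]mulrA ler_wpM2l// ?ler_wpM2r ?sqr_ge0//.
have := sqr_ge0 C; rewrite sqrrD1; lra.
Qed.

End Occupation.

(** * One step of the smoothed distance *)

Section HeatApproximation.
Context {R : realType} (M : nat).
Context {d : measure_display} {Omega : measurableType d}.
Variables (P : probability Omega R) (om : Omega -> @env R).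
Hypothesis measurable_om : forall x tau j, measurable_fun setT (fun w => om w x tau j).
Hypothesis valid_om : forall w, valid_env M (om w).
Hypothesis independent_om : sites_independent P om M.
Hypothesis identical_om : sites_identically_distributed P om M.
Hypothesis aperiodic_om : ~ (exists h x : int, 1 < h /\
  sumM M (fun j => if (h %| (j - x))%Z then pbar P om j else 0) = 1).
Hypothesis random_om : (0 < P [set w | forall j : int, (om w 0 0 j < 1)%R])%E.
Implicit Types (e : @env R) (f : int -> R) (F : int -> int -> R) (w v : nat * int).

Local Notation Ev := (Ev P om).
Local Notation p := (pbar P om).
Local Notation q := (pair_mean P om).
Local Notation nice := (@nice R M).
Local Notation valid_env := (@valid_env R M).
Local Notation mean_env := (mean_env P om).
Local Notation Q := (fejer_avg M (indep_pair p)).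
Local Notation pot := (potential M p).
Local Notation pot2 := (pair_potential M P om).
Local Notation sigma2 := (sigmaa2 P om M).
Local Notation V := (Vdrift P om M).
Local Notation centre := (centre M P om).

Definition pair_sum (c : int -> int -> R) (F : int -> int -> R) : R :=
  sumM M (fun z1 => sumM M (fun z2 => c z1 z2 * F z1 z2)).

Lemma eq_pair_sum c F G : (forall z1 z2, in_range M z1 -> in_range M z2 -> F z1 z2 = G z1 z2) ->
  pair_sum c F = pair_sum c G.
Proof.
by move=> FG; apply: eq_sumM => z1 z1M; apply: eq_sumM => z2 z2M; rewrite FG.
Qed.

Lemma pair_sumD c F G : pair_sum c (fun z1 z2 => F z1 z2 + G z1 z2) = pair_sum c F + pair_sum c G.
Proof.
rewrite /pair_sum -sumMD; apply: eq_sumM => j _.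
by rewrite -sumMD; apply: eq_sumM => j' _; rewrite mulrDr.
Qed.

Lemma pair_sumZ c a F : pair_sum c (fun z1 z2 => a * F z1 z2) = a * pair_sum c F.
Proof.
rewrite /pair_sum -sumMZ; apply: eq_sumM => j _.
by rewrite -sumMZ; apply: eq_sumM => j' _; rewrite mulrCA.
Qed.

Lemma pair_sum_cst c a : pair_law M c -> pair_sum c (fun _ _ => a) = a.
Proof.
move=> [_ c1]; rewrite /pair_sum -[RHS]mul1r -c1 -sumMZr.
by apply: eq_sumM => j _; rewrite sumMZr.
Qed.

Lemma normr_pair_sum_le c F B : pair_law M c ->
  (forall z1 z2, in_range M z1 -> in_range M z2 -> `|F z1 z2| <= B) -> `|pair_sum c F| <= B.
Proof.
move=> kc FB; rewrite -[leRHS](pair_sum_cst B kc).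
apply: le_trans (ler_norm_sumM _ _) _; apply: ler_sumM => z1 z1M.
apply: le_trans (ler_norm_sumM _ _) _; apply: ler_sumM => z2 z2M.
by rewrite normrM (ger0_norm (kc.1 _ _)) ler_wpM2l ?FB//; exact: kc.1.
Qed.

Lemma pair_sum_quadratic c F (delta : int -> int -> R) a b b' : pair_law M c ->
  pair_sum c (fun z1 z2 => F z1 z2 + (a + (b * delta z1 z2 + b' * delta z1 z2 ^+ 2))) =
  pair_sum c F + (a + (b * pair_sum c delta + b' * pair_sum c (fun z1 z2 => delta z1 z2 ^+ 2))).
Proof. by move=> kc; rewrite !pair_sumD (pair_sum_cst _ kc) !pair_sumZ. Qed.

(** Second-order Taylor expansion: the first-order term is centred and drops out, and the
    second-order one has coefficient 1 because the second space derivative of [heat_abs] is twice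
    [heat]. *)
Lemma heat_pair_sum c (delta : int -> int -> R) (eps v a r B : R) : pair_law M c ->
  0 < eps -> eps <= v -> 0 < r ->
  (forall z1 z2, in_range M z1 -> in_range M z2 -> `|delta z1 z2| <= B) ->
  pair_sum c delta = 0 ->
  `|pair_sum c (fun z1 z2 => heat_abs v (a + delta z1 z2 / r)) - heat_abs v a
     - pair_sum c (fun z1 z2 => delta z1 z2 ^+ 2) / r ^+ 2 * heat v a|
    <= 2 / eps * (B / r) ^+ 3.
Proof.
move=> kc e0 ev r0 dB d0.
pose rest z1 z2 := heat_abs v (a + delta z1 z2 / r) - heat_abs v a
  - delta z1 z2 / r * sign_mean (a / Num.sqrt v) - (delta z1 z2 / r) ^+ 2 * heat v a.
have -> : pair_sum c (fun z1 z2 => heat_abs v (a + delta z1 z2 / r)) - heat_abs v a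
     - pair_sum c (fun z1 z2 => delta z1 z2 ^+ 2) / r ^+ 2 * heat v a = pair_sum c rest.
  rewrite (_ : pair_sum c (fun z1 z2 => heat_abs v (a + delta z1 z2 / r)) =
    pair_sum c (fun z1 z2 => rest z1 z2 + (heat_abs v a
      + (sign_mean (a / Num.sqrt v) / r * delta z1 z2 + heat v a / r ^+ 2 * delta z1 z2 ^+ 2)))).
    rewrite pair_sum_quadratic// d0 mulr0 add0r; ring.
  apply: eq_pair_sum => z1 z2 _ _; rewrite /rest; field.
  by rewrite gt_eqF// sqrtr_gt0 gt_eqF//= (lt_le_trans e0).
apply: normr_pair_sum_le => // z1 z2 z1M z2M.
apply: le_trans (heat_abs_taylor _ _ e0 ev) _.
apply: ler_wpM2l; first by rewrite divr_ge0// ltW.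
have B0 : 0 <= B by apply: le_trans (dB _ _ z1M z2M).
apply: lerXn2r; rewrite ?nnegrE; [exact: normr_ge0|by rewrite divr_ge0// ltW|].
rewrite normrM normfV (gtr0_norm r0); apply: ler_wpM2r; [by rewrite invr_ge0 ltW|exact: dB].
Qed.

Section Pair.
Variables (T K : nat) (w v : nat * int) (eps r : R).
Hypothesis eps_gt0 : 0 < eps.
Hypothesis r_ge1 : 1 <= r.

Let r_gt0 : 0 < r. Proof. exact: lt_le_trans r_ge1. Qed.

Definition remaining (u : nat * int) k : nat := (K - maxn k u.1)%N.

(* The smoothed distance at stage [K], averaged over the steps of two walks
   which move independently between the stages [k] and [K]. *)
Definition heat_dist k (x y : int) : R :=
  heat_abs (eps + sigma2 / r ^+ 2 * ((remaining w k)%:R + (remaining v k)%:R))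
    (((y - x)%:~R + V * ((remaining v k)%:R - (remaining w k)%:R)) / r).

Let time_ge k : eps <= eps + sigma2 / r ^+ 2 * ((remaining w k)%:R + (remaining v k)%:R).
Proof.
rewrite lerDl mulr_ge0 ?addr_ge0// divr_ge0 ?sqr_ge0//.
exact: sigmaa2_ge0 valid_om.
Qed.

Lemma heat_dist_osc k x y z1 z2 : in_range M z1 -> in_range M z2 ->
  `|heat_dist k (x + z1) (y + z2) - heat_dist k x y| <= (2 * M%:R) / r.
Proof.
move=> z1M z2M; rewrite /heat_dist; set a := (_ / r in X in `|_ - X|).
have -> : ((y + z2 - (x + z1))%:~R + V * ((remaining v k)%:R - (remaining w k)%:R)) / r =
    a + (z2 - z1)%:~R / r.
  by rewrite /a -mulrDl; congr (_ / _); rewrite !intrB !intrD; ring.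
apply: le_trans (heat_abs_lipschitz _ _ (lt_le_trans eps_gt0 (time_ge k))) _.
rewrite normrM normfV (gtr0_norm r_gt0); apply: ler_wpM2r; first by rewrite invr_ge0 ltW.
rewrite -intr_norm -natrM pmulrn ler_int.
by move: z1M z2M; clear; rewrite /in_range; lia.
Qed.

Let act (u : nat * int) k (z : int) : int := if (u.1 <= k)%N then z else 0.

(** A waiting walk is given a dummy jump that is averaged over but not performed, so that one
    formula covers all four cases. *)
Lemma stage_step2_pair_sum k F x y :
  stage_step2 M T mean_env w v k F x y =
  pair_sum (indep_pair p) (fun z1 z2 => F (x + act w k z1) (y + act v k z2)).
Proof.
have p1 := sum_pbar P measurable_om valid_om.
rewrite /stage_step2 /stage_step /act /pair_sum /indep_pair.
case: (w.1 <= k)%N; case: (v.1 <= k)%N.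
- by apply: eq_sumM => z1 _; rewrite -sumMZ; apply: eq_sumM => z2 _; rewrite mulrA.
- apply: eq_sumM => z1 _; rewrite addr0 -[LHS]mul1r -p1 -sumMZr.
  by apply: eq_sumM => z2 _; rewrite /mean_env; ring.
- rewrite -[LHS]mul1r -p1 -sumMZr; apply: eq_sumM => z1 _; rewrite addr0 -sumMZ.
  by apply: eq_sumM => z2 _; rewrite mulrA.
- rewrite !addr0 -[LHS]mul1r -{1}p1 -sumMZr; apply: eq_sumM => z1 _.
  by rewrite -[LHS]mulr1 -[in LHS]p1 -sumMZ; apply: eq_sumM => z2 _; rewrite mulrAC.
Qed.

Let dev (u : nat * int) k (z : int) : R := if (u.1 <= k)%N then z%:~R - V else 0.

(** The shift by V times the remaining steps anticipates the drift, so a step moves the argument by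
    centred jumps only. *)
Lemma heat_dist_step k x y z1 z2 : (k < K)%N ->
  heat_dist k.+1 (x + act w k z1) (y + act v k z2) =
  heat_abs (eps + sigma2 / r ^+ 2 * ((remaining w k.+1)%:R + (remaining v k.+1)%:R))
   (((y - x)%:~R + V * ((remaining v k)%:R - (remaining w k)%:R)) / r
    + (dev v k z2 - dev w k z1) / r).
Proof.
move=> kK; rewrite /heat_dist; congr heat_abs; rewrite -mulrDl; congr (_ / _).
have rem (u : nat * int) z : (remaining u k)%:R * V + dev u k z =
    (remaining u k.+1)%:R * V + (act u k z)%:~R.
  rewrite /act /dev; have [uk|ku] := leqP u.1 k.
    have -> : remaining u k = (remaining u k.+1).+1 by rewrite /remaining; clear -kK uk; lia.
    by rewrite -natr1; ring.
  have -> : remaining u k = remaining u k.+1 by rewrite /remaining; clear -ku; lia.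
  by [].
have := rem w z1; have := rem v z2; rewrite !intrB !intrD => e1 e2.
transitivity (y%:~R - x%:~R + ((remaining v k.+1)%:R * V + (act v k z2)%:~R)
  - ((remaining w k.+1)%:R * V + (act w k z1)%:~R)); first by ring.
by rewrite -e1 -e2; ring.
Qed.

Lemma remaining_step u k : (k < K)%N ->
  (remaining u k)%:R = (remaining u k.+1)%:R + (u.1 <= k)%N%:R :> R.
Proof.
move=> kK; rewrite -natrD; congr (_%:R); rewrite /remaining.
by have [uk|ku] := leqP u.1 k; clear -kK uk || clear -ku; lia.
Qed.

Lemma dev_sums k :
  sumM M (fun z => p z * dev w k z) = 0 /\
  sumM M (fun z => p z * dev w k z ^+ 2) = (w.1 <= k)%N%:R * sigma2.
Proof.
rewrite /dev; case: (w.1 <= k)%N.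
  by rewrite (sum_pbar_centered P measurable_om valid_om) sum_pbar_sqr mul1r.
by rewrite mul0r /sumM !big1// => i _; rewrite ?expr0n mulr0.
Qed.
End Pair.

Lemma dev_pair_sums (w v : nat * int) (k : nat) (dw dv : int -> R) (bw bv : R) :
  sumM M (fun z => p z * dw z) = 0 -> sumM M (fun z => p z * dv z) = 0 ->
  sumM M (fun z => p z * dw z ^+ 2) = bw * sigma2 ->
  sumM M (fun z => p z * dv z ^+ 2) = bv * sigma2 ->
  pair_sum (indep_pair p) (fun z1 z2 => dv z2 - dw z1) = 0 /\
  pair_sum (indep_pair p) (fun z1 z2 => (dv z2 - dw z1) ^+ 2) = (bw + bv) * sigma2.
Proof.
move=> w0 v0 w2 v2; have p1 := sum_pbar P measurable_om valid_om.
have avg (x : R) : x = sumM M (fun z2 => p z2 * x) by rewrite sumMZr p1 mul1r.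
split.
  transitivity (sumM M (fun z1 => p z1 * sumM M (fun z2 => p z2 * dv z2) - p z1 * dw z1)).
    apply: eq_sumM => z1 _; rewrite -sumMZ [p z1 * dw z1]avg -sumMB.
    by apply: eq_sumM => z2 _; rewrite /indep_pair; ring.
  by rewrite v0 sumMB w0 subr0 /sumM big1// => i _; rewrite mulr0.
transitivity (sumM M (fun z1 => p z1 * sumM M (fun z2 => p z2 * dv z2 ^+ 2)
   + p z1 * dw z1 ^+ 2 - 2 * (p z1 * dw z1) * sumM M (fun z2 => p z2 * dv z2))).
  apply: eq_sumM => z1 _; rewrite [p z1 * dw z1 ^+ 2]avg -!sumMZ -sumMD -sumMB.
  by apply: eq_sumM => z2 _; rewrite /indep_pair; ring.
rewrite v0 v2 sumMB sumMD w2 sumMZr p1 mul1r sumMZr mulr0 subr0; ring.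
Qed.

(** Away from meetings the variance of the step matches the loss of remaining time; by the heat
    equation the second-order terms cancel and O(r^-3) is left. At a meeting the variance is that of
    [pair_mean], only O(r^-2) is gained, and the collision count will pay for it. *)
Lemma heat_step_bound (eps : R) : 0 < eps -> exists2 C : R, 0 <= C &
  forall (r : R) T K w v k x y, 1 <= r -> (k < K)%N ->
   `|mean_step2 M T P om w v k (heat_dist K w v eps r k.+1) x y - heat_dist K w v eps r k x y| <=
   C * (r ^- 3 + (if (w.1 <= k)%N && (v.1 <= k)%N then (x == y)%:R else 0) / r ^+ 2).
Proof.
move=> e0; set B : R := 2 * (M%:R + `|V|).
have B0 : 0 <= B by rewrite mulr_ge0// addr_ge0.
have s20 : 0 <= sigma2 by exact: sigmaa2_ge0 valid_om.
have se0 : 0 < Num.sqrt eps by rewrite sqrtr_gt0.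
pose C1 := 2 / eps * B ^+ 3 + (eps * Num.sqrt eps)^-1 * (4 * sigma2 ^+ 2).
pose C2 := 2 / eps * B ^+ 3 + B ^+ 2 * (Num.sqrt eps)^-1 + (Num.sqrt eps)^-1 * (2 * sigma2).
have t10 : 0 <= 2 / eps * B ^+ 3 by rewrite mulr_ge0 ?exprn_ge0// divr_ge0// ltW.
have C10 : 0 <= C1.
  by rewrite addr_ge0// mulr_ge0 ?mulr_ge0 ?sqr_ge0// invr_ge0 mulr_ge0// ltW.
have C20 : 0 <= C2.
  by rewrite !addr_ge0// mulr_ge0 ?sqr_ge0 ?mulr_ge0 ?invr_ge0// ltW.
exists (C1 + C2); first exact: addr_ge0.
move=> r T K w v k x y r1 kK.
have r0 : 0 < r by exact: lt_le_trans r1.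
have r20 : 0 < r ^+ 2 by rewrite exprn_gt0.
have r3 : 0 <= r ^- 3 by rewrite invr_ge0 exprn_ge0// ltW.
have r43 : (r ^+ 4)^-1 <= r ^- 3.
  by rewrite lef_pV2 ?posrE ?exprn_gt0// [leRHS]exprS ler_peMl// exprn_ge0// ltW.
have r32 : r ^- 3 <= (r ^+ 2)^-1.
  by rewrite lef_pV2 ?posrE ?exprn_gt0// [leRHS]exprS ler_peMl// exprn_ge0// ltW.
set t1 := eps + sigma2 / r ^+ 2 * ((remaining K w k.+1)%:R + (remaining K v k.+1)%:R).
have et1 : eps <= t1 by rewrite lerDl mulr_ge0 ?addr_ge0// divr_ge0// ltW.
set a := ((y - x)%:~R + V * ((remaining K v k)%:R - (remaining K w k)%:R)) / r.
set bw : R := (w.1 <= k)%N%:R; set bv : R := (v.1 <= k)%N%:R.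
have bw01 : 0 <= bw <= 1 by rewrite /bw; case: (w.1 <= k)%N; rewrite ?lexx ?ler01.
have bv01 : 0 <= bv <= 1 by rewrite /bv; case: (v.1 <= k)%N; rewrite ?lexx ?ler01.
pose dt := sigma2 / r ^+ 2 * (bw + bv).
have dt0 : 0 <= dt.
  have sr0 : 0 <= sigma2 / r ^+ 2 by rewrite divr_ge0// ltW.
  by apply: mulr_ge0 => //; lra.
have dtle : dt <= 2 * sigma2 / r ^+ 2.
  have sr0 : 0 <= sigma2 / r ^+ 2 by rewrite divr_ge0// ltW.
  rewrite /dt [leRHS](_ : _ = sigma2 / r ^+ 2 * 2); last by ring.
  by apply: ler_wpM2l => //; lra.
have Uk : heat_dist K w v eps r k x y = heat_abs (t1 + dt) a.
  rewrite /heat_dist; congr heat_abs; rewrite /t1 /dt (remaining_step w kK) (remaining_step v kK) -/bw -/bv; ring.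
rewrite Uk.
pose dev (u : nat * int) (z : int) : R := if (u.1 <= k)%N then z%:~R - V else 0.
have devB u z : in_range M z -> `|dev u z| <= M%:R + `|V|.
  rewrite /dev /in_range; case: (u.1 <= k)%N => zM; last by rewrite normr0 addr_ge0.
  apply: le_trans (ler_normB _ _) _; rewrite lerD2r -intr_norm pmulrn ler_int.
  by move: zM; clear; lia.
have devs u : sumM M (fun z => p z * dev u z) = 0 /\
    sumM M (fun z => p z * dev u z ^+ 2) = (u.1 <= k)%N%:R * sigma2 by exact: dev_sums.
have free : pair_sum (indep_pair p) (fun z1 z2 => dev v z2 - dev w z1) = 0 /\
    pair_sum (indep_pair p) (fun z1 z2 => (dev v z2 - dev w z1) ^+ 2) = (bw + bv) * sigma2.
  have [w1 w2] := devs w; have [v1 v2] := devs v.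
  exact: dev_pair_sums.
have kp : pair_law M (indep_pair p).
  by apply: indep_pair_law => [j|]; [exact: pbar_ge0 valid_om j|exact: sum_pbar].
have Br3 : (B / r) ^+ 3 = B ^+ 3 * r ^- 3 by rewrite expr_div_n.
have [|coll] := boolP [&& (w.1 <= k)%N, (v.1 <= k)%N & x == y]; last first.
  rewrite (mean_step2_free T measurable_om valid_om independent_om identical_om)//.
  rewrite stage_step2_pair_sum.
  rewrite (eq_pair_sum _ (fun z1 z2 _ _ => heat_dist_step w v eps r x y z1 z2 kK)).
  apply: (@le_trans _ _ (C1 * r ^- 3)); last first.
    apply: (@le_trans _ _ ((C1 + C2) * r ^- 3)).
      by rewrite ler_wpM2r// lerDl.
    apply: ler_wpM2l; first exact: addr_ge0.
    rewrite lerDl; case: ifP => _; last by rewrite mul0r.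
    by rewrite divr_ge0// ltW.
  have dB z1 z2 : in_range M z1 -> in_range M z2 -> `|dev v z2 - dev w z1| <= B.
    move=> z1M z2M; apply: le_trans (ler_normB _ _) _.
    by have := devB v z2 z2M; have := devB w z1 z1M; rewrite /B; lra.
  have h1 := heat_pair_sum a kp e0 et1 r0 dB free.1.
  rewrite free.2 in h1.
  have h2 := heat_abs_time_step a e0 et1 dt0.
  have dts : dt ^+ 2 <= 4 * sigma2 ^+ 2 * r ^- 3.
    apply: (@le_trans _ _ ((2 * sigma2 / r ^+ 2) ^+ 2)).
      by apply: lerXn2r; rewrite ?nnegrE// mulr_ge0 ?mulr_ge0// invr_ge0 ltW.
    rewrite expr_div_n exprMn -exprM; rewrite (_ : 2 ^+ 2 = 4 :> R); last by ring.
    by apply: ler_wpM2l => //; rewrite mulr_ge0// sqr_ge0.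
  have h3 : (eps * Num.sqrt eps)^-1 * dt ^+ 2 <= (eps * Num.sqrt eps)^-1 * (4 * sigma2 ^+ 2) * r ^- 3.
    rewrite -mulrA ler_wpM2l// invr_ge0 mulr_ge0// ltW//.
  (* The cancellation: the variance of the rescaled step equals the time step [dt]. *)
  have e12 : (bw + bv) * sigma2 / r ^+ 2 * heat t1 a = dt * heat t1 a.
    by congr (_ * _); rewrite /dt; ring.
  rewrite e12 in h1.
  rewrite -/t1 -/a; set S := pair_sum _ _ in h1 *.
  have -> : S - heat_abs (t1 + dt) a = (S - heat_abs t1 a - dt * heat t1 a)
      - (heat_abs (t1 + dt) a - heat_abs t1 a - dt * heat t1 a) by ring.
  apply: le_trans (ler_normB _ _) _; rewrite /C1 mulrDl; apply: lerD.
    by rewrite -mulrA -Br3.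
  exact: le_trans h2 h3.
move=> /and3P[wk vk /eqP xy]; rewrite -xy wk vk eqxx /= mul1r.
rewrite (mean_step2_collide T measurable_om valid_om independent_om identical_om)//.
have eS : sumM M (fun z1 => sumM M (fun z2 => q z1 z2 * heat_dist K w v eps r k.+1 (x + z1) (x + z2))) =
   pair_sum q (fun z1 z2 => heat_abs t1 (a + (z2 - z1)%:~R / r)).
  rewrite -[LHS]/(pair_sum q (fun z1 z2 => heat_dist K w v eps r k.+1 (x + z1) (x + z2))).
  apply: eq_pair_sum => z1 z2 _ _; have := heat_dist_step w v eps r x x z1 z2 kK.
  rewrite wk vk => ->; congr heat_abs; rewrite /a -xy; congr (_ + _ / _).
  by rewrite intrB; ring.
rewrite eS.
have kq : pair_law M q := pair_mean_law P measurable_om valid_om.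
have dB z1 z2 : in_range M z1 -> in_range M z2 -> `|(z2 - z1)%:~R| <= B :> R.
  move=> z1M z2M; apply: (@le_trans _ _ (2 * M%:R)).
    rewrite -intr_norm -natrM pmulrn ler_int.
    by move: z1M z2M; clear; rewrite /in_range; lia.
  by rewrite ler_wpM2l// lerDl.
have d0 : pair_sum q (fun z1 z2 => (z2 - z1)%:~R) = 0.
  have : pair_sum q (fun z1 z2 => (z2 - z1)%:~R) = - pair_sum q (fun z1 z2 => (z2 - z1)%:~R).
    rewrite -[RHS]mulN1r -pair_sumZ /pair_sum sumM_exchange; apply: eq_sumM => z1 _.
    by apply: eq_sumM => z2 _; rewrite pair_meanC mulN1r -intrN opprB.
  lra.
have h1 := heat_pair_sum a kq e0 et1 r0 dB d0.
have h2 := heat_abs_time_lipschitz a e0 et1 dt0.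
set S := pair_sum q _ in h1 *; set m2 := pair_sum q _ in h1.
have m2B : `|m2| <= B ^+ 2.
  apply: (normr_pair_sum_le kq) => z1 z2 z1M z2M.
  by rewrite normrX; apply: lerXn2r; rewrite ?nnegrE//; exact: dB.
have hl : heat t1 a <= (Num.sqrt eps)^-1 by exact: heat_le.
have h4 : `|m2 / r ^+ 2 * heat t1 a| <= B ^+ 2 * (Num.sqrt eps)^-1 * (r ^+ 2)^-1.
  rewrite normrM normrM (ger0_norm (heat_ge0 _ _)) normfV (gtr0_norm r20).
  rewrite mulrAC; apply: ler_wpM2r; first by rewrite invr_ge0 ltW.
  by apply: ler_pM => //; exact: heat_ge0.
have h5 : (Num.sqrt eps)^-1 * dt <= (Num.sqrt eps)^-1 * (2 * sigma2) * (r ^+ 2)^-1.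
  by rewrite -[leRHS]mulrA ler_wpM2l// invr_ge0 ltW.
have h6 : 2 / eps * (B / r) ^+ 3 <= 2 / eps * B ^+ 3 * (r ^+ 2)^-1.
  by rewrite Br3 mulrA ler_wpM2l.
have -> : S - heat_abs (t1 + dt) a = (S - heat_abs t1 a - m2 / r ^+ 2 * heat t1 a)
   + m2 / r ^+ 2 * heat t1 a - (heat_abs (t1 + dt) a - heat_abs t1 a) by ring.
apply: (@le_trans _ _ (C2 * (r ^+ 2)^-1)); last first.
  apply: (@le_trans _ _ ((C1 + C2) * (r ^+ 2)^-1)).
    by apply: ler_wpM2r; [by rewrite invr_ge0 ltW|rewrite lerDr].
  by apply: ler_wpM2l; [exact: addr_ge0|rewrite lerDr].
apply: le_trans (ler_normB _ _) _; rewrite /C2 mulrDl; apply: lerD; last exact: le_trans h2 h5.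
apply: le_trans (ler_normD _ _) _; rewrite mulrDl; apply: lerD => //.
exact: le_trans h1 h6.
Qed.

End HeatApproximation.

(** * Approximation of the collision count *)

Section OccupationLimit.
Context {R : realType} (M : nat).
Context {d : measure_display} {Omega : measurableType d}.
Variables (P : probability Omega R) (om : Omega -> @env R).
Hypothesis measurable_om : forall x tau j, measurable_fun setT (fun w => om w x tau j).
Hypothesis valid_om : forall w, valid_env M (om w).
Hypothesis independent_om : sites_independent P om M.
Hypothesis identical_om : sites_identically_distributed P om M.
Hypothesis aperiodic_om : ~ (exists h x : int, 1 < h /\
  sumM M (fun j => if (h %| (j - x))%Z then pbar P om j else 0) = 1).
Hypothesis random_om : (0 < P [set w | forall j : int, (om w 0 0 j < 1)%R])%E.
Implicit Types (e : @env R) (f : int -> R) (F : int -> int -> R) (w v : nat * int).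

Local Notation Ev := (Ev P om).
Local Notation p := (pbar P om).
Local Notation q := (pair_mean P om).
Local Notation nice := (@nice R M).
Local Notation valid_env := (@valid_env R M).
Local Notation mean_env := (mean_env P om).
Local Notation Q := (fejer_avg M (indep_pair p)).
Local Notation pot := (potential M p).
Local Notation pot2 := (pair_potential M P om).
Local Notation sigma2 := (sigmaa2 P om M).
Local Notation V := (Vdrift P om M).
Local Notation centre := (centre M P om).
Local Notation heat_dist := (heat_dist M P om).

(** The value of [heat_dist] at stage 0, where both walks are still at their starting points and the
    environment does not enter. *)
Definition spread w v K (eps s : R) : R :=
  heat_abs (eps + sigma2 / (s ^+ 2) ^+ 2 * ((steps w K)%:R + (steps v K)%:R))
    ((centre v K - centre w K) / s ^+ 2).

(** With r = s^2 and K = O(s^4) the drift errors add up to s^4 s^-6 plus s^-4 times O(s^2)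
    collisions, i.e. O(s^-2). The noise has oscillation O(s^-2), hence size O(1/s). *)
Lemma heat_approximation (A eps : R) : 0 <= A -> 0 < eps -> exists2 C : R, 0 <= C &
  forall (s : R) T K w v, 1 <= s -> K%:R <= A * s ^+ 4 ->
    `|centre v K - centre w K| <= A * s ^+ 2 ->
    Ev (fun e => `|law2 M T e w v K (fun x y => heat_abs eps ((y - x)%:~R / s ^+ 2))
      - spread w v K eps s|) <= C / s.
Proof.
move=> A0 e0.
have [C1 C10 hC1] := heat_step_bound measurable_om valid_om independent_om identical_om e0.
have [C2 C20 hC2] := occupation_bound measurable_om valid_om independent_om identical_om
  aperiodic_om random_om A0.
have [C3 C30 hC3] := noise_bound measurable_om valid_om independent_om identical_om
  aperiodic_om random_om A0.
exists (C1 * (A + C2) + 2 * M%:R * C3).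
  by rewrite addr_ge0 ?mulr_ge0 ?addr_ge0.
move=> s T K w v s1 KA cA.
have s0 : 0 < s by exact: lt_le_trans s1.
have r1 : 1 <= s ^+ 2 by rewrite exprn_ege1.
have r0 : 0 < s ^+ 2 by exact: lt_le_trans r1.
pose f := heat_dist K w v eps (s ^+ 2).
have osc : forall k x y z1 z2, in_range M z1 -> in_range M z2 ->
    `|f k (x + z1) (y + z2) - f k x y| <= 2 * M%:R / s ^+ 2.
  by move=> k x y z1 z2; exact: heat_dist_osc.
have fK : f K = fun x y => heat_abs eps ((y - x)%:~R / s ^+ 2).
  apply: funext => x; apply: funext => y; rewrite /f /heat_dist /remaining.
  have z (u : nat * int) : (K - maxn K u.1 = 0)%N by clear; lia.
  by rewrite !z addr0 mulr0 addr0 subr0 mulr0 addr0.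
have f0 e : law2 M T e w v 0 (f 0%N) = spread w v K eps s.
  rewrite /law2 /= /f /heat_dist /spread /remaining !max0n /centre /steps.
  by congr heat_abs; rewrite intrB; congr (_ / _); ring.
rewrite -fK.
pose bias k e := law2 M T e w v k (fun x y =>
      mean_step2 M T P om w v k (f k.+1) x y - f k x y).
pose noise e := \sum_(0 <= k < K) law2 M T e w v k (step_noise M P om T w v f k e).
have nnoise : nice noise by exact: nice_step_noise_sum.
have nbias k : nice (bias k) by exact: nice_law2_cst.
have nc k : nice (collision M T w v k) by exact: nice_collision.
pose maj e := \sum_(0 <= k < K) (C1 * ((s ^+ 2) ^- 3 + ((s ^+ 2) ^+ 2)^-1 * collision M T w v k e)) + `|noise e|.
have nmaj k : nice (fun e => C1 * ((s ^+ 2) ^- 3 + ((s ^+ 2) ^+ 2)^-1 * collision M T w v k e)).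
  by apply: niceZ; apply: niceD; [exact: nice_cst|exact: niceZ].
have nmaj' : nice (fun e => \sum_(0 <= k < K) (C1 * ((s ^+ 2) ^- 3 + ((s ^+ 2) ^+ 2)^-1 * collision M T w v k e))).
  exact: nice_sum.
have biasle k e : valid_env e -> (k < K)%N ->
    `|bias k e| <= C1 * ((s ^+ 2) ^- 3 + ((s ^+ 2) ^+ 2)^-1 * collision M T w v k e).
  move=> ve kK; apply: le_trans (normr_law2 T w v k _ ve) _.
  have -> : C1 * ((s ^+ 2) ^- 3 + ((s ^+ 2) ^+ 2)^-1 * collision M T w v k e) =
    law2 M T e w v k (fun x y => C1 * ((s ^+ 2) ^- 3 +
      ((s ^+ 2) ^+ 2)^-1 * (if (w.1 <= k)%N && (v.1 <= k)%N then (x == y)%:R else 0))).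
    rewrite law2Z// law2D// law2_cst// law2Z// /collision; case: (_ && _) => //.
    by rewrite law2_cst.
  apply: le_law2 => // x y; rewrite [X in C1 * (_ + X)]mulrC; exact: hC1.
apply: (@le_trans _ _ (Ev maj)).
  apply: (le_Ev P measurable_om valid_om).
  - by apply: nice_norm; apply: niceB; [exact: nice_law2_cst|exact: nice_cst].
  - by apply: niceD => //; exact: nice_norm.
  move=> e ve; rewrite -(f0 e) (law2_decomposition P om T w v f ve (leq0n K)).
  apply: le_trans (ler_normD _ _) _; rewrite lerD2r.
  apply: le_trans (ler_norm_sum _ _ _) _.
  rewrite big_nat_cond [leRHS]big_nat_cond; apply: ler_sum => k /andP[/andP[_ kK] _].
  exact: biasle.
rewrite (EvD P measurable_om valid_om nmaj' (nice_norm nnoise)) (Ev_sum P measurable_om valid_om)//.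
have si0 : 0 <= s^-1 by rewrite invr_ge0 ltW.
have s2 : s ^- 2 <= s^-1.
  by rewrite lef_pV2 ?posrE// expr2 ler_peMr// ltW.
rewrite mulrDl; apply: lerD; last first.
  have h := hC3 s _ T 0%N K w v f s1 KA cA _ osc; apply: le_trans (h _) _.
    by rewrite divr_ge0 ?mulr_ge0// ltW.
  rewrite le_eqVlt; apply/orP; left; apply/eqP; field; by rewrite gt_eqF.
have E k : Ev (fun e => C1 * ((s ^+ 2) ^- 3 + ((s ^+ 2) ^+ 2)^-1 * collision M T w v k e)) =
    C1 * ((s ^+ 2) ^- 3 + ((s ^+ 2) ^+ 2)^-1 * Ev (collision M T w v k)).
  rewrite (EvZ P measurable_om valid_om _ (niceD (nice_cst M _) (niceZ _ (nc k)))).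
  rewrite (EvD P measurable_om valid_om (nice_cst M _) (niceZ _ (nc k))) Ev_cst.
  by rewrite (EvZ P measurable_om valid_om _ (nc k)).
rewrite (eq_bigr _ (fun k _ => E k)) -mulr_sumr -mulrA; apply: ler_wpM2l => //.
rewrite big_split /= -mulr_sumr sumr_const_nat subn0 mulrDl; apply: lerD.
  rewrite -mulr_natr; apply: (@le_trans _ _ ((s ^+ 2) ^- 3 * (A * s ^+ 4))).
    by apply: ler_wpM2l => //; rewrite invr_ge0 exprn_ge0// ltW.
  have -> : (s ^+ 2) ^- 3 * (A * s ^+ 4) = A * s ^- 2 by field; rewrite gt_eqF.
  exact: ler_wpM2l.
apply: (@le_trans _ _ (((s ^+ 2) ^+ 2)^-1 * (C2 * s ^+ 2))).
  apply: ler_wpM2l; first by rewrite invr_ge0 exprn_ge0// ltW.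
  exact: hC2.
have -> : ((s ^+ 2) ^+ 2)^-1 * (C2 * s ^+ 2) = C2 * s ^- 2 by field; rewrite gt_eqF.
exact: ler_wpM2l.
Qed.

(** The potential is |z|/Q(0) up to a constant, and after rescaling the distance is within 2
    sqrt(eps) of its smoothing. The factor of sqrt(eps) is chosen before [eps], which allows [eps]
    to vanish last. *)
Lemma potential_approximation : exists2 C : R, 0 <= C &
  forall (A eps : R), 0 <= A -> 0 < eps -> exists2 C' : R, 0 <= C' &
  forall (s : R) T K w v, 1 <= s -> K%:R <= A * s ^+ 4 ->
    `|centre v K - centre w K| <= A * s ^+ 2 ->
    Ev (fun e => `|law2 M T e w v K pot2 / s ^+ 2 - spread w v K eps s / Q 0|)
     <= C * Num.sqrt eps + C' / s.
Proof.
have p_ge0 j : 0 <= p j by exact: pbar_ge0 valid_om j.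
have p_sum : sumM M p = 1 by exact: sum_pbar.
have Q0 : 0 < Q 0 by exact: fejer_avg_gt0.
have Qi : 0 <= (Q 0)^-1 by rewrite invr_ge0 ltW.
have [Cp [Cp0 potC _]] := pot_bounds measurable_om valid_om aperiodic_om random_om.
exists (2 / Q 0); first by rewrite mulr_ge0.
move=> A eps A0 e0; have [C1 C10 hC1] := heat_approximation A0 e0.
exists (Cp + C1 / Q 0); first by rewrite addr_ge0// mulr_ge0.
move=> s T K w v s1 KA cA.
have s0 : 0 < s by exact: lt_le_trans s1.
have r0 : 0 < s ^+ 2 by rewrite exprn_gt0.
have si : 0 <= s^-1 by rewrite invr_ge0 ltW.
have ri : 0 <= (s ^+ 2)^-1 by rewrite invr_ge0 ltW.
pose F (x y : int) : R := heat_abs eps ((y - x)%:~R / s ^+ 2).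
pose D e := law2 M T e w v K F - spread w v K eps s.
have nD : nice D by apply: niceB; [exact: nice_law2_cst|exact: nice_cst].
pose B : R := Cp / s ^+ 2 + 2 * Num.sqrt eps / Q 0.
apply: (@le_trans _ _ (Ev (fun e => B + (Q 0)^-1 * `|D e|))).
  apply: (le_Ev P measurable_om valid_om).
  - apply: nice_norm; apply: niceB; last exact: nice_cst.
    by apply: niceM; [exact: nice_law2_cst|exact: nice_cst].
  - by apply: niceD; [exact: nice_cst|apply: niceZ; exact: nice_norm].
  move=> e ve; have -> : law2 M T e w v K pot2 / s ^+ 2 - spread w v K eps s / Q 0 =
    law2 M T e w v K (fun x y => (s ^+ 2)^-1 * pot2 x y - (Q 0)^-1 * F x y) + (Q 0)^-1 * D e.
    by rewrite law2B// (law2Z T w v K _ pot2 ve) (law2Z T w v K _ F ve) /D; ring.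
  apply: le_trans (ler_normD _ _) _; apply: lerD; last by rewrite normrM (ger0_norm Qi).
  apply: normr_law2_le => // x y; rewrite /pair_potential /F; set z := y - x.
  have -> : (s ^+ 2)^-1 * pot z - (Q 0)^-1 * heat_abs eps (z%:~R / s ^+ 2) =
    (s ^+ 2)^-1 * (pot z - `|z%:~R| / Q 0)
     - (Q 0)^-1 * (heat_abs eps (z%:~R / s ^+ 2) - `|z%:~R / s ^+ 2|).
    by rewrite normrM normfV (gtr0_norm r0); field; rewrite !gt_eqF.
  apply: le_trans (ler_normB _ _) _; apply: lerD.
    by rewrite normrM (ger0_norm ri) mulrC; apply: ler_wpM2r.
  by rewrite normrM (ger0_norm Qi) mulrC; apply: ler_wpM2r => //; exact: heat_abs_dist.
rewrite (EvD P measurable_om valid_om (nice_cst M _) (niceZ _ (nice_norm nD))) Ev_cst.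
rewrite (EvZ P measurable_om valid_om _ (nice_norm nD)) /B.
have h := hC1 s T K w v s1 KA cA.
have h2 : (Q 0)^-1 * Ev (fun e => `|D e|) <= (Q 0)^-1 * (C1 / s) by exact: ler_wpM2l.
have h3 : Cp / s ^+ 2 <= Cp / s.
  by apply: ler_wpM2l => //; rewrite lef_pV2 ?posrE// expr2 ler_peMr// ltW.
have -> : 2 / Q 0 * Num.sqrt eps + (Cp + C1 / Q 0) / s =
  (Cp / s + 2 * Num.sqrt eps / Q 0) + (Q 0)^-1 * (C1 / s) by ring.
by apply: lerD => //; rewrite lerD2r.
Qed.

(** The occupation identity divided by s^2, with both potentials replaced by [spread]. The stage [K]
    and the stage where the later walk starts will become the two end points of the integral in
    [Gamma_q]. *)
Lemma occupation_limit : exists2 C : R, 0 <= C &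
  forall (A eps : R), 0 <= A -> 0 < eps -> exists2 C' : R, 0 <= C' &
  forall (s : R) T K w v, 1 <= s -> (maxn w.1 v.1 <= K)%N -> K%:R <= A * s ^+ 4 ->
    `|centre v K - centre w K| <= A * s ^+ 2 ->
    `|centre v (maxn w.1 v.1) - centre w (maxn w.1 v.1)| <= A * s ^+ 2 ->
    Ev (fun e => `|beta P om M * (\sum_(0 <= k < K) collision M T w v k e) / s ^+ 2
       - (spread w v K eps s - spread w v (maxn w.1 v.1) eps s) / Q 0|)
     <= C * Num.sqrt eps + C' / s.
Proof.
have [C0 C00 hC0] := potential_approximation.
exists (C0 + C0); first exact: addr_ge0.
move=> A eps A0 e0; have [C1 C10 hC1] := hC0 A eps A0 e0.
have [C3 C30 hC3] := noise_bound measurable_om valid_om independent_om identical_om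
  aperiodic_om random_om A0.
have [Cp [Cp0 _ osc]] := pot_bounds measurable_om valid_om aperiodic_om random_om.
exists (C1 + C1 + Cp * C3); first by rewrite !addr_ge0// mulr_ge0.
move=> s T K w v s1 lK KA cA lA; set l := maxn w.1 v.1 in lK lA *.
have s0 : 0 < s by exact: lt_le_trans s1.
have r0 : 0 < s ^+ 2 by rewrite exprn_gt0.
have ri : 0 <= (s ^+ 2)^-1 by rewrite invr_ge0 ltW.
have lA' : l%:R <= A * s ^+ 4 by apply: le_trans KA; rewrite ler_nat.
pose D k e := law2 M T e w v k pot2 / s ^+ 2 - spread w v k eps s / Q 0.
have nD k : nice (D k).
  apply: niceB; last exact: nice_cst.
  by apply: niceM; [exact: nice_law2_cst|exact: nice_cst].
pose N e := \sum_(l <= k < K) law2 M T e w v k (step_noise M P om T w v (fun=> pot2) k e).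
have nN : nice N by exact: nice_step_noise_sum.
have nc k : nice (collision M T w v k) by exact: nice_collision.
apply: (@le_trans _ _ (Ev (fun e => (`|D K e| + `|D l e|) + (s ^+ 2)^-1 * `|N e|))).
  apply: (le_Ev P measurable_om valid_om).
  - apply: nice_norm; apply: niceB; last exact: nice_cst.
    by apply: niceM; [apply: niceZ; exact: nice_sum|exact: nice_cst].
  - by apply: niceD; [apply: niceD; exact: nice_norm|apply: niceZ; exact: nice_norm].
  move=> e ve; rewrite (occupation_identity measurable_om valid_om independent_om identical_om
    aperiodic_om T ve lK) -/l -/(N e).
  have -> : (law2 M T e w v K pot2 - law2 M T e w v l pot2 - N e) / s ^+ 2 -
    (spread w v K eps s - spread w v l eps s) / Q 0 = (D K e - D l e) - (s ^+ 2)^-1 * N e.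
    by rewrite /D; ring.
  apply: le_trans (ler_normB _ _) _; rewrite normrM (ger0_norm ri) lerD2r.
  exact: ler_normB.
rewrite (EvD P measurable_om valid_om (niceD (nice_norm (nD K)) (nice_norm (nD l)))
  (niceZ _ (nice_norm nN))).
rewrite (EvD P measurable_om valid_om (nice_norm (nD K)) (nice_norm (nD l))).
rewrite (EvZ P measurable_om valid_om _ (nice_norm nN)).
have h1 := hC1 s T K w v s1 KA cA; have h2 := hC1 s T l w v s1 lA' lA.
have h3 := hC3 s Cp T l K w v (fun=> pot2) s1 KA cA Cp0 (fun=> osc).
have h4 : (s ^+ 2)^-1 * Ev (fun e => `|N e|) <= Cp * C3 / s.
  apply: (@le_trans _ _ ((s ^+ 2)^-1 * (Cp * (C3 * s)))); first exact: ler_wpM2l.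
  rewrite le_eqVlt; apply/orP; left; apply/eqP; field; by rewrite gt_eqF.
have -> : (C0 + C0) * Num.sqrt eps + (C1 + C1 + Cp * C3) / s =
  (C0 * Num.sqrt eps + C1 / s) + (C0 * Num.sqrt eps + C1 / s) + Cp * C3 / s by ring.
exact (lerD (lerD h1 h2) h4).
Qed.

End OccupationLimit.

(** * A central limit theorem for bounded martingale differences *)

Section ExpBounds.
Context {R : realType}.
Implicit Types (s x y eta delta : R).

Lemma cos_taylor s x : `|cos (s + x) - cos s + x * sin s + x ^+ 2 / 2 * cos s| <= `|x| ^+ 3.
Proof.
have d1 (u : R) : is_derive u 1 (@cos R) (- sin u) by exact: is_derive_cos.
have d2 (u : R) : is_derive u 1 (fun u => - sin u : R) (- cos u).
  by have ds := is_derive_sin u; apply: is_derive_eq.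
have d3 (u : R) : is_derive u 1 (fun u => - cos u : R) (sin u).
  by have dc := is_derive_cos u; apply: is_derive_eq; rewrite opprK.
have sin1 (u : R) : `|sin u| <= 1 :> R by exact: sin_max.
have := @taylor2 R (@cos R) (fun u => - sin u) (fun u => - cos u) 1 ler01 d1 d2
  (lipschitz_derive d3 sin1) s x.
by rewrite mul1r; congr (`|_| <= _); ring.
Qed.

Lemma expR_onem_bound y : 0 <= y -> y <= 1 -> 1 - y ^+ 2 <= expR y * (1 - y) <= 1.
Proof.
move=> y0 y1; apply/andP; split.
  apply: (@le_trans _ _ ((1 + y) * (1 - y))); last first.
    by apply: ler_wpM2r; [rewrite subr_ge0|exact: expR_ge1Dx].
  rewrite le_eqVlt; apply/orP; left; apply/eqP; ring.
have := expR_ge1Dx (- y); have e0 := expR_gt0 y => h.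
by rewrite -ler_pdivlMl// mulr1 -expRN.
Qed.

Lemma expR_half_le2 y : 0 <= y -> y <= 1 / 2 -> expR y <= 2.
Proof.
move=> y0 y1; have y2 : y <= 1 by apply: le_trans y1 _; lra.
have /andP[_ h] := expR_onem_bound y0 y2.
have e0 := expR_gt0 y; have : expR y * (1 / 2) <= 1.
  apply: le_trans h; apply: ler_wpM2l; [exact: ltW|lra].
lra.
Qed.

(** exp(eta/2) compensates the loss (1 - eta/2) cos s of the mean cosine over a centred step of
    variance [eta]. Both leftover errors are O(delta eta), so they add up to O(delta) times the
    total variance. *)
Lemma expR_cos_step eta delta s m : 0 <= eta -> eta <= delta ^+ 2 -> 0 <= delta -> delta <= 1 ->
  `|m - cos s + eta / 2 * cos s| <= delta * eta ->
  `|expR (eta / 2) * m - cos s| <= 3 * delta * eta.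
Proof.
move=> eta0 etad d0 d1 hm; set y := eta / 2.
have ed : eta <= delta by apply: le_trans etad _; rewrite expr2 ler_piMl.
have y0 : 0 <= y by rewrite divr_ge0.
have y1 : y <= 1 / 2 by rewrite ler_pM2r//; exact: le_trans d1.
have e2 := expR_half_le2 y0 y1.
have /andP[l u] : 1 - y ^+ 2 <= expR y * (1 - y) <= 1 by apply: expR_onem_bound => //; lra.
have -> : expR y * m - cos s = expR y * (m - cos s + y * cos s) + (expR y * (1 - y) - 1) * cos s.
  by ring.
apply: le_trans (ler_normD _ _) _.
have -> : 3 * delta * eta = 2 * (delta * eta) + delta * eta * 1 by ring.
apply: lerD.
  rewrite normrM (ger0_norm (expR_ge0 _)); apply: ler_pM => //; exact: expR_ge0.
rewrite normrM; apply: ler_pM => //; last exact: cos_max.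
have y2 : y ^+ 2 <= delta * eta.
  apply: (@le_trans _ _ (eta ^+ 2)).
    rewrite /y expr_div_n ler_pdivrMr ?exprn_gt0//; have := sqr_ge0 eta; lra.
  by rewrite expr2; apply: ler_wpM2r.
by rewrite ler_norml; lra.
Qed.
End ExpBounds.

Section MartingaleCLT.
Context {R : realType} (M T K : nat).
Context {d : measure_display} {Omega : measurableType d}.
Variables (P : probability Omega R) (om : Omega -> @env R).
Hypothesis measurable_om : forall x tau j, measurable_fun setT (fun w => om w x tau j).
Hypothesis valid_om : forall w, valid_env M (om w).
Hypothesis independent_om : sites_independent P om M.
Implicit Types (e : @env R).

Local Notation Ev := (Ev P om).
Local Notation nice := (@nice R M).
Local Notation valid_env := (@valid_env R M).
Local Notation resample k := (mix (other_levels T k)).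

Lemma normr_Ev_resample S F b : nice F -> nice b ->
  (forall e, valid_env e -> `|Ev (fun e' => F (mix S e e'))| <= b e) -> `|Ev F| <= Ev b.
Proof.
move=> nF nb Fb; rewrite ler_norml -lerN2 opprK; apply/andP; split; last first.
  apply: (le_Ev_resample measurable_om valid_om independent_om (S := S)) => // e ve.
  exact: le_trans (ler_norm _) (Fb e ve).
rewrite -mulN1r -(EvZ P measurable_om valid_om _ nF).
apply: (le_Ev_resample measurable_om valid_om independent_om (S := S)) => //.
  exact: niceZ.
move=> e ve; rewrite (EvZ P measurable_om valid_om _ (nice_mixr S nF ve)) mulN1r.
by apply: le_trans (ler_norm _) _; rewrite normrN; exact: Fb.
Qed.

Variables (xi eta : nat -> @env R -> R) (delta : R).
Hypothesis nice_xi : forall k, nice (xi k).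
Hypothesis nice_eta : forall k, nice (eta k).
Hypothesis past_eta : forall k l e e', (k <= l)%N -> eta k (resample l e e') = eta k e.
Hypothesis past_xi : forall k l e e', (k < l)%N -> xi k (resample l e e') = xi k e.
Hypothesis centered_xi : forall k e, valid_env e -> Ev (fun e' => xi k (resample k e e')) = 0.
Hypothesis variance_xi : forall k e, valid_env e ->
  Ev (fun e' => xi k (resample k e e') ^+ 2) = eta k e.
Hypothesis bounded_xi : forall k e, valid_env e -> `|xi k e| <= delta.
Hypothesis delta_ge0 : 0 <= delta.
Hypothesis delta_le1 : delta <= 1.

Let var k e : R := \sum_(l < k) eta l e.

Let eta_ge0 k e : valid_env e -> 0 <= eta k e.
Proof.
by move=> ve; rewrite -variance_xi//; apply: (Ev_ge0 P valid_om) => e' _; exact: sqr_ge0.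
Qed.

Let eta_le k e : valid_env e -> eta k e <= delta ^+ 2.
Proof.
move=> ve; rewrite -variance_xi// -[leRHS](Ev_cst P om).
apply: (le_Ev P measurable_om valid_om).
- exact: (nice_mixr _ (niceX 2 (nice_xi k)) ve).
- exact: nice_cst.
move=> e' ve'; rewrite -real_normK ?num_real//; apply: lerXn2r; rewrite ?nnegrE//.
by apply: bounded_xi; exact: valid_mix.
Qed.

Section Truncated.
Variables (c theta : R).
Hypothesis c_ge0 : 0 <= c.

(** Increments are switched off once the accumulated variance would pass [c]. As [eta k] reads only
    levels before [k], the switch is decided before the increment is drawn: the differences stay
    centred, and the variance is surely at most [c]. *)
Let xi' k e : R := if var k.+1 e <= c then xi k e else 0.
Let eta' k e : R := if var k.+1 e <= c then eta k e else 0.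
Let sum' k e : R := \sum_(l < k) xi' l e.
Let var' k e : R := \sum_(l < k) eta' l e.
(** Nearly a martingale, because the exponential undoes the decay of the mean cosine. *)
Let W k e : R := cos (sum' k e + theta) * expR (var' k e / 2).

Let nice_var k : nice (var k).
Proof. exact: nice_sum. Qed.

Let nice_xi' k : nice (xi' k).
Proof. exact: nice_if_le. Qed.

Let nice_eta' k : nice (eta' k).
Proof. exact: nice_if_le. Qed.

Let nice_cos (F : @env R -> R) : nice F -> nice (fun e => cos (F e)).
Proof.
by apply: nice_comp; [exact: continuous_cos|exists 1 => x; exact: cos_max].
Qed.

Let nice_W k : nice (W k).
Proof.
apply: niceM.
  by apply: nice_cos; apply: niceD; [exact: nice_sum|exact: nice_cst].
by apply: nice_expR; apply: niceM; [exact: nice_sum|exact: nice_cst].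
Qed.

Let var'_le k e : valid_env e -> var' k e <= c.
Proof.
move=> ve; elim: k => [|k IHk]; first by rewrite /var' big_ord0.
rewrite /var' big_ord_recr /= -/(var' k e) /eta'; case: ifP => [h|_]; last by rewrite addr0.
apply: le_trans h; rewrite /var big_ord_recr /= lerD2r; apply: ler_sum => l _.
by rewrite /eta'; case: ifP => // _; exact: eta_ge0.
Qed.

Let past_var k l e e' : (k <= l.+1)%N -> var k (resample l e e') = var k e.
Proof.
move=> kl; apply: eq_bigr => i _; apply: past_eta.
by have := leq_trans (ltn_ord i) kl; rewrite ltnS.
Qed.

Let W_step k e : valid_env e ->
  `|Ev (fun e' => W k.+1 (resample k e e') - W k (resample k e e'))|
    <= 3 * delta * expR (c / 2) * eta' k e.
Proof.
move=> ve.
have s' e' : sum' k (resample k e e') = sum' k e.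
  apply: eq_bigr => i _; rewrite /xi' past_var; last exact: leq_trans (ltn_ord i) _.
  by rewrite past_xi.
have v' e' : var' k (resample k e e') = var' k e.
  apply: eq_bigr => i _; rewrite /eta' past_var; last exact: leq_trans (ltn_ord i) _.
  by rewrite past_eta// ltnW.
have W0 e' : W k (resample k e e') = W k e by rewrite /W s' v'.
have W1 e' : W k.+1 (resample k e e') = if var k.+1 e <= c
    then expR (var' k e / 2) * expR (eta k e / 2) * cos (sum' k e + theta + xi k (resample k e e'))
    else W k e.
  rewrite /W /sum' /var' !big_ord_recr /= -/(sum' k _) -/(var' k _) s' v' /xi' /eta' past_var//.
  case: ifP => _; last by rewrite !addr0.
  rewrite past_eta// [(_ + _) / 2]mulrDl expRD [LHS]mulrC addrAC; by [].
have nxi : nice (fun e' => xi k (resample k e e')) by exact: nice_mixr.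
rewrite (@eq_Ev _ M _ _ _ _ valid_om _ (fun e' => (if var k.+1 e <= c
    then expR (var' k e / 2) * expR (eta k e / 2) * cos (sum' k e + theta + xi k (resample k e e'))
    else W k e) - W k e)); last by move=> e' _; rewrite W0 W1.
rewrite /eta'; case: ifP => hc; last first.
  rewrite mulr0 (@eq_Ev _ M _ _ _ _ valid_om _ (fun=> 0)) ?Ev_cst ?normr0// => e' _.
  by rewrite subrr.
set s := sum' k e + theta; set m := Ev (fun e' => cos (s + xi k (resample k e e'))).
have nc : nice (fun e' => cos (s + xi k (resample k e e'))).
  by apply: nice_cos; apply: niceD => //; exact: nice_cst.
rewrite (EvB P measurable_om valid_om (niceZ _ nc) (nice_cst M _)) Ev_cst.
rewrite (EvZ P measurable_om valid_om _ nc) -/m.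
have -> : expR (var' k e / 2) * expR (eta k e / 2) * m - W k e =
    expR (var' k e / 2) * (expR (eta k e / 2) * m - cos s) by rewrite /W -/s; ring.
rewrite normrM (ger0_norm (expR_ge0 _)).
have -> : 3 * delta * expR (c / 2) * eta k e = expR (c / 2) * (3 * delta * eta k e) by ring.
apply: ler_pM; [exact: expR_ge0|exact: normr_ge0| |].
  by rewrite ler_expR; apply: ler_wpM2r => //; exact: var'_le.
apply: expR_cos_step => //; [exact: eta_ge0|exact: eta_le|].
pose x e' := xi k (resample k e e').
have nx2 : nice (fun e' => x e' ^+ 2) by exact: niceX.
pose r e' := cos (s + x e') - cos s + x e' * sin s + x e' ^+ 2 / 2 * cos s.
have nr1 : nice (fun e' => sin s * x e') by exact: niceZ.
have nr2 : nice (fun e' => cos s / 2 * x e' ^+ 2) by exact: niceZ.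
have nr0 : nice (fun e' => cos (s + x e') - cos s) by apply: niceB => //; exact: nice_cst.
have rE : forall e', valid_env e' -> r e' = cos (s + x e') - cos s + sin s * x e' + cos s / 2 * x e' ^+ 2.
  by move=> e' _; rewrite /r; ring.
have nr : nice r.
  rewrite (_ : r = fun e' => cos (s + x e') - cos s + sin s * x e' + cos s / 2 * x e' ^+ 2).
    by apply: niceD => //; exact: niceD.
  by apply: funext => e'; rewrite /r; ring.
have -> : m - cos s + eta k e / 2 * cos s = Ev r.
  rewrite (@eq_Ev _ M _ _ _ _ valid_om _ _ rE).
  rewrite (EvD P measurable_om valid_om (niceD nr0 nr1) nr2) (EvD P measurable_om valid_om nr0 nr1).
  rewrite (EvB P measurable_om valid_om nc (nice_cst M _)) Ev_cst.
  rewrite (EvZ P measurable_om valid_om _ nxi) (EvZ P measurable_om valid_om _ nx2).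
  by rewrite centered_xi// variance_xi// -/m; ring.
apply: le_trans (normr_Ev P measurable_om valid_om nr) _.
rewrite -(variance_xi k ve) -(EvZ P measurable_om valid_om _ nx2).
apply: (le_Ev P measurable_om valid_om); [exact: nice_norm|exact: niceZ|move=> e' ve'].
apply: le_trans (cos_taylor s (x e')) _.
rewrite exprS real_normK ?num_real//; apply: ler_wpM2r; first exact: sqr_ge0.
by apply: bounded_xi; exact: valid_mix.
Qed.

Let W_sum k : `|Ev (W k) - cos theta| <= 3 * delta * expR (c / 2) * Ev (var' k).
Proof.
elim: k => [|k IHk].
  have -> : Ev (W 0) = cos theta.
    rewrite -[RHS](Ev_cst P om); congr Ex; apply: funext => o.
    by rewrite /W /sum' /var' !big_ord0 add0r mul0r expR0 mulr1.
  rewrite subrr normr0 mulr_ge0 ?mulr_ge0 ?expR_ge0//.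
  by apply: (Ev_ge0 P valid_om) => e _; rewrite /var' big_ord0.
have nv : nice (var' k) by exact: nice_sum.
have -> : Ev (var' k.+1) = Ev (var' k) + Ev (eta' k).
  rewrite -(EvD P measurable_om valid_om nv (nice_eta' k)); congr Ex; apply: funext => o.
  by rewrite /var' big_ord_recr.
have -> : Ev (W k.+1) - cos theta = (Ev (W k.+1) - Ev (W k)) + (Ev (W k) - cos theta) by ring.
apply: le_trans (ler_normD _ _) _; rewrite mulrDr addrC; apply: lerD => //.
rewrite -(EvB P measurable_om valid_om (nice_W k.+1) (nice_W k)).
rewrite -(EvZ P measurable_om valid_om _ (nice_eta' k)).
apply: (normr_Ev_resample (S := other_levels T k)).
- by apply: niceB.
- exact: niceZ.
- by move=> e ve; exact: W_step.
Qed.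

(** If the total variance stays below [c], truncation changes nothing and the error is that of
    exp(x) - 1 with x = (var - v)/2. Otherwise the variance differs from [v] by more than 1, as c =
    v + 1, and a crude bound suffices. *)
Let truncation (v : R) e : valid_env e -> 0 <= v -> c = v + 1 ->
  `|cos (\sum_(k < K) xi k e + theta) - expR (- (v / 2)) * W K e|
    <= (1 + expR (c / 2)) * `|var K e - v|.
Proof.
move=> ve v0 cv; have ec := expR_ge0 (c / 2).
have [h|h] := leP (var K e) c.
  have le_var k : (k <= K)%N -> var k e <= c.
    move=> kK; apply: le_trans h.
    rewrite -(subnKC kK) /var big_split_ord /= lerDl.
    by apply: sumr_ge0 => l _; exact: eta_ge0.
  have -> : W K e = cos (\sum_(k < K) xi k e + theta) * expR (var K e / 2).
    congr (cos (_ + _) * expR (_ / _)); apply: eq_bigr => l _.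
      by rewrite /xi' le_var.
    by rewrite /eta' le_var.
  rewrite mulrCA -expRD -{1}[cos _]mulr1 -mulrBr normrM.
  rewrite -[leRHS]mul1r; apply: ler_pM => //; first exact: cos_max.
  pose x := (var K e - v) / 2.
  have -> : - (v / 2) + var K e / 2 = x by rewrite /x; ring.
  have xc : x <= c / 2.
    by rewrite /x; apply: ler_wpM2r => //; apply: le_trans h; rewrite gerBl.
  have ex := expR_ge1Dx x; have emx := expR_ge1Dx (- x).
  have e0 := expR_gt0 x; have emon : expR x <= expR (c / 2) by rewrite ler_expR.
  have x2 : `|x| <= `|var K e - v|.
    rewrite /x normrM [X in _ * X]ger0_norm ?invr_ge0//; have := normr_ge0 (var K e - v); lra.
  apply: (@le_trans _ _ ((1 + expR (c / 2)) * `|x|)); last first.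
    by apply: ler_wpM2l => //; rewrite addr_ge0.
  have [x0|x0] := leP 0 x.
    (* e^x - 1 <= x e^x for x >= 0 *)
    have h1 : expR x * (1 - x) <= 1.
      by rewrite -ler_pdivlMl// mulr1 -expRN.
    rewrite (ger0_norm x0) ler0_norm; last by rewrite subr_le0; apply: le_trans ex; lra.
    have : x * expR x <= x * expR (c / 2) by exact: ler_wpM2l.
    lra.
  rewrite (ltr0_norm x0) ger0_norm; last by rewrite subr_ge0 -expR0 ler_expR ltW.
  have : 0 <= - x * expR (c / 2) by rewrite mulr_ge0// oppr_ge0 ltW.
  lra.
have far : 1 <= `|var K e - v|.
  by rewrite ger0_norm; lra.
apply: (@le_trans _ _ ((1 + expR (c / 2)) * 1)); last first.
  by apply: ler_wpM2l => //; rewrite addr_ge0.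
rewrite mulr1; apply: le_trans (ler_normB _ _) _; apply: lerD; first exact: cos_max.
rewrite normrM (ger0_norm (expR_ge0 _)) -[leRHS]mul1r; apply: ler_pM => //.
- by rewrite -expR0 ler_expR oppr_le0 divr_ge0.
rewrite normrM (ger0_norm (expR_ge0 _)) -[leRHS]mul1r; apply: ler_pM => //.
- exact: cos_max.
- by rewrite ler_expR; apply: ler_wpM2r => //; exact: var'_le.
Qed.

Lemma truncated_clt (v : R) : 0 <= v -> c = v + 1 ->
  `|Ev (fun e => cos (\sum_(k < K) xi k e + theta)) - expR (- (v / 2)) * cos theta|
   <= (1 + expR (c / 2)) * Ev (fun e => `|var K e - v|) + 3 * delta * expR (c / 2) * c.
Proof.
move=> v0 cv.
have nS : nice (fun e => cos (\sum_(k < K) xi k e + theta)).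
  by apply: nice_cos; apply: niceD; [exact: nice_sum|exact: nice_cst].
have nD : nice (fun e => `|var K e - v|).
  by apply: nice_norm; apply: niceB; [exact: nice_var|exact: nice_cst].
have nWv := niceZ (expR (- (v / 2))) (nice_W K).
have -> : Ev (fun e => cos (\sum_(k < K) xi k e + theta)) - expR (- (v / 2)) * cos theta =
  Ev (fun e => cos (\sum_(k < K) xi k e + theta) - expR (- (v / 2)) * W K e) +
  expR (- (v / 2)) * (Ev (W K) - cos theta).
  rewrite (EvB P measurable_om valid_om nS nWv) (EvZ P measurable_om valid_om _ (nice_W K)); ring.
apply: le_trans (ler_normD _ _) _; apply: lerD.
  apply: le_trans (normr_Ev P measurable_om valid_om (niceB nS nWv)) _.
  rewrite -(EvZ P measurable_om valid_om _ nD); apply: (le_Ev P measurable_om valid_om).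
  - by apply: nice_norm; exact: niceB.
  - exact: niceZ.
  - by move=> e ve; exact: truncation.
rewrite normrM (ger0_norm (expR_ge0 _)) -[leRHS]mul1r; apply: ler_pM => //.
- by rewrite -expR0 ler_expR oppr_le0 divr_ge0.
apply: le_trans (W_sum K) _; apply: ler_wpM2l.
  by rewrite mulr_ge0 ?expR_ge0// mulr_ge0.
rewrite -[leRHS](Ev_cst P om); apply: (le_Ev P measurable_om valid_om).
- exact: nice_sum.
- exact: nice_cst.
- by move=> e ve; exact: var'_le.
Qed.
End Truncated.

(** An explicit bound for one row of an array rather than a limit, since the walks, the levels and
    the increments all change with n. *)
Lemma martingale_clt (v theta : R) : 0 <= v ->
  `|Ev (fun e => cos (\sum_(k < K) xi k e + theta)) - expR (- (v / 2)) * cos theta|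
   <= (1 + expR ((v + 1) / 2)) * Ev (fun e => `|\sum_(k < K) eta k e - v|)
      + 3 * delta * expR ((v + 1) / 2) * (v + 1).
Proof. by move=> v0; apply: truncated_clt => //; rewrite addr_ge0. Qed.

Lemma martingale_second_moment :
  Ev (fun e => (\sum_(k < K) xi k e) ^+ 2) = Ev (fun e => \sum_(k < K) eta k e).
Proof.
elim: K => [|k IHk].
  by congr Ex; apply: funext => o; rewrite !big_ord0 expr0n.
pose S e := \sum_(l < k) xi l e.
have nS : nice S by exact: nice_sum.
have nV : nice (fun e => \sum_(l < k) eta l e) by exact: nice_sum.
have -> : Ev (fun e => \sum_(l < k.+1) eta l e) = Ev (fun e => \sum_(l < k) eta l e) + Ev (eta k).
  rewrite -(EvD P measurable_om valid_om nV (nice_eta k)); congr Ex; apply: funext => o.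
  by rewrite big_ord_recr.
rewrite -IHk.
have -> : Ev (fun e => (\sum_(l < k.+1) xi l e) ^+ 2) =
    Ev (fun e => S e ^+ 2 + (2 * (S e * xi k e) + xi k e ^+ 2)).
  by congr Ex; apply: funext => o; rewrite big_ord_recr /= -/(S _); ring.
have nSx : nice (fun e => S e * xi k e) by exact: niceM.
have nx2 : nice (fun e => xi k e ^+ 2) by exact: niceX.
rewrite (EvD P measurable_om valid_om (niceX 2 nS) (niceD (niceZ _ nSx) nx2)).
rewrite (EvD P measurable_om valid_om (niceZ _ nSx) nx2) (EvZ P measurable_om valid_om _ nSx).
congr (_ + _).
have -> : Ev (fun e => S e * xi k e) = 0.
  rewrite -(Ev_cst P om 0).
  apply: (Ev_resample measurable_om valid_om independent_om (S := other_levels T k)) => //.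
    exact: nice_cst.
  move=> e ve; have nxi : nice (fun e' => xi k (resample k e e')) by exact: nice_mixr.
  rewrite (@eq_Ev _ M _ _ _ _ valid_om _ (fun e' => S e * xi k (resample k e e'))).
    by rewrite (EvZ P measurable_om valid_om _ nxi) centered_xi// mulr0.
  by move=> e' _; congr (_ * _); apply: eq_bigr => l _; rewrite past_xi.
rewrite mulr0 add0r.
apply: (Ev_resample measurable_om valid_om independent_om (S := other_levels T k)) => // e ve.
exact: variance_xi.
Qed.

End MartingaleCLT.

(** * Martingale differences of the quenched mean *)

Section WalkMartingale.
Context {R : realType} (M : nat).
Context {d : measure_display} {Omega : measurableType d}.
Variables (P : probability Omega R) (om : Omega -> @env R).
Hypothesis measurable_om : forall x tau j, measurable_fun setT (fun w => om w x tau j).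
Hypothesis valid_om : forall w, valid_env M (om w).
Hypothesis independent_om : sites_independent P om M.
Hypothesis identical_om : sites_identically_distributed P om M.
Implicit Types (e : @env R) (w v : nat * int).

Local Notation Ev := (Ev P om).
Local Notation p := (pbar P om).
Local Notation nice := (@nice R M).
Local Notation valid_env := (@valid_env R M).
Local Notation V := (Vdrift P om M).
Local Notation sigD := (sigmaD2 P om M).
Local Notation centre := (centre M P om).

(** The fluctuation D - V of the mean jump at one site. *)
Definition drift_noise e tau x : R := sumM M (fun j => (j%:~R - V) * e x tau j).

Lemma nice_drift_noise tau x : nice (fun e => drift_noise e tau x).
Proof.
apply: nice_sumM => j jM; apply: niceZ; exact: nice_coord.
Qed.

Lemma drift_noise_bound e tau x : valid_env e -> `|drift_noise e tau x| <= M%:R + `|V|.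
Proof.
move=> ve; have [e0 es] := ve.
apply: le_trans (ler_norm_sumM _ _) _.
have -> : M%:R + `|V| = sumM M (fun j => (M%:R + `|V|) * e x tau j) by rewrite sumMZ es mulr1.
apply: ler_sumM => j jM.
rewrite normrM (ger0_norm (e0 x tau j)).
apply: ler_wpM2r; first exact: e0.
apply: le_trans (ler_normB _ _) _; rewrite lerD2r.
rewrite -[M%:R]/(M%:Z%:~R) ler_norml -mulrNz !ler_int; exact: jM.
Qed.

Lemma transition_id e tau x : valid_env e ->
  transition M e tau (fun y => y%:~R) x = x%:~R + V + drift_noise e tau x.
Proof.
move=> ve; have [e0 es] := ve.
have -> : x%:~R + V = sumM M (fun j => (x%:~R + V) * e x tau j) by rewrite sumMZ es mulr1.
rewrite /transition /drift_noise -sumMD.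
by apply: eq_sumM => j _; rewrite intrD; ring.
Qed.

Lemma Ev_drift_noise tau x : Ev (fun e => drift_noise e tau x) = 0.
Proof.
rewrite (Ev_sumM P measurable_om valid_om); last by move=> j jM; apply: niceZ; exact: nice_coord.
rewrite -(sum_pbar_centered P measurable_om valid_om).
apply: eq_sumM => j jM; rewrite (EvZ P measurable_om valid_om); last exact: nice_coord.
by rewrite (Ev_coord measurable_om valid_om independent_om identical_om)// mulrC.
Qed.

Lemma Ev_drift_noise2 tau x y :
  Ev (fun e => drift_noise e tau x * drift_noise e tau y) = sigD * (x == y)%:R.
Proof.
have expand x' y' tau' : Ev (fun e => drift_noise e tau' x' * drift_noise e tau' y') =
    sumM M (fun z1 => sumM M (fun z2 => (z1%:~R - V) * (z2%:~R - V) *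
      Ev (fun e => e x' tau' z1 * e y' tau' z2))).
  have nc z1 z2 : in_range M z1 -> in_range M z2 -> nice (fun e => e x' tau' z1 * e y' tau' z2).
    by move=> h1 h2; apply: niceM; exact: nice_coord.
  rewrite -(@eq_Ev _ M _ _ _ _ valid_om (fun e => sumM M (fun z1 => sumM M (fun z2 =>
      (z1%:~R - V) * (z2%:~R - V) * (e x' tau' z1 * e y' tau' z2))))); last first.
    move=> e _; rewrite /drift_noise -sumMZr; apply: eq_sumM => z1 _.
    by rewrite -sumMZ; apply: eq_sumM => z2 _; ring.
  rewrite (Ev_sumM P measurable_om valid_om); last first.
    by move=> z1 h1; apply: nice_sumM => z2 h2; apply: niceZ; exact: nc.
  apply: eq_sumM => z1 h1; rewrite (Ev_sumM P measurable_om valid_om); last first.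
    by move=> z2 h2; apply: niceZ; exact: nc.
  by apply: eq_sumM => z2 h2; rewrite (EvZ P measurable_om valid_om)//; exact: nc.
have [<-|xy] := eqVneq x y; rewrite ?mulr1 ?mulr0; last first.
  rewrite expand -[RHS](mulr0 0) -{1 2}(sum_pbar_centered P measurable_om valid_om) -sumMZr.
  apply: eq_sumM => z1 h1; rewrite -sumMZ; apply: eq_sumM => z2 h2.
  by rewrite (Ev_coord_neq measurable_om valid_om independent_om identical_om)//; ring.
have -> : sigD = Ev (fun e => drift_noise e 0 0 * drift_noise e 0 0).
  have nn : nice (fun e => drift_noise e 0 0 * drift_noise e 0 0).
    by apply: niceM; exact: nice_drift_noise.
  rewrite /sigmaD2 fine_expectation; congr Ex; apply: funext => o /=.
  rewrite -expr2; congr (_ ^+ 2); have [e0 es] := valid_om o.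
  rewrite /Dmean /drift_noise.
  have {1}-> : V = sumM M (fun j => V * om o 0 0 j) by rewrite sumMZ es mulr1.
  rewrite -sumMB.
  by apply: eq_sumM => j _; ring.
rewrite !expand; apply: eq_sumM => z1 h1; apply: eq_sumM => z2 h2.
by rewrite !(Ev_coord_same measurable_om valid_om independent_om identical_om).
Qed.

Section Walks.
Variable T : nat.

Definition walk_noise w k e : R :=
  if (w.1 <= k)%N then law M T e w k (fun x => drift_noise e (level T k) x) else 0.

Lemma nice_walk_noise w k : nice (walk_noise w k).
Proof.
rewrite /walk_noise; case: (w.1 <= k)%N; last exact: nice_cst.
by apply: nice_law => x; exact: nice_drift_noise.
Qed.

(** Each step adds V plus the drift fluctuation averaged over the current position, so the centred
    quenched mean has one term per level. *)
Lemma law_id_decomposition w K e : valid_env e ->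
  law M T e w K (fun x => x%:~R) - centre w K = \sum_(k < K) walk_noise w k e.
Proof.
move=> ve; elim: K => [|K IHK]; first by rewrite big_ord0 /centre /steps /= sub0n mulr0 addr0 subrr.
rewrite big_ord_recr /= -IHK /walk_noise /stage_step /centre /steps.
case: leqP => h; last first.
  rewrite addr0; have -> : (K.+1 - w.1 = K - w.1)%N by move: h; clear; lia.
  by [].
rewrite (subSn h) -natr1.
have -> : law M T e w K (transition M e (level T K) (fun x => x%:~R)) =
    law M T e w K (fun x => (x%:~R + V) + drift_noise e (level T K) x).
  by congr law; apply: funext => x; rewrite transition_id.
by rewrite !lawD// law_cst//; ring.
Qed.

Lemma walk_noise_past w k l e e' : (k < l)%N ->
  walk_noise w k (mix (other_levels T l) e e') = walk_noise w k e.
Proof.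
move=> kl; rewrite /walk_noise; case: (_ <= _)%N => //.
have sb := @same_below_mix _ T l e e'.
rewrite (@law_same_below _ M T _ e w k); last by move=> x i j ik; apply: sb; exact: ltn_trans kl.
congr law; apply: funext => x; apply: eq_sumM => j _; congr (_ * _); exact: sb.
Qed.

Lemma walk_noise_resample w k e e' : walk_noise w k (mix (other_levels T k) e e') =
  if (w.1 <= k)%N then law M T e w k (drift_noise e' (level T k)) else 0.
Proof.
rewrite /walk_noise; case: (_ <= _)%N => //.
rewrite (@law_same_below _ M T _ e w k); last exact: same_below_mix.
by congr law; apply: funext => x; apply: eq_sumM => j _; rewrite mix_level.
Qed.

Lemma Ev_walk_noise w k e : valid_env e ->
  Ev (fun e' => walk_noise w k (mix (other_levels T k) e e')) = 0.
Proof.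
move=> ve; rewrite (@eq_Ev _ M _ _ _ _ valid_om _ (fun e' =>
  if (w.1 <= k)%N then law M T e w k (drift_noise e' (level T k)) else 0)); last first.
  by move=> e' _; exact: walk_noise_resample.
case: (_ <= _)%N; last exact: Ev_cst.
rewrite (Ev_law T P measurable_om valid_om)//; last by move=> x; exact: nice_drift_noise.
have -> : (fun x => Ev (fun e' => drift_noise e' (level T k) x)) = fun=> 0.
  by apply: funext => x; exact: Ev_drift_noise.
exact: law_cst.
Qed.

(** Drift fluctuations at distinct sites of a level are uncorrelated, so averaging over the level
    keeps only the event that both walks share a site: the conditional covariance is a collision
    probability. *)
Lemma Ev_walk_noise2 w v k e : valid_env e ->
  Ev (fun e' => walk_noise w k (mix (other_levels T k) e e') *
                walk_noise v k (mix (other_levels T k) e e')) = sigD * collision M T w v k e.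
Proof.
move=> ve; pose D e' := drift_noise e' (level T k).
rewrite (@eq_Ev _ M _ _ _ _ valid_om _ (fun e' =>
  if (w.1 <= k)%N && (v.1 <= k)%N then law2 M T e w v k (fun x y => D e' x * D e' y) else 0));
  last first.
  move=> e' _; rewrite !walk_noise_resample; case: (w.1 <= k)%N; last by rewrite mul0r.
  case: (v.1 <= k)%N; last by rewrite mulr0.
  rewrite /law2 [RHS](_ : _ = law M T e w k (fun x => law M T e v k (D e') * D e' x)).
    by rewrite lawZ// mulrC.
  by congr law; apply: funext => x; rewrite lawZ// mulrC.
rewrite /collision; case: (_ && _); last by rewrite Ev_cst mulr0.
rewrite (Ev_law2 T P measurable_om valid_om)//; last first.
  by move=> x y; apply: niceM; exact: nice_drift_noise.
rewrite -law2Z//; congr law2; apply: funext => x; apply: funext => y.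
exact: Ev_drift_noise2.
Qed.

Lemma walk_noise_bound w k e : valid_env e -> `|walk_noise w k e| <= M%:R + `|V|.
Proof.
move=> ve; rewrite /walk_noise; case: (_ <= _)%N; last by rewrite normr0 addr_ge0.
by apply: normr_law_le => // x; exact: drift_noise_bound.
Qed.

Lemma collision_past w v k l e e' : (k <= l)%N ->
  collision M T w v k (mix (other_levels T l) e e') = collision M T w v k e.
Proof.
move=> kl; rewrite /collision; case: (_ && _) => //.
rewrite (@law2_same_below _ M T _ e w v k)// => x i j ik; apply: same_below_mix.
exact: leq_trans kl.
Qed.

Section Combination.
Variables (m K : nat) (w : 'I_m -> nat * int) (c : 'I_m -> R).

Let xi k e : R := \sum_(i < m) c i * walk_noise (w i) k e.
Let eta k e : R :=
  \sum_(i < m) \sum_(j < m) c i * c j * (sigD * collision M T (w i) (w j) k e).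

Let nice_xi k : nice (xi k).
Proof. by apply: nice_sum => i; apply: niceZ; exact: nice_walk_noise. Qed.

Let nice_eta k : nice (eta k).
Proof.
by apply: nice_sum => i; apply: nice_sum => j; do 2 apply: niceZ; exact: nice_collision.
Qed.

Let past_eta k l e e' : (k <= l)%N -> eta k (mix (other_levels T l) e e') = eta k e.
Proof.
by move=> kl; apply: eq_bigr => i _; apply: eq_bigr => j _; rewrite collision_past.
Qed.

Let past_xi k l e e' : (k < l)%N -> xi k (mix (other_levels T l) e e') = xi k e.
Proof. by move=> kl; apply: eq_bigr => i _; rewrite walk_noise_past. Qed.

Let nice_res i k e : valid_env e ->
  nice (fun e' => walk_noise (w i) k (mix (other_levels T k) e e')).
Proof. by move=> ve; apply: nice_mixr => //; exact: nice_walk_noise. Qed.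

Let centered_xi k e : valid_env e -> Ev (fun e' => xi k (mix (other_levels T k) e e')) = 0.
Proof.
move=> ve; rewrite (Ev_sum P measurable_om valid_om); last by move=> i; apply: niceZ; exact: nice_res.
apply: big1 => i _; rewrite (EvZ P measurable_om valid_om); last exact: nice_res.
by rewrite Ev_walk_noise// mulr0.
Qed.

Let variance_xi k e : valid_env e ->
  Ev (fun e' => xi k (mix (other_levels T k) e e') ^+ 2) = eta k e.
Proof.
move=> ve; pose W i e' := walk_noise (w i) k (mix (other_levels T k) e e').
have nW i j : nice (fun e' => W i e' * W j e') by apply: niceM; exact: nice_res.
rewrite (@eq_Ev _ M _ _ _ _ valid_om _ (fun e' =>
  \sum_(i < m) \sum_(j < m) c i * c j * (W i e' * W j e'))); last first.
  move=> e' _; rewrite expr2 /xi mulr_suml; apply: eq_bigr => i _.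
  by rewrite mulr_sumr; apply: eq_bigr => j _; rewrite -/(W i e') -/(W j e'); ring.
rewrite (Ev_sum P measurable_om valid_om); last first.
  by move=> i; apply: nice_sum => j; apply: niceZ.
apply: eq_bigr => i _; rewrite (Ev_sum P measurable_om valid_om); last by move=> j; apply: niceZ.
by apply: eq_bigr => j _; rewrite (EvZ P measurable_om valid_om)// Ev_walk_noise2.
Qed.

Let delta : R := (\sum_(i < m) `|c i|) * (M%:R + `|V|).

Let bounded_xi k e : valid_env e -> `|xi k e| <= delta.
Proof.
move=> ve; apply: le_trans (ler_norm_sum _ _ _) _; rewrite /delta mulr_suml.
by apply: ler_sum => i _; rewrite normrM; apply: ler_wpM2l => //; exact: walk_noise_bound.
Qed.

Let delta_ge0 : 0 <= delta.
Proof. by rewrite mulr_ge0 ?addr_ge0//; apply: sumr_ge0 => i _. Qed.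

Let sum_xi e : valid_env e -> \sum_(k < K) xi k e =
  \sum_(i < m) c i * (law M T e (w i) K (fun x => x%:~R) - centre (w i) K).
Proof.
move=> ve; rewrite exchange_big; apply: eq_bigr => i _.
by rewrite law_id_decomposition// mulr_sumr.
Qed.

Let sum_eta e : \sum_(k < K) eta k e = \sum_(i < m) \sum_(j < m)
  c i * c j * (sigD * \sum_(k < K) collision M T (w i) (w j) k e).
Proof.
rewrite exchange_big; apply: eq_bigr => i _; rewrite exchange_big; apply: eq_bigr => j _.
by rewrite !mulr_sumr.
Qed.

Lemma walks_clt (v theta : R) : 0 <= v -> delta <= 1 ->
  `|Ev (fun e => cos (\sum_(i < m) c i * (law M T e (w i) K (fun x => x%:~R) - centre (w i) K)
       + theta)) - expR (- (v / 2)) * cos theta|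
   <= (1 + expR ((v + 1) / 2)) * Ev (fun e => `|\sum_(i < m) \sum_(j < m)
        c i * c j * (sigD * \sum_(k < K) collision M T (w i) (w j) k e) - v|)
      + 3 * delta * expR ((v + 1) / 2) * (v + 1).
Proof.
move=> v0 d1; have := martingale_clt K measurable_om valid_om independent_om nice_xi nice_eta
  past_eta past_xi centered_xi variance_xi bounded_xi delta_ge0 d1 theta v0.
rewrite (@eq_Ev _ M _ _ _ _ valid_om _ (fun e => cos (\sum_(i < m) c i *
  (law M T e (w i) K (fun x => x%:~R) - centre (w i) K) + theta))); last first.
  by move=> e ve; rewrite sum_xi.
rewrite (@eq_Ev _ M _ _ _ _ valid_om (fun e => `|\sum_(k < K) eta k e - v|)
  (fun e => `|\sum_(i < m) \sum_(j < m)
        c i * c j * (sigD * \sum_(k < K) collision M T (w i) (w j) k e) - v|)) //.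
by move=> e ve; rewrite sum_eta.
Qed.

Lemma walks_second_moment :
  Ev (fun e => (\sum_(i < m) c i * (law M T e (w i) K (fun x => x%:~R) - centre (w i) K)) ^+ 2) =
  Ev (fun e => \sum_(i < m) \sum_(j < m)
        c i * c j * (sigD * \sum_(k < K) collision M T (w i) (w j) k e)).
Proof.
have := martingale_second_moment K measurable_om valid_om independent_om nice_xi nice_eta
  past_xi centered_xi variance_xi.
rewrite (@eq_Ev _ M _ _ _ _ valid_om _ (fun e => (\sum_(i < m) c i *
  (law M T e (w i) K (fun x => x%:~R) - centre (w i) K)) ^+ 2)); last first.
  by move=> e ve; rewrite sum_xi.
by move=> ->; apply: (@eq_Ev _ M _ _ _ _ valid_om) => e ve; rewrite sum_eta.
Qed.

End Combination.
End Walks.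
End WalkMartingale.

(** * The smoothed distance under diffusive rescaling *)

Section HeatContinuity.
Context {R : realType}.

Lemma heat_abs_dist2 (eps v1 v2 x1 x2 : R) : 0 < eps -> 0 <= v1 -> 0 <= v2 ->
  `|heat_abs (eps + v1) x1 - heat_abs (eps + v2) x2| <=
    (Num.sqrt eps)^-1 * `|v1 - v2| + `|x1 - x2|.
Proof.
move=> e0 v10 v20.
have time v v' x : 0 <= v -> v <= v' ->
    `|heat_abs (eps + v') x - heat_abs (eps + v) x| <= (Num.sqrt eps)^-1 * (v' - v).
  move=> v0 vv'; have -> : eps + v' = (eps + v) + (v' - v) by ring.
  by apply: heat_abs_time_lipschitz => //; rewrite ?subr_ge0// lerDl.
have -> : heat_abs (eps + v1) x1 - heat_abs (eps + v2) x2 =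
  (heat_abs (eps + v1) x1 - heat_abs (eps + v2) x1) +
  (heat_abs (eps + v2) x1 - heat_abs (eps + v2) x2) by ring.
apply: le_trans (ler_normD _ _) _; apply: lerD.
  have [h|h] := leP v1 v2.
    by rewrite distrC (distrC v1) (ger0_norm (_ : 0 <= v2 - v1)) ?subr_ge0// time.
  by rewrite (ger0_norm (_ : 0 <= v1 - v2)) ?subr_ge0 ?(ltW h)// time// ltW.
have := @heat_abs_lipschitz R (eps + v2) x2 (x1 - x2); rewrite subrKC; apply.
by rewrite ltr_wpDr.
Qed.

(** Absorbs the integer parts: a step count within 2 of u s^4 and a distance within [G] of rho s^2
    cost O(1/s) after rescaling. *)
Lemma heat_abs_rescaled (eps sigma2 u rho G s S D : R) : 0 < eps -> 0 <= sigma2 -> 0 <= u ->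
  1 <= s -> 0 <= S -> 0 <= G -> `|S - u * s ^+ 4| <= 2 -> `|D - rho * s ^+ 2| <= G ->
  `|heat_abs (eps + sigma2 / (s ^+ 2) ^+ 2 * S) (D / s ^+ 2) - heat_abs0 (sigma2 * u) rho|
    <= 5 * Num.sqrt eps + ((Num.sqrt eps)^-1 * (2 * sigma2) + G) / s.
Proof.
move=> e0 s20 u0 s1 S0 G0 hS hD.
have s0 : 0 < s by exact: lt_le_trans s1.
have r0 : 0 < s ^+ 2 by rewrite exprn_gt0.
have s2i : (s ^+ 2)^-1 <= s^-1.
  by rewrite lef_pV2 ?posrE// expr2 ler_peMl// ltW.
have s4i : ((s ^+ 2) ^+ 2)^-1 <= s^-1.
  apply: le_trans s2i; rewrite lef_pV2 ?posrE ?exprn_gt0//.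
  by rewrite [leRHS]expr2 ler_peMl// ?exprn_ege1// ltW.
have i2 : 0 <= (s ^+ 2)^-1 by rewrite invr_ge0 ltW.
have i4 : 0 <= ((s ^+ 2) ^+ 2)^-1 by rewrite invr_ge0 exprn_ge0// ltW.
have su : 0 <= sigma2 * u by exact: mulr_ge0.
have sS : 0 <= sigma2 / (s ^+ 2) ^+ 2 * S by rewrite mulr_ge0// divr_ge0// exprn_ge0// ltW.
apply: (@le_trans _ _ (`|heat_abs (eps + sigma2 / (s ^+ 2) ^+ 2 * S) (D / s ^+ 2) -
  heat_abs (eps + sigma2 * u) rho| + `|heat_abs (eps + sigma2 * u) rho - heat_abs0 (sigma2 * u) rho|)).
  by apply: le_trans (ler_normD _ _); rewrite le_eqVlt; apply/orP; left; apply/eqP; congr `|_|; ring.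
rewrite addrC; apply: lerD; first exact: heat_abs0_shift.
apply: le_trans (heat_abs_dist2 _ _ e0 sS su) _; rewrite mulrDl; apply: lerD.
  rewrite -[leRHS]mulrA; apply: ler_wpM2l; first by rewrite invr_ge0 sqrtr_ge0.
  have -> : sigma2 / (s ^+ 2) ^+ 2 * S - sigma2 * u =
      sigma2 * ((S - u * s ^+ 4) * ((s ^+ 2) ^+ 2)^-1) by field; rewrite gt_eqF.
  rewrite normrM (ger0_norm s20) -[leRHS]mulrA [leRHS]mulrCA; apply: ler_wpM2l => //.
  by rewrite normrM (ger0_norm i4); exact: ler_pM.
have -> : D / s ^+ 2 - rho = (D - rho * s ^+ 2) / s ^+ 2 by field; rewrite gt_eqF.
by rewrite normrM (ger0_norm i2); exact: ler_pM.
Qed.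
End HeatContinuity.

(** * Limit of the number of collisions *)

Section CollisionLimit.
Context {R : realType} (M : nat).
Context {d : measure_display} {Omega : measurableType d}.
Variables (P : probability Omega R) (om : Omega -> @env R).
Hypothesis measurable_om : forall x tau j, measurable_fun setT (fun w => om w x tau j).
Hypothesis valid_om : forall w, valid_env M (om w).
Hypothesis independent_om : sites_independent P om M.
Hypothesis identical_om : sites_identically_distributed P om M.
Hypothesis aperiodic_om : ~ (exists h x : int, 1 < h /\
  sumM M (fun j => if (h %| (j - x))%Z then pbar P om j else 0) = 1).
Hypothesis random_om : (0 < P [set w | forall j : int, (om w 0 0 j < 1)%R])%E.
Implicit Types (e : @env R) (w v : nat * int).

Local Notation Ev := (Ev P om).
Local Notation nice := (@nice R M).
Local Notation valid_env := (@valid_env R M).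
Local Notation V := (Vdrift P om M).
Local Notation sigD := (sigmaD2 P om M).
Local Notation sigma2 := (sigmaa2 P om M).
Local Notation Q := (fejer_avg M (indep_pair (pbar P om))).
Local Notation centre := (centre M P om).

Let sigma2_pos : 0 < sigma2. Proof. exact: sigma2_gt0. Qed.

(** The walks start at the stages T - a and T - b, so together they have made a + b steps at stage
    T, and |a - b| when the later one starts. In the limit these are the times ti + tj and |ti - tj|
    between which [Gamma_q] integrates. *)
Lemma collision_limit : exists2 C : R, 0 <= C &
  forall (A G ti tj rho eps : R), 0 <= A -> 0 <= G -> 0 <= ti -> 0 <= tj -> 0 < eps ->
  exists2 C' : R, 0 <= C' &
  forall (s : R) (T a b : nat) (x y : int), 1 <= s -> (a <= T)%N -> (b <= T)%N ->
    T%:R <= A * s ^+ 4 -> `|a%:R - ti * s ^+ 4| <= 1 -> `|b%:R - tj * s ^+ 4| <= 1 ->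
    `|(y%:~R + V * b%:R) - (x%:~R + V * a%:R) - rho * s ^+ 2| <= G ->
    Ev (fun e => `|beta P om M *
        (\sum_(k < T) collision M T ((T - a)%N, x) ((T - b)%N, y) k e) / s ^+ 2
       - (heat_abs0 (sigma2 * (ti + tj)) rho - heat_abs0 (sigma2 * `|ti - tj|) rho) / Q 0|)
     <= C * Num.sqrt eps + C' / s.
Proof.
have [C0 C00 hC0] := occupation_limit measurable_om valid_om independent_om identical_om
  aperiodic_om random_om.
have Q0 : 0 < Q 0 by rewrite (Q0E P measurable_om valid_om) mulr_gt0.
(* 10 is twice the 5 of [heat_abs0_shift], one for each end point. *)
exists (C0 + 10 / Q 0); first by rewrite addr_ge0// divr_ge0// ltW.
move=> A G ti tj rho eps A0 G0 ti0 tj0 e0.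
set A' := A + (`|rho| + G).
have A'0 : 0 <= A' by rewrite !addr_ge0.
have [C1 C10 hC1] := hC0 A' eps A'0 e0.
set C2 := (Num.sqrt eps)^-1 * (2 * sigma2) + G.
have C20 : 0 <= C2 by rewrite addr_ge0// mulr_ge0 ?invr_ge0 ?sqrtr_ge0// mulr_ge0// ltW.
exists (C1 + 2 * C2 / Q 0); first by rewrite addr_ge0// divr_ge0 ?mulr_ge0// ltW.
move=> s T a b x y s1 aT bT TA ha hb hxy.
set w := ((T - a)%N, x); set v := ((T - b)%N, y); set l := maxn w.1 v.1.
have s0 : 0 < s by exact: lt_le_trans s1.
have r0 : 0 < s ^+ 2 by rewrite exprn_gt0.
have r1 : 1 <= s ^+ 2 by exact: exprn_ege1.
have lT : (l <= T)%N by rewrite geq_max !leq_subr.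
have swT : steps w T = a by rewrite /steps /=; move: aT; clear; lia.
have svT : steps v T = b by rewrite /steps /=; move: bT; clear; lia.
have sl : (steps w l)%:R + (steps v l)%:R = `|a%:R - b%:R| :> R.
  have [h|h] := leqP a b.
    have -> : steps w l = 0%N by rewrite /steps /l /=; move: aT bT h; clear; lia.
    have -> : steps v l = (b - a)%N by rewrite /steps /l /=; move: aT bT h; clear; lia.
    by rewrite add0r natrB// distrC ger0_norm// subr_ge0 ler_nat.
  have -> : steps v l = 0%N by rewrite /steps /l /=; move: aT bT h; clear; lia.
  have -> : steps w l = (a - b)%N by rewrite /steps /l /=; move: aT bT h; clear; lia.
  by rewrite addr0 natrB ?(ltnW h)// ger0_norm// subr_ge0 ler_nat ltnW.
have dT : centre v T - centre w T = (y%:~R + V * b%:R) - (x%:~R + V * a%:R).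
  by rewrite /centre swT svT.
have dl : centre v l - centre w l = (y%:~R + V * b%:R) - (x%:~R + V * a%:R).
  have hh : (steps v l)%:R - (steps w l)%:R = b%:R - a%:R :> R.
    have : (steps v l + a = steps w l + b)%N.
      by rewrite /steps /l /=; move: aT bT; clear; lia.
    by move/(congr1 (fun n => n%:R : R)); rewrite !natrD; lra.
  rewrite /centre /= [LHS](_ : _ = y%:~R - x%:~R + V * ((steps v l)%:R - (steps w l)%:R)).
    by rewrite hh; ring.
  by ring.
have bnd : `|(y%:~R + V * b%:R) - (x%:~R + V * a%:R)| <= A' * s ^+ 2.
  rewrite -[_ - _](subrK (rho * s ^+ 2)).
  apply: le_trans (ler_normD _ _) _; rewrite normrM (ger0_norm (ltW r0)).
  apply: (@le_trans _ _ (G * s ^+ 2 + `|rho| * s ^+ 2)).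
    by rewrite lerD2r; apply: le_trans hxy _; rewrite ler_peMr.
  by rewrite -mulrDl; apply: ler_wpM2r; rewrite ?(ltW r0)// /A' [leLHS]addrC lerDr.
have TA' : T%:R <= A' * s ^+ 4.
  by apply: le_trans TA _; apply: ler_wpM2r; rewrite ?exprn_ge0 ?(ltW s0)// lerDl addr_ge0.
have h1 := hC1 s T T w v s1 lT TA'; rewrite dT dl in h1.
have {}h1 := h1 bnd bnd.
set ST := spread M P om w v T eps s in h1.
set Sl := spread M P om w v l eps s in h1.
set HT := heat_abs0 _ rho; set Hl := heat_abs0 _ rho.
have e1 : `|ST - HT| <= 5 * Num.sqrt eps + C2 / s.
  rewrite /ST /spread dT swT svT; apply: heat_abs_rescaled => //; first exact: ltW.
  - exact: addr_ge0.
  have -> : a%:R + b%:R - (ti + tj) * s ^+ 4 = (a%:R - ti * s ^+ 4) + (b%:R - tj * s ^+ 4) by ring.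
  by apply: le_trans (ler_normD _ _) _; apply: (le_trans (lerD ha hb)).
have e2 : `|Sl - Hl| <= 5 * Num.sqrt eps + C2 / s.
  rewrite /Sl /spread dl sl; apply: heat_abs_rescaled => //; first exact: ltW.
  have -> : `|ti - tj| * s ^+ 4 = `|(ti - tj) * s ^+ 4|.
    by rewrite normrM (ger0_norm (exprn_ge0 4 (ltW s0))).
  apply: le_trans (ler_dist_dist _ _) _.
  have -> : a%:R - b%:R - (ti - tj) * s ^+ 4 = (a%:R - ti * s ^+ 4) - (b%:R - tj * s ^+ 4) by ring.
  by apply: le_trans (ler_normB _ _) _; apply: (le_trans (lerD ha hb)).
pose X e := beta P om M * (\sum_(0 <= k < T) collision M T w v k e) / s ^+ 2.
have nX : nice X.
  apply: niceM; last exact: nice_cst.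
  by apply: niceZ; apply: nice_sum => k; exact: nice_collision.
have nXc c : nice (fun e => `|X e - c|).
  by apply: nice_norm; apply: niceB => //; exact: nice_cst.
rewrite (@eq_Ev _ M _ _ _ _ valid_om _ (fun e => `|X e - (HT - Hl) / Q 0|)); last first.
  by move=> e _; rewrite /X big_mkord.
apply: (@le_trans _ _ (Ev (fun e => `|X e - (ST - Sl) / Q 0| +
    ((5 * Num.sqrt eps + C2 / s) + (5 * Num.sqrt eps + C2 / s)) / Q 0))).
  apply: (le_Ev P measurable_om valid_om) => //.
    by apply: niceD => //; exact: nice_cst.
  move=> e ve; have -> : X e - (HT - Hl) / Q 0 =
    (X e - (ST - Sl) / Q 0) + ((ST - HT) - (Sl - Hl)) / Q 0 by ring.
  apply: le_trans (ler_normD _ _) _; rewrite lerD2l normrM.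
  rewrite (ger0_norm (_ : 0 <= (Q 0)^-1)) ?invr_ge0 ?(ltW Q0)//.
  apply: ler_wpM2r; first by rewrite invr_ge0 ltW.
  by apply: le_trans (ler_normB _ _) _; exact: lerD.
rewrite (EvD P measurable_om valid_om (nXc _) (nice_cst M _)) Ev_cst.
apply: le_trans (lerD h1 (lexx _)) _.
rewrite le_eqVlt; apply/orP; left; apply/eqP; ring.
Qed.

End CollisionLimit.

(** * Limits of the quenched means *)

Section Scale.
Context {R : realType}.

Definition scale (n : nat) : R := Num.sqrt (Num.sqrt n%:R).

Lemma scale_sqr n : scale n ^+ 2 = Num.sqrt n%:R.
Proof. by rewrite sqr_sqrtr// sqrtr_ge0. Qed.

Lemma scale4 n : scale n ^+ 4 = n%:R.
Proof. by rewrite (exprM _ 2 2) scale_sqr sqr_sqrtr. Qed.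

Lemma scale_ge1 n : (0 < n)%N -> 1 <= scale n.
Proof.
have sqrt_ge1 (x : R) : 1 <= x -> 1 <= Num.sqrt x by move/ler_wsqrtr; rewrite sqrtr1.
by move=> n0; apply/sqrt_ge1/sqrt_ge1; rewrite ler1n.
Qed.

Lemma scale_ge (b : R) n : b ^+ 4 <= n%:R -> b <= scale n.
Proof.
move=> bn; apply: le_trans (ler_norm b) _.
rewrite -(ler_pXn2r (n := 4)) ?nnegrE ?sqrtr_ge0// scale4.
by rewrite (exprM _ 2 2) real_normK ?num_real// -exprM.
Qed.

(** n tends to infinity at fixed [eps]: [C'] may depend on [eps], [C] may not. *)
Lemma vanishing_cvg (u : nat -> R) (C : R) : 0 <= C ->
  (forall eps, 0 < eps -> exists2 C' : R, 0 <= C' &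
    forall n, (0 < n)%N -> `|u n| <= C * Num.sqrt eps + C' / scale n) ->
  u n @[n --> \oo] --> 0.
Proof.
move=> C0 hu; apply/cvgr0Pnorm_lt => e e0.
(* Makes C sqrt(eps) <= e / 2; adding 1 to C avoids a division by zero. *)
pose eps := (e / (2 * (C + 1))) ^+ 2.
have c1 : 0 < C + 1 by rewrite ltr_wpDl.
have q0 : 0 < e / (2 * (C + 1)) by rewrite divr_gt0// mulr_gt0.
have eps0 : 0 < eps by rewrite exprn_gt0.
have [C' C'0 hC'] := hu _ eps0.
have Ce : C * Num.sqrt eps <= e / 2.
  rewrite sqrtr_sqr gtr0_norm//.
  have -> : C * (e / (2 * (C + 1))) = (C / (C + 1)) * (e / 2) by field; rewrite gt_eqF.
  by apply: ler_piMl; [rewrite divr_ge0// ltW|rewrite ler_pdivrMr// mul1r lerDl].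
pose b := 2 * C' / e + 1.
have b0 : 0 < b by rewrite ltr_wpDl// divr_ge0 ?mulr_ge0// ltW.
exists (Num.truncn (b ^+ 4)).+1 => //= n bn.
have n0 : (0 < n)%N by exact: leq_ltn_trans bn.
have sb : b <= scale n.
  apply: scale_ge; apply: ltW; apply: lt_le_trans (_ : (Num.truncn (b ^+ 4)).+1%:R <= _).
    by have /andP[] := truncn_itv (exprn_ge0 4 (ltW b0)).
  by rewrite ler_nat.
have s0 : 0 < scale n by exact: lt_le_trans sb.
apply: le_lt_trans (hC' n n0) _.
have h : C' / scale n < e / 2.
  rewrite ltr_pdivrMr//; apply: lt_le_trans (_ : e / 2 * b <= _); last first.
    by apply: ler_wpM2l => //; rewrite divr_ge0// ltW.
  have -> : e / 2 * b = C' + e / 2 by rewrite /b; field; rewrite gt_eqF.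
  by rewrite ltrDl divr_gt0.
by apply: (le_lt_trans (lerD Ce (lexx _))); rewrite [ltRHS](splitr e) ltrD2l.
Qed.

Lemma floor_dist (x : R) : `|(Num.floor x)%:~R - x| <= 1.
Proof.
have /andP[h1 h2] := floor_itv x; move: h2; rewrite intrD => h2.
by rewrite ler_norml; lra.
Qed.

Lemma truncn_dist (x : R) : 0 <= x -> `|(Num.truncn x)%:R - x| <= 1.
Proof.
move=> x0; have /andP[h1] := truncn_itv x0; rewrite -natr1 => h2.
by rewrite ler_norml; lra.
Qed.

Lemma cos_dist (x y : R) : `|cos x - cos y| <= `|x - y|.
Proof.
have d1 (u : R) : is_derive u 1 (@cos R) (- sin u) by exact: is_derive_cos.
have s1 (u : R) : `|- sin u| <= 1 :> R by rewrite normrN; exact: sin_max.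
by have := lipschitz_derive d1 s1 y (x - y); rewrite subrKC mul1r.
Qed.

End Scale.

Section QuenchedMeanLimit.
Context {R : realType} (M : nat).
Context {d : measure_display} {Omega : measurableType d}.
Variables (P : probability Omega R) (om : Omega -> @env R).
Hypothesis measurable_om : forall x tau j, measurable_fun setT (fun w => om w x tau j).
Hypothesis valid_om : forall w, valid_env M (om w).
Hypothesis independent_om : sites_independent P om M.
Hypothesis identical_om : sites_identically_distributed P om M.
Hypothesis aperiodic_om : ~ (exists h x : int, 1 < h /\
  sumM M (fun j => if (h %| (j - x))%Z then pbar P om j else 0) = 1).
Hypothesis random_om : (0 < P [set w | forall j : int, (om w 0 0 j < 1)%R])%E.
Variables (m : nat) (t r : 'I_m -> R).
Hypothesis t_ge0 : forall i, 0 <= t i.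
Implicit Types (e : @env R) (a : 'I_m -> R).

Local Notation Ev := (Ev P om).
Local Notation nice := (@nice R M).
Local Notation valid_env := (@valid_env R M).
Local Notation V := (Vdrift P om M).
Local Notation sigD := (sigmaD2 P om M).
Local Notation sigma2 := (sigmaa2 P om M).
Local Notation Q := (fejer_avg M (indep_pair (pbar P om))).
Local Notation centre := (centre M P om).
Local Notation Gam i j := (Gamma_q P om M (t i, r i) (t j, r j)).

Let tau n i : nat := Num.truncn (n%:R * t i).
(** The common top level; walks with a smaller time wait at their start until their own level
    comes. *)
Let T n : nat := \max_i tau n i.
Let start n i : int := Num.floor (n%:R * t i * bdrift P om M) + Num.floor (r i * Num.sqrt n%:R).
Let walk n i : nat * int := ((T n - tau n i)%N, start n i).
(** What the integer parts leave of the compensation of the drift by b = -V: bounded in n, hence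
    negligible after division by n^(1/4). *)
Let recentring n i : R := (Num.floor (n%:R * t i * bdrift P om M))%:~R + V * (tau n i)%:R.
Let occupation n i j e : R := \sum_(k < T n) collision M (T n) (walk n i) (walk n j) k e.
Let variance a n e : R := \sum_(i < m) \sum_(j < m)
  (a i / scale n) * (a j / scale n) * (sigD * occupation n i j e).

Definition limit_variance a : R := \sum_(i < m) \sum_(j < m) a i * a j * Gam i j.

Let nt_ge0 n i : 0 <= n%:R * t i. Proof. by rewrite mulr_ge0. Qed.

Let tauT n i : (tau n i <= T n)%N. Proof. exact: leq_bigmax. Qed.

Let recentring_le n i : `|recentring n i| <= 1 + `|V|.
Proof.
have -> : recentring n i = ((Num.floor (n%:R * t i * bdrift P om M))%:~R -
    n%:R * t i * bdrift P om M) + V * ((tau n i)%:R - n%:R * t i).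
  by rewrite /recentring /bdrift; ring.
apply: le_trans (ler_normD _ _) _; apply: lerD; first exact: floor_dist.
by rewrite normrM ler_piMr// truncn_dist.
Qed.

Let start_dist n i j : `|((start n j)%:~R + V * (tau n j)%:R) -
  ((start n i)%:~R + V * (tau n i)%:R) - (r j - r i) * scale n ^+ 2| <= 4 + 2 * `|V|.
Proof.
rewrite scale_sqr; set q := Num.sqrt _.
pose h i : R := (Num.floor (r i * q))%:~R - r i * q.
have -> : ((start n j)%:~R + V * (tau n j)%:R) -
  ((start n i)%:~R + V * (tau n i)%:R) - (r j - r i) * q =
  (recentring n j - recentring n i) + (h j - h i).
  by rewrite /start /recentring /h -/q !intrD; ring.
have h1 := recentring_le n j; have h2 := recentring_le n i.
have h3 := floor_dist (r j * q); have h4 := floor_dist (r i * q).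
apply: le_trans (ler_normD _ _) _.
apply: (le_trans (lerD (ler_normB _ _) (ler_normB _ _))).
apply: (le_trans (lerD (lerD h1 h2) (lerD h3 h4))).
lra.
Qed.

Let T_le n : (T n)%:R <= (\sum_i t i) * scale n ^+ 4.
Proof.
have S0 : 0 <= n%:R * \sum_i t i by rewrite mulr_ge0// sumr_ge0.
rewrite scale4 mulrC; have /andP[h _] := truncn_itv S0; apply: le_trans h.
rewrite ler_nat; apply/bigmax_leqP => i _; apply: le_truncn; apply: ler_wpM2l => //.
by rewrite (bigD1 i)//= lerDl sumr_ge0.
Qed.

(** The heat integral is an increment of [heat_abs0], and Q(0) = 2 sigma_a^2 absorbs both the factor
    1/2 and the sigma_a^2 of kappa. *)
Lemma Gamma_q_heat i j : Gam i j = sigD / beta P om M *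
  ((heat_abs0 (sigma2 * (t i + t j)) (r j - r i) -
    heat_abs0 (sigma2 * `|t i - t j|) (r j - r i)) / Q 0).
Proof.
have s0 : 0 < sigma2 by exact: sigma2_gt0.
have b0 : 0 < beta P om M by exact: (beta_gt0 measurable_om valid_om aperiodic_om random_om).
rewrite (Q0E P measurable_om valid_om) /Gamma_q /kappa.
have -> : (fun v : R => (Num.sqrt (pi *+ 2 * v))^-1 * expR (- (r i - r j) ^+ 2 / (v *+ 2))) =
    heat^~ (r j - r i).
  by apply: funext => v; rewrite /heat -(sqrrN (r i - r j)) opprB.
rewrite Rintegral_heat ?mulr_ge0 ?(ltW s0)//; last first.
  apply: ler_wpM2l; first exact: ltW.
  by apply: le_trans (ler_normB _ _) _; rewrite !ger0_norm// addrC.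
rewrite (addrC (t j)) (distrC (t j)); field.
by rewrite !gt_eqF.
Qed.

Let nice_occupation n i j : nice (occupation n i j).
Proof. by apply: nice_sum => k; exact: nice_collision. Qed.

Let nice_variance a n : nice (variance a n).
Proof. by apply: nice_sum => i; apply: nice_sum => j; do 2 apply: niceZ. Qed.

Lemma variance_limit a : exists2 C : R, 0 <= C & forall eps, 0 < eps -> exists2 C' : R, 0 <= C' &
  forall n, (0 < n)%N -> Ev (fun e => `|variance a n e - limit_variance a|) <=
    C * Num.sqrt eps + C' / scale n.
Proof.
have b0 : 0 < beta P om M by exact: (beta_gt0 measurable_om valid_om aperiodic_om random_om).
have sD0 : 0 <= sigD.
  rewrite /sigmaD2 fine_expectation; apply: Rintegral_ge0 => x _; exact: sqr_ge0.
have [C C0 hC] := collision_limit measurable_om valid_om independent_om identical_om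
  aperiodic_om random_om.
pose A i j := `|a i * a j| * (sigD / beta P om M).
have A0 i j : 0 <= A i j by rewrite mulr_ge0// divr_ge0// ltW.
exists (\sum_i \sum_j A i j * C).
  by apply: sumr_ge0 => i _; apply: sumr_ge0 => j _; exact: mulr_ge0.
move=> eps e0.
have S0 : 0 <= \sum_i t i by exact: sumr_ge0.
have V0 : 0 <= 4 + 2 * `|V| by rewrite addr_ge0// mulr_ge0.
have hCij i j := hC _ _ _ _ (r j - r i) _ S0 V0 (t_ge0 i) (t_ge0 j) e0.
pose C' i j := projT1 (cid2 (hCij i j)).
exists (\sum_i \sum_j A i j * C' i j).
  apply: sumr_ge0 => i _; apply: sumr_ge0 => j _; apply: mulr_ge0 => //.
  by rewrite /C'; case: cid2.
move=> n n0; have s1 := scale_ge1 n0 : 1 <= scale n :> R.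
have s0 : 0 < scale n :> R by exact: lt_le_trans s1.
pose Y i j e := beta P om M * occupation n i j e / scale n ^+ 2
  - (heat_abs0 (sigma2 * (t i + t j)) (r j - r i) -
     heat_abs0 (sigma2 * `|t i - t j|) (r j - r i)) / Q 0.
have nY i j : nice (fun e => `|Y i j e|).
  apply: nice_norm; apply: niceB; last exact: nice_cst.
  by apply: niceM; [exact: niceZ|exact: nice_cst].
apply: (@le_trans _ _ (Ev (fun e => \sum_i \sum_j A i j * `|Y i j e|))).
  apply: (le_Ev P measurable_om valid_om).
  - by apply: nice_norm; apply: niceB => //; exact: nice_cst.
  - by apply: nice_sum => i; apply: nice_sum => j; exact: niceZ.
  move=> e ve; rewrite /variance /limit_variance -sumrB.
  apply: le_trans (ler_norm_sum _ _ _) _; apply: ler_sum => i _; rewrite -sumrB.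
  apply: le_trans (ler_norm_sum _ _ _) _; apply: ler_sum => j _.
  have -> : a i / scale n * (a j / scale n) * (sigD * occupation n i j e) - a i * a j * Gam i j =
      a i * a j * (sigD / beta P om M) * Y i j e.
    rewrite Gamma_q_heat /Y mulrBr; congr (_ - _); last by ring.
    by field; rewrite !gt_eqF.
  by rewrite normrM (normrM (a i * a j)) (ger0_norm (_ : 0 <= sigD / beta P om M))// divr_ge0// ltW.
rewrite (Ev_sum P measurable_om valid_om); last first.
  by move=> i; apply: nice_sum => j; exact: niceZ.
rewrite !mulr_suml -big_split /=; apply: ler_sum => i _.
rewrite (Ev_sum P measurable_om valid_om); last by move=> j; exact: niceZ.
rewrite !mulr_suml -big_split /=; apply: ler_sum => j _.
rewrite (EvZ P measurable_om valid_om)//.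
have -> : A i j * C * Num.sqrt eps + A i j * C' i j / scale n =
  A i j * (C * Num.sqrt eps + C' i j / scale n) by ring.
apply: ler_wpM2l => //; rewrite /C'; case: cid2 => c c0 /= hc; apply: hc => //.
- by rewrite scale4 mulrC; exact: truncn_dist.
- by rewrite scale4 mulrC; exact: truncn_dist.
Qed.

Let fluct n i e : R := law M (T n) e (walk n i) (T n) (fun x => x%:~R) - centre (walk n i) (T n).

Lemma y_n_fluct n i w : (0 < n)%N ->
  y_n P om M n (t i) (r i) w = (fluct n i (om w) + recentring n i) / scale n.
Proof.
move=> n0; rewrite /y_n -/(scale n) mulrC; congr (_ / _).
rewrite /fluct -{2}(subnK (tauT n i)) law_qE /level.
have -> : (T n)%:Z - (T n - tau n i)%N%:Z = Num.floor (n%:R * t i).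
  have := truncn_floor (n%:R * t i); rewrite nt_ge0 -/(tau n i) => e1.
  have f0 : 0 <= Num.floor (n%:R * t i) by rewrite floor_ge0.
  by move: (tauT n i) e1 f0; clear; lia.
have -> : centre (walk n i) (T n) = (start n i)%:~R + V * (tau n i)%:R.
  by rewrite /centre /steps /= subKn.
by rewrite /start /recentring intrD -/(tau n i); ring.
Qed.

Section LinearCombination.
Variable a : 'I_m -> R.

Let S n e : R := \sum_(i < m) (a i / scale n) * fluct n i e.
Let err n : R := \sum_(i < m) (a i / scale n) * recentring n i.
Let sum_a : R := \sum_(i < m) `|a i|.

Let sum_a_ge0 : 0 <= sum_a. Proof. exact: sumr_ge0. Qed.

Let y_nE n w : (0 < n)%N -> \sum_(i < m) a i * y_n P om M n (t i) (r i) w = S n (om w) + err n.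
Proof.
move=> n0; rewrite /S /err -big_split /=; apply: eq_bigr => i _.
by rewrite y_n_fluct//; ring.
Qed.

Let normr_scaled n i : (0 < n)%N -> `|a i / scale n| = `|a i| / scale n.
Proof.
move=> n0; rewrite normrM (ger0_norm (_ : 0 <= (scale n)^-1))//.
by rewrite invr_ge0 sqrtr_ge0.
Qed.

Let err_le n : (0 < n)%N -> `|err n| <= sum_a * (1 + `|V|) / scale n.
Proof.
move=> n0; apply: le_trans (ler_norm_sum _ _ _) _; rewrite /sum_a !mulr_suml.
apply: ler_sum => i _; rewrite normrM normr_scaled// mulrAC.
by rewrite -!mulrA; apply: ler_wpM2l => //; apply: ler_wpM2r; rewrite ?invr_ge0 ?sqrtr_ge0.
Qed.

Let nice_S n : nice (S n).
Proof.
apply: nice_sum => i; apply: niceZ; apply: niceB; last exact: nice_cst.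
by apply: nice_law => x; exact: nice_cst.
Qed.

Let Ev_S2 n : Ev (fun e => S n e ^+ 2) = Ev (variance a n).
Proof.
exact: (walks_second_moment measurable_om valid_om independent_om identical_om (T n) (T n)
  (walk n) (fun i => a i / scale n)).
Qed.

Let Ev_variance_le n : Ev (variance a n) <=
  limit_variance a + Ev (fun e => `|variance a n e - limit_variance a|).
Proof.
have nA : nice (fun e => `|variance a n e - limit_variance a|).
  by apply: nice_norm; apply: niceB => //; exact: nice_cst.
rewrite -{1}(Ev_cst P om (limit_variance a)) -(EvD P measurable_om valid_om (nice_cst M _) nA).
apply: (le_Ev P measurable_om valid_om) => //; first by apply: niceD => //; exact: nice_cst.
by move=> e _; rewrite -lerBlDl; exact: ler_norm.
Qed.

(** Seen from probability rather than from the formula: it is a limit of second moments. This is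
    what makes the matrix of [Gamma_q] a covariance matrix. *)
Lemma limit_variance_ge0 : 0 <= limit_variance a.
Proof.
have [C C0 hC] := variance_limit a.
pose u n := Ev (fun e => `|variance a n e - limit_variance a|).
have u0 : u n @[n --> \oo] --> 0.
  apply: (vanishing_cvg C0) => eps e0; have [C' C'0 hC'] := hC eps e0; exists C' => // n n0.
  rewrite ger0_norm; first exact: hC'.
  by apply: (Ev_ge0 P valid_om).
rewrite leNgt; apply/negP => v0.
have /cvgr0Pnorm_lt/(_ (- limit_variance a)) := u0; rewrite oppr_gt0 => /(_ v0) [N _ hN].
have /= := hN N (leqnn N); have h := Ev_variance_le N; rewrite -Ev_S2 in h.
have h2 : 0 <= Ev (fun e => S N e ^+ 2) by apply: (Ev_ge0 P valid_om) => e _; exact: sqr_ge0.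
have h3 := ler_norm (u N) => h4; have := le_lt_trans h3 h4.
rewrite -/(u N) in h; lra.
Qed.

(** Serves tightness, which is needed because trigonometric polynomials approximate a function on a
    box only. *)
Lemma second_moment_bounded : exists B : R, forall n, (0 < n)%N ->
  Ex P (fun w => (\sum_(i < m) a i * y_n P om M n (t i) (r i) w) ^+ 2) <= B.
Proof.
have [C C0 hC] := variance_limit a; have [C' C'0 hC'] := hC 1 ltr01.
exists (2 * (limit_variance a + (C + C')) + 2 * (sum_a * (1 + `|V|)) ^+ 2) => n n0.
have s1 := scale_ge1 n0 : 1 <= scale n :> R.
have s0 : 0 < scale n :> R by exact: lt_le_trans s1.
have -> : Ex P (fun w => (\sum_(i < m) a i * y_n P om M n (t i) (r i) w) ^+ 2) =
    Ev (fun e => (S n e + err n) ^+ 2).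
  by congr Ex; apply: funext => w; rewrite y_nE.
have nS2 : nice (fun e => S n e ^+ 2) by exact: niceX.
apply: (@le_trans _ _ (Ev (fun e => 2 * S n e ^+ 2 + 2 * err n ^+ 2))).
  apply: (le_Ev P measurable_om valid_om).
  - by apply: niceX; apply: niceD => //; exact: nice_cst.
  - by apply: niceD; [exact: niceZ|exact: nice_cst].
  move=> e _; have := sqr_ge0 (S n e - err n); rewrite sqrrB sqrrD; lra.
rewrite (EvD P measurable_om valid_om (niceZ _ nS2) (nice_cst M _)) Ev_cst.
rewrite (EvZ P measurable_om valid_om _ nS2) Ev_S2.
have si : (scale n)^-1 <= 1 :> R by rewrite invf_le1.
apply: lerD; apply: ler_wpM2l => //.
  apply: le_trans (Ev_variance_le n) _; rewrite lerD2l.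
  apply: le_trans (hC' n n0) _; rewrite sqrtr1 mulr1 lerD2l ler_piMr//.
rewrite -(real_normK (num_real (err n))); apply: lerXn2r; rewrite ?nnegrE//.
  by rewrite mulr_ge0// addr_ge0.
apply: le_trans (err_le n0) _; rewrite ler_piMr// mulr_ge0// addr_ge0.
Qed.

Lemma cos_limit (theta : R) :
  Ex P (fun w => cos (\sum_(i < m) a i * y_n P om M n (t i) (r i) w + theta)) @[n --> \oo] -->
  expR (- (limit_variance a / 2)) * cos theta.
Proof.
set v := limit_variance a; have v0 : 0 <= v := limit_variance_ge0.
have [C C0 hC] := variance_limit a.
pose K1 := 1 + expR ((v + 1) / 2).
have K10 : 0 <= K1 by rewrite addr_ge0// expR_ge0.
apply/subr_cvg0; apply: (@vanishing_cvg _ _ (K1 * C)); first exact: mulr_ge0.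
move=> eps e0; have [C' C'0 hC'] := hC eps e0.
pose D := sum_a * (M%:R + `|V|).
have D0 : 0 <= D by rewrite mulr_ge0// addr_ge0.
pose K2 := 3 * D * expR ((v + 1) / 2) * (v + 1) + 2 * D.
have K20 : 0 <= K2 by rewrite addr_ge0 ?mulr_ge0 ?expR_ge0// addr_ge0.
pose K3 := sum_a * (1 + `|V|).
have K30 : 0 <= K3 by rewrite mulr_ge0// addr_ge0.
exists (K1 * C' + K2 + K3); first exact: addr_ge0 (addr_ge0 (mulr_ge0 K10 C'0) K20) K30.
move=> n n0; have s1 := scale_ge1 n0 : 1 <= scale n :> R.
have s0 : 0 < scale n :> R by exact: lt_le_trans s1.
have si0 : 0 <= (scale n)^-1 :> R by rewrite invr_ge0 ltW.
have ncos (c : R) : nice (fun e => cos (S n e + c)).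
  apply: (nice_comp (h := @cos R)); last by apply: niceD => //; exact: nice_cst.
    exact: continuous_cos.
  by exists 1 => x; exact: cos_max.
have -> : Ex P (fun w => cos (\sum_(i < m) a i * y_n P om M n (t i) (r i) w + theta)) =
    Ev (fun e => cos (S n e + (err n + theta))).
  by congr Ex; apply: funext => w; rewrite y_nE// addrA.
have -> : Ev (fun e => cos (S n e + (err n + theta))) - expR (- (v / 2)) * cos theta =
  Ev (fun e => cos (S n e + (err n + theta)) - cos (S n e + theta)) +
  (Ev (fun e => cos (S n e + theta)) - expR (- (v / 2)) * cos theta).
  by rewrite (EvB P measurable_om valid_om (ncos _) (ncos _)); ring.
apply: le_trans (ler_normD _ _) _.
have -> : K1 * C * Num.sqrt eps + (K1 * C' + K2 + K3) / scale n =
  K3 / scale n + (K1 * (C * Num.sqrt eps + C' / scale n) + K2 / scale n) by ring.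
apply: lerD.
  apply: le_trans (normr_Ev P measurable_om valid_om (niceB (ncos _) (ncos _))) _.
  rewrite -[leRHS](Ev_cst P om); apply: (le_Ev P measurable_om valid_om).
  - by apply: nice_norm; apply: niceB; exact: ncos.
  - exact: nice_cst.
  move=> e _; apply: le_trans (cos_dist _ _) _.
  have -> : S n e + (err n + theta) - (S n e + theta) = err n by ring.
  exact: err_le.
pose delta := (\sum_(i < m) `|a i / scale n|) * (M%:R + `|V|).
have dE : delta = D / scale n.
  rewrite /delta /D /sum_a [RHS]mulrAC; congr (_ * _); rewrite mulr_suml.
  by apply: eq_bigr => i _; rewrite normr_scaled.
(* The central limit bound asks for increments of size at most 1. This fails for finitely many n
   only, where the trivial bound 2 is below 2 D / scale n. *)
have [d1|d1] := leP delta 1.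
  apply: le_trans (walks_clt measurable_om valid_om independent_om identical_om (T n) (T n)
    (walk n) theta v0 d1) _.
  apply: lerD; first by apply: ler_wpM2l => //; exact: hC'.
  rewrite -/delta dE /K2 [leRHS]mulrDl.
  have -> : 3 * (D / scale n) * expR ((v + 1) / 2) * (v + 1) =
    3 * D * expR ((v + 1) / 2) * (v + 1) / scale n by ring.
  by rewrite lerDl divr_ge0 ?mulr_ge0// ltW.
apply: (@le_trans _ _ 2).
  apply: le_trans (ler_normB _ _) _; have -> : (2 : R) = 1 + 1 by [].
  apply: lerD.
    apply: le_trans (normr_Ev P measurable_om valid_om (ncos _)) _.
    rewrite -[leRHS](Ev_cst P om); apply: (le_Ev P measurable_om valid_om).
    - by apply: nice_norm; exact: ncos.
    - exact: nice_cst.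
    - by move=> e _; exact: cos_max.
  rewrite normrM -[leRHS]mul1r; apply: ler_pM => //; last exact: cos_max.
  by rewrite ger0_norm ?expR_ge0// -expR0 ler_expR oppr_le0 divr_ge0.
apply: (@le_trans _ _ (2 * D / scale n)).
  by rewrite -mulrA -dE -[leLHS]mulr1; apply: ler_wpM2l => //; exact: ltW.
have -> : K2 / scale n = 3 * D * expR ((v + 1) / 2) * (v + 1) / scale n + 2 * D / scale n.
  by rewrite /K2 mulrDl.
rewrite addrA -[leLHS]add0r lerD2r; apply: addr_ge0.
  by apply: mulr_ge0 => //; rewrite addr_ge0// mulr_ge0// sqrtr_ge0.
by apply: mulr_ge0 => //; rewrite mulr_ge0 ?addr_ge0// mulr_ge0 ?expR_ge0// mulr_ge0.
Qed.

End LinearCombination.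
End QuenchedMeanLimit.

(** * Trigonometric approximation and weak convergence *)

Section Bernstein.
Context {R : realType}.
Implicit Types (u v : R).

Definition bernstein N k u : R := 'C(N, k)%:R * (u ^+ k * (1 - u) ^+ (N - k)).

Lemma bernstein_ge0 N k u : 0 <= u <= 1 -> 0 <= bernstein N k u.
Proof.
by move=> /andP[u0 u1]; rewrite mulr_ge0// mulr_ge0// exprn_ge0// subr_ge0.
Qed.

Lemma sum_bernstein N u : \sum_(k < N.+1) bernstein N k u = 1.
Proof.
have -> : 1 = (1 - u + u) ^+ N by rewrite subrK expr1n.
rewrite exprDn; apply: eq_bigr => k _.
by rewrite /bernstein -[RHS]mulr_natl; congr (_ * _); rewrite mulrC.
Qed.

Let bernstein_shift N k u : k.+1%:R * bernstein N.+1 k.+1 u = N.+1%:R * u * bernstein N k u.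
Proof.
rewrite /bernstein subSS exprS; have := congr1 (fun n => n%:R : R) (mul_bin_diag N.+1 k).
rewrite /= !natrM => e; rewrite mulrA -e; ring.
Qed.

Let bernstein_mean N u : \sum_(k < N.+1) k%:R * bernstein N k u = N%:R * u.
Proof.
case: N => [|N]; first by rewrite big_ord_recl big_ord0 /= !mul0r addr0.
rewrite big_ord_recl /= mul0r add0r.
rewrite (eq_bigr (fun k : 'I_N.+1 => N.+1%:R * u * bernstein N k u)).
  by rewrite -mulr_sumr sum_bernstein mulr1.
by move=> k _; exact: bernstein_shift.
Qed.

Let bernstein_sqr N u : \sum_(k < N.+1) k%:R ^+ 2 * bernstein N k u =
  N%:R * u * (1 + (N%:R - 1) * u).
Proof.
case: N => [|N]; first by rewrite big_ord_recl big_ord0 /= expr0n !mul0r addr0.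
rewrite big_ord_recl /= expr0n /= mul0r add0r.
rewrite (eq_bigr (fun k : 'I_N.+1 =>
  N.+1%:R * u * (bernstein N k u + k%:R * bernstein N k u))); last first.
  move=> k _; rewrite [LHS](_ : _ = k.+1%:R * (k.+1%:R * bernstein N.+1 k.+1 u)).
    by rewrite bernstein_shift -natr1; ring.
  by rewrite expr2 mulrA.
by rewrite -mulr_sumr big_split /= sum_bernstein bernstein_mean -natr1; ring.
Qed.

(** The variance of k / N for a binomial k is u (1 - u) / N; it feeds a Chebyshev argument. *)
Lemma bernstein_variance N u : 0 <= u <= 1 -> (0 < N)%N ->
  \sum_(k < N.+1) bernstein N k u * (k%:R / N%:R - u) ^+ 2 <= N%:R^-1.
Proof.
move=> /andP[u0 u1] N0; have n0 : 0 < N%:R :> R by rewrite ltr0n.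
rewrite (eq_bigr (fun k : 'I_N.+1 => (N%:R ^+ 2)^-1 * (k%:R ^+ 2 * bernstein N k u)
  - 2 * u / N%:R * (k%:R * bernstein N k u) + u ^+ 2 * bernstein N k u)); last first.
  by move=> k _; field; rewrite gt_eqF.
rewrite big_split sumrB /= -!mulr_sumr sum_bernstein bernstein_mean bernstein_sqr.
have -> : (N%:R ^+ 2)^-1 * (N%:R * u * (1 + (N%:R - 1) * u)) - 2 * u / N%:R * (N%:R * u)
  + u ^+ 2 * 1 = N%:R^-1 * (u * (1 - u)) by field; rewrite gt_eqF.
rewrite -[leRHS]mulr1; apply: ler_wpM2l; first by rewrite invr_ge0 ltW.
by rewrite mulr_ile1// ?subr_ge0// gerBl.
Qed.
End Bernstein.

Section TrigPolynomials.
Context {R : realType} (m : nat).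
Local Notation vec := 'rV[R]_m.
Implicit Types (f g : vec -> R) (y : vec) (a : 'I_m -> R).

Definition trig_sum (s : seq (R * ('I_m -> R) * R)) y : R :=
  \sum_(p <- s) p.1.1 * cos (\sum_(i < m) p.1.2 i * y 0 i + p.2).

Definition trig g : Prop := exists s, g = trig_sum s.

Lemma trig_cos a theta : trig (fun y => cos (\sum_(i < m) a i * y 0 i + theta)).
Proof.
by exists [:: (1, a, theta)]; apply: funext => y; rewrite /trig_sum big_seq1 mul1r.
Qed.

Lemma trigZ c g : trig g -> trig (fun y => c * g y).
Proof.
move=> [s ->]; exists [seq (c * p.1.1, p.1.2, p.2) | p <- s]; apply: funext => y.
by rewrite /trig_sum big_map mulr_sumr; apply: eq_bigr => p _; rewrite mulrA.
Qed.

Lemma trigD f g : trig f -> trig g -> trig (fun y => f y + g y).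
Proof.
by move=> [s ->] [s' ->]; exists (s ++ s'); apply: funext => y; rewrite /trig_sum big_cat.
Qed.

Lemma trig_cst c : trig (fun=> c).
Proof.
have := trigZ c (trig_cos (fun=> 0) 0); congr trig; apply: funext => y.
by rewrite big1 ?addr0 ?cos0 ?mulr1// => i _; rewrite mul0r.
Qed.

Lemma trig_sumr (I : Type) (r : seq I) (G : I -> vec -> R) :
  (forall i, trig (G i)) -> trig (fun y => \sum_(i <- r) G i y).
Proof.
move=> tG; elim: r => [|i r IHr].
  by have := trig_cst 0; congr trig; apply: funext => y; rewrite big_nil.
by have := trigD (tG i) IHr; congr trig; apply: funext => y; rewrite big_cons.
Qed.

Lemma cosMcos (a b : R) : cos a * cos b = 2^-1 * cos (a + b) + 2^-1 * cos (a - b).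
Proof. by rewrite cosB cosD; field. Qed.

Lemma trigM f g : trig f -> trig g -> trig (fun y => f y * g y).
Proof.
move=> [s ->] [s' ->].
have -> : (fun y => trig_sum s y * trig_sum s' y) = fun y =>
    \sum_(p <- s) \sum_(q <- s') (p.1.1 * q.1.1) *
      (2^-1 * cos (\sum_(i < m) (p.1.2 i + q.1.2 i) * y 0 i + (p.2 + q.2)) +
       2^-1 * cos (\sum_(i < m) (p.1.2 i - q.1.2 i) * y 0 i + (p.2 - q.2))).
  apply: funext => y; rewrite /trig_sum mulr_suml; apply: eq_bigr => p _.
  rewrite mulr_sumr; apply: eq_bigr => q _.
  rewrite mulrACA cosMcos; congr (_ * (_ * cos _ + _ * cos _)).
    under [in RHS]eq_bigr do rewrite mulrDl.
    by rewrite big_split /=; ring.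
  under [in RHS]eq_bigr do rewrite mulrBl.
  by rewrite sumrB; ring.
apply: trig_sumr => p; apply: trig_sumr => q; apply: trigZ; apply: trigD; apply: trigZ.
  exact: trig_cos.
exact: trig_cos.
Qed.

Lemma trigX f n : trig f -> trig (fun y => f y ^+ n).
Proof.
move=> tf; elim: n => [|n IHn].
  by have := trig_cst 1; congr trig.
by have := trigM tf IHn; congr trig; apply: funext => y; rewrite exprS.
Qed.

Lemma trig_prod (I : Type) (r : seq I) (G : I -> vec -> R) :
  (forall i, trig (G i)) -> trig (fun y => \prod_(i <- r) G i y).
Proof.
move=> tG; elim: r => [|i r IHr].
  by have := trig_cst 1; congr trig; apply: funext => y; rewrite big_nil.
by have := trigM (tG i) IHr; congr trig; apply: funext => y; rewrite big_cons.
Qed.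

Lemma trig_sin c i : trig (fun y => sin (c * y 0 i)).
Proof.
have := trig_cos (fun j => if j == i then c else 0) (- (pi / 2)); congr trig.
apply: funext => y; rewrite (bigD1 i)//= eqxx big1 ?addr0 ?cosBpihalf//.
by move=> j /negbTE ->; rewrite mul0r.
Qed.

Lemma trig_bernstein N k f : trig f -> trig (fun y => bernstein N k (f y)).
Proof.
move=> tf; apply: trigZ; apply: trigM; apply: trigX => //.
have := trigD (trig_cst 1) (trigZ (-1) tf); congr trig; apply: funext => y.
by rewrite mulN1r.
Qed.
End TrigPolynomials.

Section UniformContinuity.
Context {R : realType} (m : nat).
Local Notation vec := 'rV[R]_m.

(** Only [y] is confined to the box, [x] may leave it; hence a compactness argument with balls of
    the whole space. *)
Lemma uniform_continuity_box (f : vec -> R) (L eta : R) : continuous f -> 0 < eta ->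
  exists2 delta, 0 < delta & forall x y : vec, (forall i, `|y 0 i| <= L) ->
    (forall i, `|x 0 i - y 0 i| < delta) -> `|f x - f y| <= eta.
Proof.
move=> cf eta0; pose K := [set y : vec | forall i, `[- L, L]%classic (y 0 i)].
have cK : compact K.
  by apply: (@rV_compact _ _ (fun=> `[- L, L]%classic)) => _; exact: segment_compact.
have hdelta : \forall delta \near (0 : R)^'+, K `<=` (fun y => forall x : vec,
    (forall i, `|x 0 i - y 0 i| < delta) -> `|f x - f y| <= eta).
  apply: ((compact_near_coveringP K).1 cK).
  move=> x Kx; have /cvgrPdist_lt/(_ (eta / 2)) := cf x.
  rewrite divr_gt0// => /(_ isT)/nbhs_ballP [e e0 he].
  exists ([set y | ball x (e / 2) y], [set delta | delta < e / 2]).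
    split; first by apply: nbhsx_ballx; rewrite divr_gt0.
    by apply: nbhs_right_lt; rewrite divr_gt0.
  move=> [y delta] /= [xy de] z zy.
  have hy := he y (le_ball _ xy); have hz : `|f x - f z| < eta / 2.
    apply: he; rewrite [e]splitr; apply: ball_triangle xy _.
    split; first by rewrite divr_gt0.
    by move=> i j; rewrite ord1 /ball /= distrC; apply: lt_trans de.
  have {}hy : `|f x - f y| < eta / 2.
    by apply: hy; rewrite ler_pdivrMr// ler_peMr ?(ltW e0)// ler1n.
  have -> : f z - f y = (f x - f y) - (f x - f z) by ring.
  by apply: le_trans (ler_normB _ _) _; rewrite [leRHS]splitr; apply: lerD; exact: ltW.
have {}hdelta : \forall delta \near (0 : R)^'+, 0 < delta /\ K `<=` (fun y => forall x : vec,
    (forall i, `|x 0 i - y 0 i| < delta) -> `|f x - f y| <= eta).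
  near=> delta; split; first by near: delta; exact: nbhs_right_gt.
  by near: delta.
have [delta [d0 hd]] := @filter_ex _ _ _ _ hdelta.
exists delta => // x y yL xy; apply: hd => // i /=.
by rewrite in_itv /= -ler_norml.
Unshelve. all: by end_near. Qed.
End UniformContinuity.

Section Approximation.
Context {R : realType}.
Implicit Types (a b : R).

(** The difference is 2 cos((a + b)/2) sin((a - b)/2), and for b <= a the cosine is at least the
    sine because |a + b|/2 + |a - b|/2 <= pi/2. This quantifies the injectivity of the sine. *)
Lemma sin_dist a b : - (pi / 2) <= a <= pi / 2 -> - (pi / 2) <= b <= pi / 2 ->
  2 * sin (`|a - b| / 2) ^+ 2 <= `|sin a - sin b|.
Proof.
wlog ab : a b / b <= a.
  move=> h ha hb; have [ab|/ltW ab] := leP b a; first exact: h.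
  by rewrite distrC (distrC (sin a)); exact: h.
move=> /andP[a1 a2] /andP[b1 b2]; rewrite (ger0_norm (_ : 0 <= a - b)) ?subr_ge0//.
set h := (a - b) / 2; set c := (a + b) / 2.
have -> : sin a - sin b = 2 * (cos c * sin h).
  have -> : a = c + h by rewrite /c /h; field.
  have -> : b = c - h by rewrite /c /h; field.
  by rewrite sinD sinB; ring.
have h0 : 0 <= h by rewrite divr_ge0// subr_ge0.
have sh : 0 <= sin h.
  apply: sin_ge0_pi; rewrite ?h0//=; have := pi_ge0 R; rewrite /h; lra.
have hc : sin h <= cos c.
  have hcmp (x : R) : 0 <= x -> x <= pi / 2 - h -> sin h <= cos x.
    move=> x0 xh; have p0 := pi_ge0 R.
    have xI : x \in `[0, pi] by rewrite in_itv /=; apply/andP; split; lra.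
    have hI : pi / 2 - h \in `[0, pi] by rewrite in_itv /=; apply/andP; split; lra.
    by rewrite -cosBpihalf -cosN opprB leNgt ltr_cos// -leNgt.
  have [c0|c0] := leP 0 c; first by apply: hcmp => //; rewrite /c /h; lra.
  by rewrite -cosN; apply: hcmp; [rewrite oppr_ge0 ltW|rewrite /c /h; lra].
rewrite ger0_norm ?mulr_ge0//; last by apply: le_trans hc.
by apply: ler_wpM2l => //; rewrite expr2; apply: ler_wpM2r.
Qed.
End Approximation.

Section TrigApproximation.
Context {R : realType} (m : nat).
Local Notation vec := 'rV[R]_m.
Implicit Types (f g : vec -> R) (y : vec).

Section Grid.
Variables (L : R) (N : nat).
Hypothesis L_gt0 : 0 < L.

(** Maps [-L, L] onto [-pi/2, pi/2], where the sine is injective. *)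
Let c : R := pi / (2 * L).
Let c_gt0 : 0 < c. Proof. by rewrite divr_gt0 ?pi_gt0// mulr_gt0. Qed.

Definition sin_fraction (x : R) : R := 2^-1 * (1 + sin (c * x)).
(** The point of [-L, L] at which [sin_fraction] takes the value k / N. *)
Definition grid_point (k : nat) : R := asin (2 * (k%:R / N%:R) - 1) / c.
Definition grid_weight (k : {ffun 'I_m -> 'I_N.+1}) y : R :=
  \prod_(i < m) bernstein N (k i) (sin_fraction (y 0 i)).

Lemma sin_fraction_itv x : 0 <= sin_fraction x <= 1.
Proof.
have := sin_max (c * x); rewrite ler_norml /sin_fraction => /andP[h1 h2].
by apply/andP; split; lra.
Qed.

Lemma grid_weight_ge0 k y : 0 <= grid_weight k y.
Proof. by apply: prodr_ge0 => i _; apply: bernstein_ge0; exact: sin_fraction_itv. Qed.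

Lemma sum_grid_weight y : \sum_k grid_weight k y = 1.
Proof.
rewrite -(bigA_distr_bigA (fun i (k : 'I_N.+1) => bernstein N k (sin_fraction (y 0 i)))).
by apply: big1 => i _; exact: sum_bernstein.
Qed.

Lemma grid_variance y i : (0 < N)%N ->
  \sum_k grid_weight k y * ((k i)%:R / N%:R - sin_fraction (y 0 i)) ^+ 2 <= N%:R^-1.
Proof.
move=> N0; pose F j (k : 'I_N.+1) := bernstein N k (sin_fraction (y 0 j)) *
  (if j == i then (k%:R / N%:R - sin_fraction (y 0 j)) ^+ 2 else 1).
rewrite (eq_bigr (fun k : {ffun 'I_m -> 'I_N.+1} => \prod_j F j (k j))); last first.
  move=> k _; rewrite big_split /=; congr (_ * _).
  by rewrite (bigD1 i)//= eqxx big1 ?mulr1// => j /negbTE ->.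
rewrite -(bigA_distr_bigA F) (bigD1 i)//= [X in _ * X]big1 ?mulr1.
  apply: le_trans (bernstein_variance (sin_fraction_itv (y 0 i)) N0).
  by apply: ler_sum => k _; rewrite /F eqxx.
move=> j /negbTE ji; rewrite -[RHS](sum_bernstein N (sin_fraction (y 0 j))).
by apply: eq_bigr => k _; rewrite /F ji mulr1.
Qed.

Lemma trig_grid_weight k : trig (grid_weight k).
Proof.
apply: trig_prod => i; apply: trig_bernstein; apply: trigZ; apply: trigD; first exact: trig_cst.
exact: trig_sin.
Qed.

Lemma grid_point_dist (delta : R) (k : 'I_N.+1) x : (0 < N)%N -> 0 <= delta -> delta <= L ->
  `|x| <= L -> delta <= `|grid_point k - x| ->
  sin (c * delta / 2) ^+ 2 <= `|k%:R / N%:R - sin_fraction x|.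
Proof.
move=> N0 d0 dL xL hd; have p0 := pi_gt0 R.
have cL : c * L = pi / 2 by rewrite /c; field; rewrite gt_eqF.
have n0 : 0 < N%:R :> R by rewrite ltr0n.
have kN : 0 <= (k%:R / N%:R : R) <= 1.
  by rewrite divr_ge0//= ler_pdivrMr// mul1r ler_nat -ltnS.
have sI : -1 <= (2 * (k%:R / N%:R) - 1 : R) <= 1 by move/andP: kN => [k0 k1]; apply/andP; split; lra.
have [gI sE] := asin_def sI.
have gE : c * grid_point k = asin (2 * (k%:R / N%:R) - 1).
  by rewrite /grid_point mulrCA divff ?mulr1 ?gt_eqF.
have cx : `|c * x| <= pi / 2.
  by rewrite normrM (ger0_norm (ltW c_gt0)) -cL; apply: ler_wpM2l => //; exact: ltW.
rewrite ler_norml in cx.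
have := sin_dist gI cx; rewrite sE -gE -mulrBr normrM (ger0_norm (ltW c_gt0)).
set h := _ / 2 => H.
have hle : c * delta / 2 <= h.
  by apply: ler_wpM2r => //; apply: ler_wpM2l => //; exact: ltW.
have hpi : h <= pi / 2.
  rewrite /h ler_pM2r// -(ger0_norm (ltW c_gt0)) -normrM mulrBr gE.
  move: gI cx => /andP[g1 g2] /andP[x1 x2]; rewrite ler_norml; apply/andP; split; lra.
have cd0 : 0 <= c * delta / 2 by rewrite divr_ge0// mulr_ge0// ltW.
have s0 : 0 <= sin (c * delta / 2).
  by apply: sin_ge0_pi; rewrite cd0 /=; apply: le_trans hle _; apply: le_trans hpi _; lra.
have ss : sin (c * delta / 2) <= sin h.
  rewrite leNgt ltr_sin ?in_itv/= -?leNgt//; apply/andP; split; lra.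
have s2 : sin (c * delta / 2) ^+ 2 <= sin h ^+ 2.
  by apply: lerXn2r; rewrite ?nnegrE// (le_trans s0).
have -> : k%:R / N%:R - sin_fraction x = (2 * (k%:R / N%:R) - 1 - sin (c * x)) / 2.
  by rewrite /sin_fraction; field; rewrite gt_eqF.
rewrite normrM (ger0_norm (_ : 0 <= 2^-1)) ?invr_ge0//; lra.
Qed.
End Grid.

(* Bernstein's operator in the variables [(1 + sin (pi y_i / (2 L))) / 2]: periodic, hence
   bounded by [B] everywhere, and close to [f] on the box where [y_i] is a function of it. *)
Lemma trig_approx f (B L eta : R) : continuous f -> (forall x, `|f x| <= B) -> 0 < L ->
  0 < eta -> exists g, [/\ trig g, forall y, `|g y| <= B &
    forall y, (forall i, `|y 0 i| <= L) -> `|g y - f y| <= eta].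
Proof.
move=> cf fB L0 e0; have p0 := pi_gt0 R.
have B0 : 0 <= B by apply: le_trans (fB 0).
have [d1 d10 unif] := uniform_continuity_box L cf (divr_gt0 e0 (ltr0n R 2)).
pose delta := Num.min d1 L.
have d0 : 0 < delta by rewrite lt_min d10.
have dL : delta <= L by rewrite ge_min lexx orbT.
have dd1 : delta <= d1 by rewrite ge_min lexx.
set c : R := pi / (2 * L).
have c0 : 0 < c by rewrite divr_gt0// mulr_gt0.
set rho : R := sin (c * delta / 2) ^+ 2.
have rho0 : 0 < rho.
  rewrite exprn_gt0// sin_gt0_pi//; apply/andP; split.
    by apply: divr_gt0 => //; exact: mulr_gt0.
  have cL : c * L = pi / 2 by rewrite /c; field; rewrite gt_eqF.
  have : c * delta <= c * L by apply: ler_wpM2l => //; exact: ltW.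
  lra.
(* A grid point that is far in coordinate i has [D k i] at least rho^2, so K times it dominates the
   trivial bound 2 B; N is then taken so large that m K / N <= eta / 2. *)
pose K := 2 * B / rho ^+ 2.
have K0 : 0 <= K by apply: divr_ge0; [exact: mulr_ge0|exact: sqr_ge0].
pose N := (Num.truncn (2 * (m%:R * K) / eta)).+1.
have N0 : (0 < N)%N by [].
have n0 : 0 < N%:R :> R by rewrite ltr0n.
have KN : m%:R * (K / N%:R) <= eta / 2.
  have mK0 : 0 <= 2 * (m%:R * K) / eta.
    by apply: divr_ge0; [rewrite mulr_ge0// mulr_ge0|exact: ltW].
  have /andP[_ h] := truncn_itv mK0; rewrite mulrA ler_pdivrMr//.
  have := ltW h; rewrite -/N ler_pdivrMr//; lra.
pose pt (k : {ffun 'I_m -> 'I_N.+1}) : vec := \row_i grid_point L N (k i).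
exists (fun y => \sum_k f (pt k) * grid_weight L k y); split.
- by apply: trig_sumr => k; apply: trigZ; exact: trig_grid_weight.
- move=> y; apply: le_trans (ler_norm_sum _ _ _) _.
  rewrite -[leRHS]mulr1 -(sum_grid_weight L N y) mulr_sumr.
  apply: ler_sum => k _; rewrite normrM (ger0_norm (grid_weight_ge0 _ _ _)).
  by apply: ler_wpM2r => //; exact: grid_weight_ge0.
move=> y yL.
have -> : f y = \sum_(k : {ffun 'I_m -> 'I_N.+1}) f y * grid_weight L k y.
  by rewrite -mulr_sumr sum_grid_weight mulr1.
rewrite -sumrB; apply: le_trans (ler_norm_sum _ _ _) _.
pose D (k : {ffun 'I_m -> 'I_N.+1}) i := ((k i)%:R / N%:R - sin_fraction L (y 0 i)) ^+ 2.
apply: (@le_trans _ _ (\sum_(k : {ffun 'I_m -> 'I_N.+1})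
    (eta / 2 * grid_weight L k y + \sum_i K * (grid_weight L k y * D k i)))).
  apply: ler_sum => k _; rewrite -mulrBl normrM (ger0_norm (grid_weight_ge0 _ _ _)).
  have -> : eta / 2 * grid_weight L k y + \sum_i K * (grid_weight L k y * D k i) =
      (eta / 2 + \sum_i K * D k i) * grid_weight L k y.
    rewrite mulrDl mulr_suml; congr (_ + _); apply: eq_bigr => i _; ring.
  apply: ler_wpM2r; first exact: grid_weight_ge0.
  have KD i : 0 <= K * D k i by rewrite mulr_ge0// sqr_ge0.
  have [/forallP near|] := boolP [forall i, `|pt k 0 i - y 0 i| < delta].
    apply: le_trans (unif (pt k) y yL _) _; last by rewrite lerDl sumr_ge0.
    by move=> i; apply: lt_le_trans (near i) dd1.
  rewrite negb_forall => /existsP[i]; rewrite -leNgt mxE => far.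
  have hr := grid_point_dist L0 N0 (ltW d0) dL (yL i) far; rewrite -/c -/rho in hr.
  apply: (@le_trans _ _ (2 * B)).
    by apply: le_trans (ler_normB _ _) _; rewrite mulr2n mulrDl mul1r; exact: lerD.
  apply: (@le_trans _ _ (K * D k i)).
    have -> : 2 * B = K * rho ^+ 2 by rewrite /K; field; rewrite gt_eqF.
    apply: ler_wpM2l => //; rewrite /D -[leRHS]real_normK ?num_real//.
    by apply: lerXn2r; rewrite ?nnegrE// ltW.
  rewrite (bigD1 i)//= addrCA lerDl addr_ge0//; first by rewrite divr_ge0// ltW.
  by apply: sumr_ge0.
rewrite big_split /= -mulr_sumr sum_grid_weight mulr1 [leRHS](splitr eta) lerD2l.
rewrite exchange_big /=; apply: le_trans KN; rewrite -[m in leRHS]card_ord -sumr_const mulr_suml.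
apply: ler_sum => i _; rewrite -mulr_sumr mul1r; apply: ler_wpM2l => //.
exact: grid_variance.
Qed.

End TrigApproximation.

Section RandomVector.
Context {R : realType} (m : nat) {d : measure_display} {T : measurableType d}.
Variables (P : probability T R) (X : T -> 'rV[R]_m).
Hypothesis measurable_X : forall i, measurable_fun setT (fun w => X w 0 i).
Local Notation vec := 'rV[R]_m.
Implicit Types (f g : vec -> R) (L : R).

Definition tail L (x : R) : R := (L < `|x|)%R%:R.

Lemma bounded_rv_tail L i : bounded_rv (fun w => tail L (X w 0 i)).
Proof.
split; last by exists 1 => w; rewrite /tail ger0_norm// lern1 leq_b1.
have mb : measurable_fun setT (fun w => L < `|X w 0 i|).
  by apply: measurable_fun_ltr => //; exact: measurableT_comp.
rewrite (_ : (fun w => _) = fun w => if L < `|X w 0 i| then 1 else 0 : R).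
  exact: measurable_fun_ifT.
by apply: funext => w; rewrite /tail; case: (L < _).
Qed.

Lemma bounded_rv_trig_sum s : bounded_rv (fun w => trig_sum s (X w)).
Proof.
apply: bounded_rv_sum => p _; apply: bounded_rvZ; split; last by exists 1 => w; exact: cos_max.
apply: measurableT_comp; first by apply: continuous_measurable_fun; exact: continuous_cos.
apply: measurable_funD => //; apply: measurable_sum => i; exact: measurable_funM.
Qed.

Lemma bounded_rv_trig g : trig g -> bounded_rv (fun w => g (X w)).
Proof. by move=> [s ->]; exact: bounded_rv_trig_sum. Qed.

(** Only the coordinates of [X] are assumed measurable, so [f] composed with [X] is obtained as a
    pointwise limit of trigonometric polynomials that approximate [f] on growing boxes. *)
Lemma bounded_rv_continuous f (B : R) : continuous f -> (forall x, `|f x| <= B) ->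
  bounded_rv (fun w => f (X w)).
Proof.
move=> cf fB; split; last by exists B => w; exact: fB.
pose approx n := cid (trig_approx cf fB (ltr0Sn R n) (divr_gt0 ltr01 (ltr0Sn R n))).
pose g n := projT1 (approx n).
apply: (@measurable_fun_cvg _ _ _ _ (fun n w => g n (X w))).
  by move=> n; rewrite /g; case: (approx n) => h [th _ _] /=; case: (bounded_rv_trig th).
move=> w _; apply/cvgrPdist_le => e e0.
pose b : R := \sum_i `|X w 0 i| + e^-1.
exists (Num.truncn b).+1 => //= n bn.
have b0 : 0 <= b by rewrite addr_ge0 ?sumr_ge0// invr_ge0 ltW.
have bn' : b <= n.+1%:R.
  have /andP[_ h] := truncn_itv b0; apply: le_trans (ltW h) _; rewrite ler_nat.
  exact: leq_trans bn _.
rewrite /g; case: (approx n) => h [_ _ hf] /=; rewrite distrC; apply: le_trans (hf _ _) _.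
  move=> i; apply: le_trans bn'; rewrite /b (bigD1 i)//= -addrA lerDl.
  by rewrite addr_ge0 ?sumr_ge0// invr_ge0 ltW.
rewrite div1r invf_ple ?posrE//; apply: le_trans bn'.
by rewrite /b lerDr sumr_ge0.
Qed.

Lemma Ex_trig_approx f g (B L eta : R) : continuous f -> (forall x, `|f x| <= B) ->
  trig g -> (forall y, `|g y| <= B) -> 0 <= eta ->
  (forall y : vec, (forall i, `|y 0 i| <= L) -> `|g y - f y| <= eta) ->
  `|Ex P (fun w => g (X w)) - Ex P (fun w => f (X w))| <=
    eta + 2 * B * \sum_i Ex P (fun w => tail L (X w 0 i)).
Proof.
move=> cf fB tg gB e0 gf.
have bf := bounded_rv_continuous cf fB; have bg := bounded_rv_trig tg.
have B0 : 0 <= B by apply: le_trans (fB 0).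
have bt : bounded_rv (fun w => \sum_(i < m) tail L (X w 0 i)).
  by apply: bounded_rv_sum => i _; exact: bounded_rv_tail.
rewrite -ExB//; apply: le_trans (normr_Ex _ (bounded_rvB bg bf)) _.
rewrite -Ex_sum; last by move=> i _; exact: bounded_rv_tail.
rewrite -ExZ// -{1}(Ex_cst P eta) -ExD//; last 2 first.
- exact: bounded_rv_cst.
- exact: bounded_rvZ.
apply: le_Ex.
- by apply: bounded_rv_norm; exact: bounded_rvB.
- by apply: bounded_rvD; [exact: bounded_rv_cst|exact: bounded_rvZ].
move=> w; have S0 : 0 <= \sum_(i < m) tail L (X w 0 i) by apply: sumr_ge0 => i _; rewrite /tail.
have [/forallP h|] := boolP [forall i, `|X w 0 i| <= L].
  by apply: le_trans (gf _ h) _; rewrite lerDl !mulr_ge0.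
rewrite negb_forall => /existsP[i]; rewrite -ltNge => h.
apply: (@le_trans _ _ (2 * B * 1)).
  by rewrite mulr1 mulr2n mulrDl mul1r; apply: le_trans (ler_normB _ _) _; exact: lerD.
apply: (@le_trans _ _ (2 * B * \sum_(i < m) tail L (X w 0 i))); last by rewrite lerDr.
apply: ler_wpM2l; first exact: mulr_ge0.
by rewrite (bigD1 i)//= /tail h lerDl sumr_ge0.
Qed.

Lemma tail_antitone (L L' x : R) : L <= L' -> tail L' x <= tail L x.
Proof.
move=> LL'; rewrite /tail ler_nat; case: (L' < `|x|) / boolP => // h.
by rewrite (le_lt_trans LL' h).
Qed.

Lemma Ex_tail_small i (eta : R) : 0 < eta ->
  exists L, forall L', L <= L' -> Ex P (fun w => tail L' (X w 0 i)) <= eta.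
Proof.
move=> e0; pose A n := [set w | n%:R < `|X w 0 i|].
have mA n : measurable (A n).
  rewrite -[A n]setTI; apply: (measurable_fun_ltr _ _ measurableT) => //.
  exact: measurableT_comp.
have PA n : P (A n) = (Ex P (fun w => tail n%:R (X w 0 i)))%:E.
  rewrite -(expectation_Ex _ (bounded_rv_tail n%:R i)) unlock -[in LHS](setIT (A n)).
  rewrite -integral_indic//; apply: eq_integral => w _; congr EFin.
  rewrite indicE /tail; congr (_%:R); congr nat_of_bool.
  by apply/idP/idP; rewrite inE.
have A0 : \bigcap_n A n = set0.
  rewrite -subset0 => w Aw; have := Aw (Num.truncn `|X w 0 i|).+1 I.
  by rewrite /A /= ltNge; have /andP[_ /ltW ->] := truncn_itv (normr_ge0 (X w 0 i)).
have : P \o A @ \oo --> P (\bigcap_n A n).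
  apply: nonincreasing_cvg_mu => //.
  - exact: le_lt_trans (probability_le1 P (mA 0)) (ltry 1).
  - by rewrite A0; exact: measurable0.
  - move=> n k nk; apply/subsetPset => w; rewrite /A /=; apply: le_lt_trans.
    by rewrite ler_nat.
rewrite A0 measure0 => cA; have {cA} : Ex P (fun w => tail n%:R (X w 0 i)) @[n --> \oo] --> 0.
  have cE : (Ex P (fun w => tail n%:R (X w 0 i)))%:E @[n --> \oo] --> (0 : R)%:E.
    by rewrite (_ : (fun n => _) = P \o A)//; apply/funext => n; rewrite -PA.
  exact: (fine_cvg cE).
move=> /cvgrPdist_le/(_ eta e0)[N _ hN]; exists N%:R => L' NL.
have := hN N (leqnn N); rewrite /= sub0r normrN => h.
apply: le_trans (le_trans (ler_norm _) h); apply: le_Ex; try exact: bounded_rv_tail.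
by move=> w; exact: tail_antitone.
Qed.

Lemma Ex_tail_markov L i : bounded_rv (fun w => X w 0 i ^+ 2) -> 0 < L ->
  Ex P (fun w => tail L (X w 0 i)) <= Ex P (fun w => X w 0 i ^+ 2) / L ^+ 2.
Proof.
move=> bX L0; rewrite mulrC -ExZ//; apply: le_Ex; [exact: bounded_rv_tail|exact: bounded_rvZ|].
move=> w; rewrite /tail mulrC ler_pdivlMr ?exprn_gt0//.
case: (ltP L `|X w 0 i|) => h; last by rewrite mul0r sqr_ge0.
rewrite mul1r -[leRHS]real_normK ?num_real//; apply: lerXn2r; rewrite ?nnegrE ?ltW//.
exact: lt_trans h.
Qed.
End RandomVector.

Section WeakConvergence.
Context {R : realType} (m : nat).
Context {d : measure_display} {Omega : measurableType d} (P : probability Omega R).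
Context {d' : measure_display} {T : measurableType d'} (P' : probability T R).
Variables (Xn : nat -> Omega -> 'rV[R]_m) (X : T -> 'rV[R]_m).
Hypothesis measurable_Xn : forall n i, measurable_fun setT (fun w => Xn n w 0 i).
Hypothesis measurable_X : forall i, measurable_fun setT (fun w => X w 0 i).
Hypothesis trig_cvg : forall (a : 'I_m -> R) theta,
  Ex P (fun w => cos (\sum_(i < m) a i * Xn n w 0 i + theta)) @[n --> \oo] -->
  Ex P' (fun w => cos (\sum_(i < m) a i * X w 0 i + theta)).
Hypothesis tight_Xn : forall i (eta : R), 0 < eta ->
  exists L, forall n L', (0 < n)%N -> L <= L' -> Ex P (fun w => tail L' (Xn n w 0 i)) <= eta.

Lemma trig_expectation_cvg g : trig g ->
  Ex P (fun w => g (Xn n w)) @[n --> \oo] --> Ex P' (fun w => g (X w)).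
Proof.
move=> [s ->].
have b1 (d0 : measure_display) (S : measurableType d0) (Y : S -> 'rV[R]_m) p :
    (forall i, measurable_fun setT (fun w => Y w 0 i)) ->
    bounded_rv (fun w => cos (\sum_(i < m) p.1.2 i * Y w 0 i + p.2)).
  move=> mY; have := bounded_rv_trig_sum mY [:: (1 : R, p.1.2, p.2)].
  by congr bounded_rv; apply: funext => w; rewrite /trig_sum big_seq1 mul1r.
have ExE (d0 : measure_display) (S : measurableType d0) (Q : probability S R)
    (Y : S -> 'rV[R]_m) : (forall i, measurable_fun setT (fun w => Y w 0 i)) ->
    Ex Q (fun w => trig_sum s (Y w)) =
    \sum_(p <- s) p.1.1 * Ex Q (fun w => cos (\sum_(i < m) p.1.2 i * Y w 0 i + p.2)).
  move=> mY; rewrite /trig_sum Ex_sum; last by move=> p _; apply: bounded_rvZ; exact: b1.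
  by apply: eq_bigr => p _; rewrite ExZ//; exact: b1.
rewrite ExE//; under eq_fun do rewrite ExE//.
apply: cvg_big => [|p _]; first exact: add_continuous.
by apply: cvgMr; exact: trig_cvg.
Qed.

Lemma weak_convergence f (B : R) : continuous f -> (forall x, `|f x| <= B) ->
  Ex P (fun w => f (Xn n w)) @[n --> \oo] --> Ex P' (fun w => f (X w)).
Proof.
move=> cf fB; have B0 : 0 <= B by apply: le_trans (fB 0).
apply/cvgrPdist_le => e e0.
(* Five eta are spent: two for each replacement of [f] by [g], one for the convergence of the means
   of [g]. *)
pose eta := e / 6; have eta0 : 0 < eta by rewrite divr_gt0.
pose C := 2 * B * m%:R + 1.
have C0 : 0 < C by rewrite ltr_wpDl// mulr_ge0// mulr_ge0.
have etaC : 0 < eta / C by rewrite divr_gt0.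
pose L1 i := projT1 (cid (tight_Xn i etaC)).
pose L2 i := projT1 (cid (Ex_tail_small P' measurable_X i etaC)).
pose L := \sum_i (`|L1 i| + `|L2 i|) + 1.
have L0 : 0 < L by rewrite ltr_wpDl// sumr_ge0// => i _; rewrite addr_ge0.
have leL i : `|L1 i| + `|L2 i| <= L.
  by rewrite /L (bigD1 i)//= -addrA lerDl addr_ge0// sumr_ge0// => j _; rewrite addr_ge0.
have t1 n i : (0 < n)%N -> Ex P (fun w => tail L (Xn n w 0 i)) <= eta / C.
  move=> n0; have := leL i; rewrite /L1; case: cid => l hl /= h; apply: hl => //.
  by apply: le_trans (ler_norm _) _; apply: le_trans h; rewrite lerDl.
have t2 i : Ex P' (fun w => tail L (X w 0 i)) <= eta / C.
  have := leL i; rewrite /L2; case: cid => l hl /= h; apply: hl => //.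
  by apply: le_trans (ler_norm _) _; apply: le_trans h; rewrite lerDr.
have small (F : 'I_m -> R) : (forall i, F i <= eta / C) -> eta + 2 * B * \sum_i F i <= 2 * eta.
  move=> hF; have -> : 2 * eta = eta + eta by ring.
  rewrite lerD2l.
  apply: (@le_trans _ _ (2 * B * \sum_(i < m) eta / C)).
    by apply: ler_wpM2l; [exact: mulr_ge0|exact: ler_sum].
  rewrite sumr_const card_ord -[_ *+ m]mulr_natl.
  have -> : 2 * B * (m%:R * (eta / C)) = (2 * B * m%:R / C) * eta by ring.
  rewrite ler_piMl ?(ltW eta0)//.
  by rewrite ler_pdivrMr// mul1r /C lerDl.
have [g [tg gB gf]] := trig_approx cf fB L0 eta0.
have /cvgrPdist_le/(_ eta eta0)[N _ hN] := trig_expectation_cvg tg.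
exists N.+1 => //= n Nn; have n0 : (0 < n)%N by exact: leq_ltn_trans Nn.
have h1 := Ex_trig_approx P (measurable_Xn n) cf fB tg gB (ltW eta0) gf.
have h2 := Ex_trig_approx P' measurable_X cf fB tg gB (ltW eta0) gf.
have {}h1 := le_trans h1 (small _ (fun i => t1 n i n0)).
have {}h2 := le_trans h2 (small _ t2).
have h3 := hN n (ltnW Nn); rewrite /= in h3.
move: h1 h2 h3; rewrite !ler_norml /eta => /andP[? ?] /andP[? ?] /andP[? ?].
by apply/andP; split; lra.
Qed.

End WeakConvergence.

(** * Gaussian laws *)

Section GaussianIntegrals.
Context {R : realType}.
Local Notation mu := (@lebesgue_measure R).
Local Notation "'Int' f" := (Rintegral mu setT f) (at level 10, f at level 9).
Implicit Types (v x u theta : R).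

Lemma Rintegral_derive_eq0 (F f : R -> R) : (forall x, is_derive x 1 F (f x)) ->
  continuous f -> mu.-integrable setT (EFin \o f) ->
  F n%:R @[n --> \oo] --> 0 -> F (- n%:R) @[n --> \oo] --> 0 -> Int f = 0.
Proof.
move=> Ff cf fi F1 F2; have mf : measurable_fun setT f by exact: continuous_measurable_fun.
pose I n := `[- n.+1%:R, n.+1%:R]%classic : set R.
pose h n := fun x => (f x * \1_(I n) x)%:E.
have mI n : measurable (I n) by exact: measurable_itv.
have mh n : measurable_fun setT (h n).
  by apply/measurable_EFinP; apply: measurable_funM => //; exact: measurable_indic.
have mf' : measurable_fun setT (EFin \o f) by exact/measurable_EFinP.
have fh : {ae mu, forall x, setT x -> h ^~ x @ \oo --> (EFin \o f) x}.
  apply: aeW => x _; apply: cvg_near_cst; exists (Num.truncn `|x|) => //= n xn.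
  have xI : I n x.
    rewrite /I /= in_itv /= -ler_norml.
    have /andP[_ /ltW] := truncn_itv (normr_ge0 x); move=> /le_trans; apply.
    by rewrite ler_nat ltnS.
  by rewrite /h indicE mem_set// mulr1.
have fd : {ae mu, forall x n, setT x -> (`|h n x| <= `|(EFin \o f) x|)%E}.
  apply: aeW => x n _; rewrite /h /= lee_fin normrM ler_piMr//.
  by rewrite indicE; case: (_ \in _); rewrite ?normr1 ?normr0.
have [_ _ dc] := @dominated_convergence _ _ _ mu setT measurableT _ _ _ mh mf' fh (integrable_abse fi) fd.
have hE n : (\int[mu]_x h n x = (F n.+1%:R - F (- n.+1%:R))%:E)%E.
  rewrite /h EFinB -(@continuous_FTC2 _ f F (- n.+1%:R) n.+1%:R).
  - rewrite [RHS]integral_mkcond; apply: eq_integral => x _.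
    by rewrite patchE indicE; case: ifP => _; rewrite ?mulr1 ?mulr0.
  - by apply: (@lt_trans _ _ 0); rewrite ?oppr_lt0 ltr0n.
  - exact: continuous_subspaceT.
  - split.
    + by move=> x _; have [] := Ff x.
    + by apply: cvg_at_right_filter; exact: (is_derive_continuous Ff).
    + by apply: cvg_at_left_filter; exact: (is_derive_continuous Ff).
  - by move=> x _; rewrite derive1E; have [_] := Ff x.
have c0 : (fun n => (\int[mu]_x h n x)%E) @ \oo --> (0 : R)%:E.
  rewrite (funext hE); apply: cvg_EFin; first exact: nearW.
  rewrite -[X in _ --> X]subr0; apply: cvgB.
    by have := F1; rewrite -(cvg_shiftS (fun n => F n%:R)).
  by have := F2; rewrite -(cvg_shiftS (fun n => F (- n%:R))).
by rewrite /Rintegral (cvg_unique (@ereal_hausdorff R) dc c0).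
Qed.

(** A quadratic remainder yields the derivative, in place of differentiation under the integral
    sign. *)
Lemma is_derive_of_quadratic (G : R -> R) u D C : (forall h, `|G (u + h) - G u - h * D| <= C * h ^+ 2) ->
  is_derive u 1 G D.
Proof.
move=> hG; have C0 : 0 <= C.
  by have := hG 1; rewrite expr1n mulr1; apply: le_trans.
have cv : h^-1 *: ((G \o shift u) (h *: (1 : R)) - G u) @[h --> 0^'] --> D.
  apply/cvgrPdist_le => e e0; near=> h.
  have h0 : h != 0 by near: h; exact: nbhs_dnbhs_neq.
  have ha : 0 < `|h| by rewrite normr_gt0.
  have -> : D - h^-1 *: ((G \o shift u) (h *: (1 : R)) - G u) = - (h^-1 * (G (u + h) - G u - h * D)).
    by rewrite /GRing.scale /= mulr1 (addrC h); field.
  rewrite normrN normrM normfV ler_pdivrMl//; apply: le_trans (hG h) _.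
  rewrite -real_normK ?num_real// expr2 mulrCA; apply: ler_wpM2l => //.
  have : `|h| <= e / (C + 1).
    near: h; apply: dnbhs0_le; rewrite divr_gt0// ltr_wpDl//.
  rewrite ler_pdivlMr ?ltr_wpDl// => hh; apply: le_trans hh.
  by rewrite mulrC; apply: ler_wpM2l => //; rewrite lerDl.
split; first by apply/cvg_ex; exists D.
by apply: cvg_lim.
Unshelve. all: by end_near. Qed.

Section Heat.
Variable v : R.
Hypothesis v_gt0 : 0 < v.

Lemma normal_pdf_heat : normal_pdf 0 (Num.sqrt v) = heat v.
Proof.
have sv : Num.sqrt v != 0 by rewrite gt_eqF// sqrtr_gt0.
apply: funext => x; rewrite /normal_pdf (negbTE sv) /normal_peak /normal_fun subr0.
rewrite sqr_sqrtr ?(ltW v_gt0)// /heat; congr (_^-1 * _); congr Num.sqrt.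
by rewrite mulrnAl mulrC.
Qed.

Lemma is_derive_heat x : is_derive x 1 (heat v) (- (x / v) * heat v x).
Proof.
have -> : heat v = fun x => gauss (x / Num.sqrt v) * (Num.sqrt v)^-1.
  by apply: funext => y; exact: heatE.
have dg := is_derive_dilate (Num.sqrt v) x is_derive_gauss.
apply: is_derive_eq; rewrite /GRing.scale /= mulr0 add0r.
have sv : Num.sqrt v != 0 by rewrite gt_eqF// sqrtr_gt0.
have e := esym (sqr_sqrtr (ltW v_gt0)); set s := Num.sqrt v in sv e *; rewrite [in RHS]e.
by field.
Qed.

Lemma continuous_heat : continuous (heat v).
Proof. exact: is_derive_continuous is_derive_heat. Qed.

(** Half of the exponent, y = x^2 / (4 v), is spent on 1 + y <= exp y; the other half is the kernel
    of variance 2 v up to its normalisation. *)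
Lemma heat_growth x : (1 + x ^+ 2 / (v *+ 4)) * heat v x <= Num.sqrt 2 * heat (2 * v) x.
Proof.
set y := x ^+ 2 / (v *+ 4).
have y0 : 0 <= y by rewrite divr_ge0 ?sqr_ge0// mulrn_wge0// ltW.
have -> : heat v x = (Num.sqrt (pi *+ 2 * v))^-1 * (expR (- y) * expR (- y)).
  rewrite /heat -expRD; congr (_ * expR _); rewrite /y; field; by rewrite gt_eqF.
have -> : heat (2 * v) x = (Num.sqrt 2 * Num.sqrt (pi *+ 2 * v))^-1 * expR (- y).
  rewrite /heat -sqrtrM//; congr ((Num.sqrt _)^-1 * expR _); first by ring.
  by rewrite /y; field; rewrite gt_eqF.
have s2 : 0 < Num.sqrt 2 :> R by rewrite sqrtr_gt0.
have sp : 0 < Num.sqrt (pi *+ 2 * v) by rewrite sqrtr_gt0 mulr_gt0// mulrn_wgt0// pi_gt0.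
have -> : Num.sqrt 2 * ((Num.sqrt 2 * Num.sqrt (pi *+ 2 * v))^-1 * expR (- y)) =
  (Num.sqrt (pi *+ 2 * v))^-1 * expR (- y) by field; rewrite !gt_eqF.
rewrite mulrCA; apply: ler_wpM2l; first by rewrite invr_ge0 ltW.
by rewrite mulrA ler_piMl ?expR_ge0// expRN_bound.
Qed.
End Heat.

Lemma integrable_heat v : 0 < v -> mu.-integrable setT (EFin \o heat v).
Proof. by move=> v0; rewrite -normal_pdf_heat//; exact: integrable_normal_pdf. Qed.

Lemma Rintegral_heat_space v : 0 < v -> Int (heat v) = 1.
Proof. by move=> v0; rewrite /Rintegral -normal_pdf_heat// integral_normal_pdf. Qed.

Lemma integrable_heat_growth v (h : R -> R) c : 0 < v -> measurable_fun setT h ->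
  (forall x, `|h x| <= c * (1 + x ^+ 2 / (v *+ 4))) ->
  mu.-integrable setT (EFin \o (fun x => h x * heat v x)).
Proof.
move=> v0 mh hc; have v20 : 0 < 2 * v by rewrite mulr_gt0.
have c0 : 0 <= c.
  by have := hc 0; rewrite expr0n /= mul0r addr0 mulr1; apply: le_trans.
have mheat : measurable_fun setT (heat v) by apply: continuous_measurable_fun; exact: continuous_heat.
apply: (le_integrable measurableT _ _ (integrableZl measurableT (c * Num.sqrt 2) (integrable_heat v20))).
  by apply/measurable_EFinP; exact: measurable_funM.
move=> x _ /=; rewrite lee_fin normrM (ger0_norm (heat_ge0 _ _)).
apply: (@le_trans _ _ (c * (Num.sqrt 2 * heat (2 * v) x))).
  apply: le_trans (ler_wpM2l c0 (heat_growth v0 x)); rewrite [leRHS]mulrA.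
  by apply: ler_wpM2r; [exact: heat_ge0|exact: hc].
by rewrite mulrA ler_norm.
Qed.

Section CharacteristicFunction.
Variables (v theta : R).
Hypothesis v_gt0 : 0 < v.

Let growth x : R := 1 + x ^+ 2 / (v *+ 4).
Let v4 : 0 < v *+ 4. Proof. by rewrite mulrn_wgt0. Qed.
Let growth_ge1 x : 1 <= growth x.
Proof. by rewrite lerDl divr_ge0 ?sqr_ge0// ltW. Qed.

Let abs_growth x : `|x| <= (1 + v) * growth x.
Proof.
have -> : (1 + v) * growth x = 1 + v + x ^+ 2 / 4 / v + x ^+ 2 / 4.
  by rewrite /growth; field; rewrite gt_eqF.
have h : 0 <= x ^+ 2 / 4 / v by rewrite divr_ge0 ?divr_ge0 ?sqr_ge0// ltW.
have : `|x| <= 1 + x ^+ 2 / 4.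
  have := sqr_ge0 (`|x| - 2); rewrite sqrrB real_normK ?num_real//; lra.
move=> h2; apply: le_trans h2 _; rewrite -!addrA lerD2l addrCA addrA lerDr.
by rewrite addr_ge0// ltW.
Qed.

Let sqr_growth x : x ^+ 2 <= (v *+ 4) * growth x.
Proof.
rewrite /growth mulrDr mulr1 mulrCA divff ?mulr1 ?gt_eqF//.
by rewrite lerDr ltW.
Qed.

Let char u : R := Int (fun x => cos (u * x + theta) * heat v x).
Let slope u : R := Int (fun x => x * sin (u * x + theta) * heat v x).

Let continuous_phase (f : R -> R) u : continuous f -> continuous (fun x : R => f (u * x + theta)).
Proof.
move=> cf x; apply: continuous_comp; last exact: cf.
by apply: cvgD; [apply: cvgMr; exact: cvg_id|exact: cvg_cst].
Qed.

Let ccos u := @continuous_phase _ u (@continuous_cos R).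
Let csin u := @continuous_phase _ u (@continuous_sin R).

Let integrable_cos u : mu.-integrable setT (EFin \o (fun x => cos (u * x + theta) * heat v x)).
Proof.
apply: (integrable_heat_growth (c := 1)) => //.
  by apply: continuous_measurable_fun; exact: ccos.
by move=> x; rewrite mul1r; apply: le_trans (growth_ge1 x); exact: cos_max.
Qed.

Let integrable_sin u : mu.-integrable setT (EFin \o (fun x => x * sin (u * x + theta) * heat v x)).
Proof.
apply: (integrable_heat_growth (c := 1 + v)) => //.
  by apply: measurable_funM => //; apply: continuous_measurable_fun; exact: csin.
move=> x; apply: le_trans (abs_growth x).
by rewrite normrM ler_piMr//; exact: sin_max.
Qed.

Let integrable_sqr : mu.-integrable setT (EFin \o (fun x => x ^+ 2 * heat v x)).
Proof.
apply: (integrable_heat_growth (c := v *+ 4)) => //.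
by move=> x; rewrite ger0_norm ?sqr_ge0.
Qed.

Let is_derive_char u : is_derive u 1 char (- slope u).
Proof.
apply: (@is_derive_of_quadratic _ _ _ (Int (fun x => x ^+ 2 * heat v x))) => h.
pose f1 x := cos ((u + h) * x + theta) * heat v x - cos (u * x + theta) * heat v x.
pose f2 x := h * (x * sin (u * x + theta) * heat v x).
have i1' : mu.-integrable setT (EFin \o f1).
  exact: (integrableB measurableT (integrable_cos (u + h)) (integrable_cos u)).
have i2' : mu.-integrable setT (EFin \o f2) by exact: (integrableZl measurableT h (integrable_sin u)).
have i1 : mu.-integrable setT (EFin \o (fun x => f1 x + f2 x)).
  exact: (integrableD measurableT i1' i2').
have -> : char (u + h) - char u - h * - slope u = Int (fun x => f1 x + f2 x).
  by rewrite RintegralD// RintegralB// RintegralZl// mulrN opprK.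
apply: le_trans (le_normr_Rintegral measurableT i1) _.
rewrite mulrC -RintegralZl//; apply: le_Rintegral => //.
- exact: (integrable_norm i1).
- exact: (integrableZl measurableT _ integrable_sqr).
move=> x _; rewrite /f1 /f2.
have -> : cos ((u + h) * x + theta) * heat v x - cos (u * x + theta) * heat v x
    + h * (x * sin (u * x + theta) * heat v x) =
  (cos (u * x + theta + h * x) - cos (u * x + theta) + h * x * sin (u * x + theta)) * heat v x.
  have -> : (u + h) * x + theta = u * x + theta + h * x by ring.
  by ring.
rewrite normrM (ger0_norm (heat_ge0 _ _)) mulrA; apply: ler_wpM2r; first exact: heat_ge0.
rewrite -exprMn; set s := u * x + theta; set y := h * x.
pose g y := cos (s + y) + y * sin s.
have dg (z : R) : is_derive z 1 g (- (sin (s + z) - sin s)).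
  have dc : is_derive z 1 (fun y => cos (s + y)) (- sin (s + z)).
    by apply: is_derive_translate => w; exact: is_derive_cos.
  rewrite /g; apply: is_derive_eq; rewrite /GRing.scale /=; ring.
have := @increment_bound _ g _ y `|y| dg _.
rewrite {2}/g addr0 mul0r addr0 -expr2 real_normK ?num_real//.
have -> : g y - cos s = cos (s + y) - cos s + y * sin s by rewrite /g; ring.
apply=> z zy; rewrite normrN; apply: le_trans zy; rewrite -[leRHS]mul1r.
by apply: (lipschitz_derive (fun x => is_derive_sin x)) => w; exact: cos_max.
Qed.

(** Integration by parts, as x heat(x) is -v times the derivative of the kernel. *)
Let slopeE u : slope u = v * u * char u.
Proof.
pose F x := sin (u * x + theta) * heat v x.
have dF (x : R) : is_derive x 1 F
    (u * (cos (u * x + theta) * heat v x) - v^-1 * (x * sin (u * x + theta) * heat v x)).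
  have dl : is_derive x 1 (fun x => u * x + theta) u.
    by apply: is_derive_eq; rewrite /GRing.scale /= mulr1 ?mulr0 ?addr0 ?add0r.
  have ds : is_derive x 1 (fun x => sin (u * x + theta)) (cos (u * x + theta) * u).
    exact: (@is_derive1_comp _ (@sin R) (fun x => u * x + theta) x _ _ (is_derive_sin _) dl).
  have dh := is_derive_heat v_gt0 x.
  rewrite /F; apply: is_derive_eq; rewrite /GRing.scale /=; ring.
have F_small (z : nat -> R) : (forall n, `|z n| = n%:R) -> F (z n) @[n --> \oo] --> 0.
  move=> zn; pose K := Num.sqrt 2 * (Num.sqrt (2 * v))^-1 * (v *+ 4).
  have v20 : 0 < 2 * v by rewrite mulr_gt0.
  have K0 : 0 <= K.
    by apply: mulr_ge0 (ltW v4); apply: mulr_ge0; rewrite ?invr_ge0 sqrtr_ge0.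
  apply/cvgr0Pnorm_le => e e0; exists (Num.truncn (K / e)).+1 => //= n Kn.
  have n0 : 0 < n%:R :> R by rewrite ltr0n; exact: leq_ltn_trans Kn.
  have n1 : 1 <= n%:R :> R by rewrite ler1n; exact: leq_ltn_trans Kn.
  apply: (@le_trans _ _ (heat v (z n))).
    by rewrite /F normrM (ger0_norm (heat_ge0 _ _)) ler_piMl ?heat_ge0//; exact: sin_max.
  have h1 := le_trans (heat_growth v_gt0 (z n)) (ler_wpM2l (sqrtr_ge0 2) (heat_le (z n) v20 (lexx _))).
  have h2 : n%:R / (v *+ 4) * heat v (z n) <= Num.sqrt 2 * (Num.sqrt (2 * v))^-1.
    apply: le_trans h1; apply: ler_wpM2r; first exact: heat_ge0.
    apply: (@le_trans _ _ (z n ^+ 2 / (v *+ 4))); last by rewrite lerDr.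
    rewrite -[z n ^+ 2]real_normK ?num_real// zn; apply: ler_wpM2r.
      by rewrite invr_ge0 ltW.
    by rewrite expr2 ler_peMl// ltW.
  have h3 : heat v (z n) <= K / n%:R.
    rewrite ler_pdivlMr// /K -ler_pdivrMr//; apply: le_trans h2.
    by rewrite le_eqVlt; apply/orP; left; apply/eqP; ring.
  apply: le_trans h3 _; rewrite ler_pdivrMr// mulrC -ler_pdivrMr//.
  have /andP[_ /ltW] := truncn_itv (divr_ge0 K0 (ltW e0)); move=> /le_trans; apply.
  by rewrite ler_nat.
have i1 := integrableZl measurableT u (integrable_cos u).
have i2 := integrableZl measurableT v^-1 (integrable_sin u).
have cf : continuous (fun x : R =>
    u * (cos (u * x + theta) * heat v x) - v^-1 * (x * sin (u * x + theta) * heat v x)).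
  have ch := continuous_heat v_gt0.
  move=> x; apply: cvgB; apply: cvgMr.
    by apply: cvgM; [exact: ccos|exact: ch].
  by apply: cvgM; [apply: cvgM; [exact: cvg_id|exact: csin]|exact: ch].
have := Rintegral_derive_eq0 dF cf (integrableB measurableT i1 i2) (F_small _ _) (F_small _ _).
move=> /(_ (fun n => ger0_norm (ler0n _ n))).
have zN (n : nat) : `|- n%:R| = n%:R :> R by rewrite normrN ger0_norm.
move=> /(_ zN); rewrite RintegralB// !RintegralZl// -/(char u) -/(slope u) => h.
have {}h : u * char u = v^-1 * slope u by apply/eqP; rewrite -subr_eq0 h.
by rewrite -mulrA h mulrA divff ?mul1r// gt_eqF.
Qed.

(** [char] solves char' = - v u char, so its product with exp(v u^2 / 2) is constant. *)
Lemma heat_characteristic u :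
  Int (fun x => cos (u * x + theta) * heat v x) = expR (- (v * u ^+ 2 / 2)) * cos theta.
Proof.
pose K u := char u * expR (v * u ^+ 2 / 2).
have dK (w : R) : is_derive w 1 K 0.
  have dc := is_derive_char w.
  have de : is_derive w 1 (fun u => expR (v * u ^+ 2 / 2)) (expR (v * w ^+ 2 / 2) * (v * w)).
    have dq : is_derive w 1 (fun u : R => v * u ^+ 2 / 2) (v * w).
      by apply: is_derive_eq; rewrite /GRing.scale /=; field.
    exact: (@is_derive1_comp _ (@expR R) (fun u : R => v * u ^+ 2 / 2) w _ _ (is_derive_expR _) dq).
  rewrite /K; apply: is_derive_eq; rewrite /GRing.scale /= slopeE; ring.
have h0 (s : R) : `|s| <= `|u| -> `|0 : R| <= 0 by rewrite normr0.
have := increment_bound dK h0.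
rewrite mul0r normr_le0 subr_eq0 => /eqP.
rewrite /K expr0n /= mulr0 mul0r expR0 mulr1 => h.
have c0 : char 0 = cos theta.
  rewrite /char -[RHS]mulr1 -(Rintegral_heat_space v_gt0) -RintegralZl//; last exact: integrable_heat.
  by congr Rintegral; apply: funext => x; rewrite mul0r add0r.
rewrite -[LHS]/(char u) -c0 -h mulrCA -expRD addrC subrr expR0 mulr1.
by [].
Qed.
End CharacteristicFunction.

Lemma Ex_normal_prob v (f : R -> R) : 0 < v -> bounded_rv (f : measurableTypeR R -> R) ->
  Ex (normal_prob 0 (Num.sqrt v)) (f : measurableTypeR R -> R) = Int (fun x => f x * heat v x).
Proof.
move=> v0 bf; have [mf [B hB]] := bf.
rewrite /Ex /Rintegral; congr fine.
have dom := normal_prob_dominates (0 : R) (Num.sqrt v).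
rewrite -(Radon_Nikodym_change_of_variables dom)//=; last exact: (bounded_rv_integrable _ bf).
rewrite -normal_pdf_heat//; under [RHS]eq_integral do rewrite EFinM.
apply: ae_eq_integral => //.
- apply: emeasurable_funM; first exact/measurable_EFinP.
  by apply: (measurable_int mu); apply: Radon_Nikodym_integrable.
- apply: emeasurable_funM; first exact/measurable_EFinP.
  by apply/measurable_EFinP; exact: measurable_normal_pdf.
- apply: ae_eqe_mul2l => /=.
  rewrite Radon_NikodymE//=; case: cid => /= h [h1 h2 h3].
  apply: integral_ae_eq => //=.
  + by apply/measurable_EFinP; exact: measurable_normal_pdf.
  + by move=> E _ mE; rewrite -h3.
Qed.

End GaussianIntegrals.

(** * Trigonometric means determine the law *)

Section LawUniqueness.
Context {R : realType}.

Lemma Ex_bounded_cvg {d} {T : measurableType d} (P : probability T R) (F : nat -> T -> R)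
    (G : T -> R) (B : R) : (forall n, measurable_fun setT (F n)) -> measurable_fun setT G ->
  (forall n w, `|F n w| <= B) -> (forall w, F n w @[n --> \oo] --> G w) ->
  Ex P (F n) @[n --> \oo] --> Ex P G.
Proof.
move=> mF mG FB FG.
have mF' n : measurable_fun setT (EFin \o F n) by exact/measurable_EFinP.
have mG' : measurable_fun setT (EFin \o G) by exact/measurable_EFinP.
have FG' : {ae P, forall w, setT w -> (EFin \o F n) w @[n --> \oo] --> (EFin \o G) w}.
  by apply: aeW => w _; apply: cvg_EFin; [exact: nearW|exact: FG].
have iB : P.-integrable setT (fun=> B%:E).
  exact: (bounded_rv_integrable P (bounded_rv_cst B)).
have dom : {ae P, forall w n, setT w -> (`|(EFin \o F n) w| <= B%:E)%E}.
  by apply: aeW => w n _; rewrite /= lee_fin.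
have [iG _ cv] := @dominated_convergence _ _ _ P setT measurableT _ _ _ mF' mG' FG' iB dom.
by apply: fine_cvg; rewrite fineK//; exact: integrable_fin_num iG.
Qed.

(** Equal to 0 below 0, to z on [0, 1] and to 1 above 1. *)
Let clip (z : R) : R := (`|z| - `|z - 1| + 1) / 2.

Let clip_lt0 z : z <= 0 -> clip z = 0.
Proof. by move=> z0; rewrite /clip ler0_norm// ler0_norm; lra. Qed.

Let clip_ge1 z : 1 <= z -> clip z = 1.
Proof. by move=> z1; rewrite /clip ger0_norm ?ger0_norm; lra. Qed.

Let clip_itv z : 0 <= clip z <= 1.
Proof.
have [z0|z0] := leP z 0; first by rewrite clip_lt0// lexx ler01.
have [z1|z1] := leP 1 z; first by rewrite clip_ge1// ler01 lexx.
by rewrite /clip gtr0_norm// ltr0_norm; lra.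
Qed.

Let continuous_clip : continuous clip.
Proof.
move=> z; apply: cvgMl; apply: cvgD; last exact: cvg_cst.
apply: cvgB; first exact: norm_continuous.
by apply: cvg_norm; apply: cvgB; [exact: cvg_id|exact: cvg_cst].
Qed.

Let ramp (r : R) n x : R := clip (n%:R * (r - x)).

Let continuous_ramp r n : continuous (ramp r n).
Proof.
move=> x; apply: (@continuous_comp _ _ _ (fun x : R => n%:R * (r - x)) clip);
  last exact: continuous_clip.
by apply: cvgMr; apply: cvgB; [exact: cvg_cst|exact: cvg_id].
Qed.

Let ramp_bound r n x : `|ramp r n x| <= 1.
Proof. by have /andP[h1 h2] := clip_itv (n%:R * (r - x)); rewrite ger0_norm. Qed.

Let ramp_cvg r x : ramp r n x @[n --> \oo] --> ((x < r)%R%:R : R).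
Proof.
apply: cvg_near_cst; have [xr|rx] := ltP x r; last first.
  by apply: nearW => n; apply: clip_lt0; rewrite mulr_ge0_le0// subr_le0.
exists (Num.truncn (r - x)^-1).+1 => //= n hn; apply: clip_ge1.
have d0 : 0 < r - x by rewrite subr_gt0.
have di : 0 <= (r - x)^-1 by rewrite invr_ge0 ltW.
rewrite -ler_pdivrMr// div1r; have /andP[_ /ltW] := truncn_itv di.
by move=> /le_trans; apply; rewrite ler_nat.
Qed.

Context {d} {T : measurableType d} (P : probability T R).
Context {d'} {T' : measurableType d'} (P' : probability T' R).
Variables (X : T -> R) (X' : T' -> R).
Hypothesis measurable_X : measurable_fun setT X.
Hypothesis measurable_X' : measurable_fun setT X'.
Hypothesis same_trig : forall a theta,
  Ex P (fun w => cos (a * X w + theta)) = Ex P' (fun w => cos (a * X' w + theta)).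

(** Weak convergence of a constant sequence of one-dimensional vectors, whose trigonometric means
    already equal those of the target. *)
Let Ex_continuous (f : R -> R) (B : R) : continuous f -> (forall x, `|f x| <= B) ->
  Ex P (fun w => f (X w)) = Ex P' (fun w => f (X' w)).
Proof.
move=> cf fB; pose Y w : 'rV[R]_1 := \row_(i < 1) X w; pose Y' w : 'rV[R]_1 := \row_(i < 1) X' w.
have mY i : measurable_fun setT (fun w => Y w 0 i).
  by rewrite (_ : (fun w => _) = X)//; apply: funext => w; rewrite mxE.
have mY' i : measurable_fun setT (fun w => Y' w 0 i).
  by rewrite (_ : (fun w => _) = X')//; apply: funext => w; rewrite mxE.
have trig_cvg (a : 'I_1 -> R) theta :
    Ex P (fun w => cos (\sum_(i < 1) a i * Y w 0 i + theta)) @[n --> \oo] -->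
    Ex P' (fun w => cos (\sum_(i < 1) a i * Y' w 0 i + theta)).
  have -> : (fun w => cos (\sum_(i < 1) a i * Y' w 0 i + theta)) =
      fun w => cos (a ord0 * X' w + theta).
    by apply: funext => w; rewrite big_ord1 mxE.
  have -> : (fun w => cos (\sum_(i < 1) a i * Y w 0 i + theta)) =
      fun w => cos (a ord0 * X w + theta).
    by apply: funext => w; rewrite big_ord1 mxE.
  by rewrite same_trig; exact: cvg_cst.
have tight (i : 'I_1) (eta : R) : 0 < eta -> exists L, forall (n : nat) L', (0 < n)%N -> L <= L' ->
    Ex P (fun w => tail L' (Y w 0 i)) <= eta.
  by move=> e0; have [L hL] := Ex_tail_small P mY i e0; exists L => n L' _; exact: hL.
have cg : continuous (fun y : 'rV[R]_1 => f (y 0 0)).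
  by move=> y; apply: continuous_comp; [exact: coord_continuous|exact: cf].
have := @weak_convergence R 1 _ _ P _ _ P' (fun=> Y) Y' (fun=> mY) mY' trig_cvg tight _ B cg
  (fun y => fB (y 0 0)).
rewrite (_ : (fun w => f (Y w 0 0)) = fun w => f (X w)); last by apply: funext => w; rewrite mxE.
rewrite (_ : (fun w => f (Y' w 0 0)) = fun w => f (X' w)); last by apply: funext => w; rewrite mxE.
move=> h; apply: (cvg_unique _ _ h); first exact: Rhausdorff.
exact: cvg_cst.
Qed.

Let measurable_lt {d0} {S : measurableType d0} (Z : S -> R) r : measurable_fun setT Z ->
  measurable (Z @^-1` `]-oo, r[).
Proof. by move=> mZ; rewrite -[X in measurable X]setTI; exact: mZ. Qed.

Let Ex_ramp_cvg {d0} {S : measurableType d0} (Q : probability S R) (Z : S -> R) r :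
  measurable_fun setT Z ->
  Ex Q (fun w => ramp r n (Z w)) @[n --> \oo] --> fine (Q (Z @^-1` `]-oo, r[)).
Proof.
move=> mZ; have -> : fine (Q (Z @^-1` `]-oo, r[)) = Ex Q (\1_(Z @^-1` `]-oo, r[)).
  by rewrite /Ex /Rintegral integral_indic ?setIT//; exact: measurable_lt.
apply: (@Ex_bounded_cvg _ _ _ _ _ 1).
- move=> n; apply: (measurableT_comp _ mZ).
  by apply: continuous_measurable_fun; exact: continuous_ramp.
- by apply: measurable_indic; exact: measurable_lt.
- by move=> n w; exact: ramp_bound.
- move=> w; rewrite indicE.
  have -> : (w \in Z @^-1` `]-oo, r[) = (Z w < r) :> bool.
    by apply/idP/idP; rewrite inE /= in_itv.
  exact: ramp_cvg.
Qed.

(** Open half-lines form a generating pi-system, and their probabilities are limits of means of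
    continuous ramps. *)
Lemma trig_law_unique (A : set R) : measurable A -> P (X @^-1` A) = P' (X' @^-1` A).
Proof.
move=> mA.
pose X1 : {mfun T >-> R} := HB.pack X (isMeasurableFun.Build _ _ _ _ X measurable_X).
pose X2 : {mfun T' >-> R} := HB.pack X' (isMeasurableFun.Build _ _ _ _ X' measurable_X').
apply: (@measure_unique _ R _ (@RGenInftyO.G R) (fun n => `]-oo, n%:R[%classic) _ _ _ _
  (distribution P X1) (distribution P' X2)) => //.
- exact: RGenInftyO.measurableE.
- move=> _ _ [x ->] [y ->]; exists (Num.min x y).
  by apply/seteqP; split => z /=; rewrite !in_itv/= lt_min => /andP.
- by move=> n; exists n%:R.
- apply/seteqP; split => // x _; exists (Num.truncn `|x|).+1 => //=.
  rewrite in_itv /=; apply: le_lt_trans (ler_norm x) _.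
  by have /andP[] := truncn_itv (normr_ge0 x).
- move=> _ [r ->]; change (P (X @^-1` `]-oo, r[) = P' (X' @^-1` `]-oo, r[)).
  have h1 := @Ex_ramp_cvg _ _ P X r measurable_X.
  have h2 := @Ex_ramp_cvg _ _ P' X' r measurable_X'.
  have f1 := fin_num_measure P _ (@measurable_lt _ _ X r measurable_X).
  have f2 := fin_num_measure P' _ (@measurable_lt _ _ X' r measurable_X').
  rewrite -(fineK f1) -(fineK f2).
  congr EFin; apply: (cvg_unique _ h1); first exact: Rhausdorff.
  have -> : (fun n => Ex P (fun w => ramp r n (X w))) = fun n => Ex P' (fun w => ramp r n (X' w)).
    by apply: funext => n; apply: (Ex_continuous (B := 1)); [exact: continuous_ramp|exact: ramp_bound].
  exact: h2.
- by move=> n; apply: le_lt_trans (ltry 1%R); exact: probability_le1.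
Qed.
End LawUniqueness.

(** * Quadratic forms and Gaussian vectors *)

Section QuadraticForms.
Context {R : realType} (k : nat).
Implicit Types (C : 'M[R]_k) (a b : 'I_k -> R).

Definition bilinear_form C a b : R := \sum_(i < k) \sum_(j < k) a i * b j * C i j.

Lemma quadratic_form_shift C a b x : (forall i j, C i j = C j i) ->
  bilinear_form C (fun i => a i + x * b i) (fun i => a i + x * b i) =
  bilinear_form C a a + 2 * x * bilinear_form C a b + x ^+ 2 * bilinear_form C b b.
Proof.
move=> Csym.
have -> : 2 * x * bilinear_form C a b = x * bilinear_form C a b + x * bilinear_form C b a.
  have -> : bilinear_form C b a = bilinear_form C a b; last by ring.
  rewrite /bilinear_form exchange_big; apply: eq_bigr => i _; apply: eq_bigr => j _.
  by rewrite Csym mulrC [b j * _]mulrC mulrC.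
rewrite /bilinear_form !mulr_sumr -!big_split /=; apply: eq_bigr => i _.
rewrite !mulr_sumr -!big_split /=; apply: eq_bigr => j _; ring.
Qed.

Lemma bilinear_form_delta C a j : bilinear_form C a (fun i => (i == j)%:R) = \sum_(i < k) a i * C i j.
Proof.
apply: eq_bigr => i _; rewrite (bigD1 j)//= eqxx mulr1 big1 ?addr0// => l /negbTE ->.
by rewrite mulr0 mul0r.
Qed.

Lemma bilinear_form_rank_one b a :
  bilinear_form (\matrix_(i, j) (b i * b j)) a a = (\sum_(i < k) a i * b i) ^+ 2.
Proof.
rewrite expr2 mulr_suml; apply: eq_bigr => i _; rewrite mulr_sumr.
by apply: eq_bigr => j _; rewrite mxE; ring.
Qed.

Lemma bilinear_formD C C' a : bilinear_form (C + C') a a = bilinear_form C a a + bilinear_form C' a a.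
Proof.
rewrite /bilinear_form -big_split; apply: eq_bigr => i _; rewrite -big_split.
by apply: eq_bigr => j _; rewrite mxE mulrDr.
Qed.
End QuadraticForms.

Section GaussianVector.
Context {R : realType} (k : nat).
Implicit Types (C : 'M[R]_k) (a b : 'I_k -> R).

(** Unlike [centered_gaussian_vec], this form treats degenerate combinations like all others, which
    suits the induction. *)
Definition gaussian_char {d} {T : measurableType d} (P : probability T R)
    (Y : T -> 'rV[R]_k) C : Prop :=
  (forall i, measurable_fun setT (fun w => Y w 0 i)) /\
  forall a theta, Ex P (fun w => cos (\sum_(i < k) a i * Y w 0 i + theta)) =
    expR (- (bilinear_form C a a / 2)) * cos theta.

Let N01 : probability (measurableTypeR R) R := normal_prob 0 (Num.sqrt 1).

Lemma Ex_cos_normal v u theta : 0 < v ->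
  Ex (normal_prob 0 (Num.sqrt v)) (fun x : measurableTypeR R => cos (u * x + theta)) =
  expR (- (v * u ^+ 2 / 2)) * cos theta.
Proof.
move=> v0; rewrite -heat_characteristic// -Ex_normal_prob//.
split; last by exists 1 => x; exact: cos_max.
apply: measurableT_comp; first by apply: continuous_measurable_fun; exact: continuous_cos.
by apply: measurable_funD => //; exact: measurable_funM.
Qed.

(** Fubini integrates the new independent normal first; it contributes the exponential of minus half
    the square of its coefficient. *)
Lemma gaussian_char_add {d} {T : measurableType d} (P : probability T R)
    (Y : T -> 'rV[R]_k) C b : gaussian_char P Y C ->
  gaussian_char (P \x N01)%E (fun w => \row_i (Y w.1 0 i + b i * (w.2 : R)))
    (C + \matrix_(i, j) (b i * b j)).
Proof.
move=> [mY YC]; have mY' i : measurable_fun setT (fun w : T * measurableTypeR R =>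
    Y w.1 0 i + b i * (w.2 : R)).
  apply: measurable_funD; first exact: measurableT_comp (mY i) (@measurable_fst _ _ _ _).
  by apply: measurable_funM => //; exact: measurable_snd.
split.
  move=> i; rewrite (_ : (fun w => _) = fun w : T * measurableTypeR R =>
    Y w.1 0 i + b i * (w.2 : R))//.
  by apply: funext => w; rewrite mxE.
move=> a theta; pose c := \sum_(i < k) a i * b i; pose Z w := \sum_(i < k) a i * Y w 0 i.
have mZ : measurable_fun setT Z.
  by apply: measurable_sum => i; exact: measurable_funM.
have -> : (fun w : T * measurableTypeR R =>
    cos (\sum_(i < k) a i * (\row_i (Y w.1 0 i + b i * (w.2 : R))) 0 i + theta)) =
    fun w => cos (c * (w.2 : R) + (Z w.1 + theta)).
  apply: funext => w; congr cos; rewrite /c /Z mulr_suml addrA; congr (_ + _).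
  by rewrite addrC -big_split; apply: eq_bigr => i _; rewrite /= mxE; ring.
have bF : bounded_rv (fun w : T * measurableTypeR R => cos (c * (w.2 : R) + (Z w.1 + theta))).
  split; last by exists 1 => w; exact: cos_max.
  apply: measurableT_comp; first by apply: continuous_measurable_fun; exact: continuous_cos.
  apply: measurable_funD; first by apply: measurable_funM => //; exact: measurable_snd.
  by apply: measurable_funD => //; exact: measurableT_comp mZ (@measurable_fst _ _ _ _).
have iF := bounded_rv_integrable (P \x N01)%E bF.
have bG : bounded_rv (fun w => cos (Z w + theta)).
  split; last by exists 1 => w; exact: cos_max.
  apply: measurableT_comp; first by apply: continuous_measurable_fun; exact: continuous_cos.
  exact: measurable_funD.
have inner (w : T) : (\int[N01]_x (cos (c * (x : R) + (Z w + theta)))%:E)%E =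
    (expR (- (c ^+ 2 / 2)) * cos (Z w + theta))%:E.
  have := Ex_cos_normal c (Z w + theta) (ltr01 : 0 < 1 :> R); rewrite mul1r => <-.
  rewrite /Ex /Rintegral fineK//; apply: integrable_fin_num => //.
  apply: bounded_rv_integrable; split; last by exists 1 => x; exact: cos_max.
  apply: measurableT_comp; first by apply: continuous_measurable_fun; exact: continuous_cos.
  by apply: measurable_funD => //; exact: measurable_funM.
have -> : Ex (P \x N01)%E (fun w => cos (c * (w.2 : R) + (Z w.1 + theta))) =
    Ex P (fun w => expR (- (c ^+ 2 / 2)) * cos (Z w + theta)).
  rewrite /Ex /Rintegral -(integral12_prod_meas1 iF); congr fine.
  by apply: eq_integral => w _; exact: inner.
rewrite ExZ// YC bilinear_formD bilinear_form_rank_one -/c mulrA -expRD.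
by congr (expR _ * _); ring.
Qed.

Definition positive_form C : Prop :=
  (forall i j, C i j = C j i) /\ forall a, 0 <= bilinear_form C a a.

(* Cholesky: eliminating the last nonzero row of the covariance splits off one normal variable. *)
Lemma gaussian_char_exists_below n C : positive_form C ->
  (forall i j : 'I_k, (n <= i)%N -> C i j = 0) ->
  exists d (T : measurableType d) (P : probability T R) Y, gaussian_char P Y C.
Proof.
elim: n C => [|n IHn] C [Csym Cpos] Czero.
  exists _, _, N01, (fun=> 0); split.
    move=> i; rewrite (_ : (fun w => _) = fun=> 0); first exact: measurable_cst.
    by apply: funext => w; rewrite mxE.
  move=> a theta; rewrite (_ : (fun w => _) = fun=> cos theta); last first.
    by apply: funext => w; rewrite big1 ?add0r// => i _; rewrite mxE mulr0.
  rewrite Ex_cst /bilinear_form big1 ?mul0r ?oppr0 ?expR0 ?mul1r// => i _.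
  by apply: big1 => j _; rewrite Czero ?mulr0.
have [nk|kn] := ltnP n k; last first.
  by apply: IHn => // i j ni; move: (ltn_ord i); rewrite ltnNge (leq_trans kn ni).
pose j := Ordinal nk; set c := C j j.
pose delta l : 'I_k -> R := fun i => (i == l)%:R.
have formj a x : bilinear_form C (fun i => a i + x * delta j i) (fun i => a i + x * delta j i) =
    bilinear_form C a a + 2 * x * (\sum_(i < k) a i * C i j) + x ^+ 2 * c.
  rewrite quadratic_form_shift// !bilinear_form_delta; congr (_ + _ + _ * _).
  by rewrite (bigD1 j)//= /delta eqxx mul1r big1 ?addr0// => i /negbTE ->; rewrite mul0r.
(* A zero diagonal entry of a positive form forces the whole row to vanish, so there is nothing to
   eliminate. *)
have [c0|c_neq0] := eqVneq c 0.
  apply: IHn => // i l; rewrite leq_eqVlt => /predU1P[ni|ni]; last exact: Czero.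
  have -> : i = j by apply/val_inj.
  apply/eqP; apply: contraT => s0.
  have s0' : C l j != 0 by rewrite Csym.
  (* If C l j is nonzero, this multiple of the j-th unit vector brings the form to C l l - (C l l +
     1) = -1. *)
  have := Cpos (fun i => delta l i + (- (C l l + 1) / (2 * C l j)) * delta j i).
  rewrite formj c0 mulr0 addr0 bilinear_form_delta.
  have sum_delta m' : \sum_(i < k) delta l i * C i m' = C l m'.
    by rewrite (bigD1 l)//= /delta eqxx mul1r big1 ?addr0// => i' /negbTE ->; rewrite mul0r.
  rewrite !sum_delta.
  have -> : C l l + 2 * (- (C l l + 1) / (2 * C l j)) * C l j = -1 by field.
  by rewrite oppr_ge0 ler10.
have c_gt0 : 0 < c.
  rewrite lt_neqAle eq_sym c_neq0; have := Cpos (delta j); rewrite bilinear_form_delta.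
  by rewrite (bigD1 j)//= /delta eqxx mul1r big1 ?addr0// => i /negbTE ->; rewrite mul0r.
(* [C'] is the Schur complement: its row j vanishes, and its form is the minimum of that of [C]
   along the j-th unit vector, hence nonnegative. *)
pose b i := C i j / Num.sqrt c; pose C' := C - \matrix_(i, l) (b i * b l).
have bb i l : b i * b l = C i j * C l j / c.
  rewrite /b -[in RHS](sqr_sqrtr (ltW c_gt0)); field.
  by rewrite gt_eqF// sqrtr_gt0.
have CE : C = C' + \matrix_(i, l) (b i * b l) by rewrite subrK.
have sqr_c a : (\sum_(i < k) a i * b i) ^+ 2 = (\sum_(i < k) a i * C i j) ^+ 2 / c.
  have -> : \sum_(i < k) a i * b i = (\sum_(i < k) a i * C i j) / Num.sqrt c.
    by rewrite mulr_suml; apply: eq_bigr => i _; rewrite /b mulrA.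
  by rewrite expr_div_n sqr_sqrtr// ltW.
have C'form a : bilinear_form C' a a =
    bilinear_form C a a - (\sum_(i < k) a i * C i j) ^+ 2 / c.
  have := bilinear_formD C' (\matrix_(i, l) (b i * b l)) a.
  by rewrite -CE bilinear_form_rank_one sqr_c => ->; rewrite addrK.
have [|i l|d [T [P [Y YC]]]] := IHn C'.
- split; first by move=> i l; rewrite !mxE Csym mulrC.
  move=> a; rewrite C'form; set s := \sum_(i < k) _.
  have := Cpos (fun i => a i + (- s / c) * delta j i); rewrite formj -/s.
  suff -> : bilinear_form C a a + 2 * (- s / c) * s + (- s / c) ^+ 2 * c =
    bilinear_form C a a - s ^+ 2 / c by [].
  by field.
- rewrite leq_eqVlt !mxE bb => /predU1P[ni|ni]; last by rewrite (Czero i l ni) (Czero i j ni) !mul0r subr0.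
  have -> : i = j by apply/val_inj.
  by rewrite -/c (Csym l) mulrAC divff// mul1r subrr.
by do 3 eexists; eexists; rewrite CE; exact: gaussian_char_add b YC.
Qed.

Lemma gaussian_char_exists C : positive_form C ->
  exists d (T : measurableType d) (P : probability T R) Y, gaussian_char P Y C.
Proof.
move=> pC; apply: (@gaussian_char_exists_below k C pC) => i j ki.
by move: (ltn_ord i); rewrite ltnNge ki.
Qed.

(** Each projection is compared with the constant 0 if its variance vanishes and with a normal
    variable otherwise. *)
Lemma gaussian_char_vec {d} {T : measurableType d} (P : probability T R) (Y : T -> 'rV[R]_k) C :
  positive_form C -> gaussian_char P Y C -> centered_gaussian_vec P Y C.
Proof.
move=> [_ Cpos] [mY YC]; split => // a A mA.
set v := \sum_(i < k) _; have vE : v = bilinear_form C (a 0) (a 0) by [].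
pose Z w := \sum_(i < k) a 0 i * Y w 0 i.
have mZ : measurable_fun setT Z.
  by apply: measurable_sum => i; exact: measurable_funM.
have ZC u theta : Ex P (fun w => cos (u * Z w + theta)) = expR (- (v * u ^+ 2 / 2)) * cos theta.
  have -> : v * u ^+ 2 = bilinear_form C (fun i => u * a 0 i) (fun i => u * a 0 i).
    rewrite vE /bilinear_form mulr_suml; apply: eq_bigr => i _.
    by rewrite mulr_suml; apply: eq_bigr => j _; ring.
  rewrite -YC; congr Ex; apply: funext => w; congr (cos (_ + _)).
  by rewrite /Z mulr_sumr; apply: eq_bigr => i _; rewrite mulrA.
rewrite -/(Z @^-1` A); have [v0|v_neq0] := eqVneq v 0.
  rewrite (@trig_law_unique _ _ _ P _ _ P Z (fun=> 0))//; last first.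
    move=> u theta; rewrite ZC v0 !mul0r oppr0 expR0 mul1r.
    by rewrite (_ : (fun w => _) = fun=> cos theta) ?Ex_cst//; apply: funext => w; rewrite mulr0 add0r.
  rewrite preimage_cst indicE; case: ifP => _; first exact: probability_setT.
  by rewrite measure0.
have v_gt0 : 0 < v by rewrite lt_neqAle eq_sym v_neq0 vE Cpos.
rewrite (@trig_law_unique _ _ _ P _ _ (normal_prob 0 (Num.sqrt v)) Z (fun x : measurableTypeR R => x : R))//.
by move=> u theta; rewrite ZC Ex_cos_normal.
Qed.
End GaussianVector.

Section QuenchedMeanMeasurable.
Context {R : realType} (M : nat).
Context {d : measure_display} {Omega : measurableType d}.
Variables (P : probability Omega R) (om : Omega -> @env R).
Hypothesis measurable_om : forall x tau j, measurable_fun setT (fun w => om w x tau j).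
Hypothesis valid_om : forall w, valid_env M (om w).

Lemma bounded_rv_y_n n (t r : R) : 0 <= t -> bounded_rv (y_n P om M n t r).
Proof.
move=> t0; apply: bounded_rvZ; apply: bounded_rvB; last exact: bounded_rv_cst.
have f0 : 0 <= Num.floor (n%:R * t) by rewrite floor_ge0 mulr_ge0.
(* With the top level at the integer part of n t the walk starts at stage 0. *)
have -> : Num.floor (n%:R * t) = level (absz (Num.floor (n%:R * t))) 0.
  by rewrite /level subr0 gez0_abs.
set x := _ + _; set s := Num.truncn _; set T := absz _.
rewrite (_ : (fun w => _) = fun w => law M T (om w) (0%N, x) (0 + s) (fun z => z%:~R)).
  apply: (nice_bounded_rv measurable_om valid_om (F := fun e => law M T e (0%N, x) (0 + s) (fun z => z%:~R))).
  by apply: nice_law => z; exact: nice_cst.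
by apply: funext => w; rewrite law_qE.
Qed.

Lemma Gamma_qC (sq tr : R * R) : Gamma_q P om M sq tr = Gamma_q P om M tr sq.
Proof.
case: sq tr => [s q] [t r]; rewrite /Gamma_q distrC (addrC t); congr (_ * _).
by congr Rintegral; apply: funext => v; rewrite -(sqrrN (q - r)) opprB.
Qed.
End QuenchedMeanMeasurable.

Unset Implicit Arguments.

Theorem theorem3p4 (R : realType) (M : nat) (d : measure_display)
  (Omega : measurableType d) (P : probability Omega R)
  (om : Omega -> int -> int -> int -> R) :
  (1 <= M)%N ->
  (* Omega = P^{Z^2}: each omega_{x,tau} is a probability vector on [-M, M] *)
  (forall x tau j, measurable_fun setT (fun w => om w x tau j)) ->
  (forall w x tau j, 0 <= om w x tau j) ->
  (forall w x tau j, M%:Z < `|j| -> om w x tau j = 0) ->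
  (forall w x tau, sumM M (om w x tau) = 1) ->
  (* the omega_{x,tau} are i.i.d. under P *)
  sites_independent P om M ->
  sites_identically_distributed P om M ->
  (* (A1) *)
  ~ (exists h x : int, 1 < h /\
       sumM M (fun j => if (h %| (j - x))%Z then pbar P om j else 0) = 1) ->
  (* (A2) *)
  (0 < P [set w | forall j : int, (om w 0 0 j < 1)%R])%E ->
  forall (k : nat) (t r : 'I_k -> R), (forall j, 0 <= t j) ->
  exists (d' : measure_display) (T : measurableType d') (P' : probability T R)
         (Y : T -> 'rV[R]_k),
    centered_gaussian_vec P' Y
      (\matrix_(i, j) Gamma_q P om M (t i, r i) (t j, r j)) /\
    conv_in_law P P' (fun n w => \row_(j < k) y_n P om M n (t j) (r j) w) Y.
Proof.
move=> M1 measurable_om om_ge0 om_range om_sum independent_om identical_om aperiodic_om random_om.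
move=> k t r t_ge0.
have valid_om w : valid_env M (om w) by split=> x tau *; [exact: om_ge0|exact: om_sum].
set C := \matrix_(i, j) _.
have formE (a : 'I_k -> R) : bilinear_form C a a = limit_variance M P om t r a.
  by apply: eq_bigr => i _; apply: eq_bigr => j _; rewrite mxE.
have pC : positive_form C.
  split; first by move=> i j; rewrite !mxE Gamma_qC.
  move=> a; rewrite formE; exact: limit_variance_ge0.
have [d' [T [P' [Y YC]]]] := gaussian_char_exists pC.
exists d', T, P', Y; split; first exact: gaussian_char_vec.
move=> f cf [B fB]; have [mY Ychar] := YC.
pose Yn n w : 'rV[R]_k := \row_(j < k) y_n P om M n (t j) (r j) w.
have YnE n w i : Yn n w 0 i = y_n P om M n (t i) (r i) w by rewrite mxE.
have bYn n i : bounded_rv (fun w => Yn n w 0 i).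
  rewrite (_ : (fun w => _) = y_n P om M n (t i) (r i)); first exact: bounded_rv_y_n.
  by apply: funext => w; exact: YnE.
have mYn n i : measurable_fun setT (fun w => Yn n w 0 i) by case: (bYn n i).
have trig_cvg (a : 'I_k -> R) theta :
    Ex P (fun w => cos (\sum_(i < k) a i * Yn n w 0 i + theta)) @[n --> \oo] -->
    Ex P' (fun w => cos (\sum_(i < k) a i * Y w 0 i + theta)).
  rewrite Ychar formE.
  rewrite (_ : (fun n => Ex P _) = fun n => Ex P (fun w =>
    cos (\sum_(i < k) a i * y_n P om M n (t i) (r i) w + theta))); last first.
    apply: funext => n; congr Ex; apply: funext => w; congr (cos (_ + _)).
    by apply: eq_bigr => i _; rewrite YnE.
  exact: cos_limit.
have tight (i : 'I_k) (eta : R) : 0 < eta -> exists L, forall n L', (0 < n)%N -> L <= L' ->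
    Ex P (fun w => tail L' (Yn n w 0 i)) <= eta.
  move=> eta0; have [b hb] := second_moment_bounded measurable_om valid_om independent_om
    identical_om aperiodic_om random_om r t_ge0 (fun j => (j == i)%:R).
  (* The summand 1 ensures L <= L^2, so that Markov's bound |b| / L^2 is at most |b| / L, hence at
     most eta. *)
  exists (`|b| / eta + 1) => n L n0 bL.
  have b0 : 0 <= `|b| / eta by rewrite divr_ge0// ltW.
  have L1 : 1 <= L by apply: le_trans bL; rewrite lerDr.
  have L0 : 0 < L by exact: lt_le_trans L1.
  have bY2 : bounded_rv (fun w => Yn n w 0 i ^+ 2) by exact: bounded_rvM.
  apply: le_trans (Ex_tail_markov P (mYn n) bY2 L0) _.
  have -> : (fun w => Yn n w 0 i ^+ 2) =
      fun w => (\sum_(j < k) (j == i)%:R * y_n P om M n (t j) (r j) w) ^+ 2.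
    apply: funext => w; rewrite (bigD1 i)//= eqxx mul1r big1 ?addr0 ?YnE// => j /negbTE ->.
    by rewrite mul0r.
  rewrite ler_pdivrMr ?exprn_gt0//; apply: le_trans (hb n n0) _; apply: le_trans (ler_norm b) _.
  rewrite mulrC -ler_pdivrMr//; apply: (@le_trans _ _ L); first by apply: le_trans bL; rewrite lerDl.
  by rewrite expr2 ler_peMl// ltW.
rewrite (expectation_Ex _ (bounded_rv_continuous mY cf fB)).
under eq_fun do rewrite (expectation_Ex _ (bounded_rv_continuous (mYn _) cf fB)).
apply: cvg_EFin; first exact: nearW.
exact: weak_convergence mYn mY trig_cvg tight _ _ cf fB.
Qed.
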